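(* There is a universal constant $\underline c>0$ such that the following holds. Let $N=3$, $d>0$, and let $\psi_n^\pm$ be the maps defined in the context with $n=n(d)$ sufficiently large so that $\mathcal F_d[\psi_n^\pm]<\mathcal F_d[u_s]$. Then the mountain pass energy $$c_d=\inf_{h\in\Gamma_d}\ \max_{t\in[-1,1]}\mathcal F_d[h(t)],\qquad \Gamma_d=\{h\in C([-1,1],\mathcal A_d^{\rm x}):h(-1)=\psi_n^-,\ h(1)=\psi_n^+\},$$ satisfies $$c_d=\mathcal F_d[u_s]\quad\text{if } d\le\sqrt2\,j_{1,1}',$$ $$0<\underline c\le c_d<\mathcal F_d[u_s]\quad\text{if } d>\sqrt2\,j_{1,1}'.$$
   Context: For $d>0$ let $\Omega_d=\{(x,x')\in\mathbb R\times\mathbb R^2: |x'|<d\}$ and, for $u=(u_1,u_2):\Omega_d\to\mathbb R^2$, $$\mathcal F_d[u]=\int_{\Omega_d}\Big(\frac12|\nabla u|^2+\frac14(1-|u|^2)^2\Big)\,dx\,dx' .$$ Let $u_s(x,x')=\big(0,\tanh\frac{x}{\sqrt2}\big)$. $\mathcal A_d^{\rm x}$ is the set of maps $u\in u_s+H^1(\Omega_d,\mathbb R^2)$ with $u_1(-x,x')=u_1(x,x')$ and $u_2(-x,x')=-u_2(x,x')$, with the topology induced by the $H^1$ norm. Fix an arbitrary nondecreasing odd function $\chi\in C^\infty(\mathbb R)$ satisfying $\chi\equiv\frac\pi2$ in $[1,\infty)$, and define $$\psi_n^\pm(x,x')=\big(\pm\cos\chi(x/n),\ \sin\chi(x/n)\big)\in\mathcal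 A_d^{\rm x}.$$ One has $\mathcal F_d[\psi_n^\pm]\to0$ as $n\to\infty$. $j_{1,1}'$ is the smallest positive zero of $J_1'$, the derivative of the Bessel function $J_1$ of the first kind and of order one. ''Universal'' means that $\underline c$ does not depend on $d$ (nor on $n$, $\chi$). *)

(* Defs.v *)
From HB Require Import structures.
From mathcomp Require Import all_boot all_order all_algebra.
From mathcomp Require Import all_classical all_reals all_analysis.
Import numFieldNormedType.Exports.

Set Implicit Arguments.
Unset Strict Implicit.
Unset Printing Implicit Defensive.
Import Order.TTheory GRing.Theory Num.Theory.

Local Open Scope classical_set_scope.
Local Open Scope ring_scope.

Lemma sigma_finite_product {d1 d2 : measure_display}
    {T1 : measurableType d1} {T2 : measurableType d2} {R : realType}
    (m1 : {sigma_finite_measure set T1 -> \bar R})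
    (m2 : {sigma_finite_measure set T2 -> \bar R}) :
  sigma_finite setT (m1 \x m2)%E.
Proof.
have /sigma_finiteP[F [TF ndF Foo]] := sigma_finiteT m1.
have /sigma_finiteP[G [TG ndG Goo]] := sigma_finiteT m2.
exists (fun n => F n `*` G n).
  rewrite -setXTT TF TG predeqE => -[x y]; split.
    move=> [/= [n _ Fnx] [k _ Gky]]; exists (maxn n k) => //; split.
    - by move: x Fnx; exact/subsetPset/ndF/leq_maxl.
    - by move: y Gky; exact/subsetPset/ndG/leq_maxr.
  by move=> [n _ []/= ? ?]; split; exists n.
move=> k; have [? ?] := Foo k; have [? ?] := Goo k.
split; first exact: measurableX.
by rewrite product_measure1E// lte_mul_pinfty// ge0_fin_numE.
Qed.

(* Lebesgue measure on R^2 and on R x R^2. *)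
Definition lebesgue2 {R : realType} :
    set (measurableTypeR R * measurableTypeR R) -> \bar R :=
  (lebesgue_measure \x lebesgue_measure)%E.
HB.instance Definition _ (R : realType) := Measure.on (@lebesgue2 R).
HB.instance Definition _ (R : realType) :=
  @Measure_isSigmaFinite.Build _ _ R (@lebesgue2 R)
    (sigma_finite_product (@lebesgue_measure R) (@lebesgue_measure R)).

Definition lebesgue3 {R : realType} :
    set (measurableTypeR R * (measurableTypeR R * measurableTypeR R)) ->
    \bar R :=
  (lebesgue_measure \x lebesgue2)%E.
HB.instance Definition _ (R : realType) := Measure.on (@lebesgue3 R).
HB.instance Definition _ (R : realType) :=
  @Measure_isSigmaFinite.Build _ _ R (@lebesgue3 R)
    (sigma_finite_product (@lebesgue_measure R) (@lebesgue2 R)).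

Section Bessel.
Context {R : realType}.

(* Bessel function of the first kind of integer order [nu], as the sum of its
   everywhere convergent power series. *)
Definition bessel_J (nu : nat) (x : R) : R :=
  limn (series (fun m : nat =>
    (-1) ^+ m / (m`! * (m + nu)`!)%:R * (x / 2) ^+ (2 * m + nu))).

Definition smallest_positive_zero (f : R -> R) (j : R) : Prop :=
  [/\ 0 < j, f j = 0 & forall x, 0 < x -> f x = 0 -> j <= x].

End Bessel.

(* A point (x, x') of R x R^2, with x = p.1 and x' = (p.2.1, p.2.2).  A plain
   notation, so that the canonical structures on products apply. *)
Notation space R := (R * (R * R))%type.

Section Sobolev.
Context {R : realType}.
Implicit Types (D K : set (space R)) (j : 'I_3) (f g phi : space R -> R).
Implicit Types (w : space R -> R * R).

Definition basis_vector j : space R :=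
  ((val j == 0%N)%:R, ((val j == 1%N)%:R, (val j == 2%N)%:R)).

Definition partial j f : space R -> R := 'D_(basis_vector j) f.

(* All iterated partial derivatives, in any order, exist and are continuous. *)
Definition smooth phi : Prop :=
  forall s : seq 'I_3, let f := foldr partial phi s in
    continuous f /\ forall j p, derivable f p (basis_vector j).

Definition test_function D phi : Prop :=
  smooth phi /\
  exists K, [/\ compact K, K `<=` D & forall p, ~ K p -> phi p = 0].

Definition measurable_on D f : Prop :=
  measurable_fun (D : set (measurableTypeR R *
                           (measurableTypeR R * measurableTypeR R))) f.

Definition locally_integrable_on D f : Prop :=
  measurable_on D f /\
  forall K, compact K -> K `<=` D -> lebesgue3.-integrable K (EFin \o f).

Definition square_integrable D f : Prop :=
  measurable_on D f /\
  lebesgue3.-integrable D (fun p => (f p ^+ 2)%:E).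

Definition is_weak_partial D j f g : Prop :=
  [/\ locally_integrable_on D f, locally_integrable_on D g &
   forall phi, test_function D phi ->
     \int[lebesgue3]_(p in D) (f p * partial j phi p) =
     - \int[lebesgue3]_(p in D) (g p * phi p)].

(* A representative of the weak partial derivative (unique a.e. in an open
   [D]); the default value 0 is used when there is none. *)
Definition weak_partial D j f : space R -> R :=
  xget (cst 0) [set g | is_weak_partial D j f g].

Definition sobolev_H1 D f : Prop :=
  square_integrable D f /\
  forall j, exists2 g, is_weak_partial D j f g & square_integrable D g.

Definition comp1 w : space R -> R := fun p => (w p).1.
Definition comp2 w : space R -> R := fun p => (w p).2.

Definition sqr_norm (y : R * R) : R := y.1 ^+ 2 + y.2 ^+ 2.

Definition sqr_norm_grad D w (p : space R) : R :=
  \sum_(j < 3) (weak_partial D j (comp1 w) p ^+ 2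
                + weak_partial D j (comp2 w) p ^+ 2).

Definition H1_norm D w : \bar R :=
  ((\int[lebesgue3]_(p in D)
     (sqr_norm (w p) + sqr_norm_grad D w p)%:E) `^ 2^-1)%E.

End Sobolev.

Section MountainPass.
Context {R : realType}.
Implicit Types (u : space R -> R * R) (h : R -> space R -> R * R).

Definition cylinder (d : R) : set (space R) :=
  [set p | Num.sqrt (p.2.1 ^+ 2 + p.2.2 ^+ 2) < d].

Definition energy (d : R) u : \bar R :=
  (\int[lebesgue3]_(p in cylinder d)
    (1 / 2 * sqr_norm_grad (cylinder d) u p
     + 1 / 4 * (1 - sqr_norm (u p)) ^+ 2)%:E)%E.

Definition tanh (x : R) : R :=
  (expR x - expR (- x)) / (expR x + expR (- x)).

Definition soliton (p : space R) : R * R := (0, tanh (p.1 / Num.sqrt 2)).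

(* Elements of the affine space [soliton + H^1] are handled through
   representatives: only their values a.e. in the cylinder matter. *)
Definition admissible (d : R) u : Prop :=
  let w := fun p => u p - soliton p in
  [/\ sobolev_H1 (cylinder d) (comp1 w), sobolev_H1 (cylinder d) (comp2 w) &
   {ae lebesgue3, forall p, cylinder d p ->
     comp1 u (- p.1, p.2) = comp1 u p /\ comp2 u (- p.1, p.2) = - comp2 u p}].

Definition profile (chi : R -> R) : Prop :=
  [/\ {homo chi : x y / x <= y}, forall x, chi (- x) = - chi x,
      forall (k : nat) x, derivable (derive1n k chi) x 1 &
      forall x, 1 <= x -> chi x = pi / 2].

(* psi_n^+ and psi_n^- for [sigma = 1] and [sigma = -1]. *)
Definition psi (chi : R -> R) (sigma : R) (n : nat) (p : space R) : R * R :=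
  (sigma * cos (chi (p.1 / n%:R)), sin (chi (p.1 / n%:R))).

(* Paths in the admissible class, parametrized by [-1, 1] (the values of [h]
   elsewhere are irrelevant), continuous for the H^1 distance, with endpoints
   [a] and [b] up to null sets. *)
Definition paths (d : R) (a b : space R -> R * R) : set (R -> space R -> R * R) :=
  [set h | [/\
    forall t : R, t \in `[-1, 1] -> admissible d (h t),
    forall t : R, t \in `[-1, 1] ->
      H1_norm (cylinder d) (fun p => h s p - h t p)
        @[s --> within [set` `[-1, 1]] (nbhs t)] --> 0%E,
    {ae lebesgue3, forall p, cylinder d p -> h (-1) p = a p} &
    {ae lebesgue3, forall p, cylinder d p -> h 1 p = b p}]].

(* The energy being continuous along a path, the supremum over [-1, 1] is a
   maximum. *)
Definition mountain_pass (d : R) (a b : space R -> R * R) : \bar R :=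
  ereal_inf [set ereal_sup [set energy d (h t) | t in [set` `[-1, 1]]]
            | h in paths d a b].

End MountainPass.

(* Main.v *)
Require Import Defs.
From mathcomp Require Import all_boot all_order all_algebra.
From mathcomp Require Import all_classical all_reals all_analysis.
From mathcomp Require Import measurable_realfun ring lra.
Import numFieldNormedType.Exports.
(* Restores the notation [space], which mathcomp's vector also declares. *)
Import Defs.
Set Implicit Arguments.
Unset Strict Implicit.
Unset Printing Implicit Defensive.
Import Order.TTheory GRing.Theory Num.Theory.
Local Open Scope classical_set_scope.
Local Open Scope ring_scope.

(* Lower bound. Every path from psi_n^- to psi_n^+ contains a map u with
   \int u_1 sech = 0, and such a map has at least the energy of the soliton (0, kink): with
   w = u_2 - kink, the energy exceeds that of the soliton by a sum of squares plus a linear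
   term that vanishes plus half of the forms \int |grad f|^2 - sech^2 f^2 for f = u_1 and
   f = w. In the direction x the one-dimensional form has the zero mode sech, and Jacobi's
   substitution bounds it below by the projection of f on sech. This projection is 0 for
   the odd function w; for u_1 it is a function a on the disc with mean 0, and the form
   becomes \int |grad a|^2 - a^2 / 2, which is nonnegative when the first Neumann eigenvalue
   j^2 / rho^2 of the disc of radius rho is at least 1/2. On the disc the part of a that is
   odd in one coordinate is compared with the first mode J_1 (r) cos theta, positive on a
   half disc, and the even part is estimated along chords. For d > sqrt 2 * j restrict u to
   the cylinder of radius sqrt 2 * j, whose soliton energy is the universal constant.

   Upper bound. Let phi_s interpolate linearly between the angle of (sech, kink) and
   chi (x / n). The maps (a cos phi_s, sin phi_s), with s decreasing from 1 to 0 for a = -1,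
   then a increasing from -1 to 1 for s = 0, then s increasing for a = 1, form a path whose
   maximal energy is that of the soliton, attained at a = s = 0. When d > sqrt 2 * j, adding
   to the first component a small multiple of (1 - a^2) sech times the first Neumann mode
   lowers this maximum strictly. *)

(** The maps are only of class H^1, while the one-dimensional inequalities are proved for C^1
    functions that vanish for large |x|. Mollification needs room, so the approximations live on
    cylinders of radius strictly below [d], and there the projection of u_1 on [sech] no longer has
    mean 0. This shapes the lower bounds: they carry an error, a constant times the square of the
    mean, with a constant uniform in the radius, and the error disappears as the radius increases to
    the full one. Oddness of the second component is also lost in the approximation and is recovered
    with an L^2 error. The threshold 1/2 is there because [sech] is an eigenfunction of - f'' -
    sech^2 f for the eigenvalue -1/2. Polar coordinates and boundary integrals are avoided:
    integrals over the disc are taken along chords, and Green's formula is used with smooth weights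
    that vanish outside the disc and tend to 1 inside. On the unimodular pieces of the path the
    energy is convex in s, so it stays below that of the soliton because it does so at both ends. *)

Section pointwise_calculus.
Context {R : realType}.
Implicit Types (f g : R -> R) (x a b k : R).

(** The calculus rules below produce derivatives in unsimplified form; this isolates the remaining
    equality, which [ring] or [field] then closes. *)
Lemma is_derive1_eq f x a b : is_derive x 1 f a -> a = b -> is_derive x 1 f b.
Proof. by move=> df <-. Qed.

Lemma is_derive1D f g x a b : is_derive x 1 f a -> is_derive x 1 g b ->
  is_derive x 1 (fun y => f y + g y) (a + b).
Proof. by move=> df dg; exact: is_deriveD. Qed.

Lemma is_derive1N f x a : is_derive x 1 f a -> is_derive x 1 (fun y => - f y) (- a).
Proof. by move=> df; exact: is_deriveN. Qed.

Lemma is_derive1B f g x a b : is_derive x 1 f a -> is_derive x 1 g b ->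
  is_derive x 1 (fun y => f y - g y) (a - b).
Proof. by move=> df dg; exact: is_deriveB. Qed.

Lemma is_derive1M f g x a b : is_derive x 1 f a -> is_derive x 1 g b ->
  is_derive x 1 (fun y => f y * g y) (a * g x + f x * b).
Proof.
move=> df dg; apply: (is_derive1_eq (is_deriveM df dg)).
by rewrite /GRing.scale/= addrC mulrC.
Qed.

Lemma is_derive1Z k f x a : is_derive x 1 f a -> is_derive x 1 (fun y => k * f y) (k * a).
Proof. by move=> df; exact: (is_deriveZ k). Qed.

Lemma is_derive1V f x a : f x != 0 -> is_derive x 1 f a ->
  is_derive x 1 (fun y => (f y)^-1) (- a / f x ^+ 2).
Proof.
move=> fx df; apply: (is_derive1_eq (is_deriveV fx df)).
by rewrite /GRing.scale/= mulNr mulrC mulNr.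
Qed.

Lemma is_derive1X n f x a : is_derive x 1 f a ->
  is_derive x 1 (fun y => f y ^+ n) (n%:R * f x ^+ n.-1 * a).
Proof.
move=> df; rewrite (_ : (fun y => f y ^+ n) = f ^+ n).
  exact: is_deriveX.
by apply/funext => y; rewrite exprfctE.
Qed.

Lemma is_derive1_compose f g x a b : is_derive (g x) 1 f a -> is_derive x 1 g b ->
  is_derive x 1 (fun y => f (g y)) (a * b).
Proof. by move=> df dg; exact: (@is_derive1_comp _ f g). Qed.

Lemma is_derive1_id x : is_derive x 1 (fun y : R => y) 1.
Proof. exact: is_derive_id. Qed.

Lemma is_derive1_cst k x : is_derive x 1 (fun _ : R => k) 0.
Proof. exact: is_derive_cst. Qed.

Lemma is_derive_continuous_at f x a : is_derive x 1 f a -> {for x, continuous f}.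
Proof.
by move=> [df _]; apply: differentiable_continuous; exact/derivable1_diffP.
Qed.

Lemma is_derive_continuous f (f' : R -> R) :
  (forall x : R, is_derive x 1 f (f' x)) -> continuous f.
Proof. by move=> df x; exact: is_derive_continuous_at (df x). Qed.

Lemma is_derive1E f x a : is_derive x 1 f a -> derive1 f x = a.
Proof. by move=> [_ <-]; rewrite derive1E. Qed.

End pointwise_calculus.

Section pointwise_continuity.
Context {R : realType} {T : topologicalType}.
Implicit Types f g : T -> R.

Lemma continuous_add f g : continuous f -> continuous g -> continuous (fun x => f x + g x).
Proof. by move=> cf cg x; apply: continuousD; [exact: cf|exact: cg]. Qed.

Lemma continuous_opp f : continuous f -> continuous (fun x => - f x).
Proof. by move=> cf x; apply: continuousN; exact: cf. Qed.

Lemma continuous_sub f g : continuous f -> continuous g -> continuous (fun x => f x - g x).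
Proof. by move=> cf cg x; apply: continuousB; [exact: cf|exact: cg]. Qed.

Lemma continuous_mul f g : continuous f -> continuous g -> continuous (fun x => f x * g x).
Proof. by move=> cf cg x; apply: continuousM; [exact: cf|exact: cg]. Qed.

Lemma continuous_exp n f : continuous f -> continuous (fun x => f x ^+ n).
Proof.
move=> cf; elim: n => [|n IH].
  by rewrite (_ : (fun _ => _) = cst 1)//; exact: cst_continuous.
rewrite (_ : (fun _ => _) = fun x => f x * f x ^+ n); first exact: continuous_mul.
by apply/funext => x; rewrite exprS.
Qed.

Lemma continuous_inv f : continuous f -> (forall x, f x != 0) ->
  continuous (fun x => (f x)^-1).
Proof. by move=> cf f0 x; apply: continuousV; [exact: f0|exact: cf]. Qed.

Lemma continuous_const (k : R) : continuous (fun _ : T => k).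
Proof. exact: cst_continuous. Qed.

Lemma continuous_compose (U : topologicalType) (f : T -> U) (g : U -> R) :
  continuous f -> continuous g -> continuous (fun x => g (f x)).
Proof. by move=> cf cg x; apply: (continuous_comp (f := f)); [exact: cf|exact: cg]. Qed.

End pointwise_continuity.

Lemma continuous_pair (T U V : topologicalType) (f : T -> U) (g : T -> V) :
  continuous f -> continuous g -> continuous (fun x => (f x, g x)).
Proof. by move=> cf cg x; apply: cvg_pair; [exact: cf|exact: cg]. Qed.

Lemma continuous_fst (U V : topologicalType) : continuous (fun p : U * V => p.1).
Proof. by move=> p; exact: cvg_fst. Qed.

Lemma continuous_snd (U V : topologicalType) : continuous (fun p : U * V => p.2).
Proof. by move=> p; exact: cvg_snd. Qed.

Lemma continuous_fst_compose (T U V : topologicalType) (f : T -> U * V) :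
  continuous f -> continuous (fun x => (f x).1).
Proof. by move=> cf x; apply: (continuous_comp (f := f)); [exact: cf|exact: cvg_fst]. Qed.

Lemma continuous_snd_compose (T U V : topologicalType) (f : T -> U * V) :
  continuous f -> continuous (fun x => (f x).2).
Proof. by move=> cf x; apply: (continuous_comp (f := f)); [exact: cf|exact: cvg_snd]. Qed.

Lemma continuous_self (T : topologicalType) : continuous (fun x : T => x).
Proof. by move=> x; exact: cvg_id. Qed.

(** * Integrals of real-valued functions *)

Section real_integrable.
Context d (T : measurableType d) (R : realType).
Variables (mu : {measure set T -> \bar R}) (D : set T).
Hypothesis mD : measurable D.
Implicit Types f g : T -> R.

Definition Rintegrable f := mu.-integrable D (EFin \o f).

Lemma RintegrableD f g : Rintegrable f -> Rintegrable g -> Rintegrable (fun x => f x + g x).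
Proof. by move=> hf hg; exact: (integrableD mD hf hg). Qed.

Lemma RintegrableB f g : Rintegrable f -> Rintegrable g -> Rintegrable (fun x => f x - g x).
Proof. by move=> hf hg; exact: (integrableB mD hf hg). Qed.

Lemma RintegrableZ k f : Rintegrable f -> Rintegrable (fun x => k * f x).
Proof. by move=> hf; exact: (integrableZl mD k hf). Qed.

Lemma Rintegrable_le f g : measurable_fun D f -> (forall x, D x -> `|f x| <= g x) ->
  Rintegrable g -> Rintegrable f.
Proof.
move=> mf fg; apply: (le_integrable mD); first exact/measurable_EFinP.
by move=> x Dx; rewrite /= lee_fin (le_trans (fg x Dx))// ler_norm.
Qed.

Lemma Rintegrable_norm f : Rintegrable f -> Rintegrable (fun x => `|f x|).
Proof. by move=> hf; exact: integrable_abse hf. Qed.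

Lemma Rintegrable_measurable f : Rintegrable f -> measurable_fun D f.
Proof. by move=> /measurable_int/measurable_EFinP. Qed.

Lemma Rintegrable_ge0P f : measurable_fun D f -> (forall x, D x -> 0 <= f x) ->
  (\int[mu]_(x in D) (f x)%:E < +oo)%E -> Rintegrable f.
Proof.
move=> mf f0 foo; apply/integrableP; split; first exact/measurable_EFinP.
by under eq_integral => x /[!inE] Dx do rewrite gee0_abs ?lee_fin ?f0//.
Qed.

Lemma RintegralE f : Rintegrable f ->
  (\int[mu]_(x in D) (f x)%:E = (\int[mu]_(x in D) f x)%:E)%E.
Proof. by move=> hf; rewrite /Rintegral fineK// integrable_fin_num. Qed.

Lemma eq_Rintegrable f g : (forall x, D x -> f x = g x) -> Rintegrable f -> Rintegrable g.
Proof.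
by move=> fg; apply: eq_integrable => // x /[!inE] Dx; rewrite /= fg.
Qed.

Lemma le_ge0_Rintegral f g : measurable_fun D f -> measurable_fun D g ->
  (forall x, D x -> 0 <= f x) -> (forall x, D x -> f x <= g x) ->
  (\int[mu]_(x in D) (f x)%:E <= \int[mu]_(x in D) (g x)%:E)%E.
Proof.
by move=> mf mg f0 fg; apply: ge0_le_integral => //; exact/measurable_EFinP.
Qed.

Lemma ge0_integral_comb (a b : R) f g : 0 <= a -> 0 <= b ->
  measurable_fun D f -> measurable_fun D g ->
  (forall x, D x -> 0 <= f x) -> (forall x, D x -> 0 <= g x) ->
  (\int[mu]_(x in D) (a * f x + b * g x)%:E =
   a%:E * \int[mu]_(x in D) (f x)%:E + b%:E * \int[mu]_(x in D) (g x)%:E)%E.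
Proof.
move=> a0 b0 mf mg f0 g0.
have mf' : measurable_fun D (fun x => (f x)%:E) by exact/measurable_EFinP.
have mg' : measurable_fun D (fun x => (g x)%:E) by exact/measurable_EFinP.
have f0' x : D x -> (0 <= (f x)%:E)%E by move=> ?; rewrite lee_fin f0.
have g0' x : D x -> (0 <= (g x)%:E)%E by move=> ?; rewrite lee_fin g0.
transitivity (\int[mu]_(x in D) (a%:E * (f x)%:E + b%:E * (g x)%:E))%E; first by [].
have h1 x : D x -> (0 <= a%:E * (f x)%:E)%E by move=> ?; rewrite mule_ge0 ?lee_fin ?f0.
have h2 x : D x -> (0 <= b%:E * (g x)%:E)%E by move=> ?; rewrite mule_ge0 ?lee_fin ?g0.
rewrite (ge0_integralD mu mD h1 (measurable_funeM a%:E mf') h2 (measurable_funeM b%:E mg')).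
have a0' : (0 <= a%:E)%E by rewrite lee_fin.
have b0' : (0 <= b%:E)%E by rewrite lee_fin.
by rewrite (ge0_integralZl mu mD mf' f0' a0') (ge0_integralZl mu mD mg' g0' b0').
Qed.

Lemma RintegralD' f g : Rintegrable f -> Rintegrable g ->
  \int[mu]_(x in D) (f x + g x) = \int[mu]_(x in D) f x + \int[mu]_(x in D) g x.
Proof. by move=> hf hg; exact: RintegralD. Qed.

Lemma RintegralB' f g : Rintegrable f -> Rintegrable g ->
  \int[mu]_(x in D) (f x - g x) = \int[mu]_(x in D) f x - \int[mu]_(x in D) g x.
Proof. by move=> hf hg; exact: RintegralB. Qed.

Lemma RintegralZ' k f : Rintegrable f ->
  \int[mu]_(x in D) (k * f x) = k * \int[mu]_(x in D) f x.
Proof. by move=> hf; exact: RintegralZl. Qed.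

Lemma le_Rintegral' f g : Rintegrable f -> Rintegrable g ->
  (forall x, D x -> f x <= g x) ->
  \int[mu]_(x in D) f x <= \int[mu]_(x in D) g x.
Proof. by move=> hf hg fg; exact: le_Rintegral. Qed.

End real_integrable.

(** * Measure-preserving maps *)

Definition measure_preserving d (T : measurableType d) (R : realType)
    (mu : set T -> \bar R) (tau : T -> T) :=
  measurable_fun [set: T] tau /\
  forall A, measurable A -> mu (tau @^-1` A) = mu A.

Section preserving.
Context d (T : measurableType d) (R : realType).
Variable mu : {measure set T -> \bar R}.

Lemma preserving_ge0_integral tau (f : T -> \bar R) :
  measure_preserving mu tau -> measurable_fun [set: T] f ->
  (forall x, 0 <= f x)%E ->
  (\int[mu]_x f (tau x) = \int[mu]_x f x)%E.
Proof.
move=> [mt pt] mf f0.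
transitivity (\int[pushforward mu tau]_x f x)%E.
  by rewrite (ge0_integral_pushforward mt mu measurableT mf).
by apply: eq_measure_integral => A mA _; exact: pt.
Qed.

Lemma preserving_integrable tau (f : T -> \bar R) :
  measure_preserving mu tau -> mu.-integrable [set: T] f ->
  mu.-integrable [set: T] (f \o tau).
Proof.
move=> pt /integrableP[mf foo]; apply/integrableP; split.
  by apply: measurableT_comp => //; case: pt.
rewrite (preserving_ge0_integral (f := fun x => `|f x|%E) pt)//.
exact: measurableT_comp.
Qed.

Lemma preserving_integral tau (f : T -> \bar R) :
  measure_preserving mu tau -> mu.-integrable [set: T] f ->
  (\int[mu]_x f (tau x) = \int[mu]_x f x)%E.
Proof.
move=> pt fi; have [mt ptE] := pt.
transitivity (\int[pushforward mu tau]_x f x)%E.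
  rewrite (integral_pushforward mt (f := f))//.
  - exact: measurable_int fi.
  - exact: preserving_integrable.
by apply: eq_measure_integral => A mA _; exact: ptE.
Qed.

Lemma preserving_preimage_measurable tau A :
  measure_preserving mu tau -> measurable A -> measurable (tau @^-1` A).
Proof. by move=> [mt _] mA; rewrite -[X in measurable X]setTI; exact: mt. Qed.

(** Both sides equal the common finite value [mu A] minus the measure of the intersection. This is
    why one-sided differences suffice in [shift_continuous]. *)
Lemma preserving_setD tau A : measure_preserving mu tau -> measurable A ->
  (mu A < +oo)%E -> mu ((tau @^-1` A) `\` A) = mu (A `\` (tau @^-1` A)).
Proof.
move=> pt mA Aoo.
have mtA := preserving_preimage_measurable pt mA.
have E : mu (tau @^-1` A) = mu A := pt.2 _ mA.
transitivity (mu (tau @^-1` A) - mu (tau @^-1` A `&` A))%E.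
  by apply: measureD => //; apply: le_lt_trans Aoo; rewrite -E.
by rewrite E setIC; apply/esym; exact: measureD.
Qed.

End preserving.

(** The push-forward agrees with the product measure on measurable rectangles, hence everywhere by
    uniqueness of the product measure. *)
Lemma preserving_prod d1 d2 (T1 : measurableType d1) (T2 : measurableType d2)
    (R : realType) (m1 : {sigma_finite_measure set T1 -> \bar R})
    (m2 : {sigma_finite_measure set T2 -> \bar R}) t1 t2 :
  measure_preserving m1 t1 -> measure_preserving m2 t2 ->
  measure_preserving (m1 \x m2)%E (fun p => (t1 p.1, t2 p.2)).
Proof.
move=> p1 p2.
have mt : measurable_fun [set: T1 * T2] (fun p : T1 * T2 => (t1 p.1, t2 p.2)).
  apply: measurable_fun_pair.
  - by apply: (measurableT_comp p1.1); exact: measurable_fst.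
  - by apply: (measurableT_comp p2.1); exact: measurable_snd.
split=> // A mA.
unshelve epose (nu := (pushforward (m1 \x m2)%E (fun p : T1 * T2 => (t1 p.1, t2 p.2))
  : {measure set (T1 * T2) -> \bar R})); first exact: mt.
suff -> : (m1 \x m2)%E A = nu A by [].
apply: product_measure_unique => // B C mB mC.
rewrite /nu /= /pushforward /=.
rewrite -(p1.2 _ mB) -(p2.2 _ mC) -product_measure1E//.
- exact: preserving_preimage_measurable p1 mB.
- exact: preserving_preimage_measurable p2 mC.
Qed.

(** * Continuity of measurable sets under small shifts *)

Section small_shifts.
Context d (T : measurableType d) (R : realType).
Variables (mu : {measure set T -> \bar R}) (S : R -> set (T -> T)).
Hypothesis S_preserving : forall e tau, S e tau -> measure_preserving mu tau.
Hypothesis S_homo : forall a b, a <= b -> S a `<=` S b.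

(** [S r] stands for the shifts of size at most [r]. Continuity of translations in L^1 is built from
    sets, starting with intervals and reaching all measurable sets of finite measure by Dynkin's
    theorem. *)
Definition shift_continuous A := forall e : R, 0 < e -> exists2 r, 0 < r &
  forall tau, S r tau -> (mu (A `\` tau @^-1` A) <= e%:E)%E.

Lemma shift_continuous_approx A : measurable A ->
  (forall e : R, 0 < e -> exists C, [/\ measurable C, C `<=` A,
      shift_continuous C & (mu (A `\` C) <= e%:E)%E]) ->
  shift_continuous A.
Proof.
move=> mA hA e e0; have e2 : 0 < e / 2 by rewrite divr_gt0.
have [C [mC CA sC AC]] := hA _ e2; have [r r0 hr] := sC _ e2.
exists r => // tau St; have pt := S_preserving St.
have mtA := preserving_preimage_measurable pt mA.
have mtC := preserving_preimage_measurable pt mC.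
apply: (@le_trans _ _ (mu ((A `\` C) `|` (C `\` tau @^-1` C)))).
  apply: le_measure; rewrite ?inE.
  - exact: measurableD.
  - by apply: measurableU; exact: measurableD.
  - move=> x [Ax tx]; have [Cx|] := pselect (C x); [right|by left].
    by split => // /CA.
apply: le_trans (measureU2 _ (measurableD mA mC) (measurableD mC mtC)) _.
by rewrite [X in (_ <= X%:E)%E]splitr EFinD leeD// hr.
Qed.

Lemma shift_continuousU A B : measurable A -> measurable B ->
  shift_continuous A -> shift_continuous B -> shift_continuous (A `|` B).
Proof.
move=> mA mB sA sB e e0; have e2 : 0 < e / 2 by rewrite divr_gt0.
have [r r0 hr] := sA _ e2; have [q q0 hq] := sB _ e2.
exists (Num.min r q); first by rewrite lt_min r0.
move=> tau St; have pt := S_preserving St.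
have mtA := preserving_preimage_measurable pt mA.
have mtB := preserving_preimage_measurable pt mB.
apply: (@le_trans _ _ (mu ((A `\` tau @^-1` A) `|` (B `\` tau @^-1` B)))).
  apply: le_measure; rewrite ?inE.
  - by apply: measurableD; [exact: measurableU|rewrite preimage_setU; exact: measurableU].
  - by apply: measurableU; exact: measurableD.
  - move=> x [[Ax|Bx] tx]; [left|right]; split => // ?; apply: tx; [by left|by right].
apply: le_trans (measureU2 _ (measurableD mA mtA) (measurableD mB mtB)) _.
rewrite [X in (_ <= X%:E)%E]splitr EFinD leeD//.
- by apply: hr; apply: S_homo St; rewrite ge_min lexx.
- by apply: hq; apply: S_homo St; rewrite ge_min lexx orbT.
Qed.

Lemma shift_continuousD A B : measurable A -> measurable B ->
  (mu B < +oo)%E -> B `<=` A ->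
  shift_continuous A -> shift_continuous B -> shift_continuous (A `\` B).
Proof.
move=> mA mB Boo BA sA sB e e0; have e2 : 0 < e / 2 by rewrite divr_gt0.
have [r r0 hr] := sA _ e2; have [q q0 hq] := sB _ e2.
exists (Num.min r q); first by rewrite lt_min r0.
move=> tau St; have pt := S_preserving St.
have mtA := preserving_preimage_measurable pt mA.
have mtB := preserving_preimage_measurable pt mB.
apply: (@le_trans _ _ (mu ((A `\` tau @^-1` A) `|` (tau @^-1` B `\` B)))).
  apply: le_measure; rewrite ?inE.
  - by apply: measurableD; [exact: measurableD|exact: (measurableD mtA mtB)].
  - by apply: measurableU; exact: measurableD.
  - move=> x [[Ax nBx] tx]; have [tA|] := pselect (A (tau x)); last by left.
    right; split => //; apply: contrapT => tB; exact: tx.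
apply: le_trans (measureU2 _ (measurableD mA mtA) (measurableD mtB mB)) _.
rewrite [X in (_ <= X%:E)%E]splitr EFinD leeD//.
- by apply: hr; apply: S_homo St; rewrite ge_min lexx.
- apply: le_trans (_ : mu (B `\` tau @^-1` B) <= _)%E; first by rewrite -(preserving_setD pt).
  by apply: hq; apply: S_homo St; rewrite ge_min lexx orbT.
Qed.

(** Since [mu A] is finite, continuity from above makes the measure of [A] minus [C n] tend to 0, so
    [A] is approximated from inside by its intersections with the sets [C n]. *)
Lemma shift_continuous_bigcup A (C : (set T)^nat) : measurable A ->
  (mu A < +oo)%E -> (forall n, measurable (C n)) ->
  nondecreasing_seq C -> A `<=` \bigcup_n C n ->
  (forall n, shift_continuous (A `&` C n)) -> shift_continuous A.
Proof.
move=> mA Aoo mC ndC AC sC; apply: shift_continuous_approx => // e e0.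
have mAC n : measurable (A `\` C n) by exact: measurableD.
have : (mu \o (fun n => A `\` C n)) @ \oo --> mu (\bigcap_n (A `\` C n)).
  apply: nonincreasing_cvg_mu => //.
  - apply: le_lt_trans Aoo; apply: le_measure; rewrite ?inE//; exact: subDsetl.
  - exact: bigcapT_measurable.
  - move=> m n mn; apply/subsetPset; apply: setDS.
    by move/subsetPset : (ndC _ _ mn).
have -> : \bigcap_n (A `\` C n) = set0.
  rewrite -subset0 => x Ax; have [Ax' _] := Ax 0%N I.
  by have [n _ Cx] := AC _ Ax'; have [_] := Ax n I.
rewrite measure0 => /fine_cvgP[_]/cvgrPdist_le/(_ _ e0)[n _ hn].
exists (A `&` C n); split => //; first exact: measurableI.
have := hn n (leqnn n); rewrite /= sub0r normrN ger0_norm ?fine_ge0//.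
rewrite setDIr setDv set0U.
have fm : (mu (A `\` C n) < +oo)%E.
  apply: le_lt_trans Aoo; apply: le_measure; rewrite ?inE//; exact: subDsetl.
by rewrite -lee_fin fineK// ge0_fin_numE.
Qed.

(** The pi-lambda theorem relative to [B]: complements are taken inside [B], whose finite measure is
    what [shift_continuousD] and [shift_continuous_bigcup] require. *)
Lemma shift_continuous_dynkin (G : set (set T)) (B : set T) :
  d.-measurable = <<s G >> -> setI_closed G -> measurable B ->
  (mu B < +oo)%E -> shift_continuous B ->
  (forall X, G X -> shift_continuous (X `&` B)) ->
  forall X, measurable X -> shift_continuous (X `&` B).
Proof.
move=> GE GI mB Boo sB sG X; rewrite GE => sX.
have foo (Y : set T) : measurable Y -> (mu (Y `&` B) < +oo)%E.
  move=> mY; apply: le_lt_trans Boo.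
  apply: le_measure; rewrite ?inE//; exact: measurableI.
apply: (dynkin_induction (P := fun Y => shift_continuous (Y `&` B)) GE GI _ _ _ _ sX) => //.
- by rewrite setTI.
- move=> Y mY sY.
  have -> : ~` Y `&` B = B `\` (Y `&` B).
    by rewrite setDIr setDv setU0 setDE setIC.
  apply: shift_continuousD => //; [exact: measurableI|exact: foo].
- move=> F mF tF sF.
  have mFn n : measurable (\big[setU/set0]_(i < n) F i) by exact: bigsetU_measurable.
  apply: (@shift_continuous_bigcup _ (fun n => \big[setU/set0]_(i < n) F i)) => //.
  + by apply: measurableI => //; exact: bigcupT_measurable.
  + by apply: foo; exact: bigcupT_measurable.
  + move=> m n mn; apply/subsetPset; exact: subset_bigsetU.
  + move=> x [[n _ Fx] Bx]; exists n.+1 => //.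
    by rewrite big_ord_recr/=; right.
  + move=> n; rewrite setIAC.
    have -> : \bigcup_k F k `&` \big[setU/set0]_(i < n) F i = \big[setU/set0]_(i < n) F i.
      apply/setIidPr => x; rewrite -bigcup_mkord => -[i _ Fx]; by exists i.
    elim: n => [|n IH]; first by rewrite big_ord0 set0I => e e0; exists 1 => // t _; rewrite set0D measure0 lee_fin ltW.
    rewrite big_ord_recr/= setIUl.
    exact: (shift_continuousU (measurableI _ _ (mFn n) mB) (measurableI _ _ (mF n) mB) IH (sF n)).
Qed.

End small_shifts.

Section small_shifts_prod.
Context d1 d2 (T1 : measurableType d1) (T2 : measurableType d2) (R : realType).
Variables (m1 : {sigma_finite_measure set T1 -> \bar R}).
Variables (m2 : {sigma_finite_measure set T2 -> \bar R}).
Variables (S1 : R -> set (T1 -> T1)) (S2 : R -> set (T2 -> T2)).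
Hypothesis S1_preserving : forall e tau, S1 e tau -> measure_preserving m1 tau.
Hypothesis S1_homo : forall a b, a <= b -> S1 a `<=` S1 b.
Hypothesis S2_preserving : forall e tau, S2 e tau -> measure_preserving m2 tau.
Hypothesis S2_homo : forall a b, a <= b -> S2 a `<=` S2 b.
Hypothesis S1_continuous : forall A, measurable A -> (m1 A < +oo)%E ->
  shift_continuous m1 S1 A.
Hypothesis S2_continuous : forall A, measurable A -> (m2 A < +oo)%E ->
  shift_continuous m2 S2 A.

Definition shift_prod (e : R) : set (T1 * T2 -> T1 * T2) :=
  [set tau | exists t1 t2, [/\ S1 e t1, S2 e t2 & tau = (fun p => (t1 p.1, t2 p.2))]].

Lemma shift_prod_preserving e tau : shift_prod e tau ->
  measure_preserving (m1 \x m2)%E tau.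
Proof.
move=> [t1 [t2 [h1 h2 ->]]].
by apply: preserving_prod; [exact: S1_preserving h1|exact: S2_preserving h2].
Qed.

Lemma shift_prod_homo a b : a <= b -> shift_prod a `<=` shift_prod b.
Proof.
move=> ab tau [t1 [t2 [h1 h2 ->]]]; exists t1, t2; split => //.
  exact: S1_homo h1.
exact: S2_homo h2.
Qed.

Lemma shift_prod_continuousX A B : measurable A -> (m1 A < +oo)%E ->
  measurable B -> (m2 B < +oo)%E ->
  shift_continuous (m1 \x m2)%E shift_prod (A `*` B).
Proof.
move=> mA Aoo mB Boo e e0.
have fA : m1 A = (fine (m1 A))%:E by rewrite fineK// ge0_fin_numE.
have fB : m2 B = (fine (m2 B))%:E by rewrite fineK// ge0_fin_numE.
set a := fine (m1 A) in fA; set b := fine (m2 B) in fB.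
have a0 : 0 <= a by exact: fine_ge0.
have b0 : 0 <= b by exact: fine_ge0.
(* The two strips below have total measure at most [k * (a + b)], which is at most [e]; the summand
   1 keeps the denominator positive when both measures vanish. *)
pose k := e / (2 * (a + b + 1)).
have k0 : 0 < k by rewrite divr_gt0// mulr_gt0// ltr_wpDl// addr_ge0.
have [r r0 hr] := S1_continuous mA Aoo k0.
have [q q0 hq] := S2_continuous mB Boo k0.
exists (Num.min r q); first by rewrite lt_min r0.
move=> _ [t1 [t2 [h1 h2 ->]]].
have {h1} h1 : S1 r t1 by apply: S1_homo h1; rewrite ge_min lexx.
have {h2} h2 : S2 q t2 by apply: S2_homo h2; rewrite ge_min lexx orbT.
have mt1 := preserving_preimage_measurable (S1_preserving h1) mA.
have mt2 := preserving_preimage_measurable (S2_preserving h2) mB.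
have mD1 : measurable (A `\` t1 @^-1` A) by exact: measurableD.
have mD2 : measurable (B `\` t2 @^-1` B) by exact: measurableD.
apply: (@le_trans _ _ ((m1 \x m2)%E
   (((A `\` t1 @^-1` A) `*` B) `|` (A `*` (B `\` t2 @^-1` B))))).
  apply: le_measure; rewrite ?inE.
  - apply: measurableD; first exact: measurableX.
    exact: (measurableX mt1 mt2).
  - by apply: measurableU; exact: measurableX.
  - move=> [x y] [[/= Ax By] /= nt].
    have [tx|] := pselect (A (t1 x)); last by left.
    by right; split => //; split => // ty; apply: nt.
apply: le_trans (measureU2 _ (measurableX mD1 mB) (measurableX mA mD2)) _.
apply: (@le_trans _ _ (k%:E * b%:E + a%:E * k%:E)%E).
  apply: leeD.
    apply: le_trans (_ : m1 (A `\` t1 @^-1` A) * m2 B <= _)%E.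
      by rewrite -(product_measure1E m1 m2 mD1 mB).
    by rewrite -fB lee_wpmul2r//; exact: hr.
  apply: le_trans (_ : m1 A * m2 (B `\` t2 @^-1` B) <= _)%E.
    by rewrite -(product_measure1E m1 m2 mA mD2).
  by rewrite -fA lee_wpmul2l//; exact: hq.
rewrite -!EFinM -EFinD lee_fin.
have -> : k * b + a * k = e * ((a + b) / (2 * (a + b + 1))) by rewrite /k; ring.
rewrite ger_pMr// ler_pdivrMr ?mulr_gt0 ?ltr_wpDl ?addr_ge0//.
by lra.
Qed.

Lemma shift_prod_continuous A : measurable A -> ((m1 \x m2)%E A < +oo)%E ->
  shift_continuous (m1 \x m2)%E shift_prod A.
Proof.
move=> mA Aoo.
have /sigma_finiteP[F [TF ndF Foo]] := sigma_finiteT m1.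
have /sigma_finiteP[G [TG ndG Goo]] := sigma_finiteT m2.
have mFG n : measurable (F n `*` G n) by apply: measurableX; [case: (Foo n)|case: (Goo n)].
apply: (@shift_continuous_bigcup _ _ _ _ _ shift_prod_preserving _ (fun n => F n `*` G n)) => //.
- move=> m n mn; apply/subsetPset => -[x y] [/= Fx Gy]; split => /=.
    by move/subsetPset : (ndF _ _ mn); apply.
  by move/subsetPset : (ndG _ _ mn); apply.
- move=> [x y] _; have : [set: T1] x by []. have : [set: T2] y by [].
  rewrite TF TG => -[m _ Gy] [n _ Fx]; exists (maxn m n) => //; split => /=.
    by move/subsetPset : (ndF _ _ (leq_maxr m n)); apply.
  by move/subsetPset : (ndG _ _ (leq_maxl m n)); apply.
move=> n; have [mF Fn] := Foo n; have [mG Gn] := Goo n.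
apply: (@shift_continuous_dynkin _ _ _ _ _ shift_prod_preserving shift_prod_homo
  _ _ (measurable_prod_measurableType T1 T2)) => //.
- move=> _ _ [A1 mA1 [A2 mA2 <-]] [B1 mB1 [B2 mB2 <-]].
  exists (A1 `&` B1); first exact: measurableI.
  by exists (A2 `&` B2); [exact: measurableI|rewrite setXI].
- apply: le_lt_trans (_ : m1 (F n) * m2 (G n) < _)%E.
    by rewrite -(product_measure1E m1 m2 mF mG).
  by rewrite lte_mul_pinfty// ge0_fin_numE.
- exact: shift_prod_continuousX.
- move=> _ [A1 mA1 [A2 mA2 <-]]; rewrite -setXI.
  apply: shift_prod_continuousX.
  + exact: measurableI.
  + by apply: le_lt_trans Fn; apply: le_measure; rewrite ?inE//; exact: measurableI.
  + exact: measurableI.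
  + by apply: le_lt_trans Gn; apply: le_measure; rewrite ?inE//; exact: measurableI.
Qed.

End small_shifts_prod.

(** * Translations and reflection of the line *)

Section line.
Context {R : realType}.
Local Notation mu := (@lebesgue_measure R).

Lemma preserving_shift (a : R) : measure_preserving mu (fun x : measurableTypeR R => x + a).
Proof.
have mt : measurable_fun [set: measurableTypeR R] (fun x : measurableTypeR R => x + a : measurableTypeR R).
  by apply: continuous_measurable_fun => x; apply: cvgD; [exact: cvg_id|exact: cvg_cst].
split=> // A mA.
unshelve epose (nu := (pushforward mu (fun x : measurableTypeR R => x + a : measurableTypeR R)
  : {measure set (measurableTypeR R) -> \bar R})); first exact: mt.
suff -> : mu A = nu A by [].
apply: lebesgue_measure_unique => // _ [[b c] _ <-] /=.
rewrite /nu /= /pushforward /=.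
have -> : (fun x : measurableTypeR R => x + a) @^-1` `]b, c] = `]b - a, c - a]%classic.
  by apply/seteqP; split => x /=; rewrite !in_itv/= ltrBlDr lerBrDr.
rewrite !lebesgue_measure_itv/= !lte_fin ltrD2r -!EFinB.
by congr (if _ then _ else _); congr (_%:E); ring.
Qed.

Lemma preserving_opp : measure_preserving mu (fun x : measurableTypeR R => - x).
Proof.
have mt : measurable_fun [set: measurableTypeR R] (fun x : measurableTypeR R => - x : measurableTypeR R).
  by apply: continuous_measurable_fun => x; exact: cvgN.
split=> // A mA.
unshelve epose (nu := (pushforward mu (fun x : measurableTypeR R => - x : measurableTypeR R)
  : {measure set (measurableTypeR R) -> \bar R})); first exact: mt.
suff -> : mu A = nu A by [].
apply: lebesgue_measure_unique => // _ [[b c] _ <-] /=.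
rewrite /nu /= /pushforward /=.
have -> : (fun x : measurableTypeR R => - x) @^-1` `]b, c] = `[- c, - b[%classic.
  by apply/seteqP; split => x /=; rewrite !in_itv/= ltrNr lerNl andbC.
rewrite !lebesgue_measure_itv/= !lte_fin ltrN2 -!EFinB.
by congr (if _ then _ else _); congr (_%:E); ring.
Qed.

(** Only shifts to the right are allowed, because the smoothing kernels used below are supported on
    one side of their base point. *)
Definition line_shifts (e : R) : set (measurableTypeR R -> measurableTypeR R) :=
  [set tau | exists2 q, 0 <= q <= e & tau = (fun x => x + q)].

Lemma line_shifts_preserving e tau : line_shifts e tau -> measure_preserving mu tau.
Proof. by move=> [q _ ->]; exact: preserving_shift. Qed.

Lemma line_shifts_homo a b : a <= b -> line_shifts a `<=` line_shifts b.
Proof.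
by move=> ab tau [q /andP[q0 qa] ->]; exists q => //; rewrite q0 (le_trans qa).
Qed.

Lemma line_shifts_itv (a b : R) : shift_continuous mu line_shifts `]a, b]%classic.
Proof.
(* The points that leave the interval under x + q lie in the strip []b - q, b]], of measure [q]. *)
move=> e e0; exists e => // tau [q /andP[q0 qe] ->].
apply: (@le_trans _ _ (mu `]b - q, b]%classic)).
  apply: le_measure; rewrite ?inE.
  - apply: measurableD; first exact: measurable_itv.
    apply: (preserving_preimage_measurable (preserving_shift q)); exact: measurable_itv.
  - exact: measurable_itv.
  - move=> x [] /=; rewrite !in_itv/= => /andP[ax xb] /negP.
    by rewrite negb_and -leNgt -ltNge => /orP[|]; lra.
rewrite lebesgue_measure_itv/= lte_fin; case: ifP => _; last by rewrite lee_fin ltW.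
by rewrite -EFinB lee_fin; lra.
Qed.

Lemma lebesgue_measure_itv_lty (a b : R) : (mu `]a, b]%classic < +oo)%E.
Proof. by rewrite lebesgue_measure_itv/=; case: ifP => // _; rewrite ltry. Qed.

Lemma line_shifts_continuous A : measurable A -> (mu A < +oo)%E ->
  shift_continuous mu line_shifts A.
Proof.
move=> mA Aoo.
apply: (@shift_continuous_bigcup _ _ _ _ _ line_shifts_preserving _
  (fun n : nat => `](- n%:R : R), n%:R]%classic)) => //.
- move=> m n mn; apply/subsetPset => x /=; rewrite !in_itv/= => /andP[h1 h2].
  have : (m%:R : R) <= n%:R by rewrite ler_nat.
  by move=> mn'; apply/andP; split; lra.
- move=> x _; exists (Num.truncn `|x|).+1 => //=; rewrite in_itv/=.
  have := truncnS_gt `|x|; rewrite ltr_norml => /andP[-> h]; exact: ltW.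
move=> n.
apply: (@shift_continuous_dynkin _ _ _ _ _ line_shifts_preserving line_shifts_homo
  (@ocitv R)) => //.
- exact: ocitvI.
- exact: lebesgue_measure_itv_lty.
- exact: line_shifts_itv.
- move=> _ [[b c] _ <-] /=.
  have /= := @ocitvI R `]b, c]%classic `](- n%:R), n%:R]%classic.
  move=> /(_ _ _)[||[x y] _ <-]; [by exists (b, c)|by exists (- n%:R, n%:R)|].
  exact: line_shifts_itv.
Qed.

End line.

(** * Continuity of translations in L^1 *)

Section L1_continuity.
Import HBSimple.
Context d (T : measurableType d) (R : realType).
Variables (mu : {measure set T -> \bar R}) (S : R -> set (T -> T)).
Hypothesis S_preserving : forall e tau, S e tau -> measure_preserving mu tau.
Hypothesis S_homo : forall a b, a <= b -> S a `<=` S b.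
Hypothesis S_continuous : forall A, measurable A -> (mu A < +oo)%E ->
  shift_continuous mu S A.

Definition L1_shift_continuous (f : T -> R) := forall e : R, 0 < e ->
  exists2 r, 0 < r & forall tau, S r tau ->
    (\int[mu]_x `|f (tau x) - f x|%:E <= e%:E)%E.

Let mnorm_sub tau (f g : T -> R) : measure_preserving mu tau ->
  measurable_fun [set: T] f -> measurable_fun [set: T] g ->
  measurable_fun [set: T] (fun x => `|f (tau x) - g x|%:E).
Proof.
move=> pt mf mg; apply/measurable_EFinP; apply: measurableT_comp => //.
apply: measurable_funB => //; by apply: measurableT_comp => //; case: pt.
Qed.

Lemma L1_shift_continuousD f g : measurable_fun [set: T] f ->
  measurable_fun [set: T] g ->
  L1_shift_continuous f -> L1_shift_continuous g ->
  L1_shift_continuous (fun x => f x + g x).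
Proof.
move=> mf mg sA sB e e0; have e2 : 0 < e / 2 by rewrite divr_gt0.
have [r r0 hr] := sA _ e2; have [q q0 hq] := sB _ e2.
exists (Num.min r q); first by rewrite lt_min r0.
move=> tau St; have pt := S_preserving St.
apply: (@le_trans _ _ (\int[mu]_x (`|f (tau x) - f x|%:E + `|g (tau x) - g x|%:E))%E).
  apply: ge0_le_integral => //.
  - apply: (mnorm_sub (f := fun x => f x + g x)) => //; exact: measurable_funD.
  - by apply: emeasurable_funD; exact: mnorm_sub.
  - move=> x _; rewrite -EFinD lee_fin.
    by rewrite (_ : _ - _ = (f (tau x) - f x) + (g (tau x) - g x)) ?ler_normD//; ring.
rewrite ge0_integralD//; [|exact: mnorm_sub|exact: mnorm_sub].
rewrite [X in (_ <= X%:E)%E]splitr EFinD leeD//.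
- by apply: hr; apply: S_homo St; rewrite ge_min lexx.
- by apply: hq; apply: S_homo St; rewrite ge_min lexx orbT.
Qed.

Lemma L1_shift_continuousZ (k : R) f : measurable_fun [set: T] f ->
  L1_shift_continuous f -> L1_shift_continuous (fun x => k * f x).
Proof.
move=> mf sf e e0.
have k0 : 0 < `|k| + 1 by rewrite ltr_wpDl.
have [r r0 hr] := sf _ (divr_gt0 e0 k0); exists r => // tau St.
have pt := S_preserving St.
apply: (@le_trans _ _ (\int[mu]_x ((`|k| + 1)%:E * `|f (tau x) - f x|%:E))%E).
  apply: ge0_le_integral => //.
  - apply: (mnorm_sub (f := fun x => k * f x)) => //; exact: measurable_funM.
  - by apply: measurable_funeM; exact: mnorm_sub.
  - move=> x _; rewrite -EFinM lee_fin -mulrBr normrM ler_wpM2r//; lra.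
rewrite ge0_integralZl//; last exact: mnorm_sub.
apply: le_trans (lee_wpmul2l _ (hr _ St)) _; first by rewrite lee_fin ltW.
by rewrite -EFinM lee_fin mulrC divfK ?gt_eqF.
Qed.

Lemma L1_shift_continuous_indic A : measurable A -> (mu A < +oo)%E ->
  L1_shift_continuous \1_A.
Proof.
move=> mA Aoo e e0; have e2 : 0 < e / 2 by rewrite divr_gt0.
have [r r0 hr] := S_continuous mA Aoo e2; exists r => // tau St.
have pt := S_preserving St.
have mtA := preserving_preimage_measurable pt mA.
have mD1 : measurable (A `\` tau @^-1` A) by exact: measurableD.
have mD2 : measurable (tau @^-1` A `\` A) by exact: measurableD.
have -> : (\int[mu]_x `|\1_A (tau x) - \1_A x|%:E =
   \int[mu]_x ((\1_(A `\` tau @^-1` A) x : R)%:E + (\1_(tau @^-1` A `\` A) x : R)%:E))%E.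
  apply: eq_integral => x _; rewrite -EFinD; congr (_%:E).
  rewrite !indicE.
  have -> : (x \in A `\` tau @^-1` A) = (x \in A) && (tau x \notin A).
    by rewrite in_setD; congr (_ && ~~ _); apply/idP/idP; rewrite !inE.
  have -> : (x \in tau @^-1` A `\` A) = (tau x \in A) && (x \notin A).
    by rewrite in_setD; congr (_ && ~~ _); apply/idP/idP; rewrite !inE.
  case: (x \in A); case: (tau x \in A) => /=;
    rewrite ?subrr ?normr0 ?subr0 ?sub0r ?normrN ?normr1 ?addr0 ?add0r//.
rewrite ge0_integralD//; [|exact/measurable_EFinP/measurable_indic|exact/measurable_EFinP/measurable_indic].
rewrite !integral_indic// !setIT.
rewrite [X in (_ <= X%:E)%E]splitr EFinD leeD//; first exact: hr.
apply: le_trans (_ : mu (A `\` tau @^-1` A) <= _)%E; first by rewrite -(preserving_setD pt).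
exact: hr.
Qed.

Lemma L1_shift_continuous_approx f : mu.-integrable [set: T] (EFin \o f) ->
  (forall e : R, 0 < e -> exists g, [/\ measurable_fun [set: T] g,
     L1_shift_continuous g & (\int[mu]_x `|f x - g x|%:E <= e%:E)%E]) ->
  L1_shift_continuous f.
Proof.
move=> fi hf e e0; have e3 : 0 < e / 3 by rewrite divr_gt0.
have /measurable_int/measurable_EFinP mf := fi.
have [g [mg sg fg]] := hf _ e3; have [r r0 hr] := sg _ e3.
exists r => // tau St; have pt := S_preserving St.
have mfg : measurable_fun [set: T] (fun x => `|f x - g x|%:E).
  by apply/measurable_EFinP; apply: measurableT_comp => //; exact: measurable_funB.
have mfgt : measurable_fun [set: T] (fun x => `|f (tau x) - g (tau x)|%:E).
  by apply: (measurableT_comp mfg); case: pt.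
apply: (@le_trans _ _ (\int[mu]_x ((`|f (tau x) - g (tau x)|%:E + `|f x - g x|%:E)
   + `|g (tau x) - g x|%:E))%E).
  apply: ge0_le_integral => //.
  - exact: mnorm_sub.
  - by apply: emeasurable_funD; [exact: emeasurable_funD|exact: mnorm_sub].
  - move=> x _; rewrite -!EFinD lee_fin.
    rewrite (_ : f (tau x) - f x =
      ((f (tau x) - g (tau x)) - (f x - g x)) + (g (tau x) - g x)); last by ring.
    apply: le_trans (ler_normD _ _) _; rewrite lerD2r.
    by apply: le_trans (ler_normB _ _) _.
rewrite ge0_integralD//; [|by move=> x _; rewrite -EFinD lee_fin addr_ge0|
  exact: emeasurable_funD|exact: mnorm_sub].
rewrite ge0_integralD//.
rewrite (preserving_ge0_integral (f := fun x => `|f x - g x|%:E) pt)//.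
apply: (@le_trans _ _ ((e / 3)%:E + (e / 3)%:E + (e / 3)%:E)%E).
  by apply: leeD; [exact: leeD|exact: hr].
by rewrite -!EFinD lee_fin; lra.
Qed.

Lemma L1_shift_continuous_integrable f : mu.-integrable [set: T] (EFin \o f) ->
  L1_shift_continuous f.
Proof.
move=> fi; apply: L1_shift_continuous_approx => // e e0.
have [g [gi gf]] := approximation_sfun_integrable measurableT fi.
move=> /fine_cvgP[fing]/cvgrPdist_le/(_ _ e0) hg.
have [n [fn hn]] : exists n, (\int[mu]_x `|(f x)%:E - (g n x)%:E|)%E \is a fin_num /\
  fine (\int[mu]_x `|(f x)%:E - (g n x)%:E|)%E <= e.
  near \oo => n; exists n; split; first by near: n.
  have : `|0 - fine (\int[mu]_x `|(f x)%:E - (g n x)%:E|)%E| <= e by near: n.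
  by rewrite sub0r normrN ger0_norm// fine_ge0// integral_ge0.
exists (g n); split.
- exact: measurable_funPT.
- have -> : (g n : T -> R) = (fun x => \sum_(y <- finmap.enum_fset (fset_set (range (g n))))
     y * \1_(g n @^-1` [set y]) x).
    apply/funext => x; rewrite fimfunE fsbig_finite//=.
  elim: (finmap.enum_fset _) => [|y s IH].
    rewrite (_ : (fun _ => _) = cst 0); last by apply/funext => x; rewrite big_nil.
    move=> k k0; exists 1 => // tau _; under eq_integral do rewrite subrr normr0.
    by rewrite integral0 lee_fin ltW.
  rewrite (_ : (fun _ => _) = fun x => y * \1_(g n @^-1` [set y]) x +
    \sum_(y <- s) y * \1_(g n @^-1` [set y]) x); last first.
    by apply/funext => x; rewrite big_cons.
  have my : measurable (g n @^-1` [set y]) by exact: measurable_funPTI.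
  apply: L1_shift_continuousD => //.
  + apply: measurable_funM => //; exact: measurable_indic.
  + apply: measurable_sum => z; apply: measurable_funM => //; exact: measurable_indic.
  (* The level set of the value 0 may have infinite measure, but its term is the zero function; for
     every other value integrability bounds the measure of the level set. *)
  + have [->|y0] := eqVneq y 0.
      move=> k k0; exists 1 => // tau _; under eq_integral do rewrite !mul0r subrr normr0.
      by rewrite integral0 lee_fin ltW.
    apply: L1_shift_continuousZ; first exact: measurable_indic.
    apply: L1_shift_continuous_indic => //.
    have /integrableP[_ goo] := gi n.
    have : (`|y|%:E * mu (g n @^-1` [set y]) < +oo)%E.
      apply: le_lt_trans goo; rewrite -[X in mu X]setIT -integral_indic//.
      rewrite -ge0_integralZl//; last exact/measurable_EFinP/measurable_indic.
      apply: ge0_le_integral => //.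
      * by apply: measurable_funeM; exact/measurable_EFinP/measurable_indic.
      * apply: measurableT_comp => //; exact/measurable_EFinP.
      * move=> x _; rewrite /= -EFinM lee_fin indicE.
        have [|_] := boolP (x \in _); last by rewrite mulr0.
        by rewrite inE/= => ->; rewrite mulr1.
    rewrite !ltey; apply: contra => /eqP ->.
    by rewrite gt0_muley// lte_fin normr_gt0.
- rewrite -(fineK fn) lee_fin; apply: hn.
Unshelve. all: by end_near.
Qed.

End L1_continuity.

(** * Open sets of product spaces are measurable *)

Section countable_base.
Context {R : realType}.
Local Notation mR := (measurableTypeR R).

(** A countable base whose members lie in [M]. Rational intervals and their products provide one,
    which makes the open sets of [space R] measurable for the product sigma-algebra. *)
Definition countable_base (T : topologicalType) (M : set (set T)) :=
  exists B : nat -> set T, (forall n, M (B n)) /\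
    forall (U : set T) x, nbhs x U -> exists n, B n x /\ B n `<=` U.

Lemma countable_base_open (T : topologicalType) (M : set (set T)) (U : set T) :
  M set0 -> (forall F : (set T)^nat, (forall n, M (F n)) -> M (\bigcup_n F n)) ->
  countable_base M -> open U -> M U.
Proof.
move=> M0 Mcup [B [MB hB]] oU.
pose F n := if `[< B n `<=` U >] then B n else set0.
have -> : U = \bigcup_n F n.
  apply/seteqP; split => x.
    move=> Ux; have [n [Bx BU]] := hB U x (open_nbhs_nbhs (conj oU Ux)).
    by exists n => //; rewrite /F asboolT.
  by move=> [n _]; rewrite /F; case: asboolP => // h /h.
by apply: Mcup => n; rewrite /F; case: ifP.
Qed.

Lemma countable_base_prod (T1 T2 : topologicalType) M1 M2 (M : set (set (T1 * T2))) :
  M set0 -> (forall A B, M1 A -> M2 B -> M (A `*` B)) ->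
  countable_base (T := T1) M1 -> countable_base (T := T2) M2 ->
  countable_base M.
Proof.
move=> M0 MX [B1 [MB1 h1]] [B2 [MB2 h2]].
exists (fun n => if unpickle n is Some (i, j) then B1 i `*` B2 j else set0); split.
  by move=> n; case: unpickle => // -[i j]; exact: MX.
move=> U [x y] [[A B] /= [Ax By] ABU].
have [i [B1x B1A]] := h1 _ _ Ax; have [j [B2y B2B]] := h2 _ _ By.
exists (pickle (i, j)); rewrite pickleK; split => //.
by move=> [u v] [/= /B1A ? /B2B ?]; exact: (ABU (u, v)).
Qed.

Lemma countable_base_line :
  countable_base (T := R) (fun A => measurable (A : set mR)).
Proof.
exists (fun n => if @unpickle (rat * rat)%type n is Some (a, b)
  then `](ratr a : R), ratr b[%classic else set0); split.
  move=> n; case: unpickle => [[a b]|]; last exact: measurable0.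
  exact: measurable_itv.
move=> U x /nbhs_ballP[e /= e0 eU].
have [a] : exists a : rat, ratr a \in `]x - e, x[ by apply: rat_in_itvoo; lra.
have [b] : exists b : rat, ratr b \in `]x, x + e[ by apply: rat_in_itvoo; lra.
rewrite !in_itv/= => /andP[xb be] /andP[ea ax].
exists (pickle (a, b)); rewrite pickleK; split; first by rewrite /= in_itv/= ax xb.
move=> y; rewrite /= in_itv/= => /andP[ay yb]; apply: eU.
by rewrite -ball_normE/= ltr_norml; lra.
Qed.

Lemma open_measurable2 (U : set (R * R)) : open U -> measurable (U : set (mR * mR)).
Proof.
apply: (countable_base_open (M := fun A => measurable (A : set (mR * mR)))).
- exact: measurable0.
- by move=> F mF; exact: bigcupT_measurable.
apply: countable_base_prod countable_base_line countable_base_line; first exact: measurable0.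
by move=> A B mA mB; exact: measurableX.
Qed.

Lemma open_measurable3 (U : set (space R)) :
  open U -> measurable (U : set (mR * (mR * mR))).
Proof.
apply: (countable_base_open (M := fun A => measurable (A : set (mR * (mR * mR))))).
- exact: measurable0.
- by move=> F mF; exact: bigcupT_measurable.
apply: (@countable_base_prod R (R * R)%type _ _ _ _ _ countable_base_line
  (@countable_base_prod R R _ _ (fun A => measurable (A : set (mR * mR))) _ _
     countable_base_line countable_base_line)).
- exact: measurable0.
- by move=> A B mA mB; exact: measurableX.
- exact: measurable0.
- by move=> A B mA mB; exact: measurableX.
Qed.

Lemma closed_measurable3 (U : set (space R)) :
  closed U -> measurable (U : set (mR * (mR * mR))).
Proof.
move=> cU; rewrite -[U]setCK; apply: measurableC; apply: open_measurable3.
exact: closed_openC.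
Qed.

Lemma continuous_measurable2 (f : R * R -> R) : continuous f ->
  measurable_fun [set: mR * mR] (f : mR * mR -> R).
Proof.
move=> cf; apply: (measurability _ (RGenOInfty.measurableE R)) => _ [_ [x ->] <-].
rewrite setTI; apply: open_measurable2.
by apply: open_comp; [move=> p _; exact: cf|exact: interval_open].
Qed.

Lemma continuous_measurable3 (f : space R -> R) : continuous f ->
  measurable_fun [set: mR * (mR * mR)] (f : mR * (mR * mR) -> R).
Proof.
move=> cf; apply: (measurability _ (RGenOInfty.measurableE R)) => _ [_ [x ->] <-].
rewrite setTI; apply: open_measurable3.
by apply: open_comp; [move=> p _; exact: cf|exact: interval_open].
Qed.

End countable_base.

(** * Smooth functions of one variable and flat functions *)

Section Ck.
Context {R : realType}.

(** The derivative is an existential witness, so closure under sums, products and affine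
    substitution follows by induction on the order. *)
Fixpoint Ck (n : nat) (f : R -> R) : Prop :=
  if n is m.+1 then exists2 f', (forall x : R, is_derive x 1 f (f' x)) & Ck m f'
  else continuous f.

Lemma CkS n f : Ck n.+1 f -> Ck n f.
Proof.
elim: n f => [f [f' df _]|n IH f [f' df Cf']]; first exact: is_derive_continuous df.
by exists f' => //; exact: IH.
Qed.

Lemma Ck_cst n (a : R) : Ck n (cst a).
Proof.
elim: n a => [a x|n IH a]; first exact: cvg_cst.
by exists (cst 0) => [x|]; [exact: is_derive_cst|exact: IH].
Qed.

Lemma CkD n f g : Ck n f -> Ck n g -> Ck n (fun x => f x + g x).
Proof.
elim: n f g => [f g cf cg x|n IH f g [f' df cf'] [g' dg cg']].
  by apply: continuousD; [exact: cf|exact: cg].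
exists (fun x => f' x + g' x); last exact: IH.
by move=> x; have := df x; have := dg x => dg0 df0; exact: is_deriveD.
Qed.

Lemma CkM n f g : Ck n f -> Ck n g -> Ck n (fun x => f x * g x).
Proof.
elim: n f g => [f g cf cg x|n IH f g Cf Cg].
  by apply: continuousM; [exact: cf|exact: cg].
have [f' df cf'] := Cf; have [g' dg cg'] := Cg.
exists (fun x => f x * g' x + g x * f' x).
  by move=> x; have := df x; have := dg x => dg0 df0; exact: is_deriveM.
by apply: CkD; apply: IH => //; exact: CkS.
Qed.

Lemma Ck_affine n f (a b : R) : Ck n f -> Ck n (fun x => f (a * x + b)).
Proof.
have dg (x : R) : is_derive x 1 (fun x => a * x + b) a.
  apply: (is_derive1_eq (is_derive1D (is_derive1Z a (is_derive1_id x)) (is_derive1_cst b x))).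
  by rewrite mulr1 addr0.
elim: n f => [f cf|n IH f [f' df cf']].
  exact: (continuous_compose (is_derive_continuous dg) cf).
exists (fun x => f' (a * x + b) * a).
  by move=> x; exact: (is_derive1_compose (df _) (dg x)).
apply: (CkM (g := cst a)); [exact: IH|exact: Ck_cst].
Qed.

Implicit Types (f : R -> R) (x : R).
Definition smooth1 f := forall n, Ck n f.

Lemma smooth1_continuous f : smooth1 f -> continuous f.
Proof. exact: (@^~ 0). Qed.

Lemma smooth1_derivable f x : smooth1 f -> is_derive x 1 f (derive1 f x).
Proof.
move=> /(_ 1)[f' df _]; have [dfx _] := df x.
by apply: DeriveDef => //; rewrite derive1E.
Qed.

Lemma smooth1_derive f : smooth1 f -> smooth1 (derive1 f).
Proof.
move=> sf n; have [f' df cf'] := sf n.+1.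
suff -> : derive1 f = f' by [].
by apply/funext => x; rewrite derive1E; have [] := df x.
Qed.

(** x^(-k) e^(-1/x) extended by 0. Derivatives of members of this family are linear combinations of
    members, which gives smoothness across 0 by induction. *)
Definition expinv (k : nat) (x : R) := if 0 < x then x ^- k * expR (- x^-1) else 0.

(** Keeping a single term of the exponential series gives e^(1/x) >= x^(-(k+1)) / (k+1)!. *)
Lemma expinv_le k x : 0 < x -> expinv k x <= (k.+1)`!%:R * x.
Proof.
move=> x0; rewrite /expinv x0.
have y0 : 0 <= x^-1 by rewrite invr_ge0 ltW.
have := expR_ge1Dxn k y0; rewrite expRN => h.
have fk : 0 < (k.+1)`!%:R :> R by rewrite ltr0n fact_gt0.
have h2 : x^-1 ^+ k.+1 / (k.+1)`!%:R <= expR x^-1 by apply: le_trans h; rewrite lerDr.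
have h3 : 0 < x^-1 ^+ k.+1 / (k.+1)`!%:R by rewrite divr_gt0// exprn_gt0// invr_gt0.
apply: (@le_trans _ _ (x ^- k * (x^-1 ^+ k.+1 / (k.+1)`!%:R)^-1)).
  by rewrite ler_wpM2l ?lef_pV2 ?posrE ?expR_gt0// invr_ge0 exprn_ge0// ltW.
have xn0 : x != 0 by rewrite gt_eqF.
rewrite exprVn invf_div exprSr invrM ?unitfE ?expf_neq0//.
by rewrite le_eqVlt; apply/orP; left; apply/eqP; field; rewrite xn0 expf_neq0.
Qed.

Lemma expinv_ge0 k x : 0 <= expinv k x.
Proof.
rewrite /expinv; case: ifPn => // x0.
by rewrite mulr_ge0 ?expR_ge0// invr_ge0 exprn_ge0// ltW.
Qed.

Lemma is_derive_expinv k (x : R) :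
  is_derive x 1 (expinv k) (- k%:R * expinv k.+1 x + expinv k.+2 x).
Proof.
have [x0|x0|->] := ltrgtP x 0.
- rewrite {2 3}/expinv ltNge (ltW x0)/= mulr0 addr0.
  apply: (near_eq_is_derive (f := cst 0)) => //.
  near=> y; rewrite /expinv/=.
  have y0 : y < 0 by near: y; exact: lt_nbhsl.
  by rewrite ltNge (ltW y0).
- apply: (near_eq_is_derive (f := fun y : R => y^-1 ^+ k * expR (- y^-1))) => //.
    near=> y; rewrite /expinv/= -exprVn.
    by have -> : 0 < y by near: y; exact: lt_nbhsr.
  have xn0 : x != 0 by rewrite gt_eqF.
  have dV := is_derive1V xn0 (is_derive1_id x).
  have dE := is_derive1_compose (is_derive_expR _) (is_derive1N dV).
  apply: (is_derive1_eq (is_derive1M (is_derive1X k dV) dE)).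
  rewrite /expinv x0.
  case: k => [|k] /=; first by rewrite exprSr expr1; field.
  rewrite !exprVn !exprS; field; by rewrite xn0 expf_neq0.
- rewrite {2 3}/expinv ltxx mulr0 addr0.
  (* At 0 the slope function is [expinv k.+1] itself, continuous there by [expinv_le]. *)
  apply/is_derive1_caratheodory; exists (expinv k.+1); split.
  + move=> z; rewrite /expinv ltxx !subr0; case: ifPn => [z0|]; last by rewrite mul0r.
    by rewrite exprS; field; rewrite ?expf_neq0 gt_eqF.
  + have E0 : expinv k.+1 0 = 0 by rewrite /expinv ltxx.
    apply/cvgrPdist_le => e e0; rewrite E0.
    have fk : 0 < (k.+2)`!%:R :> R by rewrite ltr0n fact_gt0.
    exists (e / (k.+2)`!%:R) => /=; first exact: divr_gt0.
    move=> z /=; rewrite !sub0r !normrN => hz; rewrite ger0_norm ?expinv_ge0//.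
    have [z0|z0] := ltP 0 z; last by rewrite /expinv ltNge z0/= ltW.
    apply: le_trans (expinv_le _ z0) _.
    by rewrite mulrC -ler_pdivlMr// ltW// -(gtr0_norm z0).
  + by rewrite /expinv ltxx.
Unshelve. all: by end_near. Qed.

Lemma smooth1_expinv k : smooth1 (expinv k).
Proof.
move=> n; elim: n k => [k|n IH k].
  exact: is_derive_continuous (is_derive_expinv k).
exists (fun x => - k%:R * expinv k.+1 x + expinv k.+2 x); first exact: is_derive_expinv.
apply: CkD; last exact: IH.
apply: (CkM (f := cst (- k%:R))); [exact: Ck_cst|exact: IH].
Qed.

End Ck.

(** * Partial derivatives and tensor products *)

Section coordinates.
Context {R : realType}.
Implicit Types (f : space R -> R) (p : space R) (j : 'I_3) (x : R).

Definition coord j p : R :=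
  if val j == 0%N then p.1 else if val j == 1%N then p.2.1 else p.2.2.

(** Freezing the other coordinates turns a partial derivative of [f] at [p] into the ordinary
    derivative of [f (upd j p x)] at x = [coord j p]. *)
Definition upd j p x : space R :=
  if val j == 0%N then (x, p.2) else
  if val j == 1%N then (p.1, (x, p.2.2)) else (p.1, (p.2.1, x)).

Lemma upd_coord j p : upd j p (coord j p) = p.
Proof. by case: p => a [b c]; case: j => -[|[|[|//]]]. Qed.

Lemma shift_basis j p x : x *: basis_vector j + p = upd j p (x + coord j p).
Proof.
case: p => a [b c]; case: j => -[|[|[|//]]] ?;
  rewrite /basis_vector /upd /coord [LHS]surjective_pairing [X in (_, X)]surjective_pairing /=;
  by rewrite ?scaler0 ?add0r /GRing.scale/= ?mulr1.
Qed.

Let quotientE j f p :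
  (fun h : R => h^-1 *: ((f \o shift p) (h *: basis_vector j) - f p)) =
  (fun h : R => h^-1 *: (((fun x => f (upd j p x)) \o shift (coord j p)) (h *: (1 : R)) -
     f (upd j p (coord j p)))).
Proof.
apply/funext => h /=; rewrite upd_coord shift_basis.
by rewrite /GRing.scale/= mulr1.
Qed.

Lemma derivable_upd j f p : derivable f p (basis_vector j) <->
  derivable (fun x => f (upd j p x)) (coord j p) 1.
Proof. by rewrite /derivable quotientE. Qed.

Lemma partial_upd j f p :
  partial j f p = derive1 (fun x => f (upd j p x)) (coord j p).
Proof. by rewrite /partial derive1E /derive quotientE. Qed.

Lemma is_derive_upd j f p l :
  is_derive p (basis_vector j) f l <->
  is_derive (coord j p) 1 (fun x => f (upd j p x)) l.
Proof.
split => -[df <-].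
  by apply: DeriveDef; [exact/derivable_upd|rewrite /derive quotientE].
by apply: DeriveDef; [exact/derivable_upd|rewrite /derive quotientE].
Qed.

Lemma coord_upd j p x : coord j (upd j p x) = x.
Proof. by case: j => -[|[|[|//]]]. Qed.

Lemma upd_upd j p x y : upd j (upd j p x) y = upd j p y.
Proof. by case: j => -[|[|[|//]]]. Qed.

End coordinates.

Section tensor.
Context {R : realType}.
Implicit Types (a b c : R -> R).

Definition tensor a b c (p : space R) : R := a p.1 * (b p.2.1 * c p.2.2).

Lemma continuous_tensor a b c : continuous a -> continuous b -> continuous c ->
  continuous (tensor a b c).
Proof.
move=> ca cb cc; apply: continuous_mul.
  by apply: (continuous_compose (f := fst)) => //; exact: continuous_fst.
have cs := @continuous_snd R (R * R)%type.
apply: continuous_mul.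
- by apply: (continuous_compose (f := fun q : space R => q.2.1)) => //; exact: continuous_fst_compose.
- by apply: (continuous_compose (f := fun q : space R => q.2.2)) => //; exact: continuous_snd_compose.
Qed.

Lemma is_derive_tensor j a b c p : smooth1 a -> smooth1 b -> smooth1 c ->
  is_derive p (basis_vector j) (tensor a b c)
    (tensor (if val j == 0%N then derive1 a else a)
            (if val j == 1%N then derive1 b else b)
            (if val j == 2%N then derive1 c else c) p).
Proof.
move=> sa sb sc; apply/is_derive_upd.
have da := smooth1_derivable p.1 sa; have db := smooth1_derivable p.2.1 sb.
have dc := smooth1_derivable p.2.2 sc.
case: j => -[|[|[|//]]] ?; rewrite /coord /upd /tensor /=.
- by apply: (is_derive1_eq (is_derive1M da (is_derive1_cst _ _))); rewrite mulr0 addr0.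
- apply: is_derive1Z.
  by apply: (is_derive1_eq (is_derive1M db (is_derive1_cst _ _))); rewrite mulr0 addr0.
- by do 2 apply: is_derive1Z.
Qed.

Lemma smooth_tensor a b c : smooth1 a -> smooth1 b -> smooth1 c ->
  smooth (tensor a b c).
Proof.
move=> sa sb sc s.
(* The induction on [s] needs the stronger claim that every iterated partial derivative is again a
   tensor of smooth factors. *)
suff [a' [b' [c' [sa' sb' sc' ->]]]] : exists a' b' c',
    [/\ smooth1 a', smooth1 b', smooth1 c' &
      foldr partial (tensor a b c) s = tensor a' b' c'].
  split; first by apply: continuous_tensor; exact: smooth1_continuous.
  by move=> j p; have [] := is_derive_tensor j p sa' sb' sc'.
elim: s => [|j s [a' [b' [c' [sa' sb' sc' E]]]]]; first by exists a, b, c.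
exists (if val j == 0%N then derive1 a' else a'),
  (if val j == 1%N then derive1 b' else b'),
  (if val j == 2%N then derive1 c' else c'); split.
- by case: ifP => _ //; exact: smooth1_derive.
- by case: ifP => _ //; exact: smooth1_derive.
- by case: ifP => _ //; exact: smooth1_derive.
rewrite /= E; apply/funext => p; rewrite /partial.
by have [_ ->] := is_derive_tensor j p sa' sb' sc'.
Qed.

End tensor.

(** * One-sided mollifiers *)

Section bump.
Context {R : realType}.
Local Notation mu := (@lebesgue_measure R).
Variable r : R.
Hypothesis r0 : 0 < r.

Lemma integrable_compact_support (f : R -> R) (a b : R) : continuous f ->
  (forall x, ~ (a <= x <= b) -> f x = 0) -> mu.-integrable [set: measurableTypeR R] (EFin \o f).
Proof.
move=> cf f0; have mf := continuous_measurable_fun cf.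
have : mu.-integrable `[a, b] (EFin \o f).
  apply: continuous_compact_integrable; first exact: segment_compact.
  exact: continuous_subspaceT.
move/integrableP => [_ foo]; apply/integrableP; split; first exact/measurable_EFinP.
apply: le_lt_trans foo; rewrite [leRHS]integral_mkcond.
apply: ge0_le_integral => //.
- by apply: measurableT_comp => //; exact/measurable_EFinP.
- apply/(measurable_restrictT _ _).1 => //.
  by apply: measurableT_comp => //; apply/measurable_EFinP; exact: measurable_funTS.
- move=> x _; rewrite patchE; case: ifPn => //.
  by rewrite notin_setE/= in_itv/= => /f0 ->; rewrite normr0.
Qed.

(** Positive exactly on [0 < x < r]; the one-sided support matches [line_shifts]. *)
Let raw (x : R) := expinv 0 x * expinv 0 (- 1 * x + r).

Let raw_smooth : smooth1 raw.
Proof.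
by move=> n; apply: CkM; [exact: smooth1_expinv|apply: Ck_affine; exact: smooth1_expinv].
Qed.

Let raw_ge0 x : 0 <= raw x.
Proof. by rewrite mulr_ge0// expinv_ge0. Qed.

Let raw_gt0 x : 0 < x < r -> 0 < raw x.
Proof.
move=> /andP[x0 xr]; have rx : 0 < - 1 * x + r by lra.
by rewrite /raw /expinv x0 rx !expr0 !invr1 !mul1r mulr_gt0// expR_gt0.
Qed.

Let raw_eq0 x : ~ (0 < x < r) -> raw x = 0.
Proof.
move=> /negP; rewrite negb_and -!leNgt /raw /expinv => /orP[x0|rx].
  by rewrite ltNge x0/= mul0r.
have rx' : - 1 * x + r <= 0 by lra.
by rewrite [in X in _ * X]ltNge rx'/= mulr0.
Qed.

Let raw_integrable : mu.-integrable [set: measurableTypeR R] (EFin \o raw).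
Proof.
apply: (@integrable_compact_support _ 0 r); first exact: smooth1_continuous.
by move=> x h; apply: raw_eq0 => /andP[? ?]; apply: h; rewrite !ltW.
Qed.

(** A vanishing integral would make [raw] vanish almost everywhere on []0, r[], an interval of
    positive measure on which it is positive. *)
Let raw_int_gt0 : 0 < \int[mu]_x raw x.
Proof.
rewrite lt_neqAle Rintegral_ge0// andbT; apply/negP => /eqP I0.
have : (\int[mu]_x `|(raw x)%:E| = 0)%E.
  under eq_integral do rewrite gee0_abs ?lee_fin//.
  by rewrite -(fineK (integrable_fin_num _ raw_integrable))// -/(Rintegral _ _ _) -I0.
move/ae_eq_integral_abs => /(_ measurableT (measurable_int _ raw_integrable))[N [mN N0 NN]].
suff : (mu `]0%R, r[ <= 0)%E.
  by rewrite lebesgue_measure_itv/= lte_fin r0 sube0 lee_fin leNgt r0.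
rewrite -N0; apply: le_measure; rewrite ?inE//.
move=> x; rewrite /= in_itv/= => /raw_gt0 x0; apply: NN => /= /(_ I) /eqP.
by rewrite eqe gt_eqF.
Qed.

Definition bump (x : R) := raw x / \int[mu]_x raw x.

Lemma bump_smooth : smooth1 bump.
Proof. by move=> n; apply: (CkM (g := cst _)); [exact: raw_smooth|exact: Ck_cst]. Qed.

Lemma bump_ge0 x : 0 <= bump x.
Proof. by apply: divr_ge0 => //; exact: ltW. Qed.

Lemma bump_eq0 x : ~ (0 < x < r) -> bump x = 0.
Proof. by move=> h; rewrite /bump raw_eq0// mul0r. Qed.

Lemma bump_integral : (\int[mu]_x (bump x)%:E = 1)%E.
Proof.
have I0 : \int[mu]_x raw x != 0 by exact: lt0r_neq0.
transitivity ((\int[mu]_x raw x)^-1%:E * \int[mu]_x (raw x)%:E)%E.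
  rewrite -integralZl//; apply: eq_integral => x _.
  by rewrite /bump -EFinM mulrC.
rewrite -(fineK (integrable_fin_num _ raw_integrable))// -/(Rintegral _ _ _).
by rewrite -EFinM mulVf.
Qed.

End bump.

(** * Lebesgue measure on the space *)

Section space_measure.
Context {R : realType}.
Local Notation mR := (measurableTypeR R).
Local Notation T3 := (mR * (mR * mR))%type.
Local Notation lambda := (@lebesgue3 R).

Lemma preserving2 (t1 t2 : mR -> mR) :
  measure_preserving lebesgue_measure t1 -> measure_preserving lebesgue_measure t2 ->
  measure_preserving (@lebesgue2 R) (fun p => (t1 p.1, t2 p.2)).
Proof. by move=> h1 h2; exact: preserving_prod. Qed.

Lemma preserving3 (t1 t2 t3 : mR -> mR) :
  measure_preserving lebesgue_measure t1 -> measure_preserving lebesgue_measure t2 ->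
  measure_preserving lebesgue_measure t3 ->
  measure_preserving lambda (fun p => (t1 p.1, (t2 p.2.1, t3 p.2.2))).
Proof.
by move=> h1 h2 h3; exact: (preserving_prod h1 (preserving2 h2 h3)).
Qed.

Lemma tonelli3 (f : T3 -> \bar R) : measurable_fun [set: T3] f -> (forall p, 0 <= f p)%E ->
  (\int[lambda]_p f p = \int[lebesgue_measure]_x \int[lebesgue2]_y f (x, y))%E.
Proof.
by move=> mf f0; exact: (@fubini_tonelli1 _ _ _ _ R lebesgue_measure lebesgue2 f mf f0).
Qed.

Lemma tonelli2 (f : mR * mR -> \bar R) :
  measurable_fun [set: mR * mR] f -> (forall p, 0 <= f p)%E ->
  (\int[lebesgue2]_p f p = \int[lebesgue_measure]_x \int[lebesgue_measure]_y f (x, y))%E.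
Proof.
by move=> mf f0; exact: (@fubini_tonelli1 _ _ _ _ R lebesgue_measure lebesgue_measure f mf f0).
Qed.

Lemma measurable_tensor (a b c : R -> R) : measurable_fun [set: mR] a ->
  measurable_fun [set: mR] b -> measurable_fun [set: mR] c ->
  measurable_fun [set: T3] (tensor a b c : T3 -> R).
Proof.
move=> ma mb mc; apply: measurable_funM.
  by apply: (measurableT_comp ma); exact: measurable_fst.
apply: measurable_funM.
- by apply: (measurableT_comp mb); apply: (measurableT_comp measurable_fst); exact: measurable_snd.
- by apply: (measurableT_comp mc); apply: (measurableT_comp measurable_snd); exact: measurable_snd.
Qed.

Lemma integral_tensor (a b c : R -> R) : measurable_fun [set: mR] a ->
  measurable_fun [set: mR] b -> measurable_fun [set: mR] c ->
  (forall x, 0 <= a x) -> (forall x, 0 <= b x) -> (forall x, 0 <= c x) ->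
  (\int[lambda]_p (tensor a b c p)%:E =
   \int[lebesgue_measure]_x (a x)%:E * (\int[lebesgue_measure]_x (b x)%:E *
     \int[lebesgue_measure]_x (c x)%:E))%E.
Proof.
move=> ma mb mc a0 b0 c0.
have E2 : (\int[lebesgue2]_p (b p.1 * c p.2)%:E =
    \int[lebesgue_measure]_x (b x)%:E * \int[lebesgue_measure]_x (c x)%:E)%E.
  rewrite tonelli2; last first.
  - by move=> p; rewrite lee_fin mulr_ge0.
  - apply/measurable_EFinP; apply: measurable_funM.
      by apply: (measurableT_comp mb); exact: measurable_fst.
    by apply: (measurableT_comp mc); exact: measurable_snd.
  under eq_integral => x _.
    under eq_integral do rewrite EFinM /=.
    rewrite ge0_integralZl//; [|by apply/measurable_EFinP|by move=> ? _; rewrite lee_fin|by rewrite lee_fin].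
    over.
  rewrite ge0_integralZr//; [by apply/measurable_EFinP|by move=> ? _; rewrite lee_fin|].
  by apply: integral_ge0 => ? _; rewrite lee_fin.
rewrite tonelli3; last first.
- by move=> p; rewrite lee_fin !mulr_ge0.
- by apply/measurable_EFinP; exact: measurable_tensor.
have m2 : measurable_fun [set: mR * mR] (fun p : mR * mR => (b p.1 * c p.2)%:E).
  apply/measurable_EFinP; apply: measurable_funM.
    by apply: (measurableT_comp mb); exact: measurable_fst.
  by apply: (measurableT_comp mc); exact: measurable_snd.
under eq_integral => x _.
  under eq_integral do rewrite EFinM /=.
  rewrite (ge0_integralZl lebesgue2 measurableT m2)//; [|by move=> ? _; rewrite lee_fin mulr_ge0|by rewrite lee_fin].
  rewrite E2.
  over.
rewrite ge0_integralZr//; [by apply/measurable_EFinP|by move=> ? _; rewrite lee_fin|].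
by apply: mule_ge0; apply: integral_ge0 => ? _; rewrite lee_fin.
Qed.

End space_measure.

Section test_profile.
Context {R : realType}.
Implicit Types a : R -> R.

(** Stable under [derive1], so that the derivatives of a kernel have the same support and
    boundedness properties as the kernel. *)
Definition test_profile (r : R) a := smooth1 a /\ forall x, ~ (0 <= x <= r) -> a x = 0.

Lemma test_profile_derive r a : test_profile r a -> test_profile r (derive1 a).
Proof.
move=> [sa a0]; split; first exact: smooth1_derive.
move=> x /negP; rewrite negb_and -!ltNge => xr.
apply: is_derive1E; apply: (near_eq_is_derive (f := cst 0)) => //.
case/orP : xr => xr; near=> y; rewrite a0//=.
- by apply/negP; rewrite negb_and -!ltNge; apply/orP; left; near: y; exact: lt_nbhsl.
- by apply/negP; rewrite negb_and -!ltNge; apply/orP; right; near: y; exact: lt_nbhsr.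
Unshelve. all: by end_near. Qed.

Lemma test_profile_bounded r a : test_profile r a -> exists2 M, 0 <= M & forall x, `|a x| <= M.
Proof.
move=> [sa a0]; have ca := smooth1_continuous sa.
have [r0|r0] := leP 0 r; last first.
  exists 0 => // x; rewrite a0 ?normr0// => /andP[x0 xr].
  by move: (le_trans x0 xr); rewrite leNgt r0.
have [c _ hc] := @EVT_max R (fun x => `|a x|) 0 r r0
  (continuous_subspaceT (continuous_compose ca (@norm_continuous _ _))).
exists `|a c| => // x; have [/hc//|] := boolP (x \in `[0, r]).
by rewrite in_itv/= => /negP/a0 ->; rewrite normr0.
Qed.

Lemma bump_test_profile (r : R) : 0 < r -> test_profile r (bump r).
Proof.
move=> r0; split; first exact: bump_smooth.
by move=> x h; apply: bump_eq0 => /andP[? ?]; apply: h; rewrite !ltW.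
Qed.

End test_profile.

(** It converts dominated convergence, stated for sequences, into continuity of integrals that
    depend on a parameter. *)
Lemma continuous_at_sequence (R : realType) (T : pseudoMetricType R) (f : T -> R) (p : T) :
  (forall u : nat -> T, u @ \oo --> p -> f (u n) @[n --> \oo] --> f p) ->
  {for p, continuous f}.
Proof.
move=> h; apply/cvgrPdist_le => e e0.
have [[n hn]|H] := pselect (exists n : nat, forall x, ball p (n.+1%:R^-1) x -> `|f p - f x| <= e).
  by apply/nbhs_ballP; exists n.+1%:R^-1 => /=.
have /choice[u hu] : forall n : nat, exists x, ball p (n.+1%:R^-1) x /\ ~ `|f p - f x| <= e.
  move=> n; apply: contrapT => hn; apply: H; exists n => x bx.
  by apply: contrapT => fx; apply: hn; exists x.
have up : u @ \oo --> p.
  apply/cvg_ballP => d d0; near=> n; apply: le_ball (hu n).1.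
  by apply/ltW; near: n; exact: near_infty_natSinv_lt (PosNum d0).
have /cvgrPdist_le/(_ _ e0)[n _ hn] := h _ up.
by have /(_ (leqnn n)) := hn n; case: (hu n).
Unshelve. all: by end_near. Qed.

(** * Smoothing by convolution *)

Section smoothing.
Context {R : realType}.
Local Notation mR := (measurableTypeR R).
Local Notation T3 := (mR * (mR * mR))%type.
Local Notation lambda := (@lebesgue3 R).
Implicit Types (F G : space R -> R) (a b c : R -> R) (p q : space R).

Definition centered a b c p : space R -> R :=
  tensor (fun x => a (x - p.1)) (fun y => b (y - p.2.1)) (fun z => c (z - p.2.2)).

(** The kernel occupies the box whose lower corner is [p], so differentiation in [p] yields minus
    the smoothing with the differentiated kernel. *)
Definition smoothing a b c F p := \int[lambda]_q (F q * centered a b c p q).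

Lemma smooth1_shift a (t : R) : smooth1 a -> smooth1 (fun x => a (x - t)).
Proof.
move=> sa n; have := Ck_affine 1 (- t) (sa n).
by congr (Ck n _); apply/funext => x; rewrite mul1r.
Qed.

Lemma smooth_centered a b c p : smooth1 a -> smooth1 b -> smooth1 c ->
  smooth (centered a b c p).
Proof. by move=> *; apply: smooth_tensor; exact: smooth1_shift. Qed.

Lemma continuous_centered a b c p : continuous a -> continuous b -> continuous c ->
  continuous (centered a b c p).
Proof.
have h a' t : continuous a' -> continuous (fun x : R => a' (x - t)).
  move=> ca; apply: (continuous_compose (f := fun x => x - t)) => //.
  by apply: continuous_sub; [exact: continuous_self|exact: continuous_const].
by move=> *; apply: continuous_tensor; exact: h.
Qed.

Lemma centered_bounded r a b c : test_profile r a -> test_profile r b -> test_profile r c ->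
  exists2 M, 0 <= M & forall p q, `|centered a b c p q| <= M.
Proof.
move=> /test_profile_bounded[A A0 hA] /test_profile_bounded[B B0 hB].
move=> /test_profile_bounded[C C0 hC]; exists (A * (B * C)); first by rewrite !mulr_ge0.
by move=> p q; rewrite !normrM !ler_pM.
Qed.

Lemma centered_eq0 r a b c p q : test_profile r a -> test_profile r b -> test_profile r c ->
  ~ [/\ p.1 <= q.1 <= p.1 + r, p.2.1 <= q.2.1 <= p.2.1 + r & p.2.2 <= q.2.2 <= p.2.2 + r] ->
  centered a b c p q = 0.
Proof.
move=> [_ ha] [_ hb] [_ hc] h; rewrite /centered /tensor.
have [h1|/ha ->] := pselect (0 <= q.1 - p.1 <= r); last by rewrite mul0r.
have [h2|/hb ->] := pselect (0 <= q.2.1 - p.2.1 <= r); last by rewrite mul0r mulr0.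
have [h3|/hc ->] := pselect (0 <= q.2.2 - p.2.2 <= r); last by rewrite !mulr0.
by exfalso; apply: h; split; lra.
Qed.

Lemma measurable_centered a b c p : smooth1 a -> smooth1 b -> smooth1 c ->
  measurable_fun [set: T3] (centered a b c p : T3 -> R).
Proof.
move=> sa sb sc; apply: continuous_measurable3.
by apply: continuous_centered; exact: smooth1_continuous.
Qed.

Lemma integrableM_bounded F k M : lambda.-integrable [set: T3] (EFin \o F) ->
  measurable_fun [set: T3] (k : T3 -> R) -> (forall q, `|k q| <= M) ->
  lambda.-integrable [set: T3] (EFin \o (fun q => F q * k q)).
Proof.
move=> iF mk kM.
have /measurable_int/measurable_EFinP mF := iF.
apply: (@le_integrable _ _ _ _ _ measurableT _ (fun q : T3 => M%:E * (F q)%:E)%E).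
- by apply/measurable_EFinP; exact: measurable_funM.
- move=> q _; rewrite /= lee_fin !normrM mulrC ler_wpM2r//.
  exact: le_trans (kM q) (ler_norm _).
- exact: integrableZl.
Qed.

Lemma integrable_smoothing r a b c F p : test_profile r a -> test_profile r b ->
  test_profile r c -> lambda.-integrable [set: T3] (EFin \o F) ->
  lambda.-integrable [set: T3] (EFin \o (fun q => F q * centered a b c p q)).
Proof.
move=> ta tb tc iF; have [M M0 hM] := centered_bounded ta tb tc.
apply: (integrableM_bounded iF (M := M)) => //.
by apply: measurable_centered; [exact: ta.1|exact: tb.1|exact: tc.1].
Qed.

Lemma continuous_smoothing r a b c F : test_profile r a -> test_profile r b ->
  test_profile r c -> lambda.-integrable [set: T3] (EFin \o F) ->
  continuous (smoothing a b c F).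
Proof.
move=> ta tb tc iF p; have [M M0 hM] := centered_bounded ta tb tc.
have /measurable_int/measurable_EFinP mF := iF.
have mc q : measurable_fun [set: T3] (centered a b c q : T3 -> R).
  by apply: measurable_centered; [exact: ta.1|exact: tb.1|exact: tc.1].
apply: continuous_at_sequence => u up.
have [] := @dominated_convergence _ _ _ lambda _ (@measurableT _ T3)
  (fun n q => (F q * centered a b c (u n) q)%:E) (fun q => (F q * centered a b c p q)%:E)
  (fun q => M%:E * `|F q|%:E)%E.
- by move=> n; apply/measurable_EFinP; exact: measurable_funM.
- by apply/measurable_EFinP; exact: measurable_funM.
- apply/aeW => q _; apply: cvg_EFin; first by near=> n.
  apply: cvgM; first exact: cvg_cst.
  have cont (f : R -> R) (v : nat -> R) (t w : R) : continuous f -> v @ \oo --> w ->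
      (fun n => f (t - v n)) @ \oo --> f (t - w).
    move=> cf vw; apply: (@cvg_comp _ _ _ (fun n => t - v n) f); last exact: cf.
    by apply: cvgB => //; exact: cvg_cst.
  have u1 : (fun n => (u n).1) @ \oo --> p.1.
    exact: (@cvg_comp _ _ _ u fst _ _ _ up (@cvg_fst _ _ _ _ _)).
  have u2 : (fun n => (u n).2) @ \oo --> p.2.
    exact: (@cvg_comp _ _ _ u snd _ _ _ up (@cvg_snd _ _ _ _ _)).
  apply: cvgM; first by apply: cont => //; exact: smooth1_continuous ta.1.
  apply: cvgM; apply: cont; try exact: smooth1_continuous tb.1; try exact: smooth1_continuous tc.1.
    exact: (@cvg_comp _ _ _ (fun n => (u n).2) fst _ _ _ u2 (@cvg_fst _ _ _ _ _)).
  exact: (@cvg_comp _ _ _ (fun n => (u n).2) snd _ _ _ u2 (@cvg_snd _ _ _ _ _)).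
- by apply: integrableZl => //; exact: (integrable_abse iF).
- apply/aeW => q n _; rewrite -EFinM lee_fin normrM mulrC ler_wpM2r//.
- move=> _ _; rewrite /smoothing /Rintegral.
  have fin q : (\int[lambda]_x (F x * centered a b c q x)%:E)%E \is a fin_num.
    by apply: integrable_fin_num => //; exact: (integrable_smoothing _ ta tb tc iF).
  by move=> h; apply: fine_cvg; rewrite fineK.
Unshelve. all: by end_near. Qed.

Lemma is_derive_centered j a b c p q (t : R) : smooth1 a -> smooth1 b -> smooth1 c ->
  is_derive t 1 (fun t => centered a b c (upd j p t) q)
   (- centered (if val j == 0%N then derive1 a else a)
            (if val j == 1%N then derive1 b else b)
            (if val j == 2%N then derive1 c else c) (upd j p t) q).
Proof.
move=> sa sb sc.
have h (f : R -> R) (z : R) : smooth1 f -> is_derive t 1 (fun t => f (z - t)) (- derive1 f (z - t)).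
  move=> sf; apply: (is_derive1_eq (@is_derive1_compose _ f (fun t => z - t) t _ _
    (smooth1_derivable (z - t) sf) (is_derive1B (is_derive1_cst z t) (is_derive1_id t)))).
  by rewrite sub0r mulrN1.
case: j => -[|[|[|//]]] ?; rewrite /centered /tensor /upd /=.
- apply: (is_derive1_eq (is_derive1M (h _ _ sa) (is_derive1_cst _ _))).
  by rewrite mulr0 addr0 mulNr.
- rewrite -mulrN; apply: is_derive1Z.
  apply: (is_derive1_eq (is_derive1M (h _ _ sb) (is_derive1_cst _ _))).
  by rewrite mulr0 addr0 mulNr.
- by rewrite -!mulrN; do 2 apply: is_derive1Z; exact: h.
Qed.

(** Differentiation under the integral sign, dominated by M |F|, where [M] bounds the differentiated
    kernel. *)
Lemma is_derive_smoothing r j a b c F p : test_profile r a -> test_profile r b ->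
  test_profile r c -> lambda.-integrable [set: T3] (EFin \o F) ->
  is_derive p (basis_vector j) (smoothing a b c F)
   (- smoothing (if val j == 0%N then derive1 a else a)
            (if val j == 1%N then derive1 b else b)
            (if val j == 2%N then derive1 c else c) F p).
Proof.
move=> ta tb tc iF; apply/is_derive_upd.
set a' := if val j == 0%N then _ else a; set b' := if val j == 1%N then _ else b.
set c' := if val j == 2%N then _ else c.
have ta' : test_profile r a' by rewrite /a'; case: ifP => _ //; exact: test_profile_derive.
have tb' : test_profile r b' by rewrite /b'; case: ifP => _ //; exact: test_profile_derive.
have tc' : test_profile r c' by rewrite /c'; case: ifP => _ //; exact: test_profile_derive.
have [M M0 hM] := centered_bounded ta' tb' tc'.
pose f (t : R) (q : T3) := F q * centered a b c (upd j p t) q.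
have df (t : R) q : is_derive t 1 (fun t => f t q) (F q * - centered a' b' c' (upd j p t) q).
  by apply: is_derive1Z; exact: is_derive_centered ta.1 tb.1 tc.1.
have mI (t : R) : `]t - 1, t + 1[%classic t by rewrite /= in_itv/=; lra.
have fi x : lambda.-integrable [set: T3] (EFin \o f x) by exact: (integrable_smoothing _ ta tb tc iF).
have iG : lambda.-integrable [set: T3] (EFin \o (fun q => M * `|F q|)).
  by rewrite /comp; under eq_fun do rewrite EFinM; apply: integrableZl => //; exact: (integrable_abse iF).
have ub (x : R) (q : T3) : `|partial1of2 f x q| <= M * `|F q|.
  rewrite /partial1of2 (is_derive1E (df x q)) normrM normrN mulrC.
  by rewrite ler_wpM2r.
have G0 q : 0 <= M * `|F q| by rewrite mulr_ge0.
apply: DeriveDef.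
  by apply: (@derivable_under_integral _ _ _ _ f _ measurableT _ _ _ (mI _) _ _ _ G0 iG) => //;
    move=> x q _ _; have [] := df x q.
rewrite -derive1E (@differentiation_under_integral _ _ _ _ f _ measurableT _ _ _ (mI (coord j p))
  (fun x _ => fi x) _ _ G0 iG)//.
rewrite /smoothing.
under eq_Rintegral => q _ do rewrite /partial1of2 (is_derive1E (df _ q)) upd_coord mulrN -mulN1r.
by rewrite RintegralZl ?mulN1r//; exact: (integrable_smoothing _ ta' tb' tc' iF).
Qed.

End smoothing.

(** * Convergence of mollifications *)

Section mollification.
Context {R : realType}.
Local Notation mR := (measurableTypeR R).
Local Notation T3 := (mR * (mR * mR))%type.
Local Notation lambda := (@lebesgue3 R).
Implicit Types (F G : space R -> R) (p q : space R).

Definition mollify (r : R) F := smoothing (bump r) (bump r) (bump r) F.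

Definition space_shifts : R -> set (T3 -> T3) :=
  shift_prod line_shifts (shift_prod line_shifts line_shifts).

Lemma space_shifts_preserving e tau : space_shifts e tau -> measure_preserving lambda tau.
Proof.
apply: (@shift_prod_preserving _ _ _ _ _ lebesgue_measure lebesgue2).
  exact: line_shifts_preserving.
apply: (@shift_prod_preserving _ _ _ _ _ lebesgue_measure lebesgue_measure);
  exact: line_shifts_preserving.
Qed.

Lemma space_shifts_homo a b : a <= b -> space_shifts a `<=` space_shifts b.
Proof.
apply: shift_prod_homo; first exact: line_shifts_homo.
by apply: shift_prod_homo; exact: line_shifts_homo.
Qed.

Lemma space_shifts_continuous A : measurable A -> (lambda A < +oo)%E ->
  shift_continuous lambda space_shifts A.
Proof.
apply: (@shift_prod_continuous _ _ _ _ _ lebesgue_measure lebesgue2).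
- exact: line_shifts_preserving.
- exact: line_shifts_homo.
- apply: (@shift_prod_preserving _ _ _ _ _ lebesgue_measure lebesgue_measure);
    exact: line_shifts_preserving.
- by apply: shift_prod_homo; exact: line_shifts_homo.
- exact: line_shifts_continuous.
- apply: (@shift_prod_continuous _ _ _ _ _ lebesgue_measure lebesgue_measure);
    try exact: line_shifts_preserving; try exact: line_shifts_homo;
    exact: line_shifts_continuous.
Qed.

Lemma L1_space_shift F : lambda.-integrable [set: T3] (EFin \o F) ->
  L1_shift_continuous lambda space_shifts F.
Proof.
apply: L1_shift_continuous_integrable.
- exact: space_shifts_preserving.
- exact: space_shifts_homo.
- exact: space_shifts_continuous.
Qed.

Definition translate q p : space R := (p.1 + q.1, (p.2.1 + q.2.1, p.2.2 + q.2.2)).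

Lemma translate_preserving q : measure_preserving lambda (translate q).
Proof.
exact: (preserving3 (preserving_shift q.1) (preserving_shift q.2.1) (preserving_shift q.2.2)).
Qed.

Lemma measurable_translate (F : T3 -> R) : measurable_fun [set: T3] F ->
  measurable_fun [set: T3 * T3] (fun z : T3 * T3 => F (translate z.2 z.1)).
Proof.
move=> mF; apply: (measurableT_comp mF (g := fun z : T3 * T3 => translate z.2 z.1)).
have m1 : measurable_fun [set: T3 * T3] (fun z : T3 * T3 => z.1) by exact: measurable_fst.
have m2 : measurable_fun [set: T3 * T3] (fun z : T3 * T3 => z.2) by exact: measurable_snd.
have f1 : measurable_fun [set: T3] (fun z : T3 => z.1) by exact: measurable_fst.
have f2 : measurable_fun [set: T3] (fun z : T3 => z.2.1).
  by apply: (measurableT_comp measurable_fst); exact: measurable_snd.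
have f3 : measurable_fun [set: T3] (fun z : T3 => z.2.2).
  by apply: (measurableT_comp measurable_snd); exact: measurable_snd.
apply: measurable_fun_pair.
  by apply: measurable_funD; exact: (measurableT_comp f1).
apply: measurable_fun_pair.
  by apply: measurable_funD; exact: (measurableT_comp f2).
by apply: measurable_funD; exact: (measurableT_comp f3).
Qed.

Section kernel.
Variable r : R.
Hypothesis r0 : 0 < r.

Let k := tensor (bump r) (bump r) (bump r).

Let kt := bump_test_profile r0.

Let k_ge0 q : 0 <= k q.
Proof.
exact: (mulr_ge0 (bump_ge0 r0 _) (mulr_ge0 (bump_ge0 r0 _) (bump_ge0 r0 _))).
Qed.

Let mb : measurable_fun [set: mR] (bump r).
Proof. by apply: continuous_measurable_fun; exact: smooth1_continuous kt.1. Qed.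

Let mk : measurable_fun [set: T3] (k : T3 -> R).
Proof. exact: measurable_tensor. Qed.

Let k_int : (\int[lambda]_q (k q)%:E = 1)%E.
Proof.
rewrite integral_tensor//; try by move=> ?; exact: bump_ge0.
by rewrite !bump_integral// !mule1.
Qed.

Let ik : lambda.-integrable [set: T3] (EFin \o k).
Proof.
apply/integrableP; split; first exact/measurable_EFinP.
under eq_integral do rewrite /= ger0_norm//.
by rewrite k_int ltry.
Qed.

Let k_bounded : exists2 M, 0 <= M & forall q, `|k q| <= M.
Proof.
have [M M0 hM] := centered_bounded kt kt kt; exists M => // q.
have := hM (0, (0, 0)) q; rewrite /centered /tensor /= !subr0.
by rewrite /k /tensor.
Qed.

Lemma mollifyE F p : lambda.-integrable [set: T3] (EFin \o F) ->
  mollify r F p = \int[lambda]_q (F (translate q p) * k q).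
Proof.
move=> iF.
have E : (\int[lambda]_q (F q * centered (bump r) (bump r) (bump r) p q)%:E =
    \int[lambda]_q (F (translate q p) * k q)%:E)%E.
  rewrite -(preserving_integral (translate_preserving p)); last first.
    exact: (integrable_smoothing _ kt kt kt).
  apply: eq_integral => q _; rewrite /translate /centered /k /tensor /= !addrK.
  by rewrite (addrC q.1) (addrC q.2.1) (addrC q.2.2).
by rewrite /mollify /smoothing /Rintegral E.
Qed.

Let iFk F p : lambda.-integrable [set: T3] (EFin \o F) ->
  lambda.-integrable [set: T3] (EFin \o (fun q => F (translate q p) * k q)).
Proof.
move=> iF; have [M M0 hM] := k_bounded; apply: (integrableM_bounded _ mk hM).
have := preserving_integrable (translate_preserving p) iF.
apply: eq_integrable => // q _; rewrite /= /translate.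
by rewrite (addrC q.1) (addrC q.2.1) (addrC q.2.2).
Qed.

Lemma mollify_sub F p : lambda.-integrable [set: T3] (EFin \o F) ->
  mollify r F p - F p = \int[lambda]_q ((F (translate q p) - F p) * k q).
Proof.
move=> iF; rewrite mollifyE//.
have iFp : lambda.-integrable [set: T3] (EFin \o (fun q => F p * k q)).
  by rewrite /comp; under eq_fun do rewrite EFinM; exact: integrableZl.
transitivity (\int[lambda]_q (F (translate q p) * k q) - \int[lambda]_q (F p * k q)).
  congr (_ - _); rewrite RintegralZl//.
  by rewrite /Rintegral k_int mulr1.
rewrite -RintegralB//; last exact: iFk.
by apply: eq_Rintegral => q _; rewrite mulrBl.
Qed.

(* The supports of the bump functions lie in the positive half-line, so only shifts
   in [space_shifts r] contribute. *)
Lemma mollify_average (H : space R -> space R -> R) (e : R) : 0 <= e ->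
  measurable_fun [set: T3 * T3] (fun z : T3 * T3 => H z.2 z.1) ->
  (forall p q, 0 <= H q p) ->
  (forall q, space_shifts r (translate q) -> (\int[lambda]_p (H q p)%:E <= e%:E)%E) ->
  (\int[lambda]_p \int[lambda]_q (H q p * k q)%:E <= e%:E)%E.
Proof.
move=> e0 mH H0 hH.
have mHk : measurable_fun [set: T3 * T3] (fun z : T3 * T3 => (H z.2 z.1 * k z.2)%:E).
  apply/measurable_EFinP; apply: measurable_funM => //.
  by apply: (measurableT_comp mk); exact: measurable_snd.
rewrite (@fubini_tonelli _ _ _ _ R lambda lambda (fun z : T3 * T3 => (H z.2 z.1 * k z.2)%:E) mHk)/=; last first.
  by move=> z; rewrite lee_fin mulr_ge0.
apply: (@le_trans _ _ (\int[lambda]_q (e%:E * (k q)%:E))%E); last first.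
  rewrite ge0_integralZl//;
    try by [rewrite k_int mule1|exact/measurable_EFinP|move=> ? _; rewrite lee_fin].
apply: ge0_le_integral => //.
- by move=> q _; apply: integral_ge0 => p _; rewrite lee_fin mulr_ge0.
- apply: (@measurable_fun_fubini_tonelli_G _ _ _ _ R lambda
    (fun z : T3 * T3 => (H z.2 z.1 * k z.2)%:E) mHk).
  by move=> z; rewrite lee_fin; apply: mulr_ge0.
- by apply: measurable_funeM; exact/measurable_EFinP.
move=> q _.
have mHq : measurable_fun [set: T3] (fun p : T3 => (H q p)%:E).
  apply/measurable_EFinP.
  exact: (measurable_fun_pair1 q mH).
under eq_integral do rewrite EFinM.
rewrite ge0_integralZr//; [|by move=> p _; rewrite lee_fin|by rewrite lee_fin].
have [h|h] := pselect (space_shifts r (translate q)).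
  by rewrite lee_wpmul2r ?lee_fin//; exact: hH.
suff -> : k q = 0 by rewrite !mule0.
have [h1|/bump_eq0 h1] := pselect (0 < q.1 < r); last by rewrite /k /tensor h1 ?mul0r.
have [h2|/bump_eq0 h2] := pselect (0 < q.2.1 < r); last by rewrite /k /tensor h2 ?(mul0r, mulr0).
have [h3|/bump_eq0 h3] := pselect (0 < q.2.2 < r); last by rewrite /k /tensor h3 ?(mul0r, mulr0).
exfalso; apply: h; exists (fun x => x + q.1), (fun p : mR * mR => (p.1 + q.2.1, p.2 + q.2.2)); split => //.
  by exists q.1 => //; lra.
exists (fun x => x + q.2.1), (fun x => x + q.2.2); split => //.
  by exists q.2.1 => //; lra.
by exists q.2.2 => //; lra.
Qed.

Let mTF F : measurable_fun [set: T3] (F : T3 -> R) ->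
  measurable_fun [set: T3 * T3] (fun z : T3 * T3 => F (translate z.2 z.1) - F z.1).
Proof.
move=> mF; apply: measurable_funB; first exact: measurable_translate.
by apply: (measurableT_comp mF); exact: measurable_fst.
Qed.

(** The mollification error is the kernel average of the differences between [F] and its translates;
    exchanging the integrals leaves L^1 norms of such differences, each at most [e]. *)
Lemma mollify_L1_le F (e : R) : 0 <= e -> lambda.-integrable [set: T3] (EFin \o F) ->
  (forall q, space_shifts r (translate q) ->
     (\int[lambda]_p `|F (translate q p) - F p|%:E <= e%:E)%E) ->
  (\int[lambda]_p `|mollify r F p - F p|%:E <= e%:E)%E.
Proof.
move=> e0 iF hF; have /measurable_int/measurable_EFinP mF := iF.
apply: le_trans (mollify_average (H := fun q p => `|F (translate q p) - F p|) e0 _ _ hF) => //.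
- have cm : measurable_fun [set: T3] (mollify r F : T3 -> R).
    by apply: continuous_measurable3; exact: (continuous_smoothing kt kt kt).
  apply: ge0_le_integral => //.
  + by apply/measurable_EFinP; apply: measurableT_comp => //; exact: measurable_funB.
  + apply: (@measurable_fun_fubini_tonelli_F _ _ _ _ R lambda
      (fun z : T3 * T3 => (`|F (translate z.2 z.1) - F z.1| * k z.2)%:E)) => //.
    * apply/measurable_EFinP; apply: measurable_funM.
        by apply: measurableT_comp => //; exact: mTF.
      by apply: (measurableT_comp mk); exact: measurable_snd.
    * by move=> z; rewrite lee_fin; apply: mulr_ge0.
  + move=> p _; rewrite mollify_sub// /Rintegral.
    have iD : lambda.-integrable [set: T3] (EFin \o (fun q => (F (translate q p) - F p) * k q)).
      have iFp : lambda.-integrable [set: T3] (EFin \o (fun q => F p * k q)).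
        by rewrite /comp; under eq_fun do rewrite EFinM; exact: integrableZl.
      rewrite /comp; under eq_fun do rewrite mulrBl EFinB.
      by apply: integrableB => //; exact: iFk.
    rewrite -/(Rintegral _ _ _) EFin_normr_Rintegral//.
    apply: le_trans (le_abse_integral _ _ (measurable_int _ iD)) _ => //.
    by under eq_integral do rewrite /= normrM (ger0_norm (k_ge0 _)).
- by apply: measurableT_comp => //; exact: mTF.
Qed.

Lemma mollify_L2_le F (e : R) : 0 <= e -> lambda.-integrable [set: T3] (EFin \o F) ->
  lambda.-integrable [set: T3] (EFin \o (fun p => F p ^+ 2)) ->
  (forall q, space_shifts r (translate q) ->
     (\int[lambda]_p ((F (translate q p) - F p) ^+ 2)%:E <= e%:E)%E) ->
  (\int[lambda]_p ((mollify r F p - F p) ^+ 2)%:E <= e%:E)%E.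
Proof.
move=> e0 iF iF2 hF; have /measurable_int/measurable_EFinP mF := iF.
apply: le_trans (mollify_average (H := fun q p => (F (translate q p) - F p) ^+ 2) e0 _ _ hF) => //.
- have cm : measurable_fun [set: T3] (mollify r F : T3 -> R).
    by apply: continuous_measurable3; exact: (continuous_smoothing kt kt kt).
  apply: ge0_le_integral => //.
  + by move=> p _; rewrite lee_fin sqr_ge0.
  + by apply/measurable_EFinP; apply: measurable_funX; exact: measurable_funB.
  + apply: (@measurable_fun_fubini_tonelli_F _ _ _ _ R lambda
      (fun z : T3 * T3 => ((F (translate z.2 z.1) - F z.1) ^+ 2 * k z.2)%:E)) => //.
    * apply/measurable_EFinP; apply: measurable_funM.
        by apply: measurable_funX; exact: mTF.
      by apply: (measurableT_comp mk); exact: measurable_snd.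
    * by move=> z; rewrite lee_fin; apply: mulr_ge0 => //; exact: sqr_ge0.
  + move=> p _.
    set c := mollify r F p - F p.
    have iFp x : lambda.-integrable [set: T3] (EFin \o (fun q => x * k q)).
      by rewrite /comp; under eq_fun do rewrite EFinM; exact: integrableZl.
    have i1 := iFk p iF; have i2 := iFk (F := fun p => F p ^+ 2) p iF2.
    (* Jensen: [0 <= \int (F (p + q) - F p - c)^2 k(q) dq] and the mean of
       [F (p + q) - F p] is [c] *)
    have iD : lambda.-integrable [set: T3]
        (EFin \o (fun q => (F (translate q p) - F p) ^+ 2 * k q)).
      have -> : (fun q => (F (translate q p) - F p) ^+ 2 * k q) =
          (fun q => F (translate q p) ^+ 2 * k q - ((2 * F p) * (F (translate q p) * k q)
             - F p ^+ 2 * k q)).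
        by apply/funext => q; ring.
      exact: (RintegrableB measurableT i2 (RintegrableB measurableT
        (RintegrableZ measurableT (2 * F p) i1) (iFp _))).
    have iD1 : lambda.-integrable [set: T3]
        (EFin \o (fun q => (F (translate q p) - F p) * k q)).
      rewrite /comp; under eq_fun do rewrite mulrBl EFinB.
      exact: (integrableB measurableT i1 (iFp _)).
    have cE : c = \int[lambda]_q ((F (translate q p) - F p) * k q) by exact: mollify_sub.
    have := @Rintegral_ge0 _ _ _ lambda setT (fun q => (F (translate q p) - F p - c) ^+ 2 * k q).
    move=> /(_ (fun q _ => mulr_ge0 (sqr_ge0 _) (k_ge0 q))).
    have -> : (fun q => (F (translate q p) - F p - c) ^+ 2 * k q) =
       (fun q => (F (translate q p) - F p) ^+ 2 * k q -
          ((2 * c) * ((F (translate q p) - F p) * k q) - c ^+ 2 * k q)).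
      by apply/funext => q; ring.
    have jD1 := RintegrableZ measurableT (2 * c) iD1.
    have jk := RintegrableZ measurableT (c ^+ 2) ik.
    rewrite (RintegralB' measurableT iD (RintegrableB measurableT jD1 jk)).
    rewrite (RintegralB' measurableT jD1 jk) (RintegralZ' measurableT _ iD1).
    rewrite (RintegralZ' measurableT _ ik) -cE.
    have -> : \int[lambda]_q k q = 1 by rewrite /Rintegral k_int.
    rewrite subr_ge0 => h.
    rewrite -(fineK (integrable_fin_num _ iD))// -/(Rintegral _ _ _) lee_fin.
    apply: le_trans h; lra.
- by apply: measurable_funX; exact: mTF.
- by move=> p q; exact: sqr_ge0.
Qed.

End kernel.

Lemma mollify_L1 F : lambda.-integrable [set: T3] (EFin \o F) ->
  forall e : R, 0 < e -> exists2 r0, 0 < r0 & forall r, 0 < r <= r0 ->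
    (\int[lambda]_p `|mollify r F p - F p|%:E <= e%:E)%E.
Proof.
move=> iF e e0; have [r0 r00 hr] := L1_space_shift iF e0.
exists r0 => // r /andP[rr rr0]; apply: mollify_L1_le => //; first exact: ltW.
by move=> q /(space_shifts_homo rr0); exact: hr.
Qed.

(** Dominated convergence: the squared truncation error is at most [F ^+ 2] and vanishes at a point
    once the level exceeds |F| there. *)
Lemma sqr_integral_clip F (e : R) : 0 < e -> measurable_fun [set: T3] (F : T3 -> R) ->
  Rintegrable lambda setT (fun p => F p ^+ 2) ->
  exists N : nat, (\int[lambda]_p ((F p - Num.max (- N%:R) (Num.min (F p) N%:R)) ^+ 2)%:E
    <= e%:E)%E.
Proof.
move=> e0 mF iF2.
pose H (n : nat) (p : T3) := (F p - Num.max (- n%:R) (Num.min (F p) n%:R)) ^+ 2.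
have mH n : measurable_fun [set: T3] (H n).
  apply: measurable_funX; apply: measurable_funB => //.
  by apply: measurable_maxr => //; exact: measurable_minr.
have mHE n : measurable_fun [set: T3] (fun p => (H n p)%:E) by exact/measurable_EFinP.
have H0 : {ae lambda, forall p : T3, [set: T3] p -> (H n p)%:E @[n --> \oo] --> cst 0%E p}.
  apply/aeW => p _; apply: cvg_near_cst; near=> n.
  have : `|F p| <= n%:R by near: n; exact: nbhs_infty_ger.
  rewrite ler_norml => /andP[h1 h2]; rewrite /H min_l// max_r//.
  by rewrite subrr expr0n.
have Hd : {ae lambda, forall p (n : nat), [set: T3] p -> (`|(H n p)%:E| <= (F p ^+ 2)%:E)%E}.
  apply/aeW => p n _; rewrite gee0_abs ?lee_fin ?sqr_ge0//.
  rewrite /H; have n0 : 0 <= n%:R :> R by [].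
  rewrite /Num.max /Num.min; case: ifPn; case: ifPn; rewrite -?leNgt => h1 h2; move: h1 h2 n0; clear; nra.
have [_ _] := dominated_convergence measurableT mHE (measurable_cst _) H0 iF2 Hd.
rewrite integral0 => /fine_cvgP[fin]/cvgrPdist_le/(_ _ e0) hh.
have [n [fn hn]] : exists n, (\int[lambda]_p (H n p)%:E)%E \is a fin_num /\
    fine (\int[lambda]_p (H n p)%:E)%E <= e.
  near \oo => n; exists n; split; first by near: n.
  have : `|fine 0%E - (fine \o (fun n => \int[lambda]_p (H n p)%:E)%E) n| <= e by near: n.
  by rewrite /= sub0r normrN ger0_norm// fine_ge0// integral_ge0// => p _; rewrite lee_fin sqr_ge0.
by exists n; rewrite -(fineK fn) lee_fin.
Unshelve. all: by end_near. Qed.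

(** Clipping at level [N] reduces the claim to L^1: a clipped function satisfies |G (tau p) - G p|^2
    <= 2 N |G (tau p) - G p|. *)
Lemma L2_space_shift F : Rintegrable lambda setT F ->
  Rintegrable lambda setT (fun p => F p ^+ 2) ->
  forall e : R, 0 < e -> exists2 r0, 0 < r0 & forall tau, space_shifts r0 tau ->
    (\int[lambda]_p ((F (tau p) - F p) ^+ 2)%:E <= e%:E)%E.
Proof.
move=> iF iF2 e e0; have mF := Rintegrable_measurable iF.
have e12 : 0 < e / 12 by rewrite divr_gt0.
have [N hN] := sqr_integral_clip e12 mF iF2.
pose G p := Num.max (- N%:R) (Num.min (F p) N%:R).
have mG : measurable_fun [set: T3] (G : T3 -> R).
  by apply: measurable_maxr => //; exact: measurable_minr.
have N0 : 0 <= N%:R :> R by [].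
have GN p : `|G p| <= N%:R.
  rewrite ler_norml /G /Num.max /Num.min; case: ifPn; case: ifPn; rewrite -?leNgt => h1 h2; move: h1 h2 N0; clear; lra.
have GF p : `|G p| <= `|F p|.
  have : - `|F p| <= F p <= `|F p| by rewrite -ler_norml.
  rewrite ler_norml /G /Num.max /Num.min; case: ifPn; case: ifPn; rewrite -?leNgt => h1 h2; move: h1 h2 N0; clear; lra.
have iG : Rintegrable lambda setT G.
  by apply: (Rintegrable_le measurableT mG (fun x _ => GF x)); exact: Rintegrable_norm.
have e' : 0 < e / (12 * (N%:R + 1)) by rewrite divr_gt0// mulr_gt0// ltr_wpDl.
have [r0 r00 hr] := L1_space_shift iG e'; exists r0 => // tau st.
have pt := space_shifts_preserving st.
have mt (f : T3 -> R) : measurable_fun [set: T3] f -> measurable_fun [set: T3] (fun p => f (tau p)).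
  by move=> mf; apply: (measurableT_comp mf); case: pt.
have mH : measurable_fun [set: T3] (fun p => (F p - G p) ^+ 2).
  by apply: measurable_funX; exact: measurable_funB.
have mD : measurable_fun [set: T3] (fun p => `|G (tau p) - G p|).
  by apply: measurableT_comp => //; apply: measurable_funB => //; exact: mt.
(* From (x + y + z)^2 <= 3 (x^2 + y^2 + z^2), with x the shift difference of [G] and y, z the
   clipping errors at [tau p] and [p]. *)
apply: (@le_trans _ _ (\int[lambda]_p (6 * N%:R * `|G (tau p) - G p|
    + (3 * (F (tau p) - G (tau p)) ^+ 2 + 3 * (F p - G p) ^+ 2))%:E)%E).
  apply: le_ge0_Rintegral => //.
  - by apply: measurable_funX; apply: measurable_funB => //; exact: mt.
  - apply: measurable_funD; first exact: measurable_funM.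
    apply: measurable_funD; first by apply: measurable_funM => //; exact: (mt _ mH).
    exact: measurable_funM.
  - by move=> p _; exact: sqr_ge0.
  - move=> p _.
    have h : (G (tau p) - G p) ^+ 2 <= 2 * N%:R * `|G (tau p) - G p|.
      rewrite -real_normK ?num_real// expr2 ler_wpM2r//.
      by rewrite mulr_natl mulr2n (le_trans (ler_normB _ _))// lerD.
    have := sqr_ge0 (F (tau p) - G (tau p) + (F p - G p)).
    have := sqr_ge0 (G (tau p) - G p - (F (tau p) - G (tau p))).
    have := sqr_ge0 (G (tau p) - G p + (F p - G p)).
    by move: h; clear; lra.
have mFG : measurable_fun [set: T3] (fun p => (F (tau p) - G (tau p)) ^+ 2) by exact: (mt _ mH).
have mS : measurable_fun [set: T3]
    (fun p => 3 * (F (tau p) - G (tau p)) ^+ 2 + 3 * (F p - G p) ^+ 2).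
  by apply: measurable_funD; exact: measurable_funM.
under eq_integral do rewrite -[X in _ + X]mul1r.
rewrite ge0_integral_comb//; last by move=> x _; rewrite addr_ge0// mulr_ge0// sqr_ge0.
rewrite ge0_integral_comb//; try by move=> x _; exact: sqr_ge0.
rewrite mul1e (preserving_ge0_integral (f := fun p : T3 => ((F p - G p) ^+ 2)%:E) pt); first last.
- by move=> x; rewrite lee_fin sqr_ge0.
- exact/measurable_EFinP.
apply: (@le_trans _ _ ((6 * N%:R)%:E * (e / (12 * (N%:R + 1)))%:E +
   (3%:E * (e / 12)%:E + 3%:E * (e / 12)%:E))%E).
  apply: leeD; first by rewrite lee_wpmul2l ?lee_fin ?mulr_ge0//; exact: hr.
  by apply: leeD; rewrite lee_wpmul2l ?lee_fin.
rewrite -!EFinM -!EFinD lee_fin.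
have -> : 6 * N%:R * (e / (12 * (N%:R + 1))) = e / 2 * (N%:R / (N%:R + 1)).
  by field; rewrite gt_eqF// ltr_wpDl.
have : N%:R / (N%:R + 1) <= 1 :> R by rewrite ler_pdivrMr ?ltr_wpDl// mul1r lerDl.
by move=> /(ler_wpM2l (ltW e0)); clear; lra.
Qed.

Lemma mollify_L2 F : Rintegrable lambda setT F ->
  Rintegrable lambda setT (fun p => F p ^+ 2) ->
  forall e : R, 0 < e -> exists2 r0, 0 < r0 & forall r, 0 < r <= r0 ->
    (\int[lambda]_p ((mollify r F p - F p) ^+ 2)%:E <= e%:E)%E.
Proof.
move=> iF iF2 e e0; have [r0 r00 hr] := L2_space_shift iF iF2 e0.
exists r0 => // r /andP[rr rr0]; apply: mollify_L2_le => //; first exact: ltW.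
by move=> q /(space_shifts_homo rr0); exact: hr.
Qed.

End mollification.

(** * Integrals of compactly supported functions *)

Section compact_support.
Context {R : realType}.
Local Notation mR := (measurableTypeR R).
Local Notation T2 := (mR * mR)%type.
Local Notation T3 := (mR * (mR * mR))%type.
Local Notation mu := (@lebesgue_measure R).
Local Notation lambda := (@lebesgue3 R).
Implicit Types (f u v : space R -> R) (p q : space R) (K : set (space R)).

Definition box2 (M : R) : set (R * R) := `[- M, M]%classic `*` `[- M, M]%classic.
Definition box3 (M : R) : set (space R) := `[- M, M]%classic `*` box2 M.

Lemma segment_lty (a b : R) : (mu `[a, b]%classic < +oo)%E.
Proof. by rewrite lebesgue_measure_itv/=; case: ifP => // _; rewrite ltry. Qed.

Lemma measurable_box2 M : measurable (box2 M : set T2).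
Proof. by apply: measurableX; exact: measurable_itv. Qed.

Lemma measurable_box3 M : measurable (box3 M : set T3).
Proof. by apply: measurableX; [exact: measurable_itv|exact: measurable_box2]. Qed.

Lemma box2_lty M : (@lebesgue2 R (box2 M) < +oo)%E.
Proof.
have -> : lebesgue2 (box2 M) = (mu `[(- M)%R, M%R]%classic * mu `[(- M)%R, M%R]%classic)%E.
  by apply: (product_measure1E mu mu); exact: measurable_itv.
by rewrite lte_mul_pinfty ?segment_lty// ge0_fin_numE// segment_lty.
Qed.

Lemma box3_lty M : (lambda (box3 M) < +oo)%E.
Proof.
have -> : lambda (box3 M) = (mu `[(- M)%R, M%R]%classic * lebesgue2 (box2 M))%E.
  by apply: (product_measure1E mu (@lebesgue2 R)); [exact: measurable_itv|exact: measurable_box2].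
by rewrite lte_mul_pinfty ?box2_lty// ge0_fin_numE// segment_lty.
Qed.

Lemma compact_box3 M : compact (box3 M).
Proof.
by apply: compact_setX; [|apply: compact_setX]; exact: segment_compact.
Qed.

Lemma compact_sub_box3 K : compact K -> exists2 M, 0 < M & K `<=` box3 M.
Proof.
move=> /compact_bounded[M0 [_ hM]]; pose M := Num.max M0 0 + 1.
have M0M : M0 < M by rewrite /M; have := le_max M0 M0 0; rewrite lexx/=; lra.
exists M.
  by rewrite /M ltr_wpDl// le_max lexx orbT.
move=> [x [y z]] Kp; have := hM _ M0M _ Kp.
rewrite /box3 /box2 /= !prod_normE /= !ge_max => /andP[h1 /andP[h2 h3]].
by rewrite /= !in_itv/= -!ler_norml h1 h2 h3.
Qed.

Lemma compact_measurable3 K : compact K -> measurable (K : set T3).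
Proof.
move=> cK; by apply: closed_measurable3; apply: compact_closed.
Qed.

Lemma compact_lty K : compact K -> (lambda K < +oo)%E.
Proof.
move=> cK; have [M _ KM] := compact_sub_box3 cK.
apply: le_lt_trans (box3_lty M); apply: le_measure; rewrite ?inE//.
  exact: compact_measurable3.
exact: measurable_box3.
Qed.

Lemma continuous_compact_bounded (T : topologicalType) (K : set T) (f : T -> R) :
  compact K -> continuous f -> exists2 M, 0 <= M & forall x, K x -> `|f x| <= M.
Proof.
move=> cK cf; have [K0|/set0P K0] := eqVneq K set0.
  by exists 0 => // x; rewrite K0.
have [x [Kx hx]] := @compact_EVT_max T R (fun x => `|f x|) K K0 cK
  (continuous_subspaceT (continuous_compose cf (@norm_continuous _ _))).
by exists `|f x| => // y Ky; apply: hx; rewrite inE.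
Qed.

Lemma bounded_Rintegrable d (T : measurableType d) (m : {measure set T -> \bar R})
    (D : set T) (f : T -> R) (M : R) : measurable D -> (m D < +oo)%E ->
  measurable_fun D f -> (forall x, D x -> `|f x| <= M) -> Rintegrable m D f.
Proof.
move=> mD Doo mf fM; apply: measurable_bounded_integrable => //.
exists M; split; first exact: num_real.
by move=> x Mx y Dy; apply: (le_trans (fM _ Dy)); exact: ltW.
Qed.

Lemma compact_Rintegrable K f : compact K -> continuous f -> Rintegrable lambda K f.
Proof.
move=> cK cf; have [M M0 hM] := continuous_compact_bounded cK cf.
apply: (@bounded_Rintegrable _ _ lambda _ _ M (compact_measurable3 cK) (compact_lty cK) _ hM).
by apply: measurable_funTS; exact: continuous_measurable3.
Qed.

Lemma Rintegrable_supported d (T : measurableType d) (m : {measure set T -> \bar R})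
    (A D : set T) (f : T -> R) : measurable A -> measurable D -> A `<=` D ->
  measurable_fun D f -> (forall x, D x -> ~ A x -> f x = 0) ->
  Rintegrable m A f -> Rintegrable m D f.
Proof.
move=> mA mD AD mf f0 /integrableP[_ foo]; apply/integrableP; split; first exact/measurable_EFinP.
apply: le_lt_trans foo.
rewrite [X in (X <= _)%E](_ : _ = (\int[m]_(x in A) `|(EFin \o f) x|)%E)//.
rewrite integral_mkcond [RHS]integral_mkcond; apply: eq_integral => x _.
rewrite !patchE; have [Ax|nAx] := pselect (A x); first by rewrite !mem_set//; exact: AD.
rewrite [in RHS]memNset//; case: ifPn => // /[!inE] Dx.
by rewrite /= f0// normr0.
Qed.

Lemma integral_supported d (T : measurableType d) (m : {measure set T -> \bar R})
    (A D : set T) (f : T -> R) : A `<=` D -> (forall x, D x -> ~ A x -> f x = 0) ->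
  \int[m]_(x in D) f x = \int[m]_(x in A) f x.
Proof.
move=> AD f0; rewrite Rintegral_mkcond [RHS]Rintegral_mkcond; apply: eq_Rintegral => x _.
rewrite !patchE; have [Ax|nAx] := pselect (A x); first by rewrite !mem_set//; exact: AD.
by rewrite [in RHS]memNset//; case: ifPn => // /[!inE] Dx; exact: f0.
Qed.

Lemma supported_Rintegrable3 M f : continuous f -> (forall p, ~ box3 M p -> f p = 0) ->
  Rintegrable lambda setT f.
Proof.
move=> cf f0; have mb := measurable_box3 M.
apply: (Rintegrable_supported mb) => //; [exact: continuous_measurable3|by move=> x _; exact: f0|].
by apply: compact_Rintegrable => //; exact: compact_box3.
Qed.

Lemma supported_Rintegrable2 M (f : R * R -> R) : continuous f ->
  (forall p : R * R, ~ box2 M p -> f p = 0) -> Rintegrable (@lebesgue2 R) setT f.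
Proof.
move=> cf f0; have mb := measurable_box2 M.
apply: (Rintegrable_supported mb) => //; [exact: continuous_measurable2|by move=> x _; exact: f0|].
have cb : compact (box2 M) by apply: compact_setX; exact: segment_compact.
have [N N0 hN] := continuous_compact_bounded cb cf.
apply: (@bounded_Rintegrable _ _ lebesgue2 _ _ N mb (box2_lty M) _ hN).
by apply: measurable_funTS; exact: continuous_measurable2.
Qed.

Lemma integral_derive_supported (M : R) (g g' : R -> R) : 0 < M -> continuous g' ->
  (forall x : R, is_derive x 1 g (g' x)) -> (forall x, ~ (- M <= x <= M) -> g x = 0) ->
  (\int[mu]_x (g' x)%:E = 0)%E.
Proof.
move=> M0 cg' dg g0.
have g'0 x : ~ (- M <= x <= M) -> g' x = 0.
  move=> /negP; rewrite negb_and -!ltNge => xM; rewrite -(is_derive1E (dg x)).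
  apply: is_derive1E; apply: (near_eq_is_derive (f := cst 0)) => //.
  by case/orP : xM => xM; near=> y; rewrite g0//=; apply/negP; rewrite negb_and -!ltNge;
    apply/orP; [left; near: y; exact: lt_nbhsl|right; near: y; exact: lt_nbhsr].
(* The interval is enlarged by 1 so that [g] vanishes at its end points. *)
have -> : (\int[mu]_x (g' x)%:E = \int[mu]_(x in `[(- (M + 1))%R, (M + 1)%R]) (g' x)%:E)%E.
  rewrite [RHS]integral_mkcond; apply: eq_integral => x _; rewrite patchE; case: ifPn => // h.
  rewrite g'0//; move: h; rewrite notin_setE/= in_itv/= => /negP h1 /andP[h2 h3].
  by move: h1; rewrite negb_and -!ltNge => /orP[|]; lra.
have cg := is_derive_continuous dg.
rewrite (@continuous_FTC2 _ g' g).
- by rewrite !g0 ?subee//; apply/negP; rewrite negb_and -!ltNge; apply/orP; [left|right]; lra.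
- lra.
- exact: continuous_subspaceT.
- split.
  + by move=> x _; have [] := dg x.
  + by apply: cvg_at_right_filter; exact: cg.
  + by apply: cvg_at_left_filter; exact: cg.
- by move=> x _; exact: is_derive1E.
Unshelve. all: by end_near. Qed.

Lemma box3_upd M j p (x : R) : `|coord j p - x| <= 1 -> box3 M (upd j p x) -> box3 (M + 1) p.
Proof.
case: p => a [b c]; case: j => -[|[|[|//]]] ?;
  rewrite /upd /box3 /box2 /coord /= !in_itv/= ler_norml => h [] h1 [h2 h3];
  do ?[split => /=]; rewrite ?in_itv/=; lra.
Qed.

(** By Fubini with the variable of index [j] innermost: the integral of [v] over every line in that
    direction is 0. *)
Lemma integral_partial_supported (M : R) j u v : 0 < M -> continuous v ->
  (forall p, is_derive p (basis_vector j) u (v p)) -> (forall p, ~ box3 M p -> u p = 0) ->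
  (\int[lambda]_p (v p)%:E = 0)%E.
Proof.
move=> M0 cv du u0.
have dc p : forall x : R, is_derive x 1 (fun x => u (upd j p x)) (v (upd j p x)).
  move=> x; have := (is_derive_upd j u (upd j p x) _).1 (du (upd j p x)).
  rewrite coord_upd; congr (is_derive _ _ _ _).
  by apply/funext => y; rewrite upd_upd.
have hline p : (\int[mu]_x (v (upd j p x))%:E = 0)%E.
  apply: (integral_derive_supported M0 _ (dc p)).
  - apply: (continuous_compose (f := upd j p)) => //.
    case: j {du dc} => -[|[|[|//]]] ? /=; rewrite /upd/=;
      repeat (apply: continuous_pair; first by [exact: continuous_const|exact: continuous_self|
        move=> ?; exact: cvg_cst]); by [exact: continuous_const|exact: continuous_self|move=> ?; exact: cvg_cst].
  - move=> x xM; apply: u0; case: p {dc} => a [b c]; case: j {du} => -[|[|[|//]]] ?;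
      rewrite /upd /box3 /box2 /= !in_itv/=; tauto.
have v0 p : ~ box3 (M + 1) p -> v p = 0.
  move=> nb; have := (is_derive_upd j u p _).1 (du p) => /is_derive1E <-.
  apply: is_derive1E; apply: (near_eq_is_derive (f := cst 0)) => //.
  near=> x; apply/esym/u0 => hb; apply: nb.
  have hx : `|coord j p - x| <= 1.
    by near: x; apply/nbhs_ballP; exists 1 => //= x; rewrite -ball_normE /=; exact: ltW.
  exact: box3_upd hx hb.
have iv : Rintegrable lambda setT v by exact: (supported_Rintegrable3 cv v0).
have iv2 x : Rintegrable (@lebesgue2 R) setT (fun w => v (x, w)).
  apply: (supported_Rintegrable2 (M := M + 1)).
    apply: (continuous_compose (f := fun w => (x, w))) => //.
    by apply: continuous_pair; [move=> ?; exact: cvg_cst|exact: continuous_self].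
  by move=> w nw; apply: v0 => -[].
case: j {du dc v0} hline => -[|[|[|//]]] ? hline.
- rewrite -(@integral21_prod_meas1 _ _ _ _ _ mu (@lebesgue2 R) (fun p : T3 => (v p)%:E) iv).
  by apply: integral0_eq => y _; exact: (hline (0, y)).
- rewrite -(@integral12_prod_meas1 _ _ _ _ _ mu (@lebesgue2 R) (fun p : T3 => (v p)%:E) iv).
  apply: integral0_eq => x _; rewrite /fubini_F.
  rewrite -(@integral21_prod_meas1 _ _ _ _ _ mu mu (fun w : T2 => (v (x, w))%:E) (iv2 x)).
  by apply: integral0_eq => z _; exact: (hline (x, (0, z))).
- rewrite -(@integral12_prod_meas1 _ _ _ _ _ mu (@lebesgue2 R) (fun p : T3 => (v p)%:E) iv).
  apply: integral0_eq => x _; rewrite /fubini_F.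
  rewrite -(@integral12_prod_meas1 _ _ _ _ _ mu mu (fun w : T2 => (v (x, w))%:E) (iv2 x)).
  by apply: integral0_eq => y _; exact: (hline (x, (y, 0))).
Unshelve. all: by end_near. Qed.

End compact_support.

(** * Weak derivatives *)

Section weak_derivatives.
Context {R : realType}.
Local Notation mR := (measurableTypeR R).
Local Notation T3 := (mR * (mR * mR))%type.
Local Notation lambda := (@lebesgue3 R).
Implicit Types (f g u v : space R -> R) (p q : space R) (D K : set (space R)).

Lemma continuous_measurable_on D f : continuous f -> measurable (D : set T3) ->
  measurable_on D f.
Proof. by move=> cf mD; apply: measurable_funTS; exact: continuous_measurable3. Qed.

Lemma continuous_locally_integrable D f : measurable (D : set T3) -> continuous f ->
  locally_integrable_on D f.
Proof.
move=> mD cf; split; first exact: continuous_measurable_on.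
by move=> K cK _; exact: compact_Rintegrable.
Qed.

Lemma partial_eq0 K j phi p : compact K -> (forall p, ~ K p -> phi p = 0) -> ~ K p ->
  partial j phi p = 0 :> R.
Proof.
move=> cK phi0 nKp; rewrite partial_upd; apply: is_derive1E.
apply: (near_eq_is_derive (f := cst 0)) => //.
have oK : open (~` K) by apply: closed_openC; exact: compact_closed.
have : nbhs (upd j p (coord j p)) (~` K) by rewrite upd_coord; exact: open_nbhs_nbhs.
have cu : continuous (upd j p).
  case: j => -[|[|[|//]]] ? /=; rewrite /upd/=;
    repeat (apply: continuous_pair; first by [exact: continuous_self|move=> ?; exact: cvg_cst]);
    by [exact: continuous_self|move=> ?; exact: cvg_cst].
move=> hn; have := cu (coord j p) _ hn.
rewrite (_ : nbhs (upd j p @ (coord j p)) (~` K) = \forall x \near coord j p, ~ K (upd j p x))//.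
by apply: filterS => x /= nK; rewrite phi0.
Qed.

Lemma smooth_partial phi j : smooth phi -> continuous (phi : space R -> R) /\
  continuous (partial j phi) /\ forall p, is_derive p (basis_vector j) phi (partial j phi p).
Proof.
move=> sphi; have [c0 d0] := sphi [::]; have [c1 _] := sphi [:: j]; split => //; split => //.
Qed.

Lemma integral_supported3 D (K : set (space R)) f : K `<=` D ->
  (forall p, ~ K p -> f p = 0) -> \int[lambda]_(p in D) f p = \int[lambda]_p f p.
Proof.
move=> KD f0; rewrite (integral_supported lambda KD) => [|p _]; last exact: f0.
by rewrite (integral_supported lambda (@subsetT _ K))// => p _; exact: f0.
Qed.

(** Integration by parts: the product f phi has compact support, so the integral of its partial
    derivative vanishes. *)
Lemma classical_weak_partial D j f f' : measurable (D : set T3) -> continuous f ->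
  continuous f' -> (forall p, is_derive p (basis_vector j) f (f' p)) ->
  is_weak_partial D j f f'.
Proof.
move=> mD cf cf' df; split; [exact: continuous_locally_integrable..|].
move=> phi [sphi [K [cK KD phi0]]].
have [cphi [cphi' dphi]] := smooth_partial j sphi.
have phi'0 p : ~ K p -> partial j phi p = 0 by exact: partial_eq0.
have [M M0 KM] := compact_sub_box3 cK.
have c1 : continuous (fun p => f p * partial j phi p) by exact: continuous_mul.
have c2 : continuous (fun p => f' p * phi p) by exact: continuous_mul.
have i1 : Rintegrable lambda setT (fun p => f p * partial j phi p).
  by apply: (supported_Rintegrable3 (M := M)) => // p h; rewrite phi'0 ?mulr0// => /KM.
have i2 : Rintegrable lambda setT (fun p => f' p * phi p).
  by apply: (supported_Rintegrable3 (M := M)) => // p h; rewrite phi0 ?mulr0// => /KM.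
rewrite (integral_supported3 KD) => [|p h]; last by rewrite phi'0 ?mulr0.
rewrite (integral_supported3 KD) => [|p h]; last by rewrite phi0 ?mulr0.
apply/eqP; rewrite -addr_eq0 -RintegralD//; apply/eqP.
have hd p : is_derive p (basis_vector j) (fun p => f p * phi p)
    (f p * partial j phi p + f' p * phi p).
  have h := is_deriveM (df p) (dphi p).
  by apply: (is_derive_eq h); rewrite /GRing.scale/= (mulrC (phi p)).
have hs p : ~ box3 M p -> f p * phi p = 0 by move=> h; rewrite phi0 ?mulr0// => /KM.
have E := integral_partial_supported M0 (continuous_add c1 c2) hd hs.
by rewrite /Rintegral E.
Qed.

(** All boxes of side [r] with lower corner in [B] stay in one compact subset of [D], so the
    one-sided kernels based in [B] are test functions on [D]. *)
Definition good_box D (B : set (space R)) := exists2 r, 0 < r & exists K,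
  [/\ compact K, K `<=` D & forall p q, B p -> p.1 <= q.1 <= p.1 + r ->
    p.2.1 <= q.2.1 <= p.2.1 + r -> p.2.2 <= q.2.2 <= p.2.2 + r -> K q].

Lemma good_box_cover D : open D -> exists B : nat -> set (space R),
  (forall n, measurable (B n : set T3)) /\
  forall p, D p -> exists n, B n p /\ good_box D (B n).
Proof.
move=> oD.
have [B [mB hB]] : countable_base (T := space R) (fun A => measurable (A : set T3)).
  apply: (@countable_base_prod R (R * R)%type _ _ _ _ _ countable_base_line
    (@countable_base_prod R R _ _ (fun A => measurable (A : set (mR * mR))) _ _
       countable_base_line countable_base_line)).
  - exact: measurable0.
  - by move=> A B mA mB; exact: measurableX.
  - exact: measurable0.
  - by move=> A B mA mB; exact: measurableX.
exists B; split => // p Dp.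
have [e /= e0 eD] : nbhs_ball p D by apply/nbhs_ballP; exact: open_nbhs_nbhs.
have e3 : 0 < e / 3 by rewrite divr_gt0.
have [n [Bp Be]] := hB _ p (nbhsx_ballx p (e / 3) e3).
exists n; split => //; exists (e / 3) => //.
exists (`[p.1 - e / 3 * 2, p.1 + e / 3 * 2]%classic `*` (`[p.2.1 - e / 3 * 2, p.2.1 + e / 3 * 2]%classic
  `*` `[p.2.2 - e / 3 * 2, p.2.2 + e / 3 * 2]%classic)); split.
- by apply: compact_setX; [|apply: compact_setX]; exact: segment_compact.
- move=> [x [y z]] [/= h1 [h2 h3]]; apply: eD; move: h1 h2 h3; rewrite /= !in_itv/= => h1 h2 h3.
  by split => /=; [|split => /=]; rewrite -ball_normE/= ltr_norml; lra.
- move=> [x [y z]] q /Be [/=]; rewrite -ball_normE/= => b1 [/=]; rewrite -!ball_normE/= => b2 b3 h1 h2 h3.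
  move: b1 b2 b3; rewrite !ltr_norml => b1 b2 b3.
  by split => /=; [|split => /=]; rewrite in_itv/=; lra.
Qed.

Lemma test_function_centered D r a b c p K : test_profile r a -> test_profile r b ->
  test_profile r c -> compact K -> K `<=` D ->
  (forall q, p.1 <= q.1 <= p.1 + r -> p.2.1 <= q.2.1 <= p.2.1 + r ->
     p.2.2 <= q.2.2 <= p.2.2 + r -> K q) ->
  test_function D (centered a b c p).
Proof.
move=> ta tb tc cK KD hK; split; first by apply: smooth_centered; [exact: ta.1|exact: tb.1|exact: tc.1].
exists K; split => // q nK; apply: (centered_eq0 ta tb tc) => -[h1 h2 h3].
by apply: nK; exact: hK.
Qed.

(** The hypothesis makes the mollifications of [g] vanish on a good box for small radii, while they
    converge to [g] in L^1; countably many good boxes cover [D]. *)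
Lemma weak_null D g : open D -> locally_integrable_on D g ->
  (forall phi, test_function D phi -> \int[lambda]_(p in D) (g p * phi p) = 0) ->
  {ae lambda, forall p, D p -> g p = 0}.
Proof.
move=> oD [mg ig] hg.
have mD : measurable (D : set T3) by exact: open_measurable3.
have [B [mB hB]] := good_box_cover oD.
suff h n : {ae lambda, forall p, B n p -> good_box D (B n) -> g p = 0}.
  have := ae_foralln h; apply: filterS => p hp Dp; have [n [Bp gB]] := hB _ Dp.
  exact: hp Bp gB.
have [gB|nB] := pselect (good_box D (B n)); last by apply/aeW => p _ /nB.
have [r0 r00 [K [cK KD hK]]] := gB.
have mK := compact_measurable3 cK.
(* [g] is only locally integrable. Its restriction to the compact set [K] is integrable on the whole
   space and agrees with [g] on the supports of the small kernels based in [B n]. *)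
pose G := g \_ K.
have mG : measurable_fun [set: T3] (G : T3 -> R).
  apply/(measurable_restrictT _ _).1 => //; exact: measurable_funS mg.
have iG : Rintegrable lambda setT G.
  apply: (Rintegrable_supported mK) => //.
  - by move=> p _ nK; rewrite /G patchE memNset.
  - apply: (@eq_Rintegrable _ _ _ lambda K mK g); last exact: ig.
    by move=> p Kp; rewrite /G patchE mem_set.
have BK : B n `<=` K by move=> p Bp; apply: (hK p) => //; rewrite lexx lerDl ltW.
have mol0 r p : 0 < r <= r0 -> B n p -> mollify r G p = 0.
  move=> /andP[rr rr0] Bp; have tb := bump_test_profile rr.
  have hKp q : p.1 <= q.1 <= p.1 + r -> p.2.1 <= q.2.1 <= p.2.1 + r ->
     p.2.2 <= q.2.2 <= p.2.2 + r -> K q.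
    by move=> h1 h2 h3; apply: (hK p) => //; move: h1 h2 h3 rr0; clear; lra.
  have tf := test_function_centered tb tb tb cK KD hKp.
  rewrite -(hg _ tf) /mollify /smoothing; have [_ [K' [_ _ _]]] := tf.
  have c0 q : ~ K q -> centered (bump r) (bump r) (bump r) p q = 0.
    by move=> nK; apply: (centered_eq0 tb tb tb) => -[h1 h2 h3]; apply: nK; exact: hKp.
  rewrite -(@integral_supported3 D K)// => [|q nK]; last by rewrite c0 ?mulr0.
  apply: eq_Rintegral => q _; have [Kq|nK] := pselect (K q); last by rewrite c0// !mulr0.
  by rewrite /G patchE mem_set.
have int0 : (\int[lambda]_(p in B n) `|(G p)%:E| = 0)%E.
  apply/eqP; rewrite eq_le integral_ge0// andbT; apply/lee_addgt0Pr => e e0; rewrite add0e.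
  have [r1 r10 hr] := mollify_L1 iG e0.
  pose r := Num.min r0 r1.
  have rr : 0 < r <= r1 by rewrite lt_min r00 r10 ge_min lexx orbT.
  have rr0 : 0 < r <= r0 by rewrite lt_min r00 r10 ge_min lexx.
  have tb := bump_test_profile (proj1 (andP rr)).
  have cm : measurable_fun [set: T3] (mollify r G : T3 -> R).
    by apply: continuous_measurable3; exact: (continuous_smoothing tb tb tb).
  apply: le_trans (hr r rr).
  have mGr : measurable_fun [set: T3] (fun p => `|mollify r G p - G p|%:E).
    by apply/measurable_EFinP; apply: measurableT_comp => //; exact: measurable_funB.
  apply: (@le_trans _ _ (\int[lambda]_(p in B n) `|mollify r G p - G p|%:E)%E).
    apply: ge0_le_integral => //.
    - by apply: measurableT_comp => //; apply/measurable_EFinP; exact: measurable_funTS.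
    - exact: measurable_funTS.
    - by move=> p Bp; rewrite mol0// sub0r normrN.
  by apply: ge0_subset_integral.
have /ae_eq_integral_abs := int0 => /(_ (mB n)).
move=> h; have {h} := h ((measurable_EFinP _ _).2 (measurable_funTS mG)).
apply: filterS => p /= hp Bp _; have := hp Bp => -[].
by rewrite /G patchE mem_set//; exact: BK.
Qed.

Lemma Rintegrable_mul_supported D g phi : measurable (D : set T3) ->
  locally_integrable_on D g -> test_function D phi ->
  Rintegrable lambda D (fun p => g p * phi p).
Proof.
move=> mD [mg ig] [sphi [K [cK KD phi0]]].
have [cphi _] := smooth_partial ord0 sphi.
have mK := compact_measurable3 cK.
apply: (Rintegrable_supported mK) => //.
- by apply: measurable_funM => //; exact: continuous_measurable_on.
- by move=> p _ nK; rewrite phi0 ?mulr0.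
have [M M0 hM] := continuous_compact_bounded cK cphi.
apply: (@Rintegrable_le _ _ _ lambda _ mK _ (fun p => M * `|g p|)).
- apply: measurable_funM; first exact: measurable_funS mg.
  exact: continuous_measurable_on.
- by move=> p Kp; rewrite normrM mulrC ler_wpM2r// hM.
- by apply: RintegrableZ => //; apply: Rintegrable_norm; exact: ig.
Qed.

Lemma weak_partial_unique D j f g1 g2 : open D ->
  is_weak_partial D j f g1 -> is_weak_partial D j f g2 ->
  {ae lambda, forall p, D p -> g1 p = g2 p}.
Proof.
move=> oD [_ l1 h1] [_ l2 h2].
have mD : measurable (D : set T3) by exact: open_measurable3.
have lB : locally_integrable_on D (fun p => g1 p - g2 p).
  split; first by apply: measurable_funB; [exact: l1.1|exact: l2.1].
  move=> K cK KD; have mK := compact_measurable3 cK.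
  by apply: (RintegrableB mK); [exact: l1.2|exact: l2.2].
have h0 phi : test_function D phi -> \int[lambda]_(p in D) ((g1 p - g2 p) * phi p) = 0.
  move=> tphi.
  have E : (fun p => (g1 p - g2 p) * phi p) = (fun p => g1 p * phi p - g2 p * phi p).
    by apply/funext => p; rewrite mulrBl.
  rewrite E RintegralB'//; [|exact: Rintegrable_mul_supported..].
  by apply/eqP; rewrite subr_eq0 -eqr_opp -h1// -h2.
apply: (@filterS _ _ (ae_filter_ringOfSetsType lambda) _ _ _ (weak_null oD lB h0)) => p /= hp /hp /eqP.
by rewrite subr_eq0 => /eqP.
Qed.

(** The default value of [weak_partial] is excluded as soon as some weak derivative exists;
    uniqueness then identifies the chosen representative almost everywhere. *)
Lemma weak_partialE D j f g : open D -> is_weak_partial D j f g ->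
  {ae lambda, forall p, D p -> weak_partial D j f p = g p} /\
  is_weak_partial D j f (weak_partial D j f).
Proof.
move=> oD hg; have hw : is_weak_partial D j f (weak_partial D j f).
  by rewrite /weak_partial; case: xgetP => [h _ //|/(_ g)].
by split => //; exact: weak_partial_unique hw hg.
Qed.

End weak_derivatives.

(** * Square integrable functions *)

Section square_integrable_functions.
Context d (T : measurableType d) (R : realType).
Variables (mu : {measure set T -> \bar R}) (D : set T).
Hypothesis mD : measurable D.
Implicit Types f g a : T -> R.

Definition L2 f := measurable_fun D f /\ Rintegrable mu D (fun x => f x ^+ 2).

Lemma L2_mul f g : L2 f -> L2 g -> Rintegrable mu D (fun x => f x * g x).
Proof.
move=> [mf if2] [mg ig2].
apply: (Rintegrable_le mD _ _ (RintegrableD mD if2 ig2)); first exact: measurable_funM.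
move=> x _; rewrite normrM; have := sqr_ge0 (`|f x| - `|g x|).
by rewrite -(real_normK (num_real (f x))) -(real_normK (num_real (g x))); nra.
Qed.

Lemma L2_le f g : measurable_fun D f -> (forall x, D x -> `|f x| <= `|g x|) -> L2 g -> L2 f.
Proof.
move=> mf fg [mg ig]; split => //; apply: (Rintegrable_le mD _ _ ig).
  exact: measurable_funX.
move=> x Dx; rewrite ger0_norm ?sqr_ge0// -(real_normK (num_real (f x))).
by rewrite -(real_normK (num_real (g x))) lerXn2r ?nnegrE// fg.
Qed.

Lemma L2Z k f : L2 f -> L2 (fun x => k * f x).
Proof.
move=> [mf jf]; split; first exact: measurable_funM.
apply: (@eq_Rintegrable _ _ _ mu D mD (fun x => k ^+ 2 * f x ^+ 2)); last exact: RintegrableZ.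
by move=> x _; rewrite exprMn.
Qed.

Lemma L2D f g : L2 f -> L2 g -> L2 (fun x => f x + g x).
Proof.
move=> hf hg; split; first by apply: measurable_funD; [exact: hf.1|exact: hg.1].
apply: (@eq_Rintegrable _ _ _ mu D mD (fun x => (f x ^+ 2 + g x ^+ 2) + 2 * (f x * g x))).
  by move=> x _; ring.
by apply: RintegrableD => //; [apply: RintegrableD => //; [exact: hf.2|exact: hg.2]|
  apply: RintegrableZ => //; exact: L2_mul].
Qed.

Lemma L2B f g : L2 f -> L2 g -> L2 (fun x => f x - g x).
Proof.
move=> hf hg; have := L2D hf (L2Z (-1) hg).
by congr L2; apply/funext => x; rewrite mulN1r.
Qed.

Lemma L2_bounded C a f : measurable_fun D a -> (forall x, D x -> `|a x| <= C) ->
  L2 f -> L2 (fun x => a x * f x).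
Proof.
move=> ma aC hf; have h := L2Z C hf.
apply: (L2_le _ _ h); first by apply: measurable_funM => //; exact: hf.1.
move=> x Dx; rewrite !normrM ler_wpM2r// (le_trans (aC _ Dx))// ler_norm//.
Qed.

Lemma L2_Rintegrable f : (mu D < +oo)%E -> L2 f -> Rintegrable mu D f.
Proof.
move=> Doo hf; have h1 : Rintegrable mu D (fun=> 1).
  by apply: (@bounded_Rintegrable _ _ _ mu D _ 1) => // x _; rewrite normr1.
apply: (Rintegrable_le mD hf.1 _ (RintegrableD mD h1 hf.2)) => x _.
by have := sqr_ge0 (`|f x| - 1); rewrite -(real_normK (num_real (f x))); nra.
Qed.

Lemma L2_sqrD f g : L2 f -> L2 g -> \int[mu]_(x in D) (f x + g x) ^+ 2 <=
  2 * \int[mu]_(x in D) (f x ^+ 2) + 2 * \int[mu]_(x in D) (g x ^+ 2).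
Proof.
move=> hf hg; rewrite -(RintegralZ' mD _ hf.2) -(RintegralZ' mD _ hg.2).
rewrite -RintegralD'//; [|apply: RintegrableZ => //; exact: hf.2|apply: RintegrableZ => //; exact: hg.2].
apply: le_Rintegral' => //; first exact: (L2D hf hg).2.
  by apply: RintegrableD => //; apply: RintegrableZ => //; [exact: hf.2|exact: hg.2].
by move=> x _; have := sqr_ge0 (f x - g x); lra.
Qed.

Lemma L2_le_sqr f g : measurable_fun D f -> L2 g -> (forall x, D x -> `|f x| <= `|g x|) ->
  \int[mu]_(x in D) (f x ^+ 2) <= \int[mu]_(x in D) (g x ^+ 2).
Proof.
move=> mf hg fg; apply: le_Rintegral' => //; [exact: (L2_le mf fg hg).2|exact: hg.2|].
move=> x Dx; rewrite -(real_normK (num_real (f x))) -(real_normK (num_real (g x))).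
by rewrite lerXn2r ?nnegrE// fg.
Qed.

(** Young's inequality bounds |h^2 - f^2| by s f^2 + (1 + 1/s) (h - f)^2. The tolerance [e] depends
    on [f] and [eta], but not on the weight [a] or on [h]. *)
Lemma L2_quadratic_continuity f (eta : R) : 0 < eta -> L2 f -> exists2 e, 0 < e &
  forall h a, L2 h -> \int[mu]_(x in D) ((h x - f x) ^+ 2) <= e ->
    measurable_fun D a -> (forall x, D x -> `|a x| <= 1) ->
    `|\int[mu]_(x in D) (a x * h x ^+ 2) - \int[mu]_(x in D) (a x * f x ^+ 2)| <= eta.
Proof.
move=> eta0 hf; set I := \int[mu]_(x in D) (f x ^+ 2).
have I0 : 0 <= I by apply: Rintegral_ge0 => // x _; exact: sqr_ge0.
(* Chosen so that s I <= eta / 2; the other half is left for the term in (h - f)^2. *)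
pose s := eta / (2 * (I + 1)); have s0 : 0 < s by rewrite divr_gt0//; lra.
have sI : s * I <= eta / 2.
  by rewrite /s mulrAC ler_pdivrMr; [nra|lra].
pose c := 1 + s^-1; have c0 : 0 < c by rewrite /c ltr_pwDl// invr_ge0 ltW.
exists (eta / (2 * c)); first by rewrite divr_gt0//; lra.
move=> h a hh he ma a1.
have ih : Rintegrable mu D (fun x => a x * h x ^+ 2).
  apply: (Rintegrable_le mD _ _ hh.2); first by apply: measurable_funM => //; exact: measurable_funX hh.1.
  by move=> x Dx; rewrite normrM (ger0_norm (sqr_ge0 _)) -[leRHS]mul1r ler_wpM2r ?sqr_ge0// a1.
have if_ : Rintegrable mu D (fun x => a x * f x ^+ 2).
  apply: (Rintegrable_le mD _ _ hf.2); first by apply: measurable_funM => //; exact: measurable_funX hf.1.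
  by move=> x Dx; rewrite normrM (ger0_norm (sqr_ge0 _)) -[leRHS]mul1r ler_wpM2r ?sqr_ge0// a1.
have iB := (L2B hh hf).2.
have key x : D x -> `|a x * h x ^+ 2 - a x * f x ^+ 2| <= s * f x ^+ 2 + c * (h x - f x) ^+ 2.
  move=> Dx; rewrite -mulrBr normrM -[leRHS]mul1r; apply: ler_pM => //; first exact: a1.
  have h1 : 0 <= (s * f x - (h x - f x)) ^+ 2 / s by rewrite divr_ge0 ?sqr_ge0// ltW.
  have h2 : 0 <= (s * f x + (h x - f x)) ^+ 2 / s by rewrite divr_ge0 ?sqr_ge0// ltW.
  have e1 : (s * f x - (h x - f x)) ^+ 2 / s = s * f x ^+ 2 - 2 * f x * (h x - f x) + s^-1 * (h x - f x) ^+ 2.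
    by field; lra.
  have e2 : (s * f x + (h x - f x)) ^+ 2 / s = s * f x ^+ 2 + 2 * f x * (h x - f x) + s^-1 * (h x - f x) ^+ 2.
    by field; lra.
  by rewrite /c ler_norml; apply/andP; split; have := sqr_ge0 (h x - f x); rewrite e1 in h1; rewrite e2 in h2; nra.
have ir : Rintegrable mu D (fun x => s * f x ^+ 2 + c * (h x - f x) ^+ 2).
  by apply: RintegrableD => //; apply: RintegrableZ => //; exact: hf.2.
rewrite -RintegralB'//; apply: (le_trans (le_normr_Rintegral mD (RintegrableB mD ih if_))).
apply: (le_trans (le_Rintegral' mD (Rintegrable_norm (RintegrableB mD ih if_)) ir key)).
rewrite RintegralD'//; [|by apply: RintegrableZ => //; exact: hf.2|exact: RintegrableZ].
rewrite (RintegralZ' mD _ hf.2) (RintegralZ' mD _ iB) -/I.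
have : c * \int[mu]_(x in D) ((h x - f x) ^+ 2) <= eta / 2.
  by rewrite mulrC -ler_pdivlMr//; apply: (le_trans he); rewrite invfM mulrA.
lra.
Qed.

(** Young's inequality for the product of [b] and h - f. Here [e] depends on [b] and [eta] only, so
    the estimate is uniform in both [f] and [h]. *)
Lemma L2_linear_continuity b (eta : R) : 0 < eta -> L2 b -> exists2 e, 0 < e &
  forall f h, L2 f -> L2 h -> \int[mu]_(x in D) ((h x - f x) ^+ 2) <= e ->
    `|\int[mu]_(x in D) (b x * h x) - \int[mu]_(x in D) (b x * f x)| <= eta.
Proof.
move=> eta0 hb; set I := \int[mu]_(x in D) (b x ^+ 2).
have I0 : 0 <= I by apply: Rintegral_ge0 => // x _; exact: sqr_ge0.
pose s := eta / (2 * (I + 1)); have s0 : 0 < s by rewrite divr_gt0//; lra.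
have sI : s * I <= eta / 2.
  by rewrite /s mulrAC ler_pdivrMr; [nra|lra].
exists (eta / 2 * s); first by rewrite mulr_gt0//; lra.
move=> f h hf hh he.
have ih := L2_mul hb hh; have if_ := L2_mul hb hf; have iB := (L2B hh hf).2.
have key x : D x -> `|b x * h x - b x * f x| <= s * b x ^+ 2 + s^-1 * (h x - f x) ^+ 2.
  move=> Dx.
  have h1 : 0 <= (s * b x - (h x - f x)) ^+ 2 / s by rewrite divr_ge0 ?sqr_ge0// ltW.
  have h2 : 0 <= (s * b x + (h x - f x)) ^+ 2 / s by rewrite divr_ge0 ?sqr_ge0// ltW.
  have e1 : (s * b x - (h x - f x)) ^+ 2 / s = s * b x ^+ 2 - 2 * b x * (h x - f x) + s^-1 * (h x - f x) ^+ 2.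
    by field; lra.
  have e2 : (s * b x + (h x - f x)) ^+ 2 / s = s * b x ^+ 2 + 2 * b x * (h x - f x) + s^-1 * (h x - f x) ^+ 2.
    by field; lra.
  have h3 : 0 <= s^-1 * (h x - f x) ^+ 2 by rewrite mulr_ge0 ?sqr_ge0// invr_ge0 ltW.
  have h4 : 0 <= s * b x ^+ 2 by rewrite mulr_ge0 ?sqr_ge0// ltW.
  by rewrite ler_norml; apply/andP; split; rewrite e1 in h1; rewrite e2 in h2; nra.
have ir : Rintegrable mu D (fun x => s * b x ^+ 2 + s^-1 * (h x - f x) ^+ 2).
  by apply: RintegrableD => //; apply: RintegrableZ => //; exact: hb.2.
rewrite -RintegralB'//; apply: (le_trans (le_normr_Rintegral mD (RintegrableB mD ih if_))).
apply: (le_trans (le_Rintegral' mD (Rintegrable_norm (RintegrableB mD ih if_)) ir key)).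
rewrite RintegralD'//; [|by apply: RintegrableZ => //; exact: hb.2|exact: RintegrableZ].
rewrite (RintegralZ' mD _ hb.2) (RintegralZ' mD _ iB) -/I.
have : s^-1 * \int[mu]_(x in D) ((h x - f x) ^+ 2) <= eta / 2.
  by rewrite mulrC ler_pdivrMr.
lra.
Qed.

End square_integrable_functions.

Lemma L2_subset d (T : measurableType d) (R : realType) (mu : {measure set T -> \bar R})
    (A D : set T) f : measurable A -> measurable D -> A `<=` D -> L2 mu D f -> L2 mu A f.
Proof.
move=> mA mD AD [mf jf]; split; first exact: measurable_funS mf.
exact: integrableS jf.
Qed.

Lemma L2_sqr_subset d (T : measurableType d) (R : realType) (mu : {measure set T -> \bar R})
    (A D : set T) f : measurable A -> measurable D -> A `<=` D -> L2 mu D f ->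
  \int[mu]_(x in A) (f x ^+ 2) <= \int[mu]_(x in D) (f x ^+ 2).
Proof.
move=> mA mD AD hf; have hA := L2_subset mA mD AD hf.
rewrite -lee_fin -(RintegralE mA hA.2) -(RintegralE mD hf.2).
apply: ge0_subset_integral => //; last by move=> x _; rewrite lee_fin sqr_ge0.
by apply/measurable_EFinP; exact: measurable_funX hf.1.
Qed.

(** * Cutoff functions in the variable x *)

Section cutoff.
Context {R : realType}.
Implicit Types (n : nat) (x : R).

(** The factor e normalises the value at 0 to 1. There is no plateau: the cutoffs enter only through
    the pointwise limit 1 of the rescaled functions and through bounds on values and derivative. *)
Definition chi0 x : R := expR 1 * expinv 0 (1 - x ^+ 2).
Definition chi0' x : R := expR 1 * (expinv 2 (1 - x ^+ 2) * (- (2 * x))).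

Lemma chi0_ge0 x : 0 <= chi0 x.
Proof. by rewrite mulr_ge0 ?expR_ge0 ?expinv_ge0. Qed.

Lemma chi0_le1 x : chi0 x <= 1.
Proof.
rewrite /chi0 /expinv; case: ifPn => [h|_]; last by rewrite mulr0.
rewrite expr0 invr1 mul1r -expRD -[leRHS]expR0 ler_expR subr_le0.
by rewrite invf_ge1//; have := sqr_ge0 x; lra.
Qed.

Lemma chi0_0 : chi0 0 = 1.
Proof.
by rewrite /chi0 /expinv expr0n/= subr0 ltr01 expr0 invr1 mul1r -expRD subrr expR0.
Qed.

Lemma chi0_eq0 x : 1 <= `|x| -> chi0 x = 0.
Proof.
move=> x1; rewrite /chi0 /expinv ifF ?mulr0//; apply/negbTE; rewrite -leNgt.
by rewrite -(real_normK (num_real x)) subr_le0 exprn_ege1.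
Qed.

Lemma is_derive_chi0 x : is_derive x 1 chi0 (chi0' x).
Proof.
have d1 : is_derive x 1 (fun y : R => 1 - y ^+ 2) (- (2 * x)).
  apply: (is_derive1_eq (is_derive1B (is_derive1_cst _ _) (is_derive1X 2 (is_derive1_id x)))).
  by rewrite /= expr1; ring.
apply: is_derive1Z; apply: (is_derive1_compose _ d1).
by apply: (is_derive1_eq (is_derive_expinv 0 (1 - x ^+ 2))); rewrite oppr0 mul0r add0r.
Qed.

Lemma continuous_chi0 : continuous chi0.
Proof. exact: (is_derive_continuous is_derive_chi0). Qed.

Lemma continuous_chi0' : continuous chi0'.
Proof.
have c2 : continuous (fun x : R => 1 - x ^+ 2).
  by apply: continuous_sub; [exact: continuous_const|apply: continuous_exp; exact: continuous_self].
apply: continuous_mul; first exact: continuous_const.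
apply: continuous_mul; first exact: (continuous_compose c2 (smooth1_continuous (smooth1_expinv 2))).
by apply: continuous_opp; apply: continuous_mul; [exact: continuous_const|exact: continuous_self].
Qed.

(** Where y = 1 - x^2 is positive, [expinv 2 y] is at most 3! y <= 6, and the inner derivative 2 x
    is at most 2 in absolute value. *)
Definition chi0_bound : R := 12 * expR 1.

Lemma chi0'_le x : `|chi0' x| <= chi0_bound.
Proof.
have e0 := expR_ge0 (1 : R).
rewrite /chi0' normrM (ger0_norm e0) /chi0_bound mulrC ler_wpM2r// normrM normrN normrM.
rewrite (ger0_norm (expinv_ge0 _ _)) (@ger0_norm _ 2)//.
have [h|h] := ltP 0 (1 - x ^+ 2); last first.
  by rewrite /expinv ltNge h/= mul0r.
have x1 : `|x| <= 1.
  by rewrite -(expr_le1 (n := 2))// real_normK ?num_real//; lra.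
have h2 : expinv 2 (1 - x ^+ 2) <= 6.
  apply: (le_trans (expinv_le 2 h)); rewrite (_ : 3`!%:R = 6 :> R)//.
  by have := sqr_ge0 x; lra.
by have := expinv_ge0 2 (1 - x ^+ 2); have := normr_ge0 x; nra.
Qed.

Definition cutoff n x := chi0 (x / n.+1%:R).
Definition cutoff' n x := n.+1%:R^-1 * chi0' (x / n.+1%:R).

Lemma is_derive_cutoff n x : is_derive x 1 (cutoff n) (cutoff' n x).
Proof.
rewrite /cutoff'; set k := n.+1%:R.
have d1 : is_derive x 1 (fun y : R => y / k) k^-1.
  apply: (is_derive1_eq (is_derive1M (is_derive1_id x) (is_derive1_cst k^-1 x))).
  by rewrite mulr0 addr0 div1r.
by apply: (is_derive1_eq (is_derive1_compose (is_derive_chi0 _) d1)); rewrite mulrC.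
Qed.

Lemma continuous_cutoff n : continuous (cutoff n).
Proof. exact: (is_derive_continuous (is_derive_cutoff n)). Qed.

Lemma continuous_cutoff' n : continuous (cutoff' n).
Proof.
apply: continuous_mul; first exact: continuous_const.
apply: (continuous_compose _ continuous_chi0').
by apply: continuous_mul; [exact: continuous_self|exact: continuous_const].
Qed.

Lemma cutoff_eq0 n x : n.+1%:R <= `|x| -> cutoff n x = 0.
Proof.
by move=> h; apply: chi0_eq0; rewrite normrM (@ger0_norm _ n.+1%:R^-1)// ler_pdivlMr ?mul1r.
Qed.

Lemma cutoff_ge0 n x : 0 <= cutoff n x. Proof. exact: chi0_ge0. Qed.
Lemma cutoff_le1 n x : cutoff n x <= 1. Proof. exact: chi0_le1. Qed.

Lemma cutoff'_le n x : `|cutoff' n x| <= chi0_bound / n.+1%:R.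
Proof.
by rewrite /cutoff' normrM (@ger0_norm _ n.+1%:R^-1)// mulrC ler_wpM2r// chi0'_le.
Qed.

Lemma cutoff_cvg x : cutoff n x @[n --> \oo] --> (1 : R).
Proof.
have h : (fun n => x / n.+1%:R) @ \oo --> (0 : R).
  have -> : (fun n => x / n.+1%:R) = (fun n => x * (@harmonic R n)) by [].
  by rewrite -(mulr0 x); apply: cvgMr; exact: cvg_harmonic.
by rewrite -chi0_0; exact: (cvg_comp _ _ h (continuous_chi0 (x := 0))).
Qed.

Local Notation mR := (measurableTypeR R).
Local Notation T3 := (mR * (mR * mR))%type.
Local Notation lambda := (@lebesgue3 R).

Lemma continuous_cutoff_fst n : continuous (fun p : space R => cutoff n p.1).
Proof.
apply: (continuous_compose (f := fun p : space R => p.1)); last exact: continuous_cutoff.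
exact: continuous_fst.
Qed.

Lemma continuous_cutoff'_fst n : continuous (fun p : space R => cutoff' n p.1).
Proof.
apply: (continuous_compose (f := fun p : space R => p.1)); last exact: continuous_cutoff'.
exact: continuous_fst.
Qed.

Lemma cutoff_L2 (D : set T3) (f : T3 -> R) (e : R) : measurable D -> L2 lambda D f -> 0 < e ->
  \forall n \near \oo, \int[lambda]_(p in D) (((1 - cutoff n p.1) * f p) ^+ 2) <= e.
Proof.
move=> mD hf e0.
have mc n : measurable_fun D (fun p : T3 => (1 - cutoff n p.1) * f p).
  apply: measurable_funM; last exact: hf.1.
  apply: measurable_funB => //; apply: measurable_funTS; apply: continuous_measurable3.
  exact: continuous_cutoff_fst.
have hl n p : `|(1 - cutoff n p.1) * f p| <= `|f p|.
  rewrite normrM -[leRHS]mul1r ler_wpM2r// ger0_norm; have := cutoff_ge0 n p.1;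
  by have := cutoff_le1 n p.1; lra.
have h2 n : L2 lambda D (fun p => (1 - cutoff n p.1) * f p).
  by apply: (L2_le mD (mc n) _ hf) => p _; exact: hl.
have := @dominated_cvg _ _ _ lambda D mD
  (fun n p => (((1 - cutoff n p.1) * f p) ^+ 2)%:E) (cst 0%E) (fun p => (f p ^+ 2)%:E).
have m1 n : measurable_fun D (fun p : T3 => (((1 - cutoff n p.1) * f p) ^+ 2)%:E).
  by apply/measurable_EFinP; exact: measurable_funX.
have m2 (p : T3) : D p -> (((1 - cutoff n p.1) * f p) ^+ 2)%:E @[n --> \oo] --> 0%E.
  move=> _; apply: cvg_EFin; first by near=> n.
  have -> : 0 = ((1 - 1) * f p) ^+ 2 by rewrite subrr mul0r expr0n.
  have h3 : (1 - cutoff n p.1) * f p @[n --> \oo] --> (1 - 1) * f p.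
    by apply: cvgMl; apply: cvgB; [exact: cvg_cst|exact: cutoff_cvg].
  rewrite expr2; exact: (cvgM h3 h3).
have m3 n p : D p -> (`|(((1 - cutoff n p.1) * f p) ^+ 2)%:E| <= (f p ^+ 2)%:E)%E.
  move=> _; rewrite /= lee_fin ger0_norm ?sqr_ge0// -(real_normK (num_real (_ * _))).
  by rewrite -(real_normK (num_real (f p))) lerXn2r ?nnegrE.
move=> /(_ m1 m2 (fun=> fun=> isT) hf.2 m3); rewrite integral0 => hc.
have /fine_cvgP[_ hr] := hc.
have : \forall n \near \oo, (fine \o (fun n => \int[lambda]_(p in D)
    (((1 - cutoff n p.1) * f p) ^+ 2)%:E)%E) n <= e.
  near=> n; apply: ltW; near: n; exact: (cvgr_lt _ hr).
by apply: filterS => n.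
Unshelve. all: by end_near. Qed.

End cutoff.

(** * Mollification inside a cylinder *)

Section smooth_cutoff.
Context {R : realType}.
Local Notation mR := (measurableTypeR R).
Local Notation T3 := (mR * (mR * mR))%type.
Local Notation lambda := (@lebesgue3 R).
Implicit Types (f h : space R -> R) (p q : space R) (D : set (space R)).

Lemma L2_mollify (F : T3 -> R) (e : R) : Rintegrable lambda setT F ->
  L2 lambda setT F -> 0 < e -> exists2 r0 : R, 0 < r0 & forall r : R, 0 < r <= r0 ->
  L2 lambda setT (mollify r F) /\
  \int[lambda]_p ((mollify r F p - F p) ^+ 2) <= e.
Proof.
move=> iF [mF iF2] e0; have [r0 r00 hr] := mollify_L2 iF iF2 e0.
exists r0 => // r rr; have h := hr r rr; have tb := bump_test_profile (proj1 (andP rr)).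
have cm : measurable_fun [set: T3] (mollify r F : T3 -> R).
  by apply: continuous_measurable3; exact: (continuous_smoothing tb tb tb).
have mB : measurable_fun [set: T3] (fun p : T3 => mollify r F p - F p) by exact: measurable_funB.
have iB : Rintegrable lambda setT (fun p : T3 => (mollify r F p - F p) ^+ 2).
  apply: Rintegrable_ge0P; [exact: measurable_funX|by move=> p _; exact: sqr_ge0|].
  by apply: (le_lt_trans h); rewrite ltry.
split; last by rewrite -lee_fin -RintegralE.
have lB : L2 lambda setT (fun p : T3 => mollify r F p - F p) by split.
have := L2D measurableT lB (conj mF iF2).
by congr L2; apply/funext => p; rewrite subrK.
Qed.

Lemma cylinderP (d : R) p : 0 < d -> cylinder d p <-> p.2.1 ^+ 2 + p.2.2 ^+ 2 < d ^+ 2.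
Proof.
move=> d0; rewrite /cylinder/=.
have h0 : 0 <= p.2.1 ^+ 2 + p.2.2 ^+ 2 by rewrite addr_ge0 ?sqr_ge0.
by rewrite -{2}(sqr_sqrtr h0) ltr_pXn2r ?nnegrE ?sqrtr_ge0// ltW.
Qed.

Lemma open_cylinder (d : R) : open (cylinder d : set (space R)).
Proof.
have -> : cylinder d = (fun p : space R => Num.sqrt (p.2.1 ^+ 2 + p.2.2 ^+ 2)) @^-1` [set x | x < d].
  by [].
apply: open_comp; last exact: open_lt.
move=> p _; apply: (continuous_compose (f := fun p : space R => p.2.1 ^+ 2 + p.2.2 ^+ 2)); last first.
  exact: sqrt_continuous.
by apply: continuous_add; apply: continuous_exp;
  [apply: continuous_fst_compose|apply: continuous_snd_compose]; exact: continuous_snd.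
Qed.

Lemma measurable_cylinder (d : R) : measurable (cylinder d : set T3).
Proof. by apply: open_measurable3; exact: open_cylinder. Qed.

Lemma subset_cylinder (d d' : R) : d <= d' -> cylinder d `<=` (cylinder d' : set (space R)).
Proof. by move=> dd p; rewrite /cylinder/= => /lt_le_trans; exact. Qed.

(** A displacement of at most [r] in each transverse coordinate has length at most sqrt 2 r, and 2 r
    leaves a margin. *)
Lemma cylinder_box (rho d r : R) p q : 0 < rho -> 0 < r -> rho + 2 * r <= d -> cylinder rho p ->
  p.2.1 <= q.2.1 <= p.2.1 + r -> p.2.2 <= q.2.2 <= p.2.2 + r -> cylinder d q.
Proof.
move=> rho0 r0 hd /cylinderP hp /andP[h1 h2] /andP[h3 h4].
apply/cylinderP; first lra.
have /hp {}hp := rho0; set a := q.2.1 - p.2.1; set b := q.2.2 - p.2.2.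
have -> : q.2.1 = p.2.1 + a by rewrite /a; ring.
have -> : q.2.2 = p.2.2 + b by rewrite /b; ring.
have a0 : 0 <= a <= r by rewrite /a; lra.
have b0 : 0 <= b <= r by rewrite /b; lra.
move: hp a0 b0; set x := p.2.1; set y := p.2.2; move: a b => a b hp /andP[a0 ar] /andP[b0 br].
have x1 : x <= rho by rewrite leNgt; apply/negP => xr; have := sqr_ge0 y; nra.
have y1 : y <= rho by rewrite leNgt; apply/negP => yr; have := sqr_ge0 x; nra.
apply: (@lt_le_trans _ _ ((rho + 2 * r) ^+ 2)); last by rewrite ler_sqr ?nnegrE; lra.
by nra.
Qed.

Lemma measurable_slab (K : R) : measurable ([set p : T3 | `|p.1| <= K]).
Proof.
apply: closed_measurable3.
have -> : [set p : space R | `|p.1| <= K] = (fun p : space R => `|p.1|) @^-1` [set x | x <= K] by [].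
apply: preimage_closed; last exact: closed_le.
by move=> p _; apply: (continuous_compose (f := fun p : space R => p.1)); [exact: continuous_fst|
  exact: norm_continuous].
Qed.

(** Differentiating in [p] gives minus the integral of [f] against the derivative of the kernel; the
    kernel based at [p] is a test function, and the weak derivative contributes the second minus
    sign. *)
Lemma mollify_weak_partial D j f g (A : set T3) (r : R) p : measurable A -> A `<=` D ->
  measurable (D : set T3) ->
  is_weak_partial D j f g -> 0 < r ->
  (forall q, p.1 <= q.1 <= p.1 + r -> p.2.1 <= q.2.1 <= p.2.1 + r ->
     p.2.2 <= q.2.2 <= p.2.2 + r -> A q) ->
  Rintegrable lambda setT (f \_ A) ->
  is_derive p (basis_vector j) (mollify r (f \_ A)) (mollify r (g \_ A) p).
Proof.
move=> mA AD mD [_ _ hw] r0 hA iF; have tb := bump_test_profile r0.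
pose K : set (space R) := `[p.1, p.1 + r]%classic `*` (`[p.2.1, p.2.1 + r]%classic `*` `[p.2.2, p.2.2 + r]%classic).
have cK : compact K by apply: compact_setX; [|apply: compact_setX]; exact: segment_compact.
have KA : K `<=` A.
  by move=> q [/= h1 [h2 h3]]; move: h1 h2 h3; rewrite /= !in_itv/= => *; exact: hA.
have inK q : p.1 <= q.1 <= p.1 + r -> p.2.1 <= q.2.1 <= p.2.1 + r ->
     p.2.2 <= q.2.2 <= p.2.2 + r -> K q.
  by move=> h1 h2 h3; split => /=; [|split => /=]; rewrite in_itv.
have tphi := test_function_centered tb tb tb cK (subset_trans KA AD) inK.
have sb : smooth1 (bump r) := tb.1.
have h0 (a b c : R -> R) q : test_profile r a -> test_profile r b -> test_profile r c ->
    ~ K q -> centered a b c p q = 0.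
  move=> ta tb' tc nK; apply: (centered_eq0 ta tb' tc) => -[h1 h2 h3].
  by apply: nK; exact: inK.
have hI (G : space R -> R) (a b c : R -> R) : test_profile r a -> test_profile r b -> test_profile r c ->
    smoothing a b c (G \_ A) p = \int[lambda]_(q in D) (G q * centered a b c p q).
  move=> ta tb' tc; rewrite (@integral_supported3 _ D K); last 2 first.
  - exact: subset_trans KA AD.
  - by move=> q /(h0 _ _ _ _ ta tb' tc) ->; rewrite mulr0.
  apply: eq_Rintegral => q _; have [Kq|/(h0 _ _ _ _ ta tb' tc) ->] := pselect (K q); last by rewrite !mulr0.
  by rewrite patchE mem_set//; exact: KA.
have := is_derive_smoothing j p tb tb tb iF; congr (is_derive _ _ _ _).
have tb' := test_profile_derive tb.
rewrite /mollify (hI g)// (hI f); [|by case: ifP..].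
rewrite -[RHS]opprK -(hw _ tphi); congr (- _).
apply: eq_Rintegral => q _; congr (_ * _).
rewrite partial_upd.
have := is_derive_tensor j q (smooth1_shift p.1 sb) (smooth1_shift p.2.1 sb) (smooth1_shift p.2.2 sb).
move=> /is_derive_upd /is_derive1E ->.
have ds (t x : R) : derive1 (fun x => bump r (x - t)) x = derive1 (bump r) (x - t).
  apply: is_derive1E.
  have d1 : is_derive x 1 (fun y : R => y - t) 1.
    by apply: (is_derive1_eq (is_derive1B (is_derive1_id x) (is_derive1_cst t x))); rewrite subr0.
  by apply: (is_derive1_eq (is_derive1_compose (smooth1_derivable _ sb) d1)); rewrite mulr1.
by rewrite /centered /tensor; congr (_ * (_ * _)); case: (_ == _); rewrite ?ds.
Qed.

Lemma Rintegrable_restrict (A D : set T3) f : measurable A -> measurable D -> A `<=` D ->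
  Rintegrable lambda A f -> Rintegrable lambda D (f \_ A).
Proof.
move=> mA mD AD hf; apply: (Rintegrable_supported mA) => //.
- apply: measurable_funTS; apply/(measurable_restrictT _ _).1 => //; exact: Rintegrable_measurable hf.
- by move=> p _ nA; rewrite patchE memNset.
- apply: (@eq_Rintegrable _ _ _ lambda A mA f _ _ hf).
  by move=> p Ap; rewrite patchE mem_set.
Qed.

Lemma L2_restrict (A : set T3) f : measurable A -> L2 lambda A f -> L2 lambda setT (f \_ A).
Proof.
move=> mA [mf if2]; split.
  by apply/(measurable_restrictT _ _).1.
have := Rintegrable_restrict mA measurableT (@subsetT _ A) if2.
congr Rintegrable; apply/funext => p; rewrite !patchE; case: ifP => // _.
by rewrite expr0n.
Qed.

Lemma is_derive_unique (v : space R) f p (a b : R) :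
  is_derive p v f a -> is_derive p v f b -> a = b.
Proof. by move=> [_ <-] [_ <-]. Qed.

Definition C1_cutoff (L : R) h (h' : 'I_3 -> space R -> R) :=
  [/\ continuous h, forall j, continuous (h' j),
   forall j p, is_derive p (basis_vector j) h (h' j p) & forall p, L <= `|p.1| -> h p = 0].

Lemma is_derive_fst_compose j (a : R -> R) (a' : R) p : is_derive p.1 1 a a' ->
  is_derive p (basis_vector j) (fun q : space R => a q.1) ((val j == 0%N)%:R * a').
Proof.
move=> da; apply/is_derive_upd; case: j => -[|[|[|//]]] ?; rewrite /coord /upd /=.
- by rewrite mul1r.
- by rewrite mul0r; exact: is_derive1_cst.
- by rewrite mul0r; exact: is_derive1_cst.
Qed.

End smooth_cutoff.

(** * Approximation in H^1 *)

Section H1_approximation.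
Context {R : realType}.
Local Notation mR := (measurableTypeR R).
Local Notation T3 := (mR * (mR * mR))%type.
Local Notation lambda := (@lebesgue3 R).
Implicit Types (f h : space R -> R) (p q : space R) (D : set (space R)).

Lemma norm_subr1_le1 (x : R) : 0 <= x <= 1 -> `|x - 1| <= 1.
Proof. by move=> h; rewrite ler_norml; lra. Qed.

(** A mollification of the truncated [f] is multiplied by a cutoff in x. Passing from [d] to the
    smaller [rho] leaves room for the kernels and takes the place of an extension across the lateral
    boundary. *)
Lemma H1_approximation (d rho eps : R) f (g : 'I_3 -> space R -> R) :
  0 < rho -> rho < d -> 0 < eps -> square_integrable (cylinder d) f ->
  (forall j, is_weak_partial (cylinder d) j f (g j)) ->
  (forall j, square_integrable (cylinder d) (g j)) ->
  exists (L : R) h (h' : 'I_3 -> space R -> R), [/\ 0 < L, C1_cutoff L h h',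
    L2 lambda (cylinder rho) h /\ forall j, L2 lambda (cylinder rho) (h' j),
    \int[lambda]_(p in cylinder rho) ((h p - f p) ^+ 2) <= eps &
    forall j, \int[lambda]_(p in cylinder rho) ((h' j p - g j p) ^+ 2) <= eps].
Proof.
move=> rho0 rhod eps0 hf hw hg.
have d0 : 0 < d by lra.
pose O : set T3 := cylinder d; pose U : set T3 := cylinder rho.
have mO : measurable O := measurable_cylinder d.
have mU : measurable U := measurable_cylinder rho.
have UO : U `<=` O by apply: subset_cylinder; exact: ltW.
have lf : L2 lambda O f := hf.
have lg j : L2 lambda O (g j) := hg j.
pose I := \int[lambda]_(p in O) (f p ^+ 2).
have I0 : 0 <= I by apply: Rintegral_ge0 => // x _; exact: sqr_ge0.
(* [key] below loses a factor 4 and the triangle inequality for the derivative a factor 2, so this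
   part uses eps / 2, and the term with the derivative of the cutoff the other half. *)
pose e1 := eps / 16; have e10 : 0 < e1 by rewrite divr_gt0.
pose C := @chi0_bound R.
have C0 : 0 <= C by rewrite mulr_ge0 ?expR_ge0.
(* The last condition keeps the square integral of the mollification times the derivative of the
   cutoff below eps / 4. *)
have [n [hn0 hnj hnC]] : exists n : nat,
    [/\ \int[lambda]_(p in O) (((1 - cutoff n p.1) * f p) ^+ 2) <= e1,
      forall j, \int[lambda]_(p in O) (((1 - cutoff n p.1) * g j p) ^+ 2) <= e1 &
      C ^+ 2 * (2 * e1 + 2 * I) * 4 / eps <= n%:R].
  near \oo => n; exists n; split.
  - by near: n; exact: cutoff_L2.
  - near: n; apply: filter_forall => j; exact: cutoff_L2.
  - by near: n; exact: nbhs_infty_ger.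
pose k : R := n.+1%:R; have k1 : 1 <= k by rewrite /k ler1n.
(* A piece of finite measure, where square integrable functions are integrable. It reaches to 2 k so
   that kernels of side at most [k] based at |x| <= k stay inside. *)
pose A : set T3 := O `&` [set p | `|p.1| <= 2 * k].
have mA : measurable A by apply: measurableI => //; exact: measurable_slab.
have AO : A `<=` O by move=> p [].
have Alty : (lambda A < +oo)%E.
  apply: le_lt_trans (box3_lty (2 * k + d)); apply: le_measure; rewrite ?inE//.
    exact: measurable_box3.
  move=> [x [y z]] [/(cylinderP _ d0)/= h1] /=; rewrite ler_norml => h2.
  have y1 : -d <= y <= d by apply/andP; split; rewrite leNgt; apply/negP => h; move: h h1 d0 (sqr_ge0 z); clear; nra.
  have z1 : -d <= z <= d by apply/andP; split; rewrite leNgt; apply/negP => h; move: h h1 d0 (sqr_ge0 y); clear; nra.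
  by split => /=; [|split => /=]; rewrite in_itv/=; move: h2 y1 z1 d0 k1; clear; lra.
pose F := f \_ A; pose G j := g j \_ A.
have lfA := L2_subset mA mO AO lf; have lgA j := L2_subset mA mO AO (lg j).
have iF : Rintegrable lambda setT F.
  by apply: Rintegrable_restrict => //; exact: L2_Rintegrable.
have iG j : Rintegrable lambda setT (G j).
  by apply: Rintegrable_restrict => //; exact: L2_Rintegrable (lgA j).
have lF : L2 lambda setT F by exact: L2_restrict.
have lG j : L2 lambda setT (G j) by exact: L2_restrict.
have [rF rF0 hrF] := L2_mollify iF lF e10.
have [rG hrG] : exists rG : 'I_3 -> R, forall j, 0 < rG j /\ forall r : R, 0 < r <= rG j ->
    L2 lambda setT (mollify r (G j)) /\ \int[lambda]_p ((mollify r (G j) p - G j p) ^+ 2) <= e1.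
  have h j : exists r0 : R, 0 < r0 /\ forall r : R, 0 < r <= r0 -> L2 lambda setT (mollify r (G j)) /\
      \int[lambda]_p ((mollify r (G j) p - G j p) ^+ 2) <= e1.
    by have [r h1 h2] := L2_mollify (iG j) (lG j) e10; exists r.
  by exists (fun j => sval (cid (h j))) => j; exact: (svalP (cid (h j))).
(* Small enough for all four mollifications, for the lateral room d - rho and for the room left by
   the slab. *)
pose r1 := \big[Num.min/Num.min rF (Num.min ((d - rho) / 2) k)]_j rG j.
have r10 : 0 < r1.
  apply: lt_bigmin => [|j _]; last by have [] := hrG j.
  by rewrite !lt_min rF0 /= divr_gt0 ?subr_gt0//=; exact: lt_le_trans k1.
have r1F : r1 <= rF by apply: (le_trans (bigmin_le_id _ _ _ _)); rewrite ge_min lexx.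
have r1d : rho + 2 * r1 <= d.
  have : r1 <= (d - rho) / 2 by apply: (le_trans (bigmin_le_id _ _ _ _)); rewrite !ge_min lexx orbT.
  by clear; lra.
have r1k : r1 <= k by apply: (le_trans (bigmin_le_id _ _ _ _)); rewrite !ge_min lexx !orbT.
have r1G j : r1 <= rG j by exact: bigmin_le.
have [lM eM] := hrF r1 (introT andP (conj r10 r1F)).
have hG j := (hrG j).2 r1 (introT andP (conj r10 (r1G j))).
have tb := bump_test_profile r10; have tb' := test_profile_derive tb.
pose M := mollify r1 F.
pose M' (j : 'I_3) := (fun p => - smoothing (if val j == 0%N then derive1 (bump r1) else bump r1)
     (if val j == 1%N then derive1 (bump r1) else bump r1)
     (if val j == 2%N then derive1 (bump r1) else bump r1) F p).
have dM j p : is_derive p (basis_vector j) M (M' j p) by exact: (is_derive_smoothing j p tb tb tb iF).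
have cM : continuous M by exact: (continuous_smoothing tb tb tb iF).
have cM' j : continuous (M' j).
  by apply: continuous_opp; apply: (continuous_smoothing (r := r1)) => //; case: ifP.
have ME j p : U p -> `|p.1| <= k -> M' j p = mollify r1 (G j) p.
  move=> Up pk; have := @mollify_weak_partial R O j f (g j) A r1 p mA AO mO (hw j) r10 _ iF.
  move=> h; apply: (is_derive_unique (dM j p)); apply: h => q h1 h2 h3; split.
    by apply: (cylinder_box rho0 r10 r1d Up).
  by move: pk r1k; rewrite /= !ler_norml; clear -h1; lra.
pose c p := cutoff n (p : space R).1; pose c' p := cutoff' n (p : space R).1.
have cc : continuous c by exact: continuous_cutoff_fst.
have cc' : continuous c' by exact: continuous_cutoff'_fst.
have c0 (p : space R) : k <= `|p.1| -> c p = 0 by exact: cutoff_eq0.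
have c01 p : 0 <= c p <= 1 by rewrite cutoff_ge0 cutoff_le1.
pose s j : R := (val (j : 'I_3) == 0%N)%:R.
pose h p := c p * M p.
pose h' j p := c p * M' j p + (s j * c' p) * M p.
have lMU : L2 lambda U M by exact: L2_subset lM.
have mcU D : measurable D -> measurable_fun (D : set T3) (c : T3 -> R).
  by move=> mD; apply: measurable_funTS; exact: continuous_measurable3.
have ms j : measurable_fun U (fun p : T3 => s j * c' p).
  apply: measurable_funTS; apply: continuous_measurable3.
  by apply: continuous_mul => //; exact: continuous_const.
have sb j p : `|s j * c' p| <= C / k.
  rewrite normrM; apply: (le_trans _ (cutoff'_le n p.1)); rewrite -[leRHS]mul1r ler_wpM2r//.
  by rewrite /s; case: eqP => _; rewrite ?normr1 ?normr0.
have cb p : U p -> `|c p| <= 1 by move=> _; have /andP[? ?] := c01 p; rewrite ger0_norm.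
have lGU j : L2 lambda U (mollify r1 (G j)) by exact: L2_subset (hG j).1.
have h'E j p : U p -> h' j p = c p * mollify r1 (G j) p + (s j * c' p) * M p.
  move=> Up; rewrite /h'; have [pk|pk] := leP `|p.1| k; first by rewrite ME.
  by rewrite c0 ?ltW// !mul0r.
have lh : L2 lambda U h by apply: (L2_bounded mU _ cb) => //; exact: mcU.
have lsM j : L2 lambda U (fun p => (s j * c' p) * M p).
  by apply: (L2_bounded mU (ms j) (C := C / k)) => // p _; exact: sb.
have lcG j : L2 lambda U (fun p => c p * mollify r1 (G j) p).
  by apply: (L2_bounded mU _ cb) => //; exact: mcU.
have lh' j : L2 lambda U (h' j).
  have [mm ii] := L2D mU (lcG j) (lsM j); split.
    apply: continuous_measurable_on => //; apply: continuous_add.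
      exact: continuous_mul.
    by apply: continuous_mul => //; apply: continuous_mul => //; exact: continuous_const.
  by apply: (@eq_Rintegrable _ _ _ lambda U mU _ _ _ ii) => p Up; rewrite /= h'E.
have lfU := L2_subset mU mO UO lf; have lgU j := L2_subset mU mO UO (lg j).
have key (a : space R -> R) (e : R) : L2 lambda O a -> L2 lambda U (mollify r1 (a \_ A)) ->
    L2 lambda setT (a \_ A) -> L2 lambda setT (mollify r1 (a \_ A)) ->
    \int[lambda]_p ((mollify r1 (a \_ A) p - (a \_ A) p) ^+ 2) <= e ->
    \int[lambda]_(p in O) (((1 - c p) * a p) ^+ 2) <= e ->
    L2 lambda U (fun p => c p * mollify r1 (a \_ A) p - a p) /\
    \int[lambda]_(p in U) ((c p * mollify r1 (a \_ A) p - a p) ^+ 2) <= 4 * e.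
  move=> la lmU lA lmA h1 h2; have laU := L2_subset mU mO UO la.
  have lcm : L2 lambda U (fun p => c p * mollify r1 (a \_ A) p).
    by apply: (L2_bounded mU _ cb) => //; exact: mcU.
  split; first exact: (L2B mU lcm laU).
  have lAU := L2_subset mU measurableT (@subsetT _ U) lA.
  have l1 : L2 lambda U (fun p => mollify r1 (a \_ A) p - (a \_ A) p) by exact: L2B.
  have l2 : L2 lambda U (fun p => c p * (mollify r1 (a \_ A) p - (a \_ A) p)).
    by apply: (L2_bounded mU _ cb) => //; exact: mcU.
  have c1b (D : set T3) (p : T3) : D p -> `|c p - 1| <= 1.
    by move=> _; exact: norm_subr1_le1.
  have l3 D : measurable D -> D `<=` O -> L2 lambda D (fun p => (c p - 1) * a p).
    move=> mD DO; apply: (@L2_bounded _ _ _ lambda D mD 1 (fun p => c p - 1) a _ (@c1b D)); last exact: L2_subset la.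
    by apply: measurable_funB => //; exact: mcU.
  (* The error is c times the mollification error plus (c - 1) a; on the support of [c] the
     truncation to [A] is invisible. *)
  rewrite (_ : \int[lambda]_(p in U) _ = \int[lambda]_(p in U)
     (c p * (mollify r1 (a \_ A) p - (a \_ A) p) + (c p - 1) * a p) ^+ 2); last first.
    apply: eq_Rintegral => p; rewrite inE => Up; congr (_ ^+ 2).
    suff E : c p * (a \_ A) p = c p * a p by rewrite mulrBr E; ring.
    have [pk|pk] := leP `|p.1| k; last by rewrite c0 ?mul0r// ltW.
    by rewrite patchE mem_set//; split; [exact: UO|rewrite /=; clear -pk k1; lra].
  apply: (le_trans (L2_sqrD mU l2 (l3 U mU UO))).
  have e1' : \int[lambda]_(p in U) ((c p * (mollify r1 (a \_ A) p - (a \_ A) p)) ^+ 2) <= e.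
    apply: le_trans h1; have lT := L2B measurableT lmA lA.
    apply: (le_trans _ (L2_sqr_subset mU measurableT (@subsetT _ U) lT)).
    apply: (L2_le_sqr mU l2.1 l1) => p Up.
    by rewrite normrM -[leRHS]mul1r ler_wpM2r// cb.
  have e2' : \int[lambda]_(p in U) (((c p - 1) * a p) ^+ 2) <= e.
    apply: le_trans h2; rewrite (_ : \int[lambda]_(p in O) _ = \int[lambda]_(p in O) (((c p - 1) * a p) ^+ 2)).
      by apply: L2_sqr_subset => //; exact: l3.
    by apply: eq_Rintegral => p _; ring.
  clear -e1' e2'; lra.
exists k, h, h'; split => //.
- split.
  + exact: continuous_mul.
  + move=> j; apply: continuous_add; first exact: continuous_mul.
    by apply: continuous_mul => //; apply: continuous_mul => //; exact: continuous_const.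
  + move=> j p; have d1 := is_derive_fst_compose j (is_derive_cutoff n p.1).
    have hh := is_deriveM d1 (dM j p).
    by apply: (is_derive_eq hh); rewrite /GRing.scale/= /h' /s /c /c'; ring.
  + by move=> p pk; rewrite /h c0 ?mul0r.
- by have [_] := key f e1 lf lMU lF lM eM hn0; rewrite /e1 /h => hh; apply: (le_trans hh); clear -eps0; lra.
- move=> j; have [lk hk] := key (g j) e1 (lg j) (lGU j) (lG j) (hG j).1 (hG j).2 (hnj j).
  rewrite (_ : \int[lambda]_(p in _) _ = \int[lambda]_(p in U)
     ((c p * mollify r1 (G j) p - g j p) + (s j * c' p) * M p) ^+ 2); last first.
    by apply: eq_Rintegral => p; rewrite inE => Up; rewrite h'E//; congr (_ ^+ 2); ring.
  apply: (le_trans (L2_sqrD mU lk (lsM j))).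
  have h1 : \int[lambda]_(p in U) ((s j * c' p * M p) ^+ 2) <= eps / 4.
    apply: (@le_trans _ _ (\int[lambda]_(p in U) ((C / k * M p) ^+ 2))).
      apply: (L2_le_sqr mU (lsM j).1 (L2Z mU (C / k) lMU)) => p Up.
      by rewrite normrM [leRHS]normrM; apply: ler_wpM2r => //; exact: le_trans (sb j p) (ler_norm _).
    rewrite (_ : \int[lambda]_(p in U) _ = \int[lambda]_(p in U) ((C / k) ^+ 2 * M p ^+ 2)); last first.
      by apply: eq_Rintegral => p _; rewrite exprMn.
    rewrite (RintegralZ' mU _ lMU.2).
    have h2 : \int[lambda]_(p in U) (M p ^+ 2) <= 2 * e1 + 2 * I.
      apply: (le_trans (L2_sqr_subset mU measurableT (@subsetT _ U) lM)).
      rewrite (_ : \int[lambda]_p _ = \int[lambda]_p ((M p - F p) + F p) ^+ 2); last first.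
        by apply: eq_Rintegral => p _; rewrite subrK.
      apply: (le_trans (L2_sqrD measurableT (L2B measurableT lM lF) lF)).
      have h3 : \int[lambda]_p (F p ^+ 2) <= I.
        rewrite (integral_supported lambda (@subsetT _ A)); last first.
          by move=> p _ nA; rewrite /F patchE memNset// expr0n.
        apply: le_trans (L2_sqr_subset mA mO AO lf).
        by rewrite le_eqVlt; apply/orP; left; apply/eqP; apply: eq_Rintegral => p /[!inE] Ap; rewrite /F patchE mem_set.
      by move: eM; rewrite -/M; clear -h3; lra.
    have h4 : 0 <= \int[lambda]_(p in U) (M p ^+ 2) by apply: Rintegral_ge0 => // x _; exact: sqr_ge0.
    have h5 : (C / k) ^+ 2 * (2 * e1 + 2 * I) <= eps / 4.
      move: hnC; rewrite ler_pdivrMr// => hnC.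
      have nk : n%:R <= k by rewrite /k ler_nat.
      rewrite expr_div_n mulrAC ler_pdivrMr; last by rewrite exprn_gt0//; exact: lt_le_trans k1.
      have k2 : k <= k ^+ 2 by rewrite expr2 ler_peMr// (le_trans ler01).
      clear -hnC nk k2 eps0; nra.
    apply: le_trans h5; apply: ler_wpM2l => //; exact: sqr_ge0.
  move: hk h1; rewrite /e1; clear -eps0; lra.
Unshelve. all: by end_near. Qed.

End H1_approximation.

(** * Calculus on a segment and Jacobi's inequality *)

Section segment.
Context {R : realType}.
Local Notation mu := (@lebesgue_measure R).
Implicit Types (a b c x : R) (f g H N P r w phi : R -> R).

Lemma segment_Rintegrable a b f : continuous f -> Rintegrable mu `[a, b]%classic f.
Proof.
by move=> cf; apply: continuous_compact_integrable; [exact: segment_compact|exact: continuous_subspaceT].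
Qed.

(** Integrating from [a - 1] makes both end points interior, so the primitive has a two-sided
    derivative there. *)
Lemma antiderivative a b f : continuous f ->
  exists H, forall x, a <= x <= b -> is_derive x 1 H (f x).
Proof.
move=> cf; exists (fun x => \int[mu]_(t in `[a - 1, x]%classic) f t) => x /andP[ax xb].
have xb1 : x < b + 1 by lra.
have ax1 : a - 1 < x by lra.
have [d1 d2] := @continuous_FTC1_closed R f (a - 1) x (b + 1) xb1
  (@segment_Rintegrable (a - 1) (b + 1) f cf) ax1 (cf x).
by rewrite -d2 derive1E; exact: derivableP.
Qed.

Lemma FTC_segment a b H f : a <= b -> continuous f ->
  (forall x, a <= x <= b -> is_derive x 1 H (f x)) ->
  \int[mu]_(x in `[a, b]%classic) f x = H b - H a.
Proof.
rewrite le_eqVlt => /predU1P[<-|ab] cf dH.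
  by rewrite set_itv1 Rintegral_set1 subrr.
have cH x : a <= x <= b -> {for x, continuous H} by move=> /dH/is_derive_continuous_at.
rewrite /Rintegral (@continuous_FTC2 _ f H)//; last 3 first.
- exact: continuous_subspaceT.
- split.
  + by move=> x; rewrite in_itv/= => /andP[h1 h2]; have [] := dH x (introT andP (conj (ltW h1) (ltW h2))).
  + by apply: cvg_at_right_filter; apply: cH; rewrite lexx ltW.
  + by apply: cvg_at_left_filter; apply: cH; rewrite lexx ltW.
- by move=> x; rewrite in_itv/= => /andP[h1 h2]; apply: is_derive1E; apply: dH; rewrite !ltW.
Qed.

Lemma derive_le0_homo a b f f' : a <= b ->
  (forall x, a <= x <= b -> {for x, continuous f}) ->
  (forall x, a < x < b -> is_derive x 1 f (f' x) /\ 0 <= f' x) -> f a <= f b.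
Proof.
rewrite le_eqVlt => /predU1P[<-//|ab] cf df.
have [x xab E] : exists2 c, c \in `]a, b[%R & f b - f a = f' c * (b - a).
  apply: MVT => //; first by move=> x; rewrite in_itv/= => /df[].
  by apply: continuous_in_subspaceT => x; rewrite inE/= in_itv/=; exact: cf.
rewrite -subr_ge0 E mulr_ge0//; last by rewrite subr_ge0 ltW.
by have [] := df x xab.
Qed.

(* The finitely many points of [s] where [P] need not be differentiable do no
   harm, as [P] is continuous there. *)
Lemma FTC_le a b (s : seq R) P N : a <= b -> continuous N ->
  (forall x, a <= x <= b -> {for x, continuous P}) ->
  (forall x, a < x < b -> x \notin s -> exists2 D : R, is_derive x 1 P D & D <= N x) ->
  P b - P a <= \int[mu]_(x in `[a, b]%classic) N x.
Proof.
move=> ab cN cP dP; have [H dH] := @antiderivative a b N cN.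
rewrite (FTC_segment ab cN dH).
suff h (t : seq R) : forall c d, a <= c -> c <= d -> d <= b ->
    (forall x, c < x < d -> x \notin t -> exists2 D : R, is_derive x 1 P D & D <= N x) ->
    P d - P c <= H d - H c by exact: (h s a b (lexx a) ab (lexx b) dP).
(* Without exceptional points, H - P is nondecreasing by the mean value theorem; an exceptional
   point [y] inside the interval splits it in two. *)
elim: t => [|y t IH] c d ac cd db hd.
  have [P' hP'] : exists P', forall x, c < x < d -> is_derive x 1 P (P' x) /\ P' x <= N x.
    have h x : exists D, c < x < d -> is_derive x 1 P D /\ D <= N x.
      have [xcd|] := boolP (c < x < d); last by exists 0.
      by have [D h1 h2] := hd x xcd isT; exists D.
    by exists (fun x => sval (cid (h x))) => x; exact: (svalP (cid (h x))).
  suff : H c - P c <= H d - P d by lra.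
  apply: (@derive_le0_homo c d (fun x => H x - P x) (fun x => N x - P' x) cd).
    move=> x /andP[cx xd]; have axb : a <= x <= b by lra.
    by apply: (@continuousB _ _ _ H P); [exact: is_derive_continuous_at (dH x axb)|exact: cP].
  move=> x xcd; have [d1 d2] := hP' x xcd; split; last by rewrite subr_ge0.
  by apply: is_derive1B => //; apply: dH; lra.
have [/andP[cy yd]|ycd] := boolP (c < y < d); last first.
  apply: IH => // x xcd xt; apply: hd => //; rewrite inE negb_or xt andbT.
  by apply: contraNN ycd => /eqP <-.
have h1 : P y - P c <= H y - H c.
  apply: IH; [lra..|] => x /andP[h1 h2] xt; apply: hd; first lra.
  by rewrite inE negb_or xt andbT; lra.
have h2 : P d - P y <= H d - H y.
  apply: IH; [lra..|] => x /andP[h2 h3] xt; apply: hd; first lra.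
  by rewrite inE negb_or xt andbT; lra.
lra.
Qed.

Lemma is_derive_near c f (f' e : R) : is_derive c 1 f f' -> f c = 0 -> 0 < e ->
  \forall x \near c, `|f x - f' * (x - c)| <= e * `|x - c|.
Proof.
move=> [df dE] fc e0.
have hc : (fun h : R => h^-1 *: (f (h *: (1 : R) + c) - f c)) @ 0^' --> f'.
  by rewrite -dE; exact: df.
have /cvgr_dist_le/(_ e e0) := hc.
rewrite near_withinE => /nbhs_ballP[d /= d0 hd]; apply/nbhs_ballP; exists d => //= x.
rewrite -ball_normE/= distrC => cx; have [->|xc] := eqVneq x c.
  by rewrite fc !subrr mulr0 subr0 normr0 mulr0.
have xc0 : x - c != 0 by rewrite subr_eq0.
have := hd (x - c); rewrite -ball_normE/= sub0r normrN => /(_ cx xc0).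
rewrite /GRing.scale/= mulr1 subrK fc subr0 => h.
have -> : f x - f' * (x - c) = - ((f' - (x - c)^-1 * f x) * (x - c)) by field.
by rewrite normrN normrM ler_wpM2r.
Qed.

(** Near [c] the numerator is O(|x - c|^2) and the denominator at least |phi'| |x - c| / 2, so the
    quotient tends to 0, which is its value at [c] because [r c = 0]. *)
Lemma pivot_continuous r w phi (c r' phi' : R) : is_derive c 1 r r' -> is_derive c 1 phi phi' ->
  r c = 0 -> phi c = 0 -> phi' != 0 -> {for c, continuous w} ->
  {for c, continuous (fun x => r x ^+ 2 * (w x / phi x))}.
Proof.
move=> dr dphi rc phic phi0 cw.
have p0 : 0 < `|phi'| / 2 by rewrite divr_gt0// normr_gt0.
pose M := `|r'| + 1; pose W := `|w c| + 1; pose K := M ^+ 2 * W / (`|phi'| / 2).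
have M0 : 0 < M by rewrite ltr_pwDr.
have W0 : 0 < W by rewrite ltr_pwDr.
have K0 : 0 < K by rewrite divr_gt0// mulr_gt0// exprn_gt0.
rewrite /prop_for /continuous_at /= rc expr0n/= mul0r.
have nw : \forall x \near c, `|w c - w x| <= 1 by have /cvgr_dist_le := cw; apply.
apply/cvgr0Pnorm_le => e e0.
have nc : \forall x \near c, `|x - c| <= e / K.
  apply/nbhs_ballP; exists (e / K); first exact: divr_gt0.
  by move=> x; rewrite -ball_normE/= distrC => /ltW.
near=> x.
have h1 : `|r x - r' * (x - c)| <= 1 * `|x - c| by near: x; exact: is_derive_near.
have h2 : `|phi x - phi' * (x - c)| <= `|phi'| / 2 * `|x - c| by near: x; exact: is_derive_near.
have h3 : `|w x| <= W.
  have h : `|w c - w x| <= 1 by near: x.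
  by rewrite /W -[w x](subKr (w c)) (le_trans (ler_normB _ _))// lerD2l.
have h4 : `|x - c| <= e / K.
  by near: x.
have r1 : `|r x| <= M * `|x - c|.
  rewrite -[r x](subrK (r' * (x - c))) (le_trans (ler_normD _ _))// normrM /M mulrDl addrC.
  by rewrite lerD2l.
have r2 : `|phi'| / 2 * `|x - c| <= `|phi x|.
  have := ler_normB (phi' * (x - c)) (phi' * (x - c) - phi x); rewrite subKr.
  have := ler_normD (phi x) (phi' * (x - c) - phi x); rewrite subrKC distrC normrM; lra.
have [->|xc] := eqVneq x c; first by rewrite rc expr0n/= mul0r normr0 ltW.
have xc0 : 0 < `|x - c| by rewrite normr_gt0 subr_eq0.
rewrite normrM normrX normrM normfV.
have ph0 : 0 < `|phi x| by apply: lt_le_trans r2; exact: mulr_gt0.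
rewrite mulrA ler_pdivrMr//.
apply: (@le_trans _ _ ((M * `|x - c|) ^+ 2 * W)).
  by apply: ler_pM => //; rewrite ?sqr_ge0// lerXn2r// nnegrE// mulr_ge0// ltW.
apply: (@le_trans _ _ (e * (`|phi'| / 2 * `|x - c|))); last by rewrite ler_wpM2l// ltW.
have {h4} : `|x - c| * (M ^+ 2 * W) <= e * (`|phi'| / 2).
  by rewrite -ler_pdivrMr// -mulrA -ler_pdivlMr.
by move=> /(ler_wpM2r (ltW xc0)); clear; lra.
Unshelve. all: by end_near. Qed.

(* Jacobi's form of the second variation: where [phi] is a supersolution
   vanishing only at zeros of [r], the boundary term [r^2 w / phi] is
   continuous and its derivative is at most the integrand. *)
Lemma jacobi a b (s : seq R) (r r' w w1 phi phi' q N : R -> R) : a <= b -> continuous N ->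
  (forall x, a <= x <= b -> [/\ {for x, continuous r}, {for x, continuous phi} &
     {for x, continuous w}]) ->
  (forall x, a <= x <= b -> phi x = 0 -> [/\ a < x < b, x \in s, r x = 0 & phi' x != 0]) ->
  (forall x, a < x < b -> [/\ is_derive x 1 r (r' x), is_derive x 1 phi (phi' x) &
     is_derive x 1 w (- (q x * phi x))]) ->
  (forall x, a < x < b -> [/\ w x = w1 x * phi' x, 0 <= w1 x &
     N x = w1 x * r' x ^+ 2 - q x * r x ^+ 2]) ->
  r b ^+ 2 * (w b / phi b) - r a ^+ 2 * (w a / phi a) <= \int[mu]_(x in `[a, b]%classic) N x.
Proof.
move=> ab cN hc hz hd hw.
apply: (@FTC_le a b s (fun x => r x ^+ 2 * (w x / phi x)) N ab cN).
  move=> x xab; have [cr cphi cw] := hc x xab.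
  have [p0|p0] := eqVneq (phi x) 0.
    have [xab' _ r0 p1] := hz x xab p0; have [d1 d2 _] := hd x xab'.
    exact: (pivot_continuous d1 d2).
  apply: (@continuousM _ _ (fun x => r x ^+ 2) (fun x => w x / phi x)).
    exact: (continuousM cr cr).
  by apply: (@continuousM _ _ w (fun x => (phi x)^-1)) => //; apply: (@continuousV _ _ phi).
move=> x xab xs.
have xab' : a <= x <= b by case/andP : xab => *; rewrite !ltW.
have p0 : phi x != 0.
  by apply/eqP => p0; have [_ xs' _ _] := hz x xab' p0; rewrite xs' in xs.
have [d1 d2 d3] := hd x xab; have [wE w10 NE] := hw x xab.
eexists; first exact: (is_derive1M (is_derive1X 2 d1) (is_derive1M d3 (is_derive1V p0 d2))).
rewrite NE /= wE -subr_ge0; set A := r x; set B := r' x; set p := phi x in p0 *; set p' := phi' x.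
(* Jacobi's identity: the integrand exceeds the derivative of the boundary term by a weighted
   square. *)
have -> : w1 x * B ^+ 2 - q x * A ^+ 2 - (2 * A ^+ 1 * B * (w1 x * p' / p) +
   A ^+ 2 * (- (q x * p) / p + w1 x * p' * (- p' / p ^+ 2))) = w1 x * (B - A * p' / p) ^+ 2 by field.
by rewrite mulr_ge0 ?sqr_ge0.
Qed.

End segment.

(** * The soliton profile *)

Section soliton_profile.
Context {R : realType}.
Local Notation mu := (@lebesgue_measure R).
Implicit Types (x L a : R) (f : R -> R).

Let s : R := Num.sqrt 2.

Let s0 : 0 < s. Proof. by rewrite sqrtr_gt0. Qed.
Let s2 : s ^+ 2 = 2. Proof. by rewrite sqr_sqrtr. Qed.

Definition kink x : R := tanh (x / s).
(** The hyperbolic secant of x / sqrt 2, in the scale of [kink]. For the operator - f'' - sech^2 f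
    it belongs to the eigenvalue -1/2, which gives the constant in [line_inequality], while [kink]
    is the odd solution for 0. *)
Definition sech x : R := 2 / (expR (x / s) + expR (- (x / s))).

Let denom_gt0 y : 0 < expR y + expR (- y) :> R.
Proof. by rewrite addr_gt0 ?expR_gt0. Qed.

Lemma sech_gt0 x : 0 < sech x.
Proof. by rewrite divr_gt0. Qed.

Lemma sech_kink x : sech x ^+ 2 + kink x ^+ 2 = 1.
Proof.
rewrite /sech /kink /tanh expRN; have := expR_gt0 (x / s); set y := expR _ => y0.
by field; apply/andP; split; [lra|apply: lt0r_neq0; rewrite ltr_wpDl ?sqr_ge0].
Qed.

Lemma is_derive_scaled (k : R) x : is_derive x 1 (fun y : R => y / k) k^-1.
Proof.
apply: (is_derive1_eq (is_derive1M (is_derive1_id x) (is_derive1_cst k^-1 x))).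
by rewrite mulr0 addr0 mul1r.
Qed.

Let dexp x : is_derive x 1 (fun y : R => expR (y / s)) (expR (x / s) / s).
Proof. exact: (is_derive1_compose (is_derive_expR _) (is_derive_scaled s x)). Qed.

Let dexpN x : is_derive x 1 (fun y : R => expR (- (y / s))) (- (expR (- (x / s)) / s)).
Proof.
apply: (is_derive1_eq (is_derive1_compose (is_derive_expR _) (is_derive1N (is_derive_scaled s x)))).
by rewrite mulrN.
Qed.

Lemma is_derive_kink x : is_derive x 1 kink (sech x ^+ 2 / s).
Proof.
have d0 : expR (x / s) + expR (- (x / s)) != 0 by rewrite gt_eqF.
rewrite (_ : kink = fun y => (expR (y / s) - expR (- (y / s))) / (expR (y / s) + expR (- (y / s))))//.
have dV := @is_derive1V _ (fun y => expR (y / s) + expR (- (y / s))) x _ d0 (is_derive1D (dexp x) (dexpN x)).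
apply: (is_derive1_eq (is_derive1M (is_derive1B (dexp x) (dexpN x)) dV)).
rewrite /sech; move: d0; rewrite expRN; have := expR_gt0 (x / s); set y := expR _ => y0 d0.
have ss : s != 0 by rewrite gt_eqF.
by field; rewrite ss /=; apply/andP; split; rewrite gt_eqF//; nra.
Qed.

Lemma is_derive_sech x : is_derive x 1 sech (- (sech x * kink x / s)).
Proof.
have d0 : expR (x / s) + expR (- (x / s)) != 0 by rewrite gt_eqF.
rewrite [X in is_derive _ _ X](_ : _ = fun y => 2 * (expR (y / s) + expR (- (y / s)))^-1)//.
have dV := @is_derive1V _ (fun y => expR (y / s) + expR (- (y / s))) x _ d0 (is_derive1D (dexp x) (dexpN x)).
apply: (is_derive1_eq (is_derive1Z 2 dV)).
rewrite /sech /kink /tanh; move: d0; rewrite expRN; have := expR_gt0 (x / s); set y := expR _ => y0 d0.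
have ss : s != 0 by rewrite gt_eqF.
by field; rewrite ss /=; apply/andP; split; rewrite gt_eqF//; nra.
Qed.

Lemma continuous_kink : continuous kink.
Proof. exact: is_derive_continuous is_derive_kink. Qed.

Lemma continuous_sech : continuous sech.
Proof. exact: is_derive_continuous is_derive_sech. Qed.

Lemma kinkN x : kink (- x) = - kink x.
Proof. by rewrite /kink /tanh mulNr opprK -[RHS]mulNr opprB; congr (_ / _); exact: addrC. Qed.

Lemma sechN x : sech (- x) = sech x.
Proof. by rewrite /sech mulNr opprK addrC. Qed.

Lemma sech_le1 x : sech x <= 1.
Proof.
rewrite -(@expr_le1 _ 2)//; last exact/ltW/sech_gt0.
by rewrite -(sech_kink x) lerDl sqr_ge0.
Qed.

Lemma kink_gt0 x : 0 < x -> 0 < kink x.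
Proof.
move=> x0; have xs : 0 < x / s by rewrite divr_gt0.
rewrite /kink /tanh divr_gt0// subr_gt0 ltr_expR; lra.
Qed.

Lemma kink_lt0 x : x < 0 -> kink x < 0.
Proof. by move=> x0; rewrite -[x]opprK kinkN oppr_lt0 kink_gt0// oppr_gt0. Qed.

Lemma kink0 : kink 0 = 0.
Proof. by rewrite /kink /tanh mul0r oppr0 subrr mul0r. Qed.

Lemma sech0 : sech 0 = 1.
Proof. by rewrite /sech mul0r oppr0 expR0 divff. Qed.

Lemma sech_gt_bound x : `|kink x| <= 1.
Proof.
rewrite -(@expr_le1 _ 2)// real_normK ?num_real//.
by rewrite -(sech_kink x) lerDr sqr_ge0.
Qed.

(* With [a = f 0], the remainder [f - a sech] vanishes at 0, where the zero
   mode [kink] does; the cross terms integrate exactly. *)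
Lemma line_inequality L f (f' : R -> R) : 0 < L -> continuous f' ->
  (forall x, is_derive x 1 f (f' x)) -> f (- L) = 0 -> f L = 0 ->
  - (\int[mu]_(x in `[- L, L]%classic) (f x * sech x)) ^+ 2
    / (2 * \int[mu]_(x in `[- L, L]%classic) (sech x ^+ 2)) <=
  \int[mu]_(x in `[- L, L]%classic) (f' x ^+ 2 - sech x ^+ 2 * f x ^+ 2).
Proof.
move=> L0 cf' df fNL fL; set a := f 0.
have cf := is_derive_continuous df; have ce := continuous_sech; have cT := continuous_kink.
pose e' x := - (sech x * kink x / s).
have ce' : continuous e'.
  by apply: continuous_opp; apply: continuous_mul; [exact: continuous_mul|exact: continuous_const].
pose r x := f x - a * sech x; pose r' x := f' x - a * e' x.
have dr x : is_derive x 1 r (r' x).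
  exact: (is_derive1B (df x) (is_derive1Z a (is_derive_sech x))).
have cr := is_derive_continuous dr.
have cr' : continuous r'.
  by apply: continuous_sub => //; apply: continuous_mul => //; exact: continuous_const.
have LL : - L <= L by lra.
(* The cross terms of f = r + a e, with e = sech, as total derivatives: by the equation e'' = e / 2
   - e^3, N + Z' is the integrand for [f] plus a f e - a^2 e^2 / 2. *)
pose Z x := 2 * a * (r x * e' x) + a ^+ 2 * (sech x * e' x).
pose Z' x := 2 * a * (r' x * e' x + r x * (sech x / 2 - sech x ^+ 3))
  + a ^+ 2 * (e' x ^+ 2 + sech x ^+ 2 / 2 - sech x ^+ 4).
have sn : s != 0 by rewrite gt_eqF.
have de' x : is_derive x 1 e' (sech x / 2 - sech x ^+ 3).
  have h := is_derive1N (is_derive1M (is_derive1M (is_derive_sech x) (is_derive_kink x)) (is_derive1_cst s^-1 x)).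
  apply: (is_derive1_eq h); rewrite mulr0 addr0.
  have -> : - ((- (sech x * kink x / s) * kink x + sech x * (sech x ^+ 2 / s)) / s) =
    (sech x * kink x ^+ 2 - sech x ^+ 3) / s ^+ 2 by field.
  have -> : kink x ^+ 2 = 1 - sech x ^+ 2 by rewrite -(sech_kink x); ring.
  by rewrite s2; field.
have dZ x : is_derive x 1 Z (Z' x).
  have h := is_derive1D (is_derive1Z (2 * a) (is_derive1M (dr x) (de' x)))
    (is_derive1Z (a ^+ 2) (is_derive1M (is_derive_sech x) (de' x))).
  apply: (is_derive1_eq h); by rewrite /Z' /e'; field.
have cZ' : continuous Z'.
  have cc (k : R) : continuous (fun _ : R => k) by exact: continuous_const.
  apply: continuous_add; apply: continuous_mul => //.
    apply: continuous_add; apply: continuous_mul => //; apply: continuous_sub; first exact: continuous_mul.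
    exact: continuous_exp.
  apply: continuous_sub; last exact: continuous_exp.
  apply: continuous_add; first exact: continuous_exp.
  by apply: continuous_mul => //; exact: continuous_exp.
pose N x := r' x ^+ 2 - sech x ^+ 2 * r x ^+ 2.
have cN : continuous N.
  by apply: continuous_sub; [exact: continuous_exp|apply: continuous_mul; exact: continuous_exp].
have J : r L ^+ 2 * ((sech L ^+ 2 / s) / kink L) - r (- L) ^+ 2 * ((sech (- L) ^+ 2 / s) / kink (- L)) <=
    \int[mu]_(x in `[- L, L]%classic) N x.
  apply: (@jacobi _ (- L) L [:: 0] r r' (fun x => sech x ^+ 2 / s) (cst 1) kink
    (fun x => sech x ^+ 2 / s) (fun x => sech x ^+ 2) N LL cN).
  - move=> x _; split; [exact: cr|exact: cT|].
    have c1 : continuous (fun x => sech x ^+ 2 / s).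
      by apply: continuous_mul; [exact: continuous_exp|exact: continuous_const].
    exact: c1.
  - move=> x xL kx; have -> : x = 0.
      by have [/kink_lt0|/kink_gt0|//] := ltgtP x 0; rewrite kx ltxx.
    rewrite inE eqxx sech0 expr1n div1r invr_eq0; split => //; first by lra.
    by rewrite /r sech0 mulr1 subrr.
  - move=> x _; split; [exact: dr|exact: is_derive_kink|].
    have h := is_derive1M (is_derive1X 2 (is_derive_sech x)) (is_derive1_cst s^-1 x).
    apply: (is_derive1_eq h); rewrite mulr0 addr0 /=.
    have -> : 2 * sech x ^+ 1 * - (sech x * kink x / s) / s = - (2 * sech x ^+ 2 * kink x / s ^+ 2) by field.
    by rewrite s2; field.
  - by move=> x _; split; rewrite /= ?mul1r.
have FZ := FTC_segment LL cZ' (fun x _ => dZ x).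
pose al := \int[mu]_(x in `[- L, L]%classic) (f x * sech x).
pose I := \int[mu]_(x in `[- L, L]%classic) (sech x ^+ 2).
have ir g : continuous g -> Rintegrable mu `[- L, L]%classic g by exact: segment_Rintegrable.
have mI : measurable (`[- L, L]%classic : set (measurableTypeR R)) by exact: measurable_itv.
have ce2 : continuous (fun x => sech x ^+ 2) by exact: continuous_exp.
have I0 : 0 < I.
  have dk x : is_derive x 1 (fun x => s * kink x) (sech x ^+ 2).
    by apply: (is_derive1_eq (is_derive1Z s (is_derive_kink x))); field.
  rewrite /I (FTC_segment LL ce2 (fun x _ => dk x)) kinkN.
  by rewrite mulrN opprK addr_gt0// mulr_gt0// kink_gt0.
rewrite -/al -/I.
have E : \int[mu]_(x in `[- L, L]%classic) N x + (Z L - Z (- L)) =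
    \int[mu]_(x in `[- L, L]%classic) (f' x ^+ 2 - sech x ^+ 2 * f x ^+ 2) + a * al - a ^+ 2 / 2 * I.
  have c1 : continuous (fun x => f' x ^+ 2 - sech x ^+ 2 * f x ^+ 2).
    by apply: continuous_sub; [exact: continuous_exp|apply: continuous_mul; exact: continuous_exp].
  have c2 : continuous (fun x => f x * sech x) by exact: continuous_mul.
  have c3 : continuous (fun x => sech x ^+ 2) by exact: continuous_exp.
  rewrite -FZ -(RintegralD' mI (ir _ cN) (ir _ cZ')) -(RintegralZ' mI _ (ir _ c2)).
  rewrite -(RintegralZ' mI _ (ir _ c3)).
  rewrite -(RintegralD' mI (ir _ c1) (RintegrableZ mI a (ir _ c2))).
  rewrite -(RintegralB' mI (RintegrableD mI (ir _ c1) (RintegrableZ mI a (ir _ c2))) (RintegrableZ mI _ (ir _ c3))).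
  by apply: eq_Rintegral => x _; rewrite /N /Z' /r' /r; field.
(* At the ends f = 0, hence r = - a sech, and all boundary contributions together are
   nonnegative. *)
have bd : 0 <= r L ^+ 2 * ((sech L ^+ 2 / s) / kink L) - r (- L) ^+ 2 * ((sech (- L) ^+ 2 / s) / kink (- L))
     + (Z L - Z (- L)).
  rewrite sechN kinkN /Z /r /e' fL fNL sechN kinkN.
  have kL := kink_gt0 L0; have eL := sech_gt0 L.
  rewrite [X in _ <= X](_ : _ = 2 * a ^+ 2 * sech L ^+ 2 / s * (sech L ^+ 2 / kink L + kink L)); last first.
    by field; rewrite sn gt_eqF.
  apply: mulr_ge0; first by apply: divr_ge0; [rewrite mulr_ge0 ?sqr_ge0// mulr_ge0 ?sqr_ge0//|exact: ltW].
  by rewrite addr_ge0 ?(ltW kL)// divr_ge0 ?sqr_ge0 ?(ltW kL).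
(* Completing the square removes the uncontrolled value [a]. *)
have sq : 0 <= (al - a * I) ^+ 2 / (2 * I) by rewrite divr_ge0 ?sqr_ge0//; lra.
have sqE : (al - a * I) ^+ 2 / (2 * I) = al ^+ 2 / (2 * I) - a * al + a ^+ 2 / 2 * I.
  by field; rewrite gt_eqF.
by rewrite mulNr; lra.
Qed.

End soliton_profile.

(** * Weighted one-dimensional Poincare inequalities *)

Section weighted_poincare.
Context {R : realType}.
Local Notation mu := (@lebesgue_measure R).
Implicit Types (x y k rho : R) (b : R -> R).

(* [3 x^2 - 1] is the Legendre polynomial of degree 2. *)
Lemma legendre_inequality k b (b' : R -> R) : 0 < k -> 3 * k ^+ 2 = 1 -> continuous b' ->
  (forall x, is_derive x 1 b (b' x)) -> (forall x, b (- x) = b x) ->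
  6 * \int[mu]_(x in `[- 1, 1]%classic) ((b x - b k) ^+ 2) <=
  \int[mu]_(x in `[- 1, 1]%classic) ((1 - x ^+ 2) * b' x ^+ 2).
Proof.
move=> k0 k2 cb' db be.
have cb := is_derive_continuous db.
have cid : continuous (fun x : R => x) by exact: continuous_self.
have cc (a : R) : continuous (fun _ : R => a) by exact: continuous_const.
have cp : continuous (fun x : R => 3 * x ^+ 2 - 1).
  by apply: continuous_sub => //; apply: continuous_mul => //; exact: continuous_exp.
have cw1 : continuous (fun x : R => 1 - x ^+ 2) by apply: continuous_sub => //; exact: continuous_exp.
have c1 : continuous (fun x => (b x - b k) ^+ 2) by apply: continuous_exp; exact: continuous_sub.
have c2 : continuous (fun x => (1 - x ^+ 2) * b' x ^+ 2).
  by apply: continuous_mul => //; exact: continuous_exp.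
pose N x := (1 - x ^+ 2) * b' x ^+ 2 - 6 * (b x - b k) ^+ 2.
have cN : continuous N by apply: continuous_sub => //; exact: continuous_mul.
have le11 : (-1 : R) <= 1 by lra.
(* For phi = 3 x^2 - 1 Legendre's equation reads ((1 - x^2) phi')' = - 6 phi. Evenness makes b - b k
   vanish at both zeros of phi, and the weight vanishes at the end points. *)
have := @jacobi R (-1) 1 [:: k; - k] (fun x => b x - b k) b' (fun x => (1 - x ^+ 2) * (6 * x))
  (fun x => 1 - x ^+ 2) (fun x => 3 * x ^+ 2 - 1) (fun x => 6 * x) (fun=> 6) N le11 cN.
move=> h; have {h} : 0 <= \int[mu]_(x in `[- 1, 1]%classic) N x.
  apply: le_trans (h _ _ _ _).
  - by rewrite sqrrN !expr1n subrr !mul0r !mulr0 subrr.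
  - move=> x _; split.
    + exact: (continuous_sub cb (cc (b k))).
    + exact: cp.
    + exact: (continuous_mul cw1 (continuous_mul (cc 6) cid)).
  - move=> x x1 xk.
    have : (x - k) * (x + k) = 0 by rewrite -subr_sqr; lra.
    move=> /eqP; rewrite mulf_eq0 subr_eq0 addr_eq0 => xk'.
    split; first by have := sqr_ge0 k; case/orP : xk' => /eqP ->; nra.
    + by rewrite !inE; case/orP : xk' => ->//; rewrite orbT.
    + by case/orP : xk' => /eqP ->; rewrite ?be subrr.
    + by case/orP : xk' => /eqP ->; rewrite ?mulrN ?oppr_eq0 mulf_neq0// gt_eqF.
  - move=> x _; split.
    + by apply: (is_derive1_eq (is_derive1B (db x) (is_derive1_cst (b k) x))); rewrite subr0.
    + apply: (is_derive1_eq (is_derive1B (is_derive1Z 3 (is_derive1X 2 (is_derive1_id x))) (is_derive1_cst 1 x))).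
      by rewrite /=; ring.
    + have h1 := is_derive1B (is_derive1_cst 1 x) (is_derive1X 2 (is_derive1_id x)).
      apply: (is_derive1_eq (is_derive1M h1 (is_derive1Z 6 (is_derive1_id x)))).
      by rewrite /=; ring.
  - by move=> x x1; split => //; nra.
have mI : measurable (`[- 1, 1]%classic : set (measurableTypeR R)) by exact: measurable_itv.
rewrite /N (RintegralB' mI (segment_Rintegrable _ _ c2) (segment_Rintegrable _ _ (continuous_mul (cc 6) c1))).
by rewrite (RintegralZ' mI _ (segment_Rintegrable _ _ c1)) subr_ge0.
Qed.

Definition half_chord rho y : R := Num.sqrt (rho ^+ 2 - y ^+ 2).

Lemma continuous_half_chord rho : continuous (half_chord rho).
Proof.
apply: (continuous_compose (f := fun y => rho ^+ 2 - y ^+ 2)); last exact: sqrt_continuous.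
by apply: continuous_sub; [exact: continuous_const|apply: continuous_exp; exact: continuous_self].
Qed.

Lemma half_chord_ge0 rho y : 0 <= half_chord rho y.
Proof. exact: sqrtr_ge0. Qed.

Lemma half_chord_gt0 rho y : - rho < y < rho -> 0 < half_chord rho y.
Proof. by move=> h; rewrite sqrtr_gt0; nra. Qed.

Lemma half_chord_sqr rho y : - rho <= y <= rho -> half_chord rho y ^+ 2 = rho ^+ 2 - y ^+ 2.
Proof. by move=> h; rewrite sqr_sqrtr//; nra. Qed.

Lemma half_chordN rho y : half_chord rho (- y) = half_chord rho y.
Proof. by rewrite /half_chord sqrrN. Qed.

Lemma is_derive_half_chord rho y : - rho < y < rho ->
  is_derive y 1 (half_chord rho) (- y / half_chord rho y).
Proof.
move=> yr; have h0 : 0 < rho ^+ 2 - y ^+ 2 by nra.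
have d1 : is_derive y 1 (fun y : R => rho ^+ 2 - y ^+ 2) (- (2 * y)).
  apply: (is_derive1_eq (is_derive1B (is_derive1_cst _ y) (is_derive1X 2 (is_derive1_id y)))).
  by rewrite /=; ring.
have d2 := is_derive1_sqrt h0.
rewrite [X in is_derive _ _ X](_ : _ = fun y => Num.sqrt (rho ^+ 2 - y ^+ 2))//.
apply: (is_derive1_eq (@is_derive1_compose _ Num.sqrt (fun y => rho ^+ 2 - y ^+ 2) y _ _ d2 d1)).
have := half_chord_gt0 yr; rewrite /half_chord => h.
by field; rewrite gt_eqF.
Qed.

(** 4 y^2 - rho^2 is, up to scaling, the Chebyshev polynomial of the second kind of degree 2: for l
    = [half_chord rho] it satisfies (l^3 phi')' = - 8 l phi, and its zeros are rho / 2 and - rho /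
    2. The integrand enters as a continuous [N] because [b'] may be unbounded near the ends. *)
Lemma gegenbauer_inequality rho b (b' N : R -> R) : 0 < rho -> continuous b -> continuous N ->
  (forall y, - rho < y < rho -> is_derive y 1 b (b' y) /\ N y = half_chord rho y ^+ 3 * b' y ^+ 2) ->
  (forall y, b (- y) = b y) ->
  8 * \int[mu]_(y in `[- rho, rho]%classic) (half_chord rho y * (b y - b (rho / 2)) ^+ 2) <=
  \int[mu]_(y in `[- rho, rho]%classic) N y.
Proof.
move=> rho0 cb cN hb be; set l := half_chord rho; set k := rho / 2.
have cl : continuous l by exact: continuous_half_chord.
have cid : continuous (fun x : R => x) by exact: continuous_self.
have cc (a : R) : continuous (fun _ : R => a) by exact: continuous_const.
have c1 : continuous (fun y => l y * (b y - b k) ^+ 2).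
  by apply: continuous_mul => //; apply: continuous_exp; exact: continuous_sub.
pose M y := N y - 8 * (l y * (b y - b k) ^+ 2).
have cM : continuous M by apply: continuous_sub => //; exact: continuous_mul.
have le11 : - rho <= rho by lra.
have := @jacobi R (- rho) rho [:: k; - k] (fun y => b y - b k) b' (fun y => l y ^+ 3 * (8 * y))
  (fun y => l y ^+ 3) (fun y => 4 * y ^+ 2 - rho ^+ 2) (fun y => 8 * y) (fun y => 8 * l y) M le11 cM.
move=> h; have {h} : 0 <= \int[mu]_(y in `[- rho, rho]%classic) M y.
  apply: le_trans (h _ _ _ _).
  - by rewrite /l half_chordN /half_chord subrr sqrtr0 expr0n/= !mul0r !mulr0 subrr.
  - move=> y _; split.
    + exact: (continuous_sub cb (cc (b k))).
    + exact: (continuous_sub (continuous_mul (cc 4) (continuous_exp cid)) (cc (rho ^+ 2))).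
    + exact: (continuous_mul (continuous_exp cl) (continuous_mul (cc 8) cid)).
  - move=> y y1 yk.
    have : (y - k) * (y + k) = 0 by rewrite -subr_sqr /k; lra.
    move=> /eqP; rewrite mulf_eq0 subr_eq0 addr_eq0 => xk'.
    have k0 : 0 < k by rewrite /k; lra.
    split; first by case/orP : xk' => /eqP ->; rewrite /k; lra.
    + by rewrite !inE; case/orP : xk' => ->//; rewrite orbT.
    + by case/orP : xk' => /eqP ->; rewrite ?be subrr.
    + by case/orP : xk' => /eqP ->; rewrite ?mulrN ?oppr_eq0 mulf_neq0// gt_eqF.
  - move=> y yr; have [db _] := hb y yr; split.
    + by apply: (is_derive1_eq (is_derive1B db (is_derive1_cst (b k) y))); rewrite subr0.
    + apply: (is_derive1_eq (is_derive1B (is_derive1Z 4 (is_derive1X 2 (is_derive1_id y))) (is_derive1_cst (rho ^+ 2) y))).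
      by rewrite /=; ring.
    + have dl := is_derive_half_chord yr; have l0 := half_chord_gt0 yr.
      have l2 : l y ^+ 2 = rho ^+ 2 - y ^+ 2 by apply: half_chord_sqr; lra.
      apply: (is_derive1_eq (is_derive1M (is_derive1X 3 dl) (is_derive1Z 8 (is_derive1_id y)))).
      rewrite /= -/l in l0 *.
      have -> : 3 * l y ^+ 2 * (- y / l y) * (8 * y) + l y ^+ 3 * (8 * 1) =
         l y * (8 * l y ^+ 2 - 24 * y ^+ 2) by field; rewrite gt_eqF.
      by rewrite l2; ring.
  - move=> y yr; have [_ NE] := hb y yr; split => //; first by rewrite exprn_ge0// half_chord_ge0.
    by rewrite /M NE /l mulrA.
have mI : measurable (`[- rho, rho]%classic : set (measurableTypeR R)) by exact: measurable_itv.
rewrite /M (RintegralB' mI (segment_Rintegrable _ _ cN) (segment_Rintegrable _ _ (continuous_mul (cc 8) c1))).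
by rewrite (RintegralZ' mI _ (segment_Rintegrable _ _ c1)) subr_ge0.
Qed.

(** With P / L the weighted mean of [p], the left side is the variance of [p] plus L (m - P / L)^2.
    The variance is at most the first term, and Cauchy-Schwarz bounds the contribution of the
    difference of means by the second. *)
Lemma weighted_mean a c (l p q : R -> R) (k m : R) : a <= c -> continuous l -> continuous p -> continuous q ->
  (forall x, 0 <= l x) -> 0 < \int[mu]_(x in `[a, c]%classic) l x ->
  m * \int[mu]_(x in `[a, c]%classic) l x = \int[mu]_(x in `[a, c]%classic) (l x * q x) ->
  \int[mu]_(x in `[a, c]%classic) (l x * (p x - m) ^+ 2) <=
  \int[mu]_(x in `[a, c]%classic) (l x * (p x - k) ^+ 2) +
  \int[mu]_(x in `[a, c]%classic) (l x * (p x - q x) ^+ 2).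
Proof.
move=> ac cl cp cq l0; set L := \int[mu]_(x in `[a, c]%classic) l x.
set Q := \int[mu]_(x in `[a, c]%classic) (l x * q x) => L0 mQ.
have mI : measurable (`[a, c]%classic : set (measurableTypeR R)) by exact: measurable_itv.
have cc (u : R) : continuous (fun _ : R => u) by exact: continuous_const.
have ir (g : R -> R) : continuous g -> Rintegrable mu `[a, c]%classic g by exact: segment_Rintegrable.
pose P := \int[mu]_(x in `[a, c]%classic) (l x * p x).
have clp : continuous (fun x => l x * p x) by exact: continuous_mul.
have clq : continuous (fun x => l x * q x) by exact: continuous_mul.
have E (u v : R) : \int[mu]_(x in `[a, c]%classic) (l x * (p x - u) ^+ 2) -
   \int[mu]_(x in `[a, c]%classic) (l x * (p x - v) ^+ 2) = 2 * (v - u) * P + (u ^+ 2 - v ^+ 2) * L.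
  have h w : continuous (fun x => l x * (p x - w) ^+ 2).
    by apply: continuous_mul => //; apply: continuous_exp; exact: continuous_sub.
  rewrite -(RintegralB' mI (ir _ (h u)) (ir _ (h v))) -(RintegralZ' mI _ (ir _ clp)) -(RintegralZ' mI _ (ir _ cl)).
  rewrite -(RintegralD' mI (RintegrableZ mI _ (ir _ clp)) (RintegrableZ mI _ (ir _ cl))).
  by apply: eq_Rintegral => x _; ring.
pose t := (P - Q) / L.
have F : 2 * t * (P - Q) - t ^+ 2 * L <= \int[mu]_(x in `[a, c]%classic) (l x * (p x - q x) ^+ 2).
  have h : continuous (fun x => l x * (p x - q x) ^+ 2).
    by apply: continuous_mul => //; apply: continuous_exp; exact: continuous_sub.
  have h2 : continuous (fun x => l x * p x - l x * q x) by exact: continuous_sub.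
  rewrite -(RintegralB' mI (ir _ clp) (ir _ clq)) -(RintegralZ' mI _ (ir _ h2)) -(RintegralZ' mI _ (ir _ cl)).
  rewrite -(RintegralB' mI (RintegrableZ mI _ (ir _ h2)) (RintegrableZ mI _ (ir _ cl))).
  apply: le_Rintegral' => //; last first.
    by move=> x _; have := mulr_ge0 (l0 x) (sqr_ge0 (p x - q x - t)); lra.
  - exact: ir.
  - by apply: RintegrableB => //; apply: RintegrableZ => //; exact: ir.
have := E m k.
have -> : 2 * (k - m) * P + (m ^+ 2 - k ^+ 2) * L = L * ((m - P / L) ^+ 2 - (k - P / L) ^+ 2).
  by field; rewrite gt_eqF.
have tE : L * (m - P / L) ^+ 2 = 2 * t * (P - Q) - t ^+ 2 * L.
  by rewrite /t -mQ; field; rewrite gt_eqF.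
have := mulr_ge0 (ltW L0) (sqr_ge0 (k - P / L)).
rewrite mulrBr tE; lra.
Qed.

End weighted_poincare.

(** * Entire power series *)

Section entire_series.
Context {R : realType}.
Implicit Types (c : R^nat) (x t : R).

(** Comparison with the exponential series gives convergence everywhere, and the bound is stable
    under term-by-term differentiation. *)
Definition entire c := exists K : R, forall i, `|c i| <= K / i`!%:R.
Definition power_sum c x := limn (series (fun i => c i * x ^+ i)).

Lemma cvg_entire c x : entire c -> cvgn (series (fun i => c i * x ^+ i)).
Proof.
move=> [K hK]; apply: normed_cvg.
have h i : `|c i * x ^+ i| <= K * exp_coeff `|x| i.
  rewrite normrM normrX /exp_coeff/= mulrCA [leRHS]mulrC.
  by rewrite ler_wpM2r ?exprn_ge0.
apply: (@series_le_cvg _ _ (K *: exp_coeff `|x|)) => [i|i||].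
- exact: normr_ge0.
- exact: le_trans (normr_ge0 _) (h i).
- exact: h.
- by apply: is_cvg_seriesZ; exact: is_cvg_series_exp_coeff.
Qed.

Lemma entire_diffs c : entire c -> entire (pseries_diffs c).
Proof.
move=> [K hK]; exists K => i; rewrite /pseries_diffs normrM (@ger0_norm _ i.+1%:R)//.
rewrite mulrC -ler_pdivlMr// (le_trans (hK _))// factS natrM invfM.
by rewrite mulrA mulrAC mulrC mulrCA mulrC.
Qed.

Lemma is_derive_power_sum c x : entire c ->
  is_derive x 1 (power_sum c) (power_sum (pseries_diffs c) x).
Proof.
move=> hc; have h1 := entire_diffs hc; have h2 := entire_diffs h1.
apply: (@pseries_snd_diffs R c (`|x| + 1) x).
- exact: cvg_entire.
- exact: cvg_entire.
- exact: cvg_entire.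
- by rewrite [ltRHS]ger0_norm ?addr_ge0// ltrDl.
Qed.

Lemma power_sumD c1 c2 x : entire c1 -> entire c2 ->
  power_sum (fun i => c1 i + c2 i) x = power_sum c1 x + power_sum c2 x.
Proof.
move=> h1 h2; rewrite /power_sum -(lim_seriesD (@cvg_entire _ x h1) (@cvg_entire _ x h2)).
by congr (limn (series _)); apply/funext => i; rewrite mulrDl.
Qed.

Lemma power_sumZ k c x : entire c -> power_sum (fun i => k * c i) x = k * power_sum c x.
Proof.
move=> h; rewrite /power_sum -[RHS](lim_seriesZ k (@cvg_entire _ x h)).
by congr (limn (series _)); apply/funext => i; rewrite -mulrA.
Qed.

Lemma power_sum_shift c x : entire c ->
  power_sum c x = c 0%N + x * power_sum (fun i => c i.+1) x.
Proof.
move=> hc; have hs : entire (fun i => c i.+1).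
  case: hc => K hK; exists K => i; apply: (le_trans (hK _)).
  have K0 : 0 <= K by have := le_trans (normr_ge0 _) (hK 0%N); rewrite fact0 divr1.
  by rewrite ler_wpM2l// lef_pV2 ?posrE ?ltr0n ?fact_gt0// ler_nat factS leq_pmull.
have E n : series (fun i => c i * x ^+ i) n.+1 =
    c 0%N + x * series (fun i => c i.+1 * x ^+ i) n.
  rewrite /series /= big_nat_recl//= expr0 mulr1 mulr_sumr; congr (_ + _).
  by apply: eq_bigr => i _; rewrite exprS mulrCA.
have h1 := @cvg_entire _ x hc; rewrite -(cvg_shiftS (series _)) in h1.
rewrite /power_sum; apply: (cvg_lim (@Rhausdorff R)).
rewrite -cvg_shiftS (funext E); apply: cvgD; first exact: cvg_cst.
by apply: cvgMr; exact: (@cvg_entire _ x hs).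
Qed.

Lemma power_sum0 c : entire c -> power_sum c 0 = c 0%N.
Proof. by move=> hc; rewrite power_sum_shift// mul0r addr0. Qed.

End entire_series.

(** * The Bessel function J_1 *)

Section bessel.
Context {R : realType}.
Implicit Types (s t j : R).

Definition clifford_coeff (m : nat) : R := (-1) ^+ m / (m`! * m.+1`!)%:R.

(* [J_1 s = (s / 2) clifford (s^2 / 4)]. *)
Definition clifford : R -> R := power_sum clifford_coeff.
Definition clifford' : R -> R := power_sum (pseries_diffs clifford_coeff).
Definition clifford'' : R -> R := power_sum (pseries_diffs (pseries_diffs clifford_coeff)).

Lemma entire_clifford : entire clifford_coeff.
Proof.
exists 1 => m; rewrite normrM normrX normrN1 expr1n mul1r normfV ger0_norm// mul1r.
by rewrite lef_pV2 ?posrE ?ltr0n ?muln_gt0 ?fact_gt0// ler_nat leq_pmulr ?fact_gt0.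
Qed.

Lemma is_derive_clifford t : is_derive t 1 clifford (clifford' t).
Proof. exact: is_derive_power_sum entire_clifford. Qed.

Lemma is_derive_clifford' t : is_derive t 1 clifford' (clifford'' t).
Proof. by apply: is_derive_power_sum; apply: entire_diffs; exact: entire_clifford. Qed.

Lemma continuous_clifford : continuous clifford.
Proof. exact: is_derive_continuous is_derive_clifford. Qed.

Lemma continuous_clifford' : continuous clifford'.
Proof. exact: is_derive_continuous is_derive_clifford'. Qed.

Lemma continuous_clifford'' : continuous clifford''.
Proof.
apply: (@is_derive_continuous _ _ (power_sum (pseries_diffs (pseries_diffs (pseries_diffs clifford_coeff))))) => t.
by apply: is_derive_power_sum; do 2! apply: entire_diffs; exact: entire_clifford.
Qed.

Lemma clifford0 : clifford 0 = 1.
Proof.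
by rewrite /clifford power_sum0; [rewrite /clifford_coeff expr0 !factS fact0 !muln1 divr1|exact: entire_clifford].
Qed.

(** On coefficients this is (m + 1) (m + 2) c_(m+1) = - c_m; it is Bessel's equation for J_1 in the
    variable s^2 / 4. *)
Lemma clifford_ode t : t * clifford'' t + 2 * clifford' t + clifford t = 0.
Proof.
have e0 := entire_clifford; have e1 := entire_diffs e0; have e2 := entire_diffs e1.
pose c (m : nat) : R := m%:R * pseries_diffs clifford_coeff m.
have cS : (fun m => c m.+1) = pseries_diffs (pseries_diffs clifford_coeff) by [].
have ec : entire c.
  exists 1 => m; rewrite /c /pseries_diffs /clifford_coeff mulrA -natrM !normrM normrX normrN1 expr1n.
  rewrite mul1r normfV !(@ger0_norm _ _%:R)// mul1r ler_pdivrMr ?ltr0n ?muln_gt0 ?fact_gt0//.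
  rewrite mulrC ler_pdivlMr ?ltr0n ?fact_gt0// -!natrM ler_nat.
  rewrite -mulnA -factS mulnC leq_mul2l (leq_trans _ (fact_geq _)) ?orbT//.
  by rewrite (leq_trans (leqnSn _)).
have E : t * clifford'' t = power_sum c t.
  by rewrite (power_sum_shift t ec) /c mul0r add0r.
rewrite E -(power_sumZ 2 t e1) -power_sumD//; last first.
  by case: e1 => K hK; exists (2 * K) => i; rewrite normrM ger0_norm// -mulrA ler_wpM2l.
rewrite -power_sumD//; last first.
  case: e1 => K hK; case: ec => K' hK'; exists (K' + 2 * K) => i.
  have h1 := ler_normD (c i) (2 * pseries_diffs clifford_coeff i).
  have h2 := hK' i; have h3 := hK i; rewrite (normrM 2) (@ger0_norm _ 2)// in h1.
  by rewrite (mulrDl K') -(mulrA 2); lra.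
have -> : (fun i => c i + 2 * pseries_diffs clifford_coeff i + clifford_coeff i) = (fun i => 0 * clifford_coeff i).
  apply/funext => m; rewrite mul0r /c /pseries_diffs /clifford_coeff exprS !factS !natrM.
  have h0 : m`!%:R != 0 :> R by rewrite pnatr_eq0 -lt0n fact_gt0.
  have h1 : m.+1%:R != 0 :> R by rewrite pnatr_eq0.
  have h2 : m.+2%:R != 0 :> R by rewrite pnatr_eq0.
  have h3 : m.+2%:R = m%:R + 2 :> R by rewrite -addn2 natrD.
  rewrite h3 in h2 *; field.
  by rewrite h0 nat1r h1 h2.
by rewrite power_sumZ// mul0r.
Qed.

(** This is 2 J_1' (s) at t = s^2 / 4; it also governs the radial derivative of the mode of the
    disc, see [radial_mode]. *)
Definition clifford_flux t := clifford t + 2 * t * clifford' t.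

Lemma bessel_J1E s : bessel_J 1 s = s / 2 * clifford (s ^+ 2 / 4).
Proof.
rewrite /bessel_J /clifford /power_sum.
rewrite -[RHS](lim_seriesZ (s / 2) (@cvg_entire _ _ (s ^+ 2 / 4) entire_clifford)).
congr (limn (series _)); apply/funext => m; rewrite /clifford_coeff /GRing.scale/= addn1.
have -> : s ^+ 2 / 4 = (s / 2) ^+ 2 by field.
by rewrite /GRing.scale/= addn1 exprS exprM mulrCA.
Qed.

Lemma is_derive_bessel_J1 s : is_derive s 1 (bessel_J 1) (clifford_flux (s ^+ 2 / 4) / 2).
Proof.
rewrite (funext bessel_J1E).
have d1 : is_derive s 1 (fun s : R => s ^+ 2 / 4) (s / 2).
  apply: (is_derive1_eq (is_derive1M (is_derive1X 2 (is_derive1_id s)) (is_derive1_cst 4^-1 s))).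
  by rewrite /=; field.
have d2 := is_derive1M (is_derive1M (is_derive1_id s) (is_derive1_cst 2^-1 s))
  (@is_derive1_compose _ clifford (fun s => s ^+ 2 / 4) s _ _ (is_derive_clifford _) d1).
by apply: (is_derive1_eq d2); rewrite /clifford_flux; field.
Qed.

Lemma derive_bessel_J1 s : derive1 (bessel_J 1) s = clifford_flux (s ^+ 2 / 4) / 2.
Proof. exact: is_derive1E (is_derive_bessel_J1 s). Qed.

Lemma continuous_clifford_flux : continuous clifford_flux.
Proof.
apply: continuous_add; first exact: continuous_clifford.
apply: continuous_mul; last exact: continuous_clifford'.
by apply: continuous_mul; [exact: continuous_const|exact: continuous_self].
Qed.

Section smallest_zero.
Variable j : R.
Hypothesis hj : smallest_positive_zero (derive1 (bessel_J 1)) j.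

Let j0 : 0 < j. Proof. by case: hj. Qed.

Lemma clifford_flux_zero : clifford_flux (j ^+ 2 / 4) = 0.
Proof. by case: hj => _ + _; rewrite derive_bessel_J1; lra. Qed.

(** The flux is 1 at 0, and a sign change before j^2 / 4 would produce, by the intermediate value
    theorem, a positive zero of J_1' below [j]. *)
Lemma clifford_flux_gt0 t : 0 <= t -> t < j ^+ 2 / 4 -> 0 < clifford_flux t.
Proof.
move=> t0 tj; rewrite ltNge; apply/negP => h.
have [u ut uz] : exists2 u, u \in `[0, t] & clifford_flux u = 0.
  apply: (IVT t0); first by apply: continuous_subspaceT; exact: continuous_clifford_flux.
  have f0 : clifford_flux 0 = 1 by rewrite /clifford_flux clifford0; ring.
  by rewrite f0 ge_min h orbT le_max ler01.
move: ut; rewrite in_itv/= => /andP[u0 ut].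
have un0 : u != 0.
  by apply/eqP => uE; move: uz; rewrite uE /clifford_flux clifford0; lra.
have u0' : 0 < u by rewrite lt_neqAle eq_sym un0.
pose s := 2 * Num.sqrt u; have s2 : s ^+ 2 / 4 = u.
  by rewrite /s exprMn sqr_sqrtr//; field.
have s0 : 0 < s by rewrite mulr_gt0// sqrtr_gt0.
have [_ _ /(_ s s0)] := hj; rewrite derive_bessel_J1 s2 uz mul0r => /(_ erefl) js.
have : j ^+ 2 <= s ^+ 2 by rewrite ler_pXn2r ?nnegrE ?(ltW j0) ?(ltW s0).
have : s ^+ 2 = 4 * u by lra.
lra.
Qed.

Lemma clifford_flux_ge0 t : 0 <= t -> t <= j ^+ 2 / 4 -> 0 <= clifford_flux t.
Proof.
move=> t0; rewrite le_eqVlt => /predU1P[->|h]; first by rewrite clifford_flux_zero.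
exact/ltW/clifford_flux_gt0.
Qed.

(* [s -> s clifford (s^2 / 4)] has derivative [clifford_flux (s^2 / 4)]. *)
Lemma clifford_gt0 t : 0 <= t -> t <= j ^+ 2 / 4 -> 0 < clifford t.
Proof.
rewrite le_eqVlt => /predU1P[<-|t0] tj; first by rewrite clifford0.
pose s := 2 * Num.sqrt t; have s2 : s ^+ 2 / 4 = t.
  by rewrite /s exprMn sqr_sqrtr ?ltW//; field.
have s0 : 0 < s by rewrite mulr_gt0// sqrtr_gt0.
have sj : s <= j.
  have s4 : s ^+ 2 = 4 * t by rewrite -s2; field.
  by rewrite -(@ler_pXn2r _ 2)// ?nnegrE ?(ltW j0) ?(ltW s0)// s4; lra.
pose F (x : R) := bessel_J 1 x.
have dF (x : R) : is_derive x 1 F (clifford_flux (x ^+ 2 / 4) / 2) by exact: is_derive_bessel_J1.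
have [x] : exists2 x, x \in `]0, s[%R & F s - F 0 = clifford_flux (x ^+ 2 / 4) / 2 * (s - 0).
  apply: (@MVT _ F (fun x => clifford_flux (x ^+ 2 / 4) / 2) 0 s s0 (fun x _ => dF x)).
  by apply: continuous_subspaceT; exact: is_derive_continuous dF.
rewrite in_itv/= => /andP[x0 xs]; rewrite /F !bessel_J1E mul0r mul0r subr0 subr0 s2 => E.
have p0 : 0 < clifford_flux (x ^+ 2 / 4).
  apply: clifford_flux_gt0; first by rewrite divr_ge0 ?sqr_ge0.
  have : x ^+ 2 < j ^+ 2 by rewrite ltr_pXn2r ?nnegrE ?(ltW x0) ?(ltW j0)//; lra.
  lra.
have : 0 < s / 2 * clifford t by rewrite E mulr_gt0// divr_gt0.
by rewrite pmulr_rgt0// divr_gt0.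
Qed.

(* If [j > 2] then [clifford > 0] on [0, 1] and the equation makes
   [t^2 clifford' + t^2 clifford / 2] nonincreasing there. *)
Lemma smallest_zero_le2 : j <= 2.
Proof.
rewrite leNgt; apply/negP => j2.
have j4 : 1 < j ^+ 2 / 4 by nra.
(* The differential equation gives M1' = t clifford, and then M2' = M1 / 2 for [M2] below. *)
pose M1 (t : R) := - (t ^+ 2 * clifford' t).
have d1 t : is_derive t 1 M1 (t * clifford t).
  have h := is_derive1N (is_derive1M (is_derive1X 2 (is_derive1_id t)) (is_derive_clifford' t)).
  by apply: (is_derive1_eq h); have := clifford_ode t; rewrite /=; nra.
have B0 t : 0 <= t -> t <= 1 -> 0 < clifford t by move=> h1 h2; apply: clifford_gt0 => //; lra.
have M10 t : 0 <= t -> t <= 1 -> 0 <= M1 t.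
  move=> t0 t1; have -> : 0 = M1 0 by rewrite /M1 expr0n/= mul0r oppr0.
  apply: (@derive_le0_homo _ 0 t M1 (fun t => t * clifford t)) => //.
    by move=> x _; exact: is_derive_continuous_at (d1 x).
  by move=> x /andP[x0 xt]; split => //; rewrite mulr_ge0 ?ltW// B0//; lra.
pose M2 (t : R) := M1 t - t ^+ 2 / 2 * clifford t.
have d2 t : is_derive t 1 M2 (M1 t / 2).
  have h := is_derive1B (d1 t) (is_derive1M (is_derive1M (is_derive1X 2 (is_derive1_id t)) (is_derive1_cst 2^-1 t)) (is_derive_clifford t)).
  by apply: (is_derive1_eq h); rewrite /M1 /=; field.
have : M2 0 <= M2 1.
  apply: (@derive_le0_homo _ 0 1 M2 (fun t => M1 t / 2)) => //.
    by move=> x _; exact: is_derive_continuous_at (d2 x).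
  by move=> x /andP[x0 xt]; split => //; rewrite divr_ge0// M10// ltW.
(* Since [M2 0] is 0, [M2 1] is nonnegative; this says that [clifford_flux 1] is at most 0, against
   its positivity before j^2 / 4. *)
have := clifford_flux_gt0 ler01 j4; rewrite /M2 /M1 /clifford_flux; lra.
Qed.

End smallest_zero.

End bessel.

(** * Integration over sections *)

Section sections.
Context d1 d2 (T1 : measurableType d1) (T2 : measurableType d2) (R : realType).
Variables (m1 : {sigma_finite_measure set T1 -> \bar R}) (m2 : {sigma_finite_measure set T2 -> \bar R}).
Implicit Types (E : set (T1 * T2)) (f : T1 * T2 -> R).

Lemma integral_sections12 E f : measurable E -> Rintegrable (m1 \x m2)%E E f ->
  (\int[m1 \x m2]_(q in E) (f q)%:E =
   \int[m1]_x \int[m2]_(y in [set y | E (x, y)]) (f (x, y))%:E)%E.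
Proof.
move=> mE /(integrable_mkcond _ mE).1 hf.
rewrite [LHS]integral_mkcond -(integral12_prod_meas1 hf); apply: eq_integral => x _.
rewrite [RHS]integral_mkcond; apply: eq_integral => y _ /=.
rewrite !patchE; have [Exy|nE] := pselect (E (x, y)); first by rewrite !mem_set.
by rewrite !memNset.
Qed.

Lemma integral_sections21 E f : measurable E -> Rintegrable (m1 \x m2)%E E f ->
  (\int[m1 \x m2]_(q in E) (f q)%:E =
   \int[m2]_y \int[m1]_(x in [set x | E (x, y)]) (f (x, y))%:E)%E.
Proof.
move=> mE /(integrable_mkcond _ mE).1 hf.
rewrite [LHS]integral_mkcond -(integral21_prod_meas1 hf); apply: eq_integral => y _.
rewrite [RHS]integral_mkcond; apply: eq_integral => x _ /=.
rewrite !patchE; have [Exy|nE] := pselect (E (x, y)); first by rewrite !mem_set.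
by rewrite !memNset.
Qed.

Lemma Rintegral_prod12 (A : set T1) (B : set T2) f : measurable A -> measurable B ->
  Rintegrable (m1 \x m2)%E (A `*` B) f ->
  (forall x, A x -> Rintegrable m2 B (fun y => f (x, y))) ->
  \int[(m1 \x m2)%E]_(q in A `*` B) f q = \int[m1]_(x in A) \int[m2]_(y in B) f (x, y).
Proof.
move=> mA mB hf hx; rewrite /Rintegral integral_sections12//; last exact: measurableX.
congr fine; rewrite [RHS]integral_mkcond; apply: eq_integral => x _; rewrite patchE.
have [Ax|nA] := pselect (A x).
  rewrite mem_set// fineK; last exact: integrable_fin_num (hx x Ax).
  by congr integral; apply/seteqP; split => y //= -[].
rewrite memNset// (_ : [set y | _] = set0) ?integral_set0//.
by apply/seteqP; split => y // -[].
Qed.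

Lemma Rintegral_prod21 (A : set T1) (B : set T2) f : measurable A -> measurable B ->
  Rintegrable (m1 \x m2)%E (A `*` B) f ->
  (forall y, B y -> Rintegrable m1 A (fun x => f (x, y))) ->
  \int[(m1 \x m2)%E]_(q in A `*` B) f q = \int[m2]_(y in B) \int[m1]_(x in A) f (x, y).
Proof.
move=> mA mB hf hy; rewrite /Rintegral integral_sections21//; last exact: measurableX.
congr fine; rewrite [RHS]integral_mkcond; apply: eq_integral => y _; rewrite patchE.
have [By|nB] := pselect (B y).
  rewrite mem_set// fineK; last exact: integrable_fin_num (hy y By).
  by congr integral; apply/seteqP; split => x //= -[].
rewrite memNset// (_ : [set x | _] = set0) ?integral_set0//.
by apply/seteqP; split => x // -[].
Qed.

End sections.

(** * Integration over the disc *)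

Section disc.
Context {R : realType}.
Local Notation mR := (measurableTypeR R).
Local Notation T2 := (mR * mR)%type.
Local Notation mu := (@lebesgue_measure R).
Local Notation mu2 := (@lebesgue2 R).
Implicit Types (rho : R) (q : R * R) (F : R * R -> R).

Definition disc rho : set (R * R) := [set q | q.1 ^+ 2 + q.2 ^+ 2 < rho ^+ 2].

Lemma open_disc rho : open (disc rho).
Proof.
have -> : disc rho = (fun q : R * R => q.1 ^+ 2 + q.2 ^+ 2) @^-1` [set x | x < rho ^+ 2] by [].
apply: open_comp; last exact: open_lt.
move=> p _; apply: continuous_add; apply: continuous_exp; [exact: continuous_fst|exact: continuous_snd].
Qed.

Lemma measurable_disc rho : measurable (disc rho : set T2).
Proof. by apply: open_measurable2; exact: open_disc. Qed.

Lemma disc_box rho q : 0 < rho -> disc rho q -> box2 rho q.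
Proof.
case: q => x y r0; rewrite /disc /= => h.
have h1 : - rho <= x <= rho by apply/andP; split; rewrite leNgt; apply/negP => hx; have := sqr_ge0 y; nra.
have h2 : - rho <= y <= rho by apply/andP; split; rewrite leNgt; apply/negP => hx; have := sqr_ge0 x; nra.
by split => /=; rewrite in_itv.
Qed.

Lemma disc_lty rho : 0 < rho -> (mu2 (disc rho) < +oo)%E.
Proof.
move=> r0; apply: le_lt_trans (box2_lty rho); apply: le_measure; rewrite ?inE//.
- exact: measurable_disc.
- exact: measurable_box2.
- by move=> q; exact: disc_box.
Qed.

Lemma box2_bounded F M : continuous F -> exists2 N, 0 <= N & forall q, box2 M q -> `|F q| <= N.
Proof.
by move=> cF; apply: continuous_compact_bounded => //; apply: compact_setX; exact: segment_compact.
Qed.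

Lemma disc_bounded F rho : 0 < rho -> continuous F ->
  exists2 N, 0 <= N & forall q, disc rho q -> `|F q| <= N.
Proof.
move=> r0 cF; have [N N0 hN] := box2_bounded rho cF.
by exists N => // q /(disc_box r0); exact: hN.
Qed.

Lemma disc_Rintegrable F rho : 0 < rho -> continuous F -> Rintegrable mu2 (disc rho) F.
Proof.
move=> r0 cF; have [N N0 hN] := disc_bounded r0 cF.
apply: (@bounded_Rintegrable _ _ _ mu2 _ _ N _ (disc_lty r0) _ hN); first exact: measurable_disc.
by apply: measurable_funTS; exact: continuous_measurable2.
Qed.

Lemma rect_Rintegrable F (a b : R) : continuous F ->
  Rintegrable mu2 (`[- a, a]%classic `*` `[- b, b]%classic) F.
Proof.
move=> cF; have mX : measurable ((`[- a, a]%classic `*` `[- b, b]%classic) : set T2).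
  by apply: measurableX; exact: measurable_itv.
have cb : compact (`[- a, a]%classic `*` `[- b, b]%classic : set (R * R)).
  by apply: compact_setX; exact: segment_compact.
have [N N0 hN] := continuous_compact_bounded cb cF.
apply: (@bounded_Rintegrable _ _ _ mu2 _ _ N mX _ _ hN).
- have E : lebesgue2 (`[(- a)%R, a]%classic `*` `[(- b)%R, b]%classic) =
      (mu `[(- a)%R, a]%classic * mu `[(- b)%R, b]%classic)%E.
    by apply: (product_measure1E mu mu); exact: measurable_itv.
  suff : (lebesgue2 (`[(- a)%R, a]%classic `*` `[(- b)%R, b]%classic) < +oo)%E by [].
  by rewrite E lte_mul_pinfty ?segment_lty// ge0_fin_numE// segment_lty.
- by apply: measurable_funTS; exact: continuous_measurable2.
Qed.

Lemma continuous_slice1 F y : continuous F -> continuous (fun x => F (x, y)).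
Proof.
move=> cF; apply: (continuous_compose (f := fun x => (x, y))) => //.
by apply: continuous_pair; [exact: continuous_self|move=> ?; exact: cvg_cst].
Qed.

Lemma continuous_slice2 F x : continuous F -> continuous (fun y => F (x, y)).
Proof.
move=> cF; apply: (continuous_compose (f := fun y => (x, y))) => //.
by apply: continuous_pair; [move=> ?; exact: cvg_cst|exact: continuous_self].
Qed.

Lemma rect_fubini F (a b : R) : continuous F ->
  \int[mu2]_(q in `[- a, a]%classic `*` `[- b, b]%classic) F q =
    \int[mu]_(x in `[- a, a]%classic) \int[mu]_(y in `[- b, b]%classic) F (x, y) /\
  \int[mu2]_(q in `[- a, a]%classic `*` `[- b, b]%classic) F q =
    \int[mu]_(y in `[- b, b]%classic) \int[mu]_(x in `[- a, a]%classic) F (x, y).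
Proof.
move=> cF; have iF := @rect_Rintegrable F a b cF; split.
- apply: (@Rintegral_prod12 _ _ _ _ R mu mu _ _ F _ _ iF); [exact: measurable_itv..|].
  by move=> x _; apply: segment_Rintegrable; exact: continuous_slice2.
- apply: (@Rintegral_prod21 _ _ _ _ R mu mu _ _ F _ _ iF); [exact: measurable_itv..|].
  by move=> y _; apply: segment_Rintegrable; exact: continuous_slice1.
Qed.

(** Comparing primitives covers l = 0 as well, which occurs for the degenerate chords at the top and
    bottom of the disc. *)
Lemma segment_scaling (l : R) (g : R -> R) : 0 <= l -> continuous g ->
  \int[mu]_(x in `[- l, l]%classic) g x = \int[mu]_(x in `[- 1, 1]%classic) (l * g (l * x)).
Proof.
move=> l0 cg; have [H dH] := @antiderivative _ (- l) l g cg.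
have ll : - l <= l by lra.
have l11 : (-1 : R) <= 1 by lra.
have cg1 : continuous (fun x => l * g (l * x)).
  apply: continuous_mul; first exact: continuous_const.
  apply: (continuous_compose (f := fun x => l * x)) => //.
  by apply: continuous_mul; [exact: continuous_const|exact: continuous_self].
have dH1 (x : R) : -1 <= x <= 1 -> is_derive x 1 (fun x => H (l * x)) (l * g (l * x)).
  move=> x1; have lx : - l <= l * x <= l by nra.
  have dl := is_derive1Z l (is_derive1_id x).
  apply: (is_derive1_eq (@is_derive1_compose _ H (fun x => l * x) x _ _ (dH _ lx) dl)).
  by rewrite mulr1 mulrC.
by rewrite (FTC_segment ll cg dH) (FTC_segment l11 cg1 dH1) mulr1 mulrN1.
Qed.

(** Every horizontal chord is rescaled to [-1, 1], with Jacobian [half_chord]. In place of polar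
    coordinates, this provides a rectangle on which both weighted inequalities apply along
    coordinate lines. *)
Definition elliptic rho q : R * R := (half_chord rho q.2 * q.1, q.2).

Lemma continuous_elliptic rho : continuous (elliptic rho).
Proof.
apply: continuous_pair; last exact: continuous_snd.
apply: continuous_mul; last exact: continuous_fst.
apply: (continuous_compose (f := fun q : R * R => q.2)); first exact: continuous_snd.
exact: continuous_half_chord.
Qed.

Lemma continuous_half_chord2 rho : continuous (fun q : R * R => half_chord rho q.2).
Proof.
apply: (continuous_compose (f := fun q : R * R => q.2)); first exact: continuous_snd.
exact: continuous_half_chord.
Qed.

Lemma disc_elliptic rho F : 0 < rho -> continuous F ->
  \int[mu2]_(q in disc rho) F q =
  \int[mu2]_(q in `[- 1, 1]%classic `*` `[- rho, rho]%classic)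
    (half_chord rho q.2 * F (elliptic rho q)).
Proof.
move=> r0 cF.
have cG : continuous (fun q => half_chord rho q.2 * F (elliptic rho q)).
  apply: continuous_mul; first exact: continuous_half_chord2.
  exact: (continuous_compose (@continuous_elliptic rho) cF).
rewrite (rect_fubini _ _ cG).2 /elliptic /=.
rewrite [LHS]/Rintegral [in RHS]/Rintegral; congr fine.
have iF := disc_Rintegrable r0 cF.
rewrite (@integral_sections21 _ _ _ _ R mu mu (disc rho) F (measurable_disc rho) iF).
rewrite [RHS]integral_mkcond; apply: eq_integral => y _; rewrite patchE.
have cy : continuous (fun x : R => F (x, y : R)) by exact: continuous_slice1.
case: ifPn => [|]; rewrite ?inE ?notin_setE /= in_itv/= => hy; last first.
  rewrite (_ : [set x | _] = set0) ?integral_set0//; apply/seteqP; split => x //=.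
  by rewrite /disc /= => h; apply: hy; have h2 := sqr_ge0 x; apply/andP; split;
    rewrite leNgt; apply/negP => h1; nra.
transitivity (\int[mu]_(x in `[- half_chord rho y, half_chord rho y]%classic) F (x, y))%:E; last first.
  by congr EFin; exact: (segment_scaling (half_chord_ge0 rho y) cy).
set l := half_chord rho y.
have l2 : l ^+ 2 = rho ^+ 2 - y ^+ 2 by exact: half_chord_sqr.
have l0 : 0 <= l := half_chord_ge0 rho y.
have -> : [set x | disc rho (x, y)] = `](- l), l[%classic.
  apply/seteqP; split => x; rewrite /disc /= in_itv/= => h.
    have : x ^+ 2 < l ^+ 2 by lra.
    by rewrite -(real_normK (num_real x)) ltr_pXn2r ?nnegrE// ltr_norml.
  have : x ^+ 2 < l ^+ 2 by rewrite -(real_normK (num_real x)) ltr_pXn2r ?nnegrE// ltr_norml.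
  lra.
have ic := @segment_Rintegrable _ (- l) l _ cy.
have io : Rintegrable mu `](- l), l[%classic (fun x => F (x, y)).
  apply: integrableS ic => //; exact: subset_itv_oo_cc.
have io2 : Rintegrable mu `](- l), l]%classic (fun x => F (x, y)).
  apply: integrableS ic => //; exact: subset_itv_oc_cc.
rewrite RintegralE//; congr EFin.
by rewrite Rintegral_itv_bndo_bndc// Rintegral_itv_obnd_cbnd.
Qed.

Lemma disc_preserving_integral rho (tau : R * R -> R * R) F : 0 < rho ->
  measure_preserving mu2 (tau : T2 -> T2) -> tau @^-1` disc rho = disc rho -> continuous F ->
  \int[mu2]_(q in disc rho) F (tau q) = \int[mu2]_(q in disc rho) F q.
Proof.
move=> r0 pt td cF; rewrite Rintegral_mkcond [RHS]Rintegral_mkcond /Rintegral; congr fine.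
have iF : Rintegrable mu2 setT (F \_ (disc rho)).
  have mD := measurable_disc rho.
  apply: (Rintegrable_supported mD) => //.
  - by apply/(measurable_restrictT _ _).1 => //; apply: measurable_funTS; exact: continuous_measurable2.
  - by move=> p _ nA; rewrite patchE memNset.
  - apply: (@eq_Rintegrable _ _ _ mu2 _ mD F); last exact: disc_Rintegrable.
    by move=> p Ap; rewrite patchE mem_set.
rewrite -(preserving_integral pt iF); apply: eq_integral => q _ /=; congr EFin.
rewrite !patchE; have E : disc rho (tau q) <-> disc rho q by rewrite -[in X in _ <-> X]td.
have [Dq|nD] := pselect (disc rho q); first by rewrite !mem_set//; exact/E.
by rewrite !memNset//; move=> /E.
Qed.

End disc.

Lemma Rintegral_eq0 d (T : measurableType d) (R : realType) (m : {measure set T -> \bar R})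
    (D : set T) (f : T -> R) : (forall x, D x -> f x = 0) -> \int[m]_(x in D) f x = 0.
Proof.
by move=> f0; rewrite /Rintegral integral0_eq// => x Dx; rewrite f0.
Qed.

(** * Green's formula on the disc *)

Section plane_calculus.
Context {R : realType}.
Local Notation mR := (measurableTypeR R).
Local Notation T2 := (mR * mR)%type.
Local Notation mu := (@lebesgue_measure R).
Local Notation mu2 := (@lebesgue2 R).
Implicit Types (rho n x y : R) (q : R * R) (f g u v F psi Phi : R * R -> R).

Definition is_partial1 f g := forall x y, is_derive x 1 (fun x => f (x, y)) (g (x, y)).
Definition is_partial2 f g := forall x y, is_derive y 1 (fun y => f (x, y)) (g (x, y)).
Definition C1_plane f f1 f2 :=
  [/\ continuous f, continuous f1, continuous f2, is_partial1 f f1 & is_partial2 f f2].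

Lemma box2_edge (M x y : R) : M < `|x| \/ M < `|y| -> ~ box2 M (x, y).
Proof.
by move=> h [/=]; rewrite !in_itv/= -!ler_norml => h1 h2; case: h; rewrite ltNge ?h1 ?h2.
Qed.

Lemma integral_partial1 (M : R) u v : 0 < M -> continuous v -> is_partial1 u v ->
  (forall q, ~ box2 M q -> u q = 0) -> \int[mu2]_(q in box2 (M + 1)) v q = 0.
Proof.
move=> M0 cv du u0; rewrite /box2 (rect_fubini (M + 1) (M + 1) cv).2.
apply: Rintegral_eq0 => y _; have MM : - (M + 1) <= M + 1 by lra.
have cy : continuous (fun x => v (x, y)) by exact: continuous_slice1.
rewrite (@FTC_segment _ _ _ (fun x => u (x, y)) (fun x => v (x, y)) MM cy (fun x _ => du x y)).
rewrite !u0 ?subrr//; apply: box2_edge; left; rewrite ?normrN ger0_norm; lra.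
Qed.

Lemma integral_partial2 (M : R) u v : 0 < M -> continuous v -> is_partial2 u v ->
  (forall q, ~ box2 M q -> u q = 0) -> \int[mu2]_(q in box2 (M + 1)) v q = 0.
Proof.
move=> M0 cv du u0; rewrite /box2 (rect_fubini (M + 1) (M + 1) cv).1.
apply: Rintegral_eq0 => x _; have MM : - (M + 1) <= M + 1 by lra.
have cx : continuous (fun y => v (x, y)) by exact: continuous_slice2.
rewrite (@FTC_segment _ _ _ (fun y => u (x, y)) (fun y => v (x, y)) MM cx (fun y _ => du x y)).
rewrite !u0 ?subrr//; apply: box2_edge; right; rewrite ?normrN ger0_norm; lra.
Qed.

Definition gap rho n q := n * (rho ^+ 2 - (q.1 ^+ 2 + q.2 ^+ 2)).
(** Smooth weights that vanish outside the disc; as [n] tends to infinity [bubble 0] tends to 1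
    inside. They stand in for boundary integrals in Green's formula. *)
Definition bubble (k : nat) rho n q := expinv k (gap rho n q).

Lemma bubble_eq0 k rho n q : 0 <= n -> ~ disc rho q -> bubble k rho n q = 0.
Proof.
move=> n0 /negP; rewrite /disc /= -leNgt => h; rewrite /bubble /expinv ifF//.
by apply/negbTE; rewrite -leNgt /gap mulr_ge0_le0// subr_le0.
Qed.

Lemma bubble_ge0 k rho n q : 0 <= bubble k rho n q.
Proof. exact: expinv_ge0. Qed.

Lemma continuous_bubble k rho n : continuous (bubble k rho n).
Proof.
apply: (continuous_compose (f := gap rho n)); last exact: smooth1_continuous (smooth1_expinv k).
apply: continuous_mul; first exact: continuous_const.
apply: continuous_sub; first exact: continuous_const.
by apply: continuous_add; apply: continuous_exp; [exact: continuous_fst|exact: continuous_snd].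
Qed.

Lemma is_partial1_bubble rho n :
  is_partial1 (bubble 0 rho n) (fun q => - (2 * n * q.1 * bubble 2 rho n q)).
Proof.
move=> x y; have d1 : is_derive x 1 (fun x => gap rho n (x, y)) (- (2 * n * x)).
  have h := is_derive1Z n (is_derive1B (is_derive1_cst (rho ^+ 2) x)
    (is_derive1D (is_derive1X 2 (is_derive1_id x)) (is_derive1_cst (y ^+ 2) x))).
  by apply: (is_derive1_eq h); rewrite /=; ring.
have d2 := is_derive_expinv 0 (gap rho n (x, y)).
apply: (is_derive1_eq (@is_derive1_compose _ (expinv 0) (fun x => gap rho n (x, y)) x _ _ d2 d1)).
by rewrite /bubble /=; ring.
Qed.

Lemma is_partial2_bubble rho n :
  is_partial2 (bubble 0 rho n) (fun q => - (2 * n * q.2 * bubble 2 rho n q)).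
Proof.
move=> x y; have d1 : is_derive y 1 (fun y => gap rho n (x, y)) (- (2 * n * y)).
  have h := is_derive1Z n (is_derive1B (is_derive1_cst (rho ^+ 2) y)
    (is_derive1D (is_derive1_cst (x ^+ 2) y) (is_derive1X 2 (is_derive1_id y)))).
  by apply: (is_derive1_eq h); rewrite /=; ring.
have d2 := is_derive_expinv 0 (gap rho n (x, y)).
apply: (is_derive1_eq (@is_derive1_compose _ (expinv 0) (fun y => gap rho n (x, y)) y _ _ d2 d1)).
by rewrite /bubble /=; ring.
Qed.

(** The divergence of [bubble 0] psi grad Phi has integral 0. Since the gradient of [bubble 0] is -
    2 n [bubble 2] times the position, the right side is a smoothed boundary integral of psi times
    the radial derivative of Phi. *)
Lemma green rho n (m : R) psi psi1 psi2 Phi Phi1 Phi2 Phi11 Phi22 : 0 < rho -> 0 <= n ->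
  C1_plane psi psi1 psi2 -> C1_plane Phi Phi1 Phi2 ->
  continuous Phi11 -> continuous Phi22 -> is_partial1 Phi1 Phi11 -> is_partial2 Phi2 Phi22 ->
  (forall q, Phi11 q + Phi22 q = - m * Phi q) ->
  \int[mu2]_(q in disc rho)
    (bubble 0 rho n q * (psi1 q * Phi1 q + psi2 q * Phi2 q - m * (psi q * Phi q))) =
  \int[mu2]_(q in disc rho)
    (2 * n * bubble 2 rho n q * psi q * (q.1 * Phi1 q + q.2 * Phi2 q)).
Proof.
move=> r0 n0 [cs cs1 cs2 ds1 ds2] [cp cp1 cp2 dp1 dp2] cp11 cp22 dp11 dp22 lap.
have cf : continuous (fst : R * R -> R) := @continuous_fst R R.
have cd : continuous (snd : R * R -> R) := @continuous_snd R R.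
have ck (k : R) : continuous (fun _ : R * R => k) by exact: continuous_const.
have ce k := @continuous_bubble k rho n.
pose v1 q := - (2 * n * q.1 * bubble 2 rho n q) * (psi q * Phi1 q)
  + bubble 0 rho n q * (psi1 q * Phi1 q + psi q * Phi11 q).
pose v2 q := - (2 * n * q.2 * bubble 2 rho n q) * (psi q * Phi2 q)
  + bubble 0 rho n q * (psi2 q * Phi2 q + psi q * Phi22 q).
have cv1 : continuous v1.
  apply: continuous_add; apply: continuous_mul => //.
  - by apply: continuous_opp; apply: continuous_mul => //; exact: continuous_mul.
  - exact: continuous_mul.
  - by apply: continuous_add; exact: continuous_mul.
have cv2 : continuous v2.
  apply: continuous_add; apply: continuous_mul => //.
  - by apply: continuous_opp; apply: continuous_mul => //; exact: continuous_mul.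
  - exact: continuous_mul.
  - by apply: continuous_add; exact: continuous_mul.
have d1 : is_partial1 (fun q => bubble 0 rho n q * (psi q * Phi1 q)) v1.
  by move=> x y; exact: (is_derive1M (is_partial1_bubble rho n x y) (is_derive1M (ds1 x y) (dp11 x y))).
have d2 : is_partial2 (fun q => bubble 0 rho n q * (psi q * Phi2 q)) v2.
  by move=> x y; exact: (is_derive1M (is_partial2_bubble rho n x y) (is_derive1M (ds2 x y) (dp22 x y))).
have nb q : ~ box2 rho q -> ~ disc rho q by move=> h /(disc_box r0).
have i1 := integral_partial1 r0 cv1 d1 (fun q h => etrans (congr1 (fun t => t * _) (bubble_eq0 0 n0 (nb q h))) (mul0r _)).
have i2 := integral_partial2 r0 cv2 d2 (fun q h => etrans (congr1 (fun t => t * _) (bubble_eq0 0 n0 (nb q h))) (mul0r _)).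
have db : disc rho `<=` box2 (rho + 1).
  by move=> q /(disc_box r0)[h1 h2]; split; move: h1 h2; rewrite /= !in_itv/=; lra.
have mD := measurable_disc rho.
have vD v : (forall q, ~ disc rho q -> v q = 0) -> \int[mu2]_(q in box2 (rho + 1)) v q = \int[mu2]_(q in disc rho) v q.
  by move=> v0; apply: (integral_supported mu2 db) => q _; exact: v0.
rewrite vD in i1; last by move=> q nq; rewrite /v1 !bubble_eq0//; ring.
rewrite vD in i2; last by move=> q nq; rewrite /v2 !bubble_eq0//; ring.
have iD F : continuous F -> Rintegrable mu2 (disc rho) F by exact: disc_Rintegrable.
have c1 : continuous (fun q => bubble 0 rho n q * (psi1 q * Phi1 q + psi2 q * Phi2 q - m * (psi q * Phi q))).
  apply: continuous_mul => //; apply: continuous_sub; last by apply: continuous_mul => //; exact: continuous_mul.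
  by apply: continuous_add; exact: continuous_mul.
have c2 : continuous (fun q => 2 * n * bubble 2 rho n q * psi q * (q.1 * Phi1 q + q.2 * Phi2 q)).
  apply: continuous_mul; last by apply: continuous_add; exact: continuous_mul.
  by apply: continuous_mul => //; exact: continuous_mul.
apply/eqP; rewrite -subr_eq0 -(RintegralB' mD (iD _ c1) (iD _ c2)).
have <- : \int[mu2]_(q in disc rho) (v1 q + v2 q) = \int[mu2]_(q in disc rho)
   (bubble 0 rho n q * (psi1 q * Phi1 q + psi2 q * Phi2 q - m * (psi q * Phi q)) -
    2 * n * bubble 2 rho n q * psi q * (q.1 * Phi1 q + q.2 * Phi2 q)).
  apply: eq_Rintegral => q _; have := lap q; rewrite /v1 /v2 => E.
  have -> : m * (psi q * Phi q) = - (psi q * (Phi11 q + Phi22 q)) by rewrite E; ring.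
  ring.
by rewrite (RintegralD' mD (iD _ cv1) (iD _ cv2)) i1 i2 addr0.
Qed.

Lemma disc_dominated rho (F_ : nat -> R * R -> R) F (N : R) : 0 < rho ->
  (forall k : nat, continuous (F_ k)) -> continuous F ->
  (forall q, disc rho q -> F_ k q @[k --> \oo] --> F q) ->
  (forall (k : nat) q, disc rho q -> `|F_ k q| <= N) ->
  \int[mu2]_(q in disc rho) F_ k q @[k --> \oo] --> \int[mu2]_(q in disc rho) F q.
Proof.
move=> r0 cF_ cF hF hN; have mD := measurable_disc rho.
have := @dominated_cvg _ _ _ mu2 (disc rho) mD (fun (k : nat) q => (F_ k q)%:E) (fun q => (F q)%:E) (fun=> N%:E).
have m1 (k : nat) : measurable_fun (disc rho : set T2) (fun q : T2 => (F_ k q)%:E).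
  by apply/measurable_EFinP; apply: measurable_funTS; exact: continuous_measurable2.
have m2 (q : T2) : disc rho q -> (F_ k q)%:E @[k --> \oo] --> (F q)%:E.
  by move=> Dq; apply: cvg_EFin; [exact: nearW|exact: hF].
have iN : Rintegrable mu2 (disc rho) (fun=> N).
  by apply: disc_Rintegrable => //; exact: continuous_const.
have m3 (k : nat) (q : T2) : disc rho q -> (`|(F_ k q)%:E| <= N%:E)%E.
  by move=> Dq; rewrite lee_fin; exact: hN.
move=> /(_ m1 m2 (fun=> fun=> isT) iN m3); rewrite (RintegralE mD (disc_Rintegrable r0 cF)).
by move=> /fine_cvgP[_].
Qed.

End plane_calculus.

(** * The first angular mode of the disc *)

Section disc_mode.
Context {R : realType}.
Local Notation mu2 := (@lebesgue2 R).
Implicit Types (rho x y : R) (q : R * R) (f : R * R -> R).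
Variables (al be m : R).

Definition slope q := al * q.1 + be * q.2.
Definition radius q := m / 4 * (q.1 ^+ 2 + q.2 ^+ 2).
(** For m > 0 this is, up to the factor sqrt m / 2, the function J_1 (sqrt m r) (al cos theta + be
    sin theta), written without polar coordinates. *)
Definition mode q := slope q * clifford (radius q).
Definition mode1 q := al * clifford (radius q) + slope q * (clifford' (radius q) * (m / 2 * q.1)).
Definition mode2 q := be * clifford (radius q) + slope q * (clifford' (radius q) * (m / 2 * q.2)).
Definition mode11 q := 2 * al * (clifford' (radius q) * (m / 2 * q.1)) + slope q *
  (clifford'' (radius q) * (m / 2 * q.1) ^+ 2 + clifford' (radius q) * (m / 2)).
Definition mode22 q := 2 * be * (clifford' (radius q) * (m / 2 * q.2)) + slope q *
  (clifford'' (radius q) * (m / 2 * q.2) ^+ 2 + clifford' (radius q) * (m / 2)).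

Let cst k : continuous (fun _ : R * R => k : R). Proof. exact: continuous_const. Qed.
Let c1 : continuous (fun q : R * R => q.1). Proof. exact: continuous_fst. Qed.
Let c2 : continuous (fun q : R * R => q.2). Proof. exact: continuous_snd. Qed.

Lemma continuous_slope : continuous slope.
Proof. by apply: continuous_add; exact: continuous_mul. Qed.

Lemma continuous_radius : continuous radius.
Proof. by apply: continuous_mul => //; apply: continuous_add; exact: continuous_exp. Qed.

Let cc : continuous (fun q => clifford (radius q)).
Proof. exact: (continuous_compose continuous_radius continuous_clifford). Qed.
Let cc' : continuous (fun q => clifford' (radius q)).
Proof. exact: (continuous_compose continuous_radius continuous_clifford'). Qed.
Let cc'' : continuous (fun q => clifford'' (radius q)).
Proof. exact: (continuous_compose continuous_radius continuous_clifford''). Qed.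
Let cs := continuous_slope.

Lemma continuous_mode11 : continuous mode11.
Proof.
apply: continuous_add; first by apply: continuous_mul => //; apply: continuous_mul => //; exact: continuous_mul.
apply: continuous_mul => //; apply: continuous_add; last exact: continuous_mul.
by apply: continuous_mul => //; apply: continuous_exp; exact: continuous_mul.
Qed.

Lemma continuous_mode22 : continuous mode22.
Proof.
apply: continuous_add; first by apply: continuous_mul => //; apply: continuous_mul => //; exact: continuous_mul.
apply: continuous_mul => //; apply: continuous_add; last exact: continuous_mul.
by apply: continuous_mul => //; apply: continuous_exp; exact: continuous_mul.
Qed.

Let dr1 x y : is_derive x 1 (fun x : R => radius (x, y)) (m / 2 * x).
Proof.
have h := is_derive1Z (m / 4) (is_derive1D (is_derive1X 2 (is_derive1_id x)) (is_derive1_cst (y ^+ 2) x)).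
by apply: (is_derive1_eq h); rewrite /=; field.
Qed.
Let dr2 x y : is_derive y 1 (fun y : R => radius (x, y)) (m / 2 * y).
Proof.
have h := is_derive1Z (m / 4) (is_derive1D (is_derive1_cst (x ^+ 2) y) (is_derive1X 2 (is_derive1_id y))).
by apply: (is_derive1_eq h); rewrite /=; field.
Qed.
Let ds1 x y : is_derive x 1 (fun x : R => slope (x, y)) al.
Proof.
have h := is_derive1D (is_derive1Z al (is_derive1_id x)) (is_derive1_cst (be * y) x).
by apply: (is_derive1_eq h); rewrite /=; ring.
Qed.
Let ds2 x y : is_derive y 1 (fun y : R => slope (x, y)) be.
Proof.
have h := is_derive1D (is_derive1_cst (al * x) y) (is_derive1Z be (is_derive1_id y)).
by apply: (is_derive1_eq h); rewrite /=; ring.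
Qed.
Let dc1 x y := @is_derive1_compose _ clifford (fun x : R => radius (x, y)) x _ _ (is_derive_clifford _) (dr1 x y).
Let dc2 x y := @is_derive1_compose _ clifford (fun y : R => radius (x, y)) y _ _ (is_derive_clifford _) (dr2 x y).
Let dc1' x y := @is_derive1_compose _ clifford' (fun x : R => radius (x, y)) x _ _ (is_derive_clifford' _) (dr1 x y).
Let dc2' x y := @is_derive1_compose _ clifford' (fun y : R => radius (x, y)) y _ _ (is_derive_clifford' _) (dr2 x y).

Lemma C1_mode : C1_plane mode mode1 mode2.
Proof.
split.
- exact: continuous_mul.
- by apply: continuous_add; apply: continuous_mul => //; apply: continuous_mul => //; exact: continuous_mul.
- by apply: continuous_add; apply: continuous_mul => //; apply: continuous_mul => //; exact: continuous_mul.
- by move=> x y; exact: (is_derive1M (ds1 x y) (dc1 x y)).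
- by move=> x y; exact: (is_derive1M (ds2 x y) (dc2 x y)).
Qed.

Lemma is_partial1_mode1 : is_partial1 mode1 mode11.
Proof.
move=> x y; have d1 := is_derive1Z (m / 2) (is_derive1_id x).
have h := is_derive1D (is_derive1Z al (dc1 x y)) (is_derive1M (ds1 x y) (is_derive1M (dc1' x y) d1)).
by apply: (is_derive1_eq h); rewrite /mode11 /=; ring.
Qed.

Lemma is_partial2_mode2 : is_partial2 mode2 mode22.
Proof.
move=> x y; have d1 := is_derive1Z (m / 2) (is_derive1_id y).
have h := is_derive1D (is_derive1Z be (dc2 x y)) (is_derive1M (ds2 x y) (is_derive1M (dc2' x y) d1)).
by apply: (is_derive1_eq h); rewrite /mode22 /=; ring.
Qed.

Lemma laplacian_mode q : mode11 q + mode22 q = - m * mode q.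
Proof.
have := clifford_ode (radius q); rewrite /mode => E.
have -> : clifford (radius q) = - (radius q * clifford'' (radius q) + 2 * clifford' (radius q)).
  by apply/eqP; rewrite -addr_eq0 addrC E.
by rewrite /mode11 /mode22 /slope /radius; field.
Qed.

Lemma radial_mode q : q.1 * mode1 q + q.2 * mode2 q = slope q * clifford_flux (radius q).
Proof. by rewrite /mode1 /mode2 /clifford_flux /slope /radius; field. Qed.

End disc_mode.

Section bubble_limit.
Context {R : realType}.
Implicit Types (rho : R) (q : R * R).

Lemma expinv0_le1 (x : R) : expinv 0 x <= 1.
Proof.
rewrite /expinv; case: ifP => // x0; rewrite expr0 invr1 mul1r -expR0 ler_expR oppr_le0 invr_ge0.
exact: ltW.
Qed.

Lemma expinv1_le1 (x : R) : expinv 1 x <= 1.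
Proof.
rewrite /expinv; case: ifP => // x0; rewrite expr1.
have h : x^-1 <= expR x^-1 by apply: le_trans (expR_ge1Dx _); lra.
by rewrite expRN ler_pdivrMr ?expR_gt0// mul1r.
Qed.

Let inv_gap_cvg (g : R) : (fun k => (k.+1%:R * g)^-1) @ \oo --> (0 : R).
Proof.
have -> : (fun k => (k.+1%:R * g)^-1) = (fun k => g^-1 * @harmonic R k).
  by apply/funext => k; rewrite invfM mulrC.
by rewrite -(mulr0 g^-1); apply: cvgMr; exact: cvg_harmonic.
Qed.

Let exp_inv_gap_cvg (g : R) : (fun k => expR (- (k.+1%:R * g)^-1)) @ \oo --> (1 : R).
Proof.
have h : (fun k => - (k.+1%:R * g)^-1) @ \oo --> (0 : R).
  by rewrite -oppr0; apply: cvgN; exact: inv_gap_cvg.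
by have := cvg_comp _ _ h (@continuous_expR R 0); rewrite expR0.
Qed.

Lemma bubble_cvg rho q : disc rho q -> bubble 0 rho k.+1%:R q @[k --> \oo] --> (1 : R).
Proof.
rewrite /disc /= -subr_gt0 => g0; set g := (X in 0 < X) in g0.
have E (k : nat) : bubble 0 rho k.+1%:R q = expR (- (k.+1%:R * g)^-1).
  by rewrite /bubble /gap -/g /expinv ifT ?mulr_gt0// expr0 invr1 mul1r.
rewrite (funext E); exact: exp_inv_gap_cvg.
Qed.

(** The factor [n] in the boundary term of [green] is absorbed by an integrand that vanishes
    linearly at the circle, and what remains, [bubble 1], tends to 0. *)
Lemma bubble_gapE rho (n : R) q : 0 < n ->
  n * bubble 2 rho n q * (rho ^+ 2 - (q.1 ^+ 2 + q.2 ^+ 2)) = bubble 1 rho n q.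
Proof.
move=> n0; rewrite /bubble /gap /expinv; set g := rho ^+ 2 - _.
case: ifP => h; last by rewrite mulr0 mul0r.
have gn : g != 0 by apply/eqP => g0; rewrite g0 mulr0 ltxx in h.
by field; rewrite gn gt_eqF.
Qed.

Lemma bubble1_cvg rho q : disc rho q -> bubble 1 rho k.+1%:R q @[k --> \oo] --> (0 : R).
Proof.
rewrite /disc /= -subr_gt0 => g0; set g := (X in 0 < X) in g0.
have E (k : nat) : bubble 1 rho k.+1%:R q = (k.+1%:R * g)^-1 * expR (- (k.+1%:R * g)^-1).
  by rewrite /bubble /gap -/g /expinv ifT ?mulr_gt0// expr1.
rewrite (funext E) -(mul0r (1 : R)); exact: (cvgM (inv_gap_cvg g) (exp_inv_gap_cvg g)).
Qed.

End bubble_limit.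

(** * The Neumann gap of the disc *)

Section odd_functions.
Context {R : realType}.
Local Notation mu2 := (@lebesgue2 R).
Implicit Types (rho : R) (q : R * R) (f : R * R -> R).
Variable j : R.
Hypothesis hj : smallest_positive_zero (derive1 (bessel_J 1)) j.

(* The mode [Phi = slope * clifford] is positive on one side of its nodal line
   and solves [- lap Phi = Phi / 2]; testing with [f^2 Phi / (Phi^2 + delta)]
   is Jacobi's trick, and the cutoff [bubble 0] only helps because [Phi] has
   nonnegative radial derivative where it is positive. *)
Lemma odd_poincare rho (al be C : R) f f1 f2 : 0 < rho -> rho ^+ 2 <= 2 * j ^+ 2 ->
  C1_plane f f1 f2 -> (forall q, disc rho q -> `|f q| <= C * `|slope al be q|) ->
  0 <= \int[mu2]_(q in disc rho) (f1 q ^+ 2 + f2 q ^+ 2 - 1 / 2 * f q ^+ 2).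
Proof.
move=> r0 rj cf hf; have [cf0 cf1 cf2 df1 df2] := cf.
pose Phi := mode al be (1 / 2); pose Phi1 := mode1 al be (1 / 2); pose Phi2 := mode2 al be (1 / 2).
have cPhi : C1_plane Phi Phi1 Phi2 by exact: C1_mode.
have [cP cP1 cP2 dP1 dP2] := cPhi.
have ck (k : R) : continuous (fun _ : R * R => k) by exact: continuous_const.
have rad q : disc rho q -> 0 <= radius (1 / 2) q <= rho ^+ 2 / 8.
  rewrite /disc /radius /= => h; have := sqr_ge0 q.1; have := sqr_ge0 q.2; lra.
have rj4 : rho ^+ 2 / 8 <= j ^+ 2 / 4 by lra.
have [M M0 hM] : exists2 M, 0 < M & forall q, disc rho q -> M <= clifford (radius (1 / 2) q).
  have r8 : 0 <= rho ^+ 2 / 8 by rewrite divr_ge0 ?sqr_ge0.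
  have [t tI ht] := EVT_min r8 (continuous_subspaceT (@continuous_clifford R)).
  exists (clifford t).
    move: tI; rewrite in_itv/= => /andP[t0 t8]; apply: (clifford_gt0 hj t0); lra.
  by move=> q /rad h; apply: ht; rewrite in_itv.
(* The regularisation delta = 1 / (k + 1) keeps the quotient by Phi differentiable across the nodal
   line. *)
pose D (k : nat) q := Phi q ^+ 2 + (@harmonic R k).
have h0 k : 0 < @harmonic R k by rewrite /harmonic/= invr_gt0.
have D0 k q : 0 < D k q by rewrite ltr_wpDl ?sqr_ge0.
have cD k : continuous (D k) by apply: continuous_add => //; exact: continuous_exp.
have Dn k q : D k q != 0 by rewrite gt_eqF.
have cDi k : continuous (fun q => (D k q)^-1) by apply: continuous_inv.
pose psi k q := f q ^+ 2 * Phi q / D k q.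
pose psi1 k q := (2 * f q * f1 q * Phi q + f q ^+ 2 * Phi1 q) / D k q
  - f q ^+ 2 * Phi q * (2 * Phi q * Phi1 q) * ((D k q)^-1 * (D k q)^-1).
pose psi2 k q := (2 * f q * f2 q * Phi q + f q ^+ 2 * Phi2 q) / D k q
  - f q ^+ 2 * Phi q * (2 * Phi q * Phi2 q) * ((D k q)^-1 * (D k q)^-1).
have cpsi k : C1_plane (psi k) (psi1 k) (psi2 k).
  split.
  - by apply: continuous_mul => //; apply: continuous_mul => //; exact: continuous_exp.
  - apply: continuous_sub.
      apply: continuous_mul => //; apply: continuous_add; apply: continuous_mul => //; last exact: continuous_exp.
      by apply: continuous_mul => //; exact: continuous_mul.
    apply: continuous_mul; last exact: continuous_mul.
    by apply: continuous_mul; apply: continuous_mul => //; [exact: continuous_exp|exact: continuous_mul].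
  - apply: continuous_sub.
      apply: continuous_mul => //; apply: continuous_add; apply: continuous_mul => //; last exact: continuous_exp.
      by apply: continuous_mul => //; exact: continuous_mul.
    apply: continuous_mul; last exact: continuous_mul.
    by apply: continuous_mul; apply: continuous_mul => //; [exact: continuous_exp|exact: continuous_mul].
  - move=> x y; have dD := is_derive1D (is_derive1X 2 (dP1 x y)) (is_derive1_cst (@harmonic R k) x).
    have dDi := @is_derive1V _ (fun x => D k (x, y)) x _ (Dn k (x, y)) dD.
    have h := is_derive1M (is_derive1M (is_derive1X 2 (df1 x y)) (dP1 x y)) dDi.
    by apply: (is_derive1_eq h); rewrite /psi1 /=; field; exact: Dn.
  - move=> x y; have dD := is_derive1D (is_derive1X 2 (dP2 x y)) (is_derive1_cst (@harmonic R k) y).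
    have dDi := @is_derive1V _ (fun y => D k (x, y)) y _ (Dn k (x, y)) dD.
    have h := is_derive1M (is_derive1M (is_derive1X 2 (df2 x y)) (dP2 x y)) dDi.
    by apply: (is_derive1_eq h); rewrite /psi2 /=; field; exact: Dn.
pose G q := Phi1 q ^+ 2 + Phi2 q ^+ 2.
have cG : continuous G by apply: continuous_add; exact: continuous_exp.
(* [A k] exceeds the integrand on the left of [green] by the bubble times a sum of two squares, and
   tends pointwise to the integrand of the claim. *)
pose A (k : nat) q := bubble 0 rho k.+1%:R q * (f1 q ^+ 2 + f2 q ^+ 2
  - 1 / 2 * (f q ^+ 2 * Phi q ^+ 2 / D k q) + f q ^+ 2 * G q * @harmonic R k * ((D k q)^-1 * (D k q)^-1)).
have cA k : continuous (A k).
  apply: continuous_mul; first exact: continuous_bubble.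
  apply: continuous_add; last first.
    by apply: continuous_mul; [apply: continuous_mul => //; apply: continuous_mul => //; exact: continuous_exp|exact: continuous_mul].
  apply: continuous_sub; first by apply: continuous_add; exact: continuous_exp.
  by apply: continuous_mul => //; apply: continuous_mul => //; apply: continuous_mul; exact: continuous_exp.
have mD := measurable_disc rho.
have A0 k : 0 <= \int[mu2]_(q in disc rho) A k q.
  have n0 : 0 <= k.+1%:R :> R by [].
  have := green r0 n0 (cpsi k) cPhi (@continuous_mode11 _ al be (1 / 2)) (@continuous_mode22 _ al be (1 / 2))
    (@is_partial1_mode1 _ al be (1 / 2)) (@is_partial2_mode2 _ al be (1 / 2)) (@laplacian_mode _ al be (1 / 2)).
  set lhs := (X in X = _); set rhs := (X in _ = X) => E.
  have rhs0 : 0 <= rhs.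
    apply: Rintegral_ge0 => q Dq; rewrite radial_mode /psi /Phi /mode.
    have /andP[t0 t8] := rad q Dq.
    have B0 := clifford_gt0 hj t0 (le_trans t8 rj4).
    have F0 := clifford_flux_ge0 hj t0 (le_trans t8 rj4).
    rewrite -mulrA mulr_ge0//; first by rewrite mulr_ge0 ?bubble_ge0// mulr_ge0.
    have -> : f q ^+ 2 * (slope al be q * clifford (radius (1 / 2) q)) / D k q *
      (slope al be q * clifford_flux (radius (1 / 2) q)) =
      (f q * slope al be q) ^+ 2 * (clifford (radius (1 / 2) q) * clifford_flux (radius (1 / 2) q) / D k q) by ring.
    by rewrite mulr_ge0 ?sqr_ge0// divr_ge0 ?mulr_ge0// ltW.
  rewrite -E in rhs0; apply: (le_trans rhs0).
  apply: (le_Rintegral' mD _ (disc_Rintegrable r0 (cA k))).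
    have [c0 c1 c2 _ _] := cpsi k.
    apply: disc_Rintegrable => //; apply: continuous_mul; first exact: continuous_bubble.
    apply: continuous_sub; first by apply: continuous_add; exact: continuous_mul.
    by apply: continuous_mul => //; exact: continuous_mul.
  move=> q Dq; rewrite /A ler_wpM2l ?bubble_ge0// -subr_ge0 /psi1 /psi2 /psi -/Phi -/Phi1 -/Phi2.
  set d := D k q; have dn : d != 0 := Dn k q.
  have hE : @harmonic R k = d - Phi q ^+ 2 by rewrite /d /D; ring.
  rewrite hE /G; set a := f q; set P := Phi q; set P1 := Phi1 q; set P2 := Phi2 q.
  set a1 := f1 q; set a2 := f2 q.
  rewrite [leRHS](_ : _ = (a1 - a * P * P1 / d) ^+ 2 + (a2 - a * P * P2 / d) ^+ 2).
    by rewrite addr_ge0 ?sqr_ge0.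
  by field.
have [N1 N10 hN1] := disc_bounded r0 cf1; have [N2 N20 hN2] := disc_bounded r0 cf2.
have [N3 N30 hN3] := disc_bounded r0 cf0; have [N4 N40 hN4] := disc_bounded r0 cG.
have lim := @disc_dominated R rho A (fun q => f1 q ^+ 2 + f2 q ^+ 2 - 1 / 2 * f q ^+ 2)
  (N1 ^+ 2 + N2 ^+ 2 + N3 ^+ 2 + N4 * (C / M) ^+ 2) r0 cA.
(* Near the nodal line [f] is at most of the order of Phi. This bounds the error f^2 |grad Phi|^2
   delta / D^2 uniformly and makes [f] vanish where Phi does. *)
have fP q : disc rho q -> f q ^+ 2 <= (C / M) ^+ 2 * Phi q ^+ 2.
  move=> Dq; have h := hf q Dq; have hm := hM q Dq.
  have h1 : f q ^+ 2 <= C ^+ 2 * slope al be q ^+ 2.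
    rewrite -(real_normK (num_real (f q))) -(real_normK (num_real (slope _ _ _))) -exprMn.
    have C1 : 0 <= C * `|slope al be q| by apply: le_trans h.
    by rewrite ler_pXn2r ?nnegrE.
  have -> : (C / M) ^+ 2 * Phi q ^+ 2 = C ^+ 2 * slope al be q ^+ 2 * (clifford (radius (1 / 2) q) / M) ^+ 2.
    by rewrite /Phi /mode; field; rewrite gt_eqF.
  apply: (le_trans h1); apply: ler_peMr; first by rewrite mulr_ge0 ?sqr_ge0.
  apply: exprn_ege1; rewrite ler_pdivlMr// (mul1r M); exact: hm.
suff L : \int[mu2]_(q in disc rho) A k q @[k --> \oo] -->
    \int[mu2]_(q in disc rho) (f1 q ^+ 2 + f2 q ^+ 2 - 1 / 2 * f q ^+ 2).
  rewrite -(cvg_lim (@Rhausdorff R) L); apply: limr_ge; first exact: cvgP L.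
  by apply: nearW => k; exact: A0.
apply: lim.
- apply: continuous_sub; first by apply: continuous_add; exact: continuous_exp.
  by apply: continuous_mul => //; exact: continuous_exp.
- move=> q Dq; rewrite /A -[X in _ --> X]mul1r; apply: cvgM; first exact: bubble_cvg.
  have [P0|P0] := eqVneq (Phi q) 0.
    have f0 : f q = 0.
      have := fP q Dq; rewrite P0 expr0n/= mulr0 => h.
      by apply/eqP; rewrite -sqrf_eq0 eq_le h sqr_ge0.
    under eq_fun do rewrite f0 expr0n/= !mul0r mulr0 subr0 addr0.
    by rewrite f0 expr0n/= mulr0 subr0; exact: cvg_cst.
  have P2 : Phi q ^+ 2 != 0 by rewrite sqrf_eq0.
  have cDk : (fun k => (D k q)^-1) @ \oo --> (Phi q ^+ 2)^-1.
    apply: cvgV => //; rewrite -[X in _ --> X]addr0; apply: cvgD; [exact: cvg_cst|exact: cvg_harmonic].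
  rewrite -[X in _ --> X]addr0; apply: cvgD.
    apply: cvgB; first exact: cvg_cst.
    apply: cvgMr; rewrite -[X in _ --> X](mulfK P2); apply: cvgMr; exact: cDk.
  rewrite -(mul0r ((Phi q ^+ 2)^-1 * (Phi q ^+ 2)^-1)); apply: cvgM; last exact: cvgM.
  by rewrite -(mulr0 (f q ^+ 2 * G q)); apply: cvgMr; exact: cvg_harmonic.
- move=> k q Dq; rewrite /A normrM -[leRHS]mul1r; apply: ler_pM => //.
    by rewrite ger0_norm ?bubble_ge0// expinv0_le1.
  have s1 : f1 q ^+ 2 <= N1 ^+ 2 by rewrite -(real_normK (num_real (f1 q))) ler_pXn2r ?nnegrE// hN1.
  have s2 : f2 q ^+ 2 <= N2 ^+ 2 by rewrite -(real_normK (num_real (f2 q))) ler_pXn2r ?nnegrE// hN2.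
  have s3 : f q ^+ 2 <= N3 ^+ 2 by rewrite -(real_normK (num_real (f q))) ler_pXn2r ?nnegrE// hN3.
  have G0 : 0 <= G q by rewrite addr_ge0 ?sqr_ge0.
  have s4 : G q <= N4 by apply: (le_trans (ler_norm _)); exact: hN4.
  set X := f q ^+ 2 * Phi q ^+ 2 / D k q; set Y := f q ^+ 2 * G q * _ * _.
  have X0 : 0 <= X by apply: (divr_ge0 (mulr_ge0 (sqr_ge0 _) (sqr_ge0 _))); exact: ltW.
  have X1 : X <= f q ^+ 2.
    by rewrite ler_pdivrMr// ler_wpM2l ?sqr_ge0// lerDl ltW.
  have Di0 : 0 <= (D k q)^-1 * (D k q)^-1 by rewrite mulr_ge0// invr_ge0 ltW.
  have Y0 : 0 <= Y by apply: (mulr_ge0 (mulr_ge0 (mulr_ge0 (sqr_ge0 _) G0) _) Di0); exact: ltW.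
  have Y1 : Y <= N4 * (C / M) ^+ 2.
    have -> : Y = G q * (f q ^+ 2 * @harmonic R k * ((D k q)^-1 * (D k q)^-1)) by rewrite /Y; ring.
    apply: ler_pM => //; first by apply: (mulr_ge0 (mulr_ge0 (sqr_ge0 _) _) Di0); exact: ltW.
    have -> : f q ^+ 2 * @harmonic R k * ((D k q)^-1 * (D k q)^-1) = f q ^+ 2 * @harmonic R k / (D k q) ^+ 2.
      by rewrite -invfM expr2.
    rewrite ler_pdivrMr ?exprn_gt0//.
    apply: (@le_trans _ _ ((C / M) ^+ 2 * Phi q ^+ 2 * @harmonic R k)).
      by apply: ler_wpM2r; [exact: ltW|exact: fP].
    rewrite -mulrA ler_wpM2l ?sqr_ge0// /D; have := h0 k; have := sqr_ge0 (Phi q); nra.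
  have f10 := sqr_ge0 (f1 q); have f20 := sqr_ge0 (f2 q); have CM0 := sqr_ge0 (C / M).
  have NC : 0 <= N4 * (C / M) ^+ 2 by rewrite mulr_ge0.
  have n1 := sqr_ge0 N1; have n2 := sqr_ge0 N2; have n3 := sqr_ge0 N3.
  by move: X0 X1 Y0 Y1 s1 s2 s3 f10 f20 NC n1 n2; rewrite ler_norml; clear; lra.
Qed.

(* When [m = (j / rho)^2] the mode satisfies the Neumann condition on the
   circle, so the boundary term vanishes in the limit. *)
Lemma mode_energy rho (al be : R) : 0 < rho -> let m := (j / rho) ^+ 2 in
  \int[mu2]_(q in disc rho) (mode1 al be m q ^+ 2 + mode2 al be m q ^+ 2 - m * mode al be m q ^+ 2) = 0.
Proof.
move=> r0 m; have [j0 _ _] := hj.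
pose Phi := mode al be m; pose Phi1 := mode1 al be m; pose Phi2 := mode2 al be m.
have cPhi : C1_plane Phi Phi1 Phi2 by exact: C1_mode.
have [cP cP1 cP2 dP1 dP2] := cPhi.
have ck (k : R) : continuous (fun _ : R * R => k) by exact: continuous_const.
pose F q := Phi1 q ^+ 2 + Phi2 q ^+ 2 - m * Phi q ^+ 2.
have cF : continuous F.
  apply: continuous_sub; first by apply: continuous_add; exact: continuous_exp.
  by apply: continuous_mul => //; exact: continuous_exp.
have mE : m * rho ^+ 2 = j ^+ 2 by rewrite /m; field; rewrite gt_eqF.
have m0 : 0 <= m by rewrite sqr_ge0.
have rad q : disc rho q -> 0 <= radius m q <= j ^+ 2 / 4.
  rewrite /disc /radius /= => h; have := sqr_ge0 q.1; have := sqr_ge0 q.2; nra.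
(* The flux vanishes at t = j^2 / 4, hence is bounded by a multiple of j^2 / 4 - t; this is the
   factor that [bubble_gapE] absorbs. *)
have [K K0 hK] : exists2 K, 0 <= K & forall t, 0 <= t <= j ^+ 2 / 4 -> `|clifford_flux t| <= K * (j ^+ 2 / 4 - t).
  have dfl (t : R) : is_derive t 1 (@clifford_flux R) (- (clifford' t + 2 * clifford t)).
    have h := is_derive1D (is_derive_clifford t) (is_derive1M (is_derive1Z 2 (is_derive1_id t)) (is_derive_clifford' t)).
    by apply: (is_derive1_eq h); have := clifford_ode t; lra.
  have cd : continuous (fun t : R => - (clifford' t + 2 * clifford t)).
    apply: continuous_opp; apply: continuous_add; first exact: continuous_clifford'.
    by apply: continuous_mul; [exact: continuous_const|exact: continuous_clifford].
  have [K K0 hK] := continuous_compact_bounded (@segment_compact R 0 (j ^+ 2 / 4)) cd.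
  exists K => // t /andP[t0 tj].
  have [c cI E] := @MVT_segment _ (@clifford_flux R) _ _ _ tj (fun x _ => dfl x)
    (continuous_subspaceT (@continuous_clifford_flux R)).
  move: E; rewrite (clifford_flux_zero hj) sub0r => E.
  rewrite -normrN E normrM (@ger0_norm _ (_ - t)) ?subr_ge0// ler_wpM2r ?subr_ge0//.
  by apply: hK; move: cI; rewrite /= !in_itv/= => /andP[h1 h2]; rewrite h2 andbT (le_trans t0).
have [N1 N10 hN1] := disc_bounded r0 cF.
have cz : continuous (slope al be) by exact: continuous_slope.
have [N2 N20 hN2] := disc_bounded r0 cP; have [N3 N30 hN3] := disc_bounded r0 cz.
pose A (k : nat) q := bubble 0 rho k.+1%:R q * (Phi1 q * Phi1 q + Phi2 q * Phi2 q - m * (Phi q * Phi q)).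
pose B (k : nat) q := 2 * k.+1%:R * bubble 2 rho k.+1%:R q * Phi q * (q.1 * Phi1 q + q.2 * Phi2 q).
have AE k q : A k q = bubble 0 rho k.+1%:R q * F q by rewrite /A /F !expr2.
have cA k : continuous (A k).
  by rewrite (funext (AE k)); apply: continuous_mul => //; exact: continuous_bubble.
have cB k : continuous (B k).
  have b2 := @continuous_bubble R 2 rho k.+1%:R.
  apply: continuous_mul; first by apply: continuous_mul => //; apply: continuous_mul.
  by apply: continuous_add; apply: continuous_mul => //; [exact: continuous_fst|exact: continuous_snd].
have AB k : \int[mu2]_(q in disc rho) A k q = \int[mu2]_(q in disc rho) B k q.
  exact: (green r0 (ler0n R k.+1) cPhi cPhi (@continuous_mode11 _ al be m) (@continuous_mode22 _ al be m)
    (@is_partial1_mode1 _ al be m) (@is_partial2_mode2 _ al be m) (@laplacian_mode _ al be m)).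
have limA : \int[mu2]_(q in disc rho) A k q @[k --> \oo] --> \int[mu2]_(q in disc rho) F q.
  apply: (@disc_dominated R rho A F N1 r0 cA cF).
  - move=> q Dq; rewrite -[X in _ --> X]mul1r; under eq_fun do rewrite AE.
    by apply: cvgMl; exact: bubble_cvg.
  - move=> k q Dq; rewrite AE normrM -[leRHS]mul1r; apply: ler_pM => //; last exact: hN1.
    by rewrite ger0_norm ?bubble_ge0// expinv0_le1.
have Bb k q : disc rho q -> `|B k q| <= (2 * N2 * N3 * K * (m / 4)) * bubble 1 rho k.+1%:R q.
  move=> Dq; rewrite /B radial_mode -(bubble_gapE rho q (ltr0Sn R k)) !normrM.
  rewrite (@ger0_norm _ (bubble _ _ _ _)) ?bubble_ge0// !(@ger0_norm _ _%:R)//.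
  have hf := hK _ (rad q Dq).
  have E : j ^+ 2 / 4 - radius m q = m / 4 * (rho ^+ 2 - (q.1 ^+ 2 + q.2 ^+ 2)).
    by rewrite /radius -mE; field.
  rewrite E in hf.
  have b0 := bubble_ge0 2 rho k.+1%:R q.
  apply: (@le_trans _ _ (2 * k.+1%:R * bubble 2 rho k.+1%:R q * N2 * (N3 * (K * (m / 4 * (rho ^+ 2 - (q.1 ^+ 2 + q.2 ^+ 2))))))).
    apply: ler_pM => //; first by rewrite mulr_ge0// mulr_ge0.
    by apply: ler_wpM2l; [rewrite !mulr_ge0|rewrite -normrM; exact: hN2].
    by apply: ler_pM => //; exact: hN3.
  by rewrite le_eqVlt; apply/orP; left; apply/eqP; ring.
have limB : \int[mu2]_(q in disc rho) B k q @[k --> \oo] --> \int[mu2]_(q in disc rho) (0 : R).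
  apply: (@disc_dominated R rho B (fun=> 0) (2 * N2 * N3 * K * (m / 4)) r0 cB) => //.
  - move=> q Dq; apply: norm_cvg0; apply: (@squeeze_cvgr _ _ _ _ (fun=> 0)
      (fun k => (2 * N2 * N3 * K * (m / 4)) * bubble 1 rho k.+1%:R q)).
    + by apply: nearW => k; rewrite normr_ge0 Bb.
    + exact: cvg_cst.
    + by rewrite -(mulr0 (2 * N2 * N3 * K * (m / 4))); apply: cvgMr; exact: bubble1_cvg.
  - move=> k q Dq; apply: (le_trans (Bb k q Dq)); rewrite ler_piMr ?expinv1_le1//.
    have m4 : 0 <= m / 4 by rewrite divr_ge0.
    by apply: (mulr_ge0 _ m4); rewrite !mulr_ge0.
have -> : \int[mu2]_(q in disc rho) (mode1 al be m q ^+ 2 + mode2 al be m q ^+ 2 - m * mode al be m q ^+ 2) =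
  \int[mu2]_(q in disc rho) F q by [].
rewrite (funext AB) in limA.
by rewrite -(cvg_lim (@Rhausdorff R) limA) (cvg_lim (@Rhausdorff R) limB) Rintegral_eq0.
Qed.

End odd_functions.

(** * A chain rule along graphs *)

Section chain_rule.
Context {R : realType}.
Implicit Types (x y : R) (f : R * R -> R) (phi : R -> R).

Lemma MVT_between (g g' : R -> R) (u v : R) : (forall x, is_derive x 1 g (g' x)) ->
  exists c, `|c - v| <= `|u - v| /\ g u - g v = g' c * (u - v).
Proof.
move=> dg; have cg := is_derive_continuous dg.
have [uv|vu] := leP u v.
  have [c cI E] := @MVT_segment _ g g' u v uv (fun x _ => dg x) (continuous_subspaceT cg).
  exists c; move: cI; rewrite in_itv/= => /andP[h1 h2]; split; last by rewrite -opprB E; ring.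
  by rewrite !ler0_norm ?subr_le0//; lra.
have [c cI E] := @MVT_segment _ g g' v u (ltW vu) (fun x _ => dg x) (continuous_subspaceT cg).
exists c; move: cI; rewrite in_itv/= => /andP[h1 h2]; split; last by rewrite E.
by rewrite !ger0_norm ?subr_ge0//; lra.
Qed.

Lemma is_derive_near_iff (g : R -> R) (c l : R) :
  (forall e, 0 < e -> \forall x \near c, `|g x - g c - l * (x - c)| <= e * `|x - c|) ->
  is_derive c 1 g l.
Proof.
move=> hg; suff h : (fun h : R => h^-1 *: (g (h *: (1 : R) + c) - g c)) @ 0^' --> l.
  by apply: DeriveDef; [exact: (cvgP _ h)|exact: (cvg_lim (@Rhausdorff R) h)].
apply/cvgrPdist_le => e e0.
have /nbhs_ballP[d /= d0 hd] := hg e e0.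
rewrite near_withinE; apply/nbhs_ballP; exists d => //= h; rewrite -ball_normE/= sub0r normrN => hd' h0.
have := hd (h + c); rewrite -ball_normE/= opprD addrCA subrr addr0 normrN => /(_ hd').
rewrite addrK /GRing.scale/= mulr1 => E.
have -> : l - h^-1 * (g (h + c) - g c) = - (g (h + c) - g c - l * h) / h by field.
by rewrite normrM normrN normfV ler_pdivrMr ?normr_gt0.
Qed.

(** The mean value theorem in the first variable and continuity of [f1] take the place of total
    differentiability. The curves needed are the images under [elliptic] of the lines x = const. *)
Lemma C1_plane_chain f f1 f2 phi (phi' : R) y : C1_plane f f1 f2 -> is_derive y 1 phi phi' ->
  is_derive y 1 (fun t => f (phi t, t)) (f1 (phi y, y) * phi' + f2 (phi y, y)).
Proof.
move=> [cf cf1 cf2 df1 df2] dphi; apply: is_derive_near_iff => e e0.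
pose A := `|f1 (phi y, y)| + 1; pose K := `|phi'| + 1.
have A0 : 0 < A by rewrite ltr_pwDr.
have K0 : 0 < K by rewrite ltr_pwDr.
pose e1 := e / (3 * K); pose e2 := Num.min 1 (e / (3 * A)).
have e10 : 0 < e1 by rewrite divr_gt0// mulr_gt0.
have e20 : 0 < e2 by rewrite lt_min ltr01 divr_gt0// mulr_gt0.
have e30 : 0 < e / 3 by rewrite divr_gt0.
have phi0 : is_derive y 1 (fun t => phi t - phi y) phi'.
  by apply: (is_derive1_eq (is_derive1B dphi (is_derive1_cst (phi y) y))); rewrite subr0.
have n1 := is_derive_near phi0 (subrr _) e20.
have f20 : is_derive y 1 (fun t => f (phi y, t) - f (phi y, y)) (f2 (phi y, y)).
  by apply: (is_derive1_eq (is_derive1B (df2 (phi y) y) (is_derive1_cst (f (phi y, y)) y))); rewrite subr0.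
have n2 := is_derive_near f20 (subrr _) e30.
have c1 : \forall q \near (phi y, y), `|f1 (phi y, y) - f1 q| <= e1.
  by have /cvgr_dist_le := cf1 (phi y, y); apply.
have [d /= d0 hd] := (iffLR (nbhs_ballP _ _)) c1.
have cphi := is_derive_continuous_at dphi.
have n3 : \forall t \near y, `|phi y - phi t| < d.
  by have /cvgr_dist_lt := cphi; apply.
have n4 : \forall t \near y, `|y - t| < d.
  by apply/nbhs_ballP; exists d => // t; rewrite -ball_normE.
near=> t.
have h1 : `|phi t - phi y - phi' * (t - y)| <= e2 * `|t - y| by near: t.
have h2 : `|f (phi y, t) - f (phi y, y) - f2 (phi y, y) * (t - y)| <= e / 3 * `|t - y| by near: t.
have h3 : `|phi y - phi t| < d by near: t.
have h4 : `|y - t| < d by near: t.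
have [c [cc E]] := @MVT_between (fun x => f (x, t)) (fun x => f1 (x, t)) (phi t) (phi y) (fun x => df1 x t).
have h5 : `|f1 (phi y, y) - f1 (c, t)| <= e1.
  apply: hd; split; rewrite -ball_normE/=; last by [].
  by rewrite distrC (le_lt_trans cc)// distrC.
have t0 := normr_ge0 (t - y).
have h6 : `|phi t - phi y| <= K * `|t - y|.
  rewrite -[phi t - phi y](subrK (phi' * (t - y))) (le_trans (ler_normD _ _))//.
  rewrite normrM /K mulrDl mul1r addrC lerD2l (le_trans h1)// ler_piMl//.
  by rewrite /e2 ge_min lexx.
have -> : f (phi t, t) - f (phi y, y) - (f1 (phi y, y) * phi' + f2 (phi y, y)) * (t - y) =
   (f1 (c, t) - f1 (phi y, y)) * (phi t - phi y) + f1 (phi y, y) * (phi t - phi y - phi' * (t - y)) +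
   (f (phi y, t) - f (phi y, y) - f2 (phi y, y) * (t - y)).
  have -> : f (phi t, t) = f (phi y, t) + f1 (c, t) * (phi t - phi y) by rewrite -E; ring.
  ring.
apply: (le_trans (ler_normD _ _)); rewrite (_ : e * _ = e / 3 * `|t - y| + e / 3 * `|t - y| + e / 3 * `|t - y|); last by field.
apply: lerD => //; apply: (le_trans (ler_normD _ _)); rewrite !normrM; apply: lerD.
  rewrite distrC; apply: (@le_trans _ _ (e1 * (K * `|t - y|))); first exact: ler_pM.
  by rewrite le_eqVlt; apply/orP; left; apply/eqP; rewrite /e1; field; rewrite gt_eqF.
apply: (@le_trans _ _ (A * (e / (3 * A) * `|t - y|))).
  apply: ler_pM => //; first by rewrite /A lerDl.
  by rewrite (le_trans h1)// ler_wpM2r// /e2 ge_min lexx orbT.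
by rewrite le_eqVlt; apply/orP; left; apply/eqP; field; rewrite gt_eqF.
Unshelve. all: by end_near. Qed.

End chain_rule.

(** * A Poincare inequality for functions even in both coordinates *)

Section planar_poincare.
Context {R : realType}.
Local Notation mR := (measurableTypeR R).
Local Notation T2 := (mR * mR)%type.
Local Notation mu := (@lebesgue_measure R).
Local Notation mu2 := (@lebesgue2 R).
Implicit Types (rho x y : R) (q : R * R) (a f : R * R -> R).

(** The polynomial (rho^2 - y^2) / rho is a minorant of the half chord l, since l^2 <= rho l, and
    has an explicit primitive. *)
Lemma half_chord_integral_gt0 rho : 0 < rho -> 0 < \int[mu]_(y in `[- rho, rho]%classic) half_chord rho y.
Proof.
move=> r0; have rr : - rho <= rho by lra.
have cg : continuous (fun y : R => (rho ^+ 2 - y ^+ 2) / rho).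
  apply: continuous_mul; last exact: continuous_const.
  by apply: continuous_sub; [exact: continuous_const|apply: continuous_exp; exact: continuous_self].
have dg (y : R) : is_derive y 1 (fun y : R => (rho ^+ 2 * y - y ^+ 3 / 3) / rho) ((rho ^+ 2 - y ^+ 2) / rho).
  have h := is_derive1M (is_derive1B (is_derive1Z (rho ^+ 2) (is_derive1_id y))
    (is_derive1M (is_derive1X 3 (is_derive1_id y)) (is_derive1_cst 3^-1 y))) (is_derive1_cst rho^-1 y).
  by apply: (is_derive1_eq h); rewrite /=; field; rewrite gt_eqF.
have : 0 < \int[mu]_(y in `[- rho, rho]%classic) ((rho ^+ 2 - y ^+ 2) / rho).
  rewrite (FTC_segment rr cg (fun y _ => dg y)).
  rewrite (_ : _ - _ = 4 / 3 * rho ^+ 2); last by field; rewrite gt_eqF.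
  by rewrite mulr_gt0// ?exprn_gt0// divr_gt0.
move=> /lt_le_trans; apply; apply: le_Rintegral'.
- exact: measurable_itv.
- exact: segment_Rintegrable.
- by apply: segment_Rintegrable; exact: continuous_half_chord.
- move=> y; rewrite /= in_itv/= => yr; have h2 := half_chord_sqr yr.
  have h0 := half_chord_ge0 rho y.
  have hr : half_chord rho y <= rho.
    by rewrite -(@ler_pXn2r _ 2)// ?nnegrE ?(ltW r0)// h2; have := sqr_ge0 y; lra.
  by rewrite ler_pdivrMr// -h2; nra.
Qed.

(** On each line x = const of the rectangle, [gegenbauer_inequality] and [weighted_mean] bound a - c
    up to the deviation from the trace on x = [k]; on each chord [legendre_inequality] bounds that
    deviation. The factor rho^2 / 4 is at most 2 once rho^2 <= 8, as the symmetric part requires. *)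
Lemma even_poincare rho a a1 a2 : 0 < rho -> C1_plane a a1 a2 ->
  (forall x y, a (- x, y) = a (x, y)) -> (forall x y, a (x, - y) = a (x, y)) ->
  exists c, \int[mu2]_(q in disc rho) ((a q - c) ^+ 2) <=
    rho ^+ 2 / 4 * \int[mu2]_(q in disc rho) (a1 q ^+ 2 + a2 q ^+ 2).
Proof.
move=> r0 Ca ex ey; have [ca ca1 ca2 da1 da2] := Ca.
pose l := half_chord rho; pose E := elliptic rho; pose p q := a (E q).
pose k : R := Num.sqrt (1 / 3).
have k0 : 0 < k by rewrite sqrtr_gt0 divr_gt0.
have k3 : 3 * k ^+ 2 = 1 by rewrite sqr_sqrtr; [field|rewrite divr_ge0].
have cl : continuous l by exact: continuous_half_chord.
have cl2 : continuous (fun q : R * R => l q.2) by exact: continuous_half_chord2.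
have cE : continuous E by exact: continuous_elliptic.
have cp : continuous p by exact: (continuous_compose cE ca).
have c1E : continuous (fun q => a1 (E q)) by exact: (continuous_compose cE ca1).
have c2E : continuous (fun q => a2 (E q)) by exact: (continuous_compose cE ca2).
have cx : continuous (fun q : R * R => q.1) by exact: continuous_fst.
have cy : continuous (fun q : R * R => q.2) by exact: continuous_snd.
have ck (u : R) : continuous (fun _ : R * R => u) by exact: continuous_const.
have cpk : continuous (fun q : R * R => p (k, q.2)).
  apply: (continuous_compose (f := fun q : R * R => (k, q.2))) => //.
  exact: continuous_pair.
have L0 := half_chord_integral_gt0 r0.
(* The weighted mean of the trace on x = [k]: the same constant for all lines x = const. *)
pose c := (\int[mu]_(y in `[- rho, rho]%classic) (l y * p (k, y))) / \int[mu]_(y in `[- rho, rho]%classic) l y.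
exists c.
pose N q := l q.2 * (l q.2 * a2 (E q) - q.1 * q.2 * a1 (E q)) ^+ 2.
pose F1 q := l q.2 * (p q - c) ^+ 2.
pose F3 q := l q.2 * (p q - p (k, q.2)) ^+ 2.
pose W q := l q.2 * ((1 - q.1 ^+ 2) * (l q.2 * a1 (E q)) ^+ 2).
pose G q := l q.2 * (a1 (E q) ^+ 2 + a2 (E q) ^+ 2).
have cN : continuous N.
  apply: continuous_mul => //; apply: continuous_exp; apply: continuous_sub; first exact: continuous_mul.
  by apply: continuous_mul => //; exact: continuous_mul.
have cF1 : continuous F1 by apply: continuous_mul => //; apply: continuous_exp; exact: continuous_sub.
have cF3 : continuous F3 by apply: continuous_mul => //; apply: continuous_exp; exact: continuous_sub.
have cW : continuous W.
  apply: continuous_mul => //; apply: continuous_mul.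
    by apply: continuous_sub => //; exact: continuous_exp.
  by apply: continuous_exp; exact: continuous_mul.
have cG : continuous G by apply: continuous_mul => //; apply: continuous_add; exact: continuous_exp.
pose Q := (`[- 1, 1]%classic `*` `[- rho, rho]%classic) : set T2.
have mQ : measurable Q by apply: measurableX; exact: measurable_itv.
have iQ g : continuous g -> Rintegrable mu2 Q g by exact: rect_Rintegrable.
have cD1 : continuous (fun q => (a q - c) ^+ 2) by apply: continuous_exp; exact: continuous_sub.
have cD2 : continuous (fun q => a1 q ^+ 2 + a2 q ^+ 2) by apply: continuous_add; exact: continuous_exp.
rewrite (disc_elliptic r0 cD1) (disc_elliptic r0 cD2) -/Q.
rewrite -(RintegralZ' mQ _ (iQ _ cG)) -subr_ge0 -(RintegralB' mQ (RintegrableZ mQ _ (iQ _ cG)) (iQ _ cF1)).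
have c8N : continuous (fun q => 1 / 8 * N q) by exact: continuous_mul.
have c6W : continuous (fun q => 1 / 6 * W q) by exact: continuous_mul.
have c1 : continuous (fun q => 1 / 8 * N q + F3 q - F1 q).
  by apply: continuous_sub => //; exact: continuous_add.
have c2 : continuous (fun q => 1 / 6 * W q - F3 q) by exact: continuous_sub.
have c3 : continuous (fun q => rho ^+ 2 / 4 * G q - 1 / 8 * N q - 1 / 6 * W q).
  by apply: continuous_sub => //; apply: continuous_sub => //; exact: continuous_mul.
(* Three nonnegative integrals: lines x = const, chords, and a pointwise remainder. The weights 1/8
   and 1/6 are the inverse eigenvalues of the two one-dimensional problems. *)
have -> : \int[mu2]_(q in Q) (rho ^+ 2 / 4 * G q - F1 q) =
    \int[mu2]_(q in Q) (1 / 8 * N q + F3 q - F1 q) + \int[mu2]_(q in Q) (1 / 6 * W q - F3 q) +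
    \int[mu2]_(q in Q) (rho ^+ 2 / 4 * G q - 1 / 8 * N q - 1 / 6 * W q).
  rewrite -(RintegralD' mQ (iQ _ c1) (iQ _ c2)) -(RintegralD' mQ (iQ _ (continuous_add c1 c2)) (iQ _ c3)).
  by apply: eq_Rintegral => q _; ring.
have mr : measurable (`[- rho, rho]%classic : set mR) by exact: measurable_itv.
have m1 : measurable (`[- 1, 1]%classic : set mR) by exact: measurable_itv.
have rr : - rho <= rho by lra.
apply: addr_ge0; first apply: addr_ge0.
- rewrite (rect_fubini _ _ c1).1; apply: Rintegral_ge0 => x _.
  have cpx : continuous (fun y => p (x, y)) by exact: continuous_slice2.
  have cpkx : continuous (fun y => p (k, y)) by exact: continuous_slice2.
  have cNx : continuous (fun y => N (x, y)) by exact: continuous_slice2.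
  have cF1x : continuous (fun y => F1 (x, y)) by exact: continuous_slice2.
  have cF3x : continuous (fun y => F3 (x, y)) by exact: continuous_slice2.
  have cl8 : continuous (fun y => 1 / 8 * N (x, y)) by apply: continuous_mul => //; exact: continuous_const.
  have ir g : continuous g -> Rintegrable mu `[- rho, rho]%classic g by exact: segment_Rintegrable.
  have hm : c * \int[mu]_(y in `[- rho, rho]%classic) l y = \int[mu]_(y in `[- rho, rho]%classic) (l y * p (k, y)).
    by rewrite /c divfK// gt_eqF.
  have h1 := weighted_mean (p (x, rho / 2)) rr cl cpx cpkx (half_chord_ge0 rho) L0 hm.
  have h2 : 8 * \int[mu]_(y in `[- rho, rho]%classic) (l y * (p (x, y) - p (x, rho / 2)) ^+ 2) <=
      \int[mu]_(y in `[- rho, rho]%classic) N (x, y).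
    apply: (@gegenbauer_inequality _ rho (fun y => p (x, y))
      (fun y => a1 (E (x, y)) * (- y / l y * x) + a2 (E (x, y)))) => //.
    + move=> y yr; have l0 := half_chord_gt0 yr; split; last first.
        by rewrite /N /= -/(l y); field; rewrite gt_eqF.
      have dl := is_derive1M (is_derive_half_chord yr) (is_derive1_cst x y).
      have h := @C1_plane_chain _ a a1 a2 (fun y => half_chord rho y * x) _ y Ca dl.
      by apply: (is_derive1_eq h); rewrite mulr0 addr0.
    + by move=> y; rewrite /p /E /elliptic /= half_chordN ey.
  rewrite (RintegralB' mr (RintegrableD mr (ir _ cl8) (ir _ cF3x)) (ir _ cF1x)).
  rewrite (RintegralD' mr (ir _ cl8) (ir _ cF3x)) (RintegralZ' mr _ (ir _ cNx)).
  rewrite /F1 /F3 /=; lra.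
- rewrite (rect_fubini _ _ c2).2; apply: Rintegral_ge0 => y _.
  have cpy : continuous (fun x => p (x, y)) by exact: continuous_slice1.
  have cWy : continuous (fun x => W (x, y)) by exact: continuous_slice1.
  have cF3y : continuous (fun x => F3 (x, y)) by exact: continuous_slice1.
  have ir g : continuous g -> Rintegrable mu `[- 1, 1]%classic g by exact: segment_Rintegrable.
  have cl6 : continuous (fun x => 1 / 6 * W (x, y)) by apply: continuous_mul => //; exact: continuous_const.
  have dp (x : R) : is_derive x 1 (fun x => p (x, y)) (l y * a1 (E (x, y))).
    have dl := is_derive1Z (l y) (is_derive1_id x).
    have h := @is_derive1_compose _ (fun x => a (x, y)) (fun x => l y * x) x _ _ (da1 _ _) dl.
    by apply: (is_derive1_eq h); rewrite mulr1 mulrC.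
  have cp' : continuous (fun x => l y * a1 (E (x, y))).
    apply: continuous_mul; first exact: continuous_const.
    exact: (@continuous_slice1 _ (fun q => a1 (E q))).
  have pe (x : R) : p (- x, y) = p (x, y) by rewrite /p /E /elliptic /= mulrN ex.
  have h := legendre_inequality k0 k3 cp' dp pe.
  have cq1 : continuous (fun x => (p (x, y) - p (k, y)) ^+ 2).
    by apply: continuous_exp; apply: continuous_sub => //; exact: continuous_const.
  have cq2 : continuous (fun x => (1 - x ^+ 2) * (l y * a1 (E (x, y))) ^+ 2).
    apply: continuous_mul; last exact: continuous_exp.
    by apply: continuous_sub; [exact: continuous_const|apply: continuous_exp; exact: continuous_self].
  rewrite (RintegralB' m1 (ir _ cl6) (ir _ cF3y)) (RintegralZ' m1 _ (ir _ cWy)) /W /F3 /=.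
  rewrite (RintegralZ' m1 _ (ir _ cq1)) (RintegralZ' m1 _ (ir _ cq2)).
  by have := half_chord_ge0 rho y; rewrite -/(l y); nra.
- apply: Rintegral_ge0 => -[x y] [/=]; rewrite !in_itv/= => x1 yr.
  have l2 := half_chord_sqr yr; have l0 := half_chord_ge0 rho y.
  rewrite /G /N /W /= -/(l y) in l2 l0 *; set A1 := a1 _; set A2 := a2 _.
  have -> : rho ^+ 2 / 4 * (l y * (A1 ^+ 2 + A2 ^+ 2)) - 1 / 8 * (l y * (l y * A2 - x * y * A1) ^+ 2) -
     1 / 6 * (l y * ((1 - x ^+ 2) * (l y * A1) ^+ 2)) =
     l y * (rho ^+ 2 / 4 * (A1 ^+ 2 + A2 ^+ 2) - 1 / 8 * (l y * A2 - x * y * A1) ^+ 2 -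
     1 / 6 * ((1 - x ^+ 2) * (l y ^+ 2 * A1 ^+ 2))) by ring.
  apply: mulr_ge0 => //.
  have rE : rho ^+ 2 = l y ^+ 2 + y ^+ 2 by rewrite l2; ring.
  have x2 : 0 <= 1 - x ^+ 2 by nra.
  (* An explicit sum of squares with nonnegative weights for |x| <= 1, after rho^2 = l^2 + y^2. *)
  rewrite rE [X in 0 <= X](_ : _ = 1 / 8 * (l y * A2 + x * y * A1) ^+ 2 + 1 / 4 * (y * A2) ^+ 2 +
    1 / 12 * (l y * A1) ^+ 2 + 1 / 4 * ((1 - x ^+ 2) * (y * A1) ^+ 2) + 1 / 6 * (x * (l y * A1)) ^+ 2); last by field.
  have h1 : 0 <= (1 - x ^+ 2) * (y * A1) ^+ 2 by rewrite mulr_ge0 ?sqr_ge0.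
  have h2 := sqr_ge0 (l y * A2 + x * y * A1); have h3 := sqr_ge0 (y * A2).
  have h4 := sqr_ge0 (l y * A1); have h5 := sqr_ge0 (x * (l y * A1)).
  by lra.
Qed.

End planar_poincare.

(** * The Neumann gap by symmetrisation *)

Section neumann_gap.
Context {R : realType}.
Local Notation mR := (measurableTypeR R).
Local Notation T2 := (mR * mR)%type.
Local Notation mu2 := (@lebesgue2 R).
Implicit Types (rho x y s t k : R) (q : R * R) (f g : R * R -> R).

Definition flip s t q : R * R := (s * q.1, t * q.2).

Lemma continuous_flip s t : continuous (flip s t).
Proof.
by apply: continuous_pair; apply: continuous_mul; [exact: continuous_const|exact: continuous_fst|
  exact: continuous_const|exact: continuous_snd].
Qed.

Lemma C1_planeD f f1 f2 g g1 g2 : C1_plane f f1 f2 -> C1_plane g g1 g2 ->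
  C1_plane (fun q => f q + g q) (fun q => f1 q + g1 q) (fun q => f2 q + g2 q).
Proof.
move=> [a1 a2 a3 a4 a5] [b1 b2 b3 b4 b5]; split; [exact: continuous_add..| |].
- by move=> x y; exact: (is_derive1D (a4 x y) (b4 x y)).
- by move=> x y; exact: (is_derive1D (a5 x y) (b5 x y)).
Qed.

Lemma C1_planeZ k f f1 f2 : C1_plane f f1 f2 ->
  C1_plane (fun q => k * f q) (fun q => k * f1 q) (fun q => k * f2 q).
Proof.
have ck : continuous (fun _ : R * R => k) by exact: continuous_const.
move=> [a1 a2 a3 a4 a5]; split; [exact: continuous_mul..| |].
- by move=> x y; exact: (is_derive1Z k (a4 x y)).
- by move=> x y; exact: (is_derive1Z k (a5 x y)).
Qed.

Lemma C1_plane_flip s t f f1 f2 : C1_plane f f1 f2 ->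
  C1_plane (fun q => f (flip s t q)) (fun q => s * f1 (flip s t q)) (fun q => t * f2 (flip s t q)).
Proof.
have ck k : continuous (fun _ : R * R => k) by exact: continuous_const.
move=> [a1 a2 a3 a4 a5]; split.
- exact: (continuous_compose (@continuous_flip s t) a1).
- by apply: continuous_mul => //; exact: (continuous_compose (@continuous_flip s t) a2).
- by apply: continuous_mul => //; exact: (continuous_compose (@continuous_flip s t) a3).
- move=> x y; have h := @is_derive1_compose _ (fun x => f (x, t * y)) (fun x => s * x) x _ _
    (a4 _ _) (is_derive1Z s (is_derive1_id x)).
  by apply: (is_derive1_eq h); rewrite mulr1 mulrC.
- move=> x y; have h := @is_derive1_compose _ (fun y => f (s * x, y)) (fun y => t * y) y _ _
    (a5 _ _) (is_derive1Z t (is_derive1_id y)).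
  by apply: (is_derive1_eq h); rewrite mulr1 mulrC.
Qed.

Lemma disc_flip rho s t f : 0 < rho -> s ^+ 2 = 1 -> t ^+ 2 = 1 -> continuous f ->
  \int[mu2]_(q in disc rho) f (flip s t q) = \int[mu2]_(q in disc rho) f q.
Proof.
move=> r0 s1 t1 cf; apply: disc_preserving_integral => //.
  have h k : k ^+ 2 = 1 -> measure_preserving (@lebesgue_measure R) (fun x : mR => k * x : mR).
    move=> /eqP; rewrite sqrf_eq1 => /orP[/eqP->|/eqP->].
      rewrite (_ : (fun x => _) = id); first by split; [exact: measurable_id|by []].
      by apply/funext => x; rewrite mul1r.
    rewrite (_ : (fun x => _) = (fun x => - x)); first exact: preserving_opp.
    by apply/funext => x; rewrite mulN1r.
  exact: preserving2 (h s s1) (h t t1).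
by apply/seteqP; split => q; rewrite /disc /flip /= !exprMn s1 t1 !mul1r.
Qed.

Variable j : R.
Hypothesis hj : smallest_positive_zero (derive1 (bessel_J 1)) j.

Definition form f f1 f2 q : R := f1 q ^+ 2 + f2 q ^+ 2 - 1 / 2 * f q ^+ 2.

Lemma continuous_form f f1 f2 : C1_plane f f1 f2 -> continuous (form f f1 f2).
Proof.
move=> [a1 a2 a3 a4 a5]; apply: continuous_sub; first by apply: continuous_add; exact: continuous_exp.
by apply: continuous_mul; [exact: continuous_const|exact: continuous_exp].
Qed.

(* The part of [f] that is odd under a reflection vanishes on its axis, so that
   [odd_poincare] applies: it can only increase the form. *)
Lemma form_symmetrize rho s t f f1 f2 : 0 < rho -> rho ^+ 2 <= 2 * j ^+ 2 ->
  s ^+ 2 = 1 -> t ^+ 2 = 1 -> s * t = - 1 -> C1_plane f f1 f2 ->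
  exists g g1 g2, [/\ C1_plane g g1 g2,
    (forall q, g q = (f q + f (flip s t q)) / 2),
    \int[mu2]_(q in disc rho) g q = \int[mu2]_(q in disc rho) f q &
    \int[mu2]_(q in disc rho) form g g1 g2 q <= \int[mu2]_(q in disc rho) form f f1 f2 q].
Proof.
move=> r0 rj s1 t1 st cf.
have cff := C1_plane_flip s t cf.
have ce := C1_planeZ 2^-1 (C1_planeD cf cff).
have co := C1_planeZ 2^-1 (C1_planeD cf (C1_planeZ (-1) cff)).
set e := (fun q => 2^-1 * (f q + f (flip s t q))) in ce.
set e1 := (fun q => 2^-1 * (f1 q + s * f1 (flip s t q))) in ce.
set e2 := (fun q => 2^-1 * (f2 q + t * f2 (flip s t q))) in ce.
set o := (fun q => 2^-1 * (f q + -1 * f (flip s t q))) in co.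
set o1 := (fun q => 2^-1 * (f1 q + -1 * (s * f1 (flip s t q)))) in co.
set o2 := (fun q => 2^-1 * (f2 q + -1 * (t * f2 (flip s t q)))) in co.
have mD := measurable_disc rho.
have iD (u : R * R -> R) : continuous u -> Rintegrable mu2 (disc rho) u by exact: disc_Rintegrable.
have cq := continuous_form cf; have cqe := continuous_form ce; have cqo := continuous_form co.
have cfl (u : R * R -> R) : continuous u -> continuous (fun q => u (flip s t q)).
  by move=> cu; exact: (continuous_compose (@continuous_flip s t) cu).
have [cf0 cf1 cf2 _ _] := cf.
exists e, e1, e2; split => //.
- by move=> q; rewrite /e mulrC.
- rewrite /e (RintegralZ' mD _ (iD _ (continuous_add cf0 (cfl _ cf0)))).
  by rewrite (RintegralD' mD (iD _ cf0) (iD _ (cfl _ cf0))) (disc_flip r0 s1 t1 cf0); field.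
(* The parallelogram identity for the even and odd parts, integrated with the invariance of the disc
   under the flip. *)
have E : \int[mu2]_(q in disc rho) form f f1 f2 q =
    \int[mu2]_(q in disc rho) form e e1 e2 q + \int[mu2]_(q in disc rho) form o o1 o2 q.
  rewrite -(RintegralD' mD (iD _ cqe) (iD _ cqo)).
  transitivity (2^-1 * (\int[mu2]_(q in disc rho) form f f1 f2 q + \int[mu2]_(q in disc rho) form f f1 f2 (flip s t q))).
    by rewrite (disc_flip r0 s1 t1 cq); field.
  rewrite -(RintegralD' mD (iD _ cq) (iD _ (cfl _ cq))) -(RintegralZ' mD _ (iD _ (continuous_add cq (cfl _ cq)))).
  apply: eq_Rintegral => q _; rewrite /form /e /e1 /e2 /o /o1 /o2.
  set a := f1 (flip s t q); set b := f2 (flip s t q).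
  have -> : a ^+ 2 = (s * a) ^+ 2 by rewrite exprMn s1 mul1r.
  have -> : b ^+ 2 = (t * b) ^+ 2 by rewrite exprMn t1 mul1r.
  by field.
rewrite E lerDl.
have [co0 co1 co2 do1 do2] := co.
have [C1 C10 hC1] := box2_bounded rho co1; have [C2 C20 hC2] := box2_bounded rho co2.
have bx x y x' y' : box2 rho (x, y) -> `|x'| <= `|x| -> `|y'| <= `|y| -> box2 rho (x', y').
  move=> [/=]; rewrite !in_itv/= -!ler_norml => h1 h2 h3 h4.
  by split; rewrite /= in_itv/= -ler_norml; [exact: le_trans h3 h1|exact: le_trans h4 h2].
move: (s1) => /eqP; rewrite sqrf_eq1 => /orP[/eqP sE|/eqP sE].
  have tE : t = -1 by move: st; rewrite sE mul1r.
  apply: (@odd_poincare _ j hj rho 0 1 C2 o o1 o2) => // -[x y] /(disc_box r0) Bq.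
  have o0 : o (x, 0) = 0 by rewrite /o /flip sE /= mul1r mulr0; ring.
  have [c [cc Ec]] := @MVT_between _ (fun y => o (x, y)) (fun y => o2 (x, y)) y 0 (fun y => do2 x y).
  move: Ec cc; rewrite o0 !subr0 => -> cc; rewrite normrM /slope /= mul0r mul1r add0r ler_wpM2r// hC2//.
  exact: bx Bq _ _.
have tE : t = 1 by move: st; rewrite sE mulN1r => /oppr_inj.
apply: (@odd_poincare _ j hj rho 1 0 C1 o o1 o2) => // -[x y] /(disc_box r0) Bq.
have o0 : o (0, y) = 0 by rewrite /o /flip tE /= mul1r mulr0; ring.
have [c [cc Ec]] := @MVT_between _ (fun x => o (x, y)) (fun x => o1 (x, y)) x 0 (fun x => do1 x y).
move: Ec cc; rewrite o0 !subr0 => -> cc; rewrite normrM /slope /= mul0r mul1r addr0 ler_wpM2r// hC1//.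
exact: bx Bq _ _.
Qed.

Lemma disc_area_gt0 rho : 0 < rho -> 0 < \int[mu2]_(q in disc rho) (1 : R).
Proof.
move=> r0; have c0 : continuous (fun _ : R * R => (1:R)) by exact: continuous_const.
rewrite (disc_elliptic r0 c0).
have c1 : continuous (fun q : R * R => half_chord rho q.2 * 1).
  by apply: continuous_mul; [exact: continuous_half_chord2|exact: continuous_const].
rewrite (rect_fubini _ _ c1).1 /=.
have E : \int[@lebesgue_measure R]_(y in `[- rho, rho]%classic) (half_chord rho y * 1) =
    \int[@lebesgue_measure R]_(y in `[- rho, rho]%classic) half_chord rho y.
  by apply: eq_Rintegral => y _; rewrite mulr1.
have le11 : (-1 : R) <= 1 by lra.
set v := \int[@lebesgue_measure R]_(y in `[- rho, rho]%classic) (half_chord rho y * 1).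
have dv x : -1 <= x <= 1 -> is_derive (x : R) 1 (fun x => v * x) v.
  by move=> _; apply: (is_derive1_eq (is_derive1Z v (is_derive1_id x))); exact: mulr1.
have cv : continuous (fun _ : R => v) by exact: continuous_const.
rewrite (@FTC_segment _ _ _ (fun x => v * x) (fun=> v) le11 cv dv).
by rewrite mulr1 mulrN1 opprK; have := half_chord_integral_gt0 r0; rewrite -E -/v; lra.
Qed.

(** Two reflections reduce to functions even in both coordinates, for which rho^2 <= 2 j^2 <= 8
    suffices. The mean is kept as an error term because on smaller cylinders it is only close to
    0. *)
Lemma planar_poincare rho f f1 f2 : 0 < rho -> rho ^+ 2 <= 2 * j ^+ 2 -> C1_plane f f1 f2 ->
  - (\int[mu2]_(q in disc rho) f q) ^+ 2 / (2 * \int[mu2]_(q in disc rho) (1 : R)) <=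
  \int[mu2]_(q in disc rho) form f f1 f2 q.
Proof.
move=> r0 rj cf.
have p1 : (1 : R) ^+ 2 = 1 by rewrite expr1n.
have n1 : (-1 : R) ^+ 2 = 1 by rewrite sqrrN expr1n.
have [g [g1 [g2 [cg gE gI gF]]]] := form_symmetrize r0 rj n1 p1 (mulr1 _) cf.
have [a [a1 [a2 [ca aE aI aF]]]] := form_symmetrize r0 rj p1 n1 (mul1r _) cg.
rewrite -gI -aI; apply: le_trans gF; apply: le_trans aF.
have ax x y : a (- x, y) = a (x, y).
  rewrite !aE !gE /flip /= !mul1r !mulN1r !opprK; congr (_ / _).
  by rewrite (addrC (f (- x, y))) (addrC (f (- x, - y))).
have ay x y : a (x, - y) = a (x, y).
  by rewrite !aE !gE /flip /= !mul1r !mulN1r !opprK; congr (_ / _); rewrite addrC.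
have [c hc] := even_poincare r0 ca ax ay.
have [ca0 ca1 ca2 _ _] := ca.
have mD := measurable_disc rho.
have iD (u : R * R -> R) : continuous u -> Rintegrable mu2 (disc rho) u by exact: disc_Rintegrable.
have ck k : continuous (fun _ : R * R => k) by exact: continuous_const.
have cG : continuous (fun q => a1 q ^+ 2 + a2 q ^+ 2) by apply: continuous_add; exact: continuous_exp.
have ca2' : continuous (fun q => a q ^+ 2) by exact: continuous_exp.
set V := \int[mu2]_(q in disc rho) (1 : R); set S := \int[mu2]_(q in disc rho) a q.
have V0 : 0 < V by exact: disc_area_gt0.
have r8 : rho ^+ 2 <= 8.
  have j2 := smallest_zero_le2 hj; have [j0 _ _] := hj.
  by apply: (le_trans rj); nra.
set T := \int[mu2]_(q in disc rho) (a q ^+ 2).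
have E1 : \int[mu2]_(q in disc rho) ((a q - c) ^+ 2) = T - 2 * c * S + c ^+ 2 * V.
  rewrite -(RintegralZ' mD _ (iD _ ca0)) -(RintegralZ' mD _ (iD _ (ck 1))).
  rewrite -(RintegralB' mD (iD _ ca2') (RintegrableZ mD _ (iD _ ca0))).
  rewrite -(RintegralD' mD (RintegrableB mD (iD _ ca2') (RintegrableZ mD _ (iD _ ca0))) (RintegrableZ mD _ (iD _ (ck 1)))).
  by apply: eq_Rintegral => q _; ring.
have E2 : \int[mu2]_(q in disc rho) form a a1 a2 q = \int[mu2]_(q in disc rho) (a1 q ^+ 2 + a2 q ^+ 2) - 1 / 2 * T.
  rewrite -(RintegralZ' mD _ (iD _ ca2')) -(RintegralB' mD (iD _ cG) (RintegrableZ mD _ (iD _ ca2'))).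
  by [].
set G := \int[mu2]_(q in disc rho) (a1 q ^+ 2 + a2 q ^+ 2) in hc E2.
have G0 : 0 <= G by apply: Rintegral_ge0 => q _; rewrite addr_ge0 ?sqr_ge0.
rewrite E2; rewrite E1 in hc.
have h1 : rho ^+ 2 / 4 * G <= 2 * G by rewrite ler_wpM2r// ler_pdivrMr// -natrM.
(* Completing the square eliminates the unknown constant [c] of [even_poincare]. *)
have sq : 0 <= (c * V - S) ^+ 2 / (2 * V) by rewrite divr_ge0 ?sqr_ge0// mulr_ge0// ltW.
have sqE : (c * V - S) ^+ 2 / (2 * V) = 1 / 2 * c ^+ 2 * V - c * S + S ^+ 2 / (2 * V).
  by field; rewrite gt_eqF.
by rewrite mulNr; move: hc h1 sq; rewrite sqE; clear; lra.
Qed.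

End neumann_gap.

Lemma L2_cauchy_schwarz d (T : measurableType d) (R : realType) (m : {measure set T -> \bar R})
    (D : set T) (f g : T -> R) : measurable D -> L2 m D f -> L2 m D g ->
  (\int[m]_(x in D) (f x * g x)) ^+ 2 <=
  \int[m]_(x in D) (f x ^+ 2) * \int[m]_(x in D) (g x ^+ 2).
Proof.
move=> mD hf hg; set P := \int[m]_(x in D) (f x * g x).
set A := \int[m]_(x in D) (f x ^+ 2); set B := \int[m]_(x in D) (g x ^+ 2).
have ifg := L2_mul mD hf hg.
have h t : 0 <= A - 2 * t * P + t ^+ 2 * B.
  rewrite -(RintegralZ' mD _ ifg) -(RintegralZ' mD _ hg.2).
  rewrite -(RintegralB' mD hf.2 (RintegrableZ mD _ ifg)).
  rewrite -(RintegralD' mD (RintegrableB mD hf.2 (RintegrableZ mD _ ifg)) (RintegrableZ mD _ hg.2)).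
  apply: Rintegral_ge0 => x _; have := sqr_ge0 (f x - t * g x).
  by congr (0 <= _); ring.
have B0 : 0 <= B by apply: Rintegral_ge0 => x _; exact: sqr_ge0.
have [B1|B1] := ltP 0 B.
  have := h (P / B); have -> : A - 2 * (P / B) * P + (P / B) ^+ 2 * B = A - P ^+ 2 / B.
    by field; rewrite gt_eqF.
  by rewrite subr_ge0 ler_pdivrMr.
have {B0 B1}BE : B = 0 by apply/eqP; rewrite eq_le B1 B0.
have [P0|P0] := eqVneq P 0; first by rewrite P0 BE mulr0 expr0n.
(* If B = 0 and P is nonzero, this parameter makes the nonnegative quantity equal to -1. *)
have := h ((A + 1) / (2 * P)); rewrite BE mulr0 addr0.
by have -> : A - 2 * ((A + 1) / (2 * P)) * P = - 1 by [field]; lra.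
Qed.

(** * Inequalities on the cylinder *)

Section fibers.
Context {R : realType}.
Local Notation mR := (measurableTypeR R).
Local Notation T2 := (mR * mR)%type.
Local Notation T3 := (mR * (mR * mR))%type.
Local Notation mu := (@lebesgue_measure R).
Local Notation mu2 := (@lebesgue2 R).
Local Notation lambda := (@lebesgue3 R).
Implicit Types (rho L x y t : R) (q : R * R) (p : space R) (F G : space R -> R).

Definition fiber L F q := \int[mu]_(x in `[- L, L]%classic) F (x, q).

Lemma continuous_slice F q : continuous F -> continuous (fun x => F (x, q)).
Proof.
move=> cF; apply: (continuous_compose (f := fun x => (x, q))) => //.
by apply: continuous_pair; [exact: continuous_self|move=> ?; exact: cvg_cst].
Qed.

Lemma fiber_Rintegrable L F q : continuous F -> Rintegrable mu `[- L, L]%classic (fun x => F (x, q)).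
Proof. by move=> cF; apply: segment_Rintegrable; exact: continuous_slice. Qed.

Lemma fiber_L2 L F q : continuous F -> L2 mu `[- L, L]%classic (fun x => F (x, q)).
Proof.
move=> cF; split.
  by apply: measurable_funTS; apply: continuous_measurable_fun; exact: continuous_slice.
by apply: segment_Rintegrable; apply: continuous_exp; exact: continuous_slice.
Qed.

Lemma continuous_fiber L F : continuous F -> continuous (fiber L F).
Proof.
move=> cF q; apply: continuous_at_sequence => u up.
have [M M0 hM] : exists2 M : R, 0 <= M & forall n, box2 M (u n).
  have u1 : (fun n => (u n).1) @ \oo --> q.1.
    exact: (@cvg_comp _ _ _ u fst _ _ _ up (@cvg_fst _ _ _ _ _)).
  have u2 : (fun n => (u n).2) @ \oo --> q.2.
    exact: (@cvg_comp _ _ _ u snd _ _ _ up (@cvg_snd _ _ _ _ _)).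
  have [M1 [_ h1]] := cvg_seq_bounded (cvgP _ u1); have [M2 [_ h2]] := cvg_seq_bounded (cvgP _ u2).
  pose M := Num.max 0 (Num.max M1 M2) + 1.
  have [m0 m1 m2] : [/\ 0 <= M, M1 < M & M2 < M].
    rewrite /M; split; first by rewrite addr_ge0// le_max lexx.
      by rewrite ltr_pwDr// !le_max lexx orbT.
    by rewrite ltr_pwDr// !le_max lexx !orbT.
  exists M => // n; split; rewrite /= in_itv/= -ler_norml; [exact: (h1 M m1 n)|exact: (h2 M m2 n)].
have cK : compact (`[- L, L]%classic `*` box2 M).
  by apply: compact_setX; [exact: segment_compact|apply: compact_setX; exact: segment_compact].
have [N N0 hN] := continuous_compact_bounded cK cF.
have ms q' : measurable_fun `[- L, L]%classic (fun x : mR => F (x, q')).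
  by apply: measurable_funTS; apply: continuous_measurable_fun; exact: continuous_slice.
have [] := @dominated_convergence _ _ _ mu _ (measurable_itv `[- L, L])
  (fun n x => (F (x, u n))%:E) (fun x => (F (x, q))%:E) (fun=> N%:E).
- by move=> n; apply/measurable_EFinP; exact: ms.
- by apply/measurable_EFinP; exact: ms.
- apply/aeW => x _; apply: cvg_EFin; first by near=> n.
  have cx : continuous (fun q : R * R => F (x, q)).
    apply: (continuous_compose (f := fun q : R * R => (x, q))) => //.
    by apply: continuous_pair; [move=> ?; exact: cvg_cst|exact: continuous_self].
  exact: (@cvg_comp _ _ _ u (fun q => F (x, q)) _ _ _ up (cx q)).
- have := segment_Rintegrable (- L) L (@continuous_const _ R N); exact.
- apply/aeW => x n xL; rewrite lee_fin hN//; split => //; exact: hM.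
- move=> _ _; rewrite /fiber /Rintegral.
  have fin q' : (\int[mu]_(x in `[(- L)%R, L]%classic) (F (x, q'))%:E)%E \is a fin_num.
    by apply: integrable_fin_num => //; exact: fiber_Rintegrable.
  by move=> h; apply: fine_cvg; rewrite fineK.
Unshelve. all: by end_near. Qed.

Lemma is_derive_integral L (f g : R * R -> R) t : continuous f -> continuous g ->
  (forall x y, is_derive y 1 (fun y => f (x, y)) (g (x, y))) ->
  is_derive t 1 (fun t => \int[mu]_(x in `[- L, L]%classic) f (x, t))
    (\int[mu]_(x in `[- L, L]%classic) g (x, t)).
Proof.
move=> cf cg df; set B : set mR := `[- L, L]%classic.
have mB : measurable B by exact: measurable_itv.
have cK : compact (`[- L, L]%classic `*` `[t - 1, t + 1]%classic).
  by apply: compact_setX; exact: segment_compact.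
have [N N0 hN] := continuous_compact_bounded cK cg.
have It : `]t - 1, t + 1[%classic t by rewrite /= in_itv/=; lra.
have fi s : mu.-integrable B (EFin \o (fun x : mR => f (x, s))).
  by apply: segment_Rintegrable; exact: continuous_slice1.
have iG : mu.-integrable B (EFin \o (fun x : mR => N)).
  by have := segment_Rintegrable (- L) L (@continuous_const _ R N); exact.
pose F (s : R) (x : mR) := f (x, s).
have ub (s : R) (x : mR) : `]t - 1, t + 1[%classic s -> B x -> `|partial1of2 F s x| <= N.
  rewrite /partial1of2 (is_derive1E (df x s)) => h1 h2; apply: hN; split => //=.
  by move: h1; rewrite /= !in_itv/= => /andP[h1 h3]; rewrite !ltW.
apply: DeriveDef.
  by apply: (@derivable_under_integral _ _ _ _ F _ mB _ _ _ It (fun x _ => fi x) _ _ (fun _ => N0) iG) => //;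
    move=> x s _ _; have [] := df s x.
rewrite -derive1E (@differentiation_under_integral _ _ _ _ F _ mB _ _ _ It
  (fun x _ => fi x) _ _ (fun _ => N0) iG)//.
by apply: eq_Rintegral => x _; rewrite /partial1of2 (is_derive1E (df x t)).
Qed.

(** Vanishing for |x| >= L turns the infinite cylinder into a bounded product, where Fubini
    applies. *)
Lemma cylinder_fiber rho L F : 0 < rho -> continuous F -> (forall p, L <= `|p.1| -> F p = 0) ->
  Rintegrable lambda (cylinder rho) F /\
  \int[lambda]_(p in cylinder rho) F p = \int[mu2]_(q in disc rho) fiber L F q.
Proof.
move=> r0 cF F0; set A := `[- L, L]%classic `*` disc rho.
have mA : measurable (A : set T3).
  by apply: measurableX; [exact: measurable_itv|exact: measurable_disc].
have AD : A `<=` cylinder rho by move=> p [_ h]; apply/(cylinderP p r0).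
have F0' p : cylinder rho p -> ~ A p -> F p = 0.
  move=> /(cylinderP p r0) h nA; apply: F0; rewrite leNgt; apply/negP => pL; apply: nA; split => //=.
  by rewrite in_itv/= -ler_norml ltW.
have [M LM rM] : exists2 M, L <= M & rho <= M by exists (Num.max L rho); rewrite le_max lexx ?orbT.
have AM : A `<=` box3 M.
  move=> [x q] [/= h1 /(disc_box r0)[h2 h3]]; move: h1 h2 h3; rewrite /= !in_itv/= => h1 h2 h3.
  by do !split; rewrite /= in_itv/=; lra.
have iA : Rintegrable lambda A F.
  apply: (integrableS (measurable_box3 M)) => //.
  by apply: compact_Rintegrable => //; exact: compact_box3.
split.
  apply: (Rintegrable_supported mA) => //; first exact: measurable_cylinder.
  by apply: measurable_funTS; exact: continuous_measurable3.
rewrite (integral_supported lambda AD F0').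
apply: (@Rintegral_prod21 _ _ _ _ R mu mu2 `[- L, L]%classic (disc rho) F) => //.
- exact: measurable_disc.
- by move=> q _; exact: fiber_Rintegrable.
Qed.

End fibers.

(** * The second variation for regular functions on the cylinder *)

Section cylinder_inequalities.
Context {R : realType}.
Local Notation mR := (measurableTypeR R).
Local Notation mu := (@lebesgue_measure R).
Local Notation mu2 := (@lebesgue2 R).
Local Notation lambda := (@lebesgue3 R).
Implicit Types (rho L x y t : R) (q : R * R) (p : space R) (F G h : space R -> R).
Implicit Types dh : 'I_3 -> space R -> R.

Definition i0 : 'I_3 := ord0.
Definition i1 : 'I_3 := Ordinal (isT : (1 < 3)%N).
Definition i2 : 'I_3 := Ordinal (isT : (2 < 3)%N).

Lemma C1_cutoff_partials L h dh : C1_cutoff L h dh -> forall x y z,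
  [/\ is_derive x 1 (fun x => h (x, (y, z))) (dh i0 (x, (y, z))),
      is_derive y 1 (fun y => h (x, (y, z))) (dh i1 (x, (y, z))) &
      is_derive z 1 (fun z => h (x, (y, z))) (dh i2 (x, (y, z)))].
Proof.
move=> [_ _ dhh _] x y z.
have := (is_derive_upd _ _ _ _).1 (dhh i0 (x, (y, z))).
have := (is_derive_upd _ _ _ _).1 (dhh i1 (x, (y, z))).
have := (is_derive_upd _ _ _ _).1 (dhh i2 (x, (y, z))).
by rewrite /coord /upd /=.
Qed.

(** The length grows by 1 so that the derivatives, which depend on a neighbourhood, vanish as well;
    [1 <= M] bounds [sech_mass M] below by a fixed positive number. *)
Lemma C1_cutoff_widen L h dh : 0 < L -> C1_cutoff L h dh ->
  exists M, [/\ 1 <= M, C1_cutoff M h dh & forall j p, M <= `|p.1| -> dh j p = 0].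
Proof.
move=> L0 [ch cdh dhh h0]; exists (L + 1); split; first by rewrite lerDr ltW.
  by split => // p hp; apply: h0; lra.
move=> j p hp; have d0 : is_derive p (basis_vector j) h 0.
  apply: (near_eq_is_derive (f := cst 0)) => //.
  have : \forall q \near p, L < `|q.1|.
    have cn : continuous (fun q : space R => `|q.1|).
      by move=> q; apply: cvg_norm; exact: cvg_fst.
    have np : nbhs `|p.1| [set x | L < x].
      by apply: open_nbhs_nbhs; split; [exact: open_gt|rewrite /=; lra].
    exact: (cn p _ np).
  by apply: filterS => q /ltW /h0 /= ->.
by have := is_derive_unique (dhh j p) d0.
Qed.

Definition sech_fst p : R := sech p.1.

Lemma continuous_sech_fst : continuous sech_fst.
Proof. by apply: (continuous_compose (f := fun p : space R => p.1)); [exact: continuous_fst|exact: continuous_sech]. Qed.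

Lemma continuous_sech2_fst : continuous (fun p : space R => sech p.1 ^+ 2).
Proof. by apply: continuous_exp; exact: continuous_sech_fst. Qed.

Definition sech_mass L := \int[mu]_(x in `[- L, L]%classic) (sech x ^+ 2).

Lemma sech_L2 L : L2 mu `[- L, L]%classic (sech : mR -> R).
Proof.
split; first by apply: measurable_funTS; apply: continuous_measurable_fun; exact: continuous_sech.
by apply: segment_Rintegrable; apply: continuous_exp; exact: continuous_sech.
Qed.

Lemma sech_mass_le L M : L <= M -> sech_mass L <= sech_mass M.
Proof.
move=> LM; apply: L2_sqr_subset (sech_L2 M); [exact: measurable_itv..|].
by move=> x; rewrite /= !in_itv/=; lra.
Qed.

Lemma sech_mass_gt0 : 0 < sech_mass 1.
Proof.
have h (x : R) : -1 <= x <= 1 -> is_derive x 1 (fun x : R => Num.sqrt 2 * kink x) (sech x ^+ 2).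
  move=> _; apply: (is_derive1_eq (is_derive1Z _ (is_derive_kink x))).
  by field; rewrite sqrtr_eq0 -ltNge; lra.
have cs : continuous (fun x : R => sech x ^+ 2) by apply: continuous_exp; exact: continuous_sech.
have le11 : (-1 : R) <= 1 by lra.
rewrite /sech_mass (FTC_segment le11 cs h) kinkN mulrN opprK.
have r2 : 0 < Num.sqrt (2 : R) by rewrite sqrtr_gt0; lra.
by have := mulr_gt0 r2 (@kink_gt0 R 1 ltr01); lra.
Qed.

Definition grad2 dh p := dh i0 p ^+ 2 + dh i1 p ^+ 2 + dh i2 p ^+ 2.

(** The integrand of the second variation of the energy at the soliton in the direction of the first
    component. *)
Definition well h dh p := grad2 dh p - sech p.1 ^+ 2 * h p ^+ 2.

Lemma continuous_well L h dh : C1_cutoff L h dh -> continuous (well h dh).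
Proof.
move=> [ch cdh _ _]; apply: continuous_sub.
  by apply: continuous_add; [apply: continuous_add|]; exact: continuous_exp.
by apply: continuous_mul; [exact: continuous_sech2_fst|exact: continuous_exp].
Qed.

(** [line_inequality] handles the derivative in x and Cauchy-Schwarz in x the two transverse ones;
    what results is the planar [form] of the projection on [sech]. *)
Lemma fiber_well L h dh q : 1 <= L -> C1_cutoff L h dh ->
  (fiber L (fun p => dh i1 p * sech p.1) q ^+ 2 + fiber L (fun p => dh i2 p * sech p.1) q ^+ 2
   - 1 / 2 * fiber L (fun p => h p * sech p.1) q ^+ 2) / sech_mass L <= fiber L (well h dh) q.
Proof.
move=> L1 hh; have [ch cdh _ h0] := hh.
have L0 : 0 < L by lra.
set A := `[- L, L]%classic.
have mA : measurable (A : set mR) by exact: measurable_itv.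
have S0 : 0 < sech_mass L := lt_le_trans sech_mass_gt0 (sech_mass_le L1).
have iF F : continuous F -> Rintegrable mu A (fun x => F (x, q)) by move=> cF; exact: fiber_Rintegrable.
have c0 : continuous (fun p => dh i0 p ^+ 2 - sech p.1 ^+ 2 * h p ^+ 2).
  apply: continuous_sub; first exact: continuous_exp.
  by apply: continuous_mul; [exact: continuous_sech2_fst|exact: continuous_exp].
have c1 : continuous (fun p => dh i1 p ^+ 2) by exact: continuous_exp.
have c2 : continuous (fun p => dh i2 p ^+ 2) by exact: continuous_exp.
have -> : fiber L (well h dh) q = fiber L (fun p => dh i0 p ^+ 2 - sech p.1 ^+ 2 * h p ^+ 2) q
    + fiber L (fun p => dh i1 p ^+ 2) q + fiber L (fun p => dh i2 p ^+ 2) q.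
  rewrite -(RintegralD' mA (iF _ c0) (iF _ c1)) -(RintegralD' mA (RintegrableD mA (iF _ c0) (iF _ c1)) (iF _ c2)).
  by apply: eq_Rintegral => x _; rewrite /well /grad2; ring.
have CS j : fiber L (fun p => dh j p * sech p.1) q ^+ 2 <= sech_mass L * fiber L (fun p => dh j p ^+ 2) q.
  by rewrite mulrC; apply: L2_cauchy_schwarz => //; [exact: fiber_L2|exact: sech_L2].
have line : - fiber L (fun p => h p * sech p.1) q ^+ 2 / (2 * sech_mass L) <=
    fiber L (fun p => dh i0 p ^+ 2 - sech p.1 ^+ 2 * h p ^+ 2) q.
  case: q {CS c0 c1 c2 iF} => y z.
  apply: (@line_inequality _ L (fun x => h (x, (y, z))) (fun x => dh i0 (x, (y, z)))) => //.
  - exact: continuous_slice.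
  - by move=> x; have [] := C1_cutoff_partials hh x y z.
  - by apply: h0; rewrite /= normrN ger0_norm// ltW.
  - by apply: h0; rewrite /= ger0_norm// ltW.
have S2 : 0 < 2 * sech_mass L by lra.
move: line; rewrite ler_pdivrMr// => line; rewrite ler_pdivrMr//.
by move: line (CS i1) (CS i2); clear; lra.
Qed.

Lemma C1_fiber L h dh : C1_cutoff L h dh ->
  C1_plane (fiber L (fun p => h p * sech p.1)) (fiber L (fun p => dh i1 p * sech p.1))
    (fiber L (fun p => dh i2 p * sech p.1)).
Proof.
move=> hh; have [ch cdh _ _] := hh.
have cm F : continuous F -> continuous (fun p => F p * sech p.1).
  by move=> cF; apply: continuous_mul => //; exact: continuous_sech_fst.
have cs F (f : R * R -> space R) : continuous f -> continuous F -> continuous (fun q => F (f q)).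
  by move=> cf cF; exact: (continuous_compose cf cF).
split; try (by apply: continuous_fiber; exact: cm).
- move=> y z; have c1 : continuous (fun r : R * R => (r.1, (r.2, z)) : space R).
    apply: continuous_pair; first exact: continuous_fst.
    by apply: continuous_pair; [exact: continuous_snd|move=> ?; exact: cvg_cst].
  apply: (@is_derive_integral _ L (fun r => h (r.1, (r.2, z)) * sech r.1)
    (fun r => dh i1 (r.1, (r.2, z)) * sech r.1)).
  + exact: (cs _ _ c1 (cm _ ch)).
  + exact: (cs _ _ c1 (cm _ (cdh i1))).
  + move=> x t /=; have [_ dy _] := C1_cutoff_partials hh x t z.
    by apply: (is_derive1_eq (is_derive1M dy (is_derive1_cst _ _))); rewrite mulr0 addr0.
- move=> y z; have c1 : continuous (fun r : R * R => (r.1, (y, r.2)) : space R).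
    apply: continuous_pair; first exact: continuous_fst.
    by apply: continuous_pair; [move=> ?; exact: cvg_cst|exact: continuous_snd].
  apply: (@is_derive_integral _ L (fun r => h (r.1, (y, r.2)) * sech r.1)
    (fun r => dh i2 (r.1, (y, r.2)) * sech r.1)).
  + exact: (cs _ _ c1 (cm _ ch)).
  + exact: (cs _ _ c1 (cm _ (cdh i2))).
  + move=> x t /=; have [_ _ dz] := C1_cutoff_partials hh x y t.
    by apply: (is_derive1_eq (is_derive1M dz (is_derive1_cst _ _))); rewrite mulr0 addr0.
Qed.

Lemma cylinder_well rho L h dh : 0 < rho -> C1_cutoff L h dh ->
  (forall j p, L <= `|p.1| -> dh j p = 0) ->
  \int[lambda]_(p in cylinder rho) well h dh p = \int[mu2]_(q in disc rho) fiber L (well h dh) q.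
Proof.
move=> r0 hh dh0; have [_ _ _ h0] := hh.
apply: (cylinder_fiber r0 (continuous_well hh) _).2 => p hp.
by rewrite /well /grad2 !dh0// h0// expr0n/= mulr0 !addr0 subr0.
Qed.

Variable j : R.
Hypothesis hj : smallest_positive_zero (derive1 (bessel_J 1)) j.

Lemma disc_area_le r rho : 0 < r -> r <= rho ->
  \int[mu2]_(q in disc r) (1 : R) <= \int[mu2]_(q in disc rho) (1 : R).
Proof.
move=> r0 rr; have rho0 : 0 < rho by lra.
have c1 : continuous (fun _ : R * R => (1 : R)) by exact: continuous_const.
have L2r s : 0 < s -> L2 mu2 (disc s) (fun _ => (1 : R)).
  move=> s0; split; first exact: measurable_cst.
  by have := disc_Rintegrable s0 c1; congr (Rintegrable _ _ _); apply/funext => q; rewrite expr1n.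
have := L2_sqr_subset (measurable_disc r) (measurable_disc rho) _ (L2r _ rho0).
by rewrite expr1n; apply => q; rewrite /disc /= => /lt_le_trans; apply; rewrite lerXn2r ?nnegrE//; lra.
Qed.

(* The constant does not depend on [rho], which tends to the radius of the cylinder below. *)
Lemma well_ge_mean r : 0 < r -> exists2 C, 0 <= C & forall rho L h dh, r <= rho ->
  rho ^+ 2 <= 2 * j ^+ 2 -> 0 < L -> C1_cutoff L h dh ->
  - C * (\int[lambda]_(p in cylinder rho) (h p * sech p.1)) ^+ 2 <=
  \int[lambda]_(p in cylinder rho) well h dh p.
Proof.
move=> r0; have V0 := disc_area_gt0 r0; have S0 := sech_mass_gt0.
set V := \int[mu2]_(q in disc r) (1 : R) in V0.
(* Lower bounds for the two normalisations: the mass over [-M, M] is at least that over [-1, 1], and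
   the area at least that of the disc of radius [r]. *)
exists (sech_mass 1 * (2 * V))^-1; first by rewrite invr_ge0 ltW// !mulr_gt0.
move=> rho L h dh rr rj L0 /(C1_cutoff_widen L0)[M [M1 hM dh0]].
have rho0 : 0 < rho by lra.
have [ch cdh _ h0] := hM.
have ca := C1_fiber hM.
have cm : continuous (fun p => h p * sech p.1).
  by apply: continuous_mul => //; exact: continuous_sech_fst.
rewrite (cylinder_well rho0 hM dh0) (cylinder_fiber rho0 cm (L := M) _).2; last first.
  by move=> p hp; rewrite h0// mul0r.
have SM : sech_mass 1 <= sech_mass M by exact: sech_mass_le.
have SM0 : 0 < sech_mass M by lra.
have Vr := disc_area_le r0 rr; have [c0 c1 c2 _ _] := ca.
have cf := continuous_form ca.
have mD := measurable_disc rho.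
apply: (@le_trans _ _ (\int[mu2]_(q in disc rho) ((sech_mass M)^-1 *
  form (fiber M (fun p => h p * sech p.1)) (fiber M (fun p => dh i1 p * sech p.1))
    (fiber M (fun p => dh i2 p * sech p.1)) q))); last first.
  apply: le_Rintegral' => //.
  - by apply: RintegrableZ => //; exact: disc_Rintegrable.
  - by apply: disc_Rintegrable => //; apply: continuous_fiber; exact: continuous_well hM.
  - by move=> q _; have := fiber_well q M1 hM; rewrite mulrC.
rewrite (RintegralZ' mD _ (disc_Rintegrable rho0 cf)).
have := planar_poincare hj rho0 rj ca.
set A := \int[mu2]_(q in disc rho) fiber _ _ q; set W := \int[mu2]_(q in disc rho) (1 : R).
rewrite -/V -/W in Vr *; move=> hp; have iS : 0 <= (sech_mass M)^-1 by rewrite invr_ge0 ltW.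
apply: le_trans (ler_wpM2l iS hp); rewrite !mulNr mulrN lerN2 mulrCA mulrC.
rewrite ler_wpM2r ?sqr_ge0// -invfM lef_pV2 ?posrE ?mulr_gt0//; try lra.
by apply: ler_pM => //; lra.
Qed.

Definition reflect p : space R := (- p.1, p.2).

Lemma segment_reflect L (f : R -> R) : 0 <= L -> continuous f ->
  \int[mu]_(x in `[- L, L]%classic) f (- x) = \int[mu]_(x in `[- L, L]%classic) f x.
Proof.
move=> L0 cf; have [H dH] := @antiderivative _ (- L) L f cf.
have ll : - L <= L by lra.
rewrite (FTC_segment ll cf dH).
have cfN : continuous (fun x => f (- x)).
  by apply: (continuous_compose (f := fun x : R => - x)) => // x; apply: cvgN; exact: cvg_id.
have dHN x : - L <= x <= L -> is_derive (x : R) 1 (fun x => - H (- x)) (f (- x)).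
  move=> hx; have dx : is_derive (- x) 1 H (f (- x)) by apply: dH; lra.
  have D := is_derive1N (@is_derive1_compose _ H (fun x => - x) x _ _ dx (is_derive1N (is_derive1_id x))).
  by apply: (is_derive1_eq D); rewrite mulrN1 opprK.
by rewrite (FTC_segment ll cfN dHN) !opprK addrC.
Qed.

(** Only the part of [h] that is even in x has a projection on [sech]: the projection is half the
    integral of the sum of [h] and its reflection against [sech]. Squaring and the eigenvalue -1/2
    give 1/4 * 1/2 = 1/8. *)
Lemma well_ge_even rho L h dh : 0 < rho -> 0 < L -> C1_cutoff L h dh ->
  - (1 / 8) * \int[lambda]_(p in cylinder rho) ((h p + h (reflect p)) ^+ 2) <=
  \int[lambda]_(p in cylinder rho) well h dh p.
Proof.
move=> rho0 L0 /(C1_cutoff_widen L0)[M [M1 hM dh0]].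
have [ch cdh _ h0] := hM; have M0 : 0 < M by lra.
have cr : continuous reflect.
  apply: continuous_pair; last exact: continuous_snd.
  by apply: continuous_opp; exact: continuous_fst.
have chr : continuous (fun p => h (reflect p)) by exact: (continuous_compose cr ch).
have ce : continuous (fun p => (h p + h (reflect p)) ^+ 2).
  by apply: continuous_exp; exact: continuous_add.
have cf := C1_fiber hM; have [c0 c1 c2 _ _] := cf.
rewrite (cylinder_well rho0 hM dh0) (cylinder_fiber rho0 ce (L := M) _).2; last first.
  by move=> p hp; rewrite !h0 ?addr0 ?expr0n// /reflect /= normrN.
have SM0 : 0 < sech_mass M := lt_le_trans sech_mass_gt0 (sech_mass_le M1).
have mD := measurable_disc rho.
have cfe := continuous_fiber (L := M) ce.
rewrite -(RintegralZ' mD _ (disc_Rintegrable rho0 cfe)).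
apply: le_Rintegral' => //.
- by apply: RintegrableZ => //; exact: disc_Rintegrable.
- by apply: disc_Rintegrable => //; apply: continuous_fiber; exact: continuous_well hM.
move=> q _; apply: le_trans (fiber_well q M1 hM).
set a := fiber M (fun p => h p * sech p.1) q; set E := fiber M (fun p => (h p + h (reflect p)) ^+ 2) q.
set a1 := fiber M (fun p => dh i1 p * _) q; set a2 := fiber M (fun p => dh i2 p * _) q.
have aE : 4 * a ^+ 2 <= E * sech_mass M.
  have -> : 4 * a ^+ 2 = (\int[mu]_(x in `[- M, M]%classic) ((h (x, q) + h (- x, q)) * sech x)) ^+ 2.
    have cu : continuous (fun x => h (x, q) * sech x).
      by apply: continuous_mul; [exact: continuous_slice|exact: continuous_sech].
    have cv : continuous (fun x => h (- x, q) * sech (- x)).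
      by apply: (continuous_compose (f := fun x : R => - x) _ cu) => x; apply: cvgN; exact: cvg_id.
    have -> : \int[mu]_(x in `[- M, M]%classic) ((h (x, q) + h (- x, q)) * sech x) = a + a.
      rewrite {2}/a /fiber -(segment_reflect (ltW M0) cu).
      have mM : measurable (`[- M, M]%classic : set mR) by exact: measurable_itv.
      rewrite -(RintegralD' mM (segment_Rintegrable _ _ cu) (segment_Rintegrable _ _ cv)).
      by apply: eq_Rintegral => x _; rewrite sechN; ring.
    by ring.
  apply: L2_cauchy_schwarz; [exact: measurable_itv| |exact: sech_L2].
  by have := fiber_L2 M q (continuous_add ch chr).
rewrite ler_pdivlMr//; have := sqr_ge0 a1; have := sqr_ge0 a2; move: aE.
by clear; lra.
Qed.

(** The integrand is the derivative in x of sech^2 h / sqrt 2; this is the equation of the soliton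
    tested with [h]. *)
Lemma well_kink rho L h dh : 0 < rho -> 0 < L -> C1_cutoff L h dh ->
  \int[lambda]_(p in cylinder rho)
    (sech p.1 ^+ 2 / Num.sqrt 2 * dh i0 p - sech p.1 ^+ 2 * kink p.1 * h p) = 0.
Proof.
move=> rho0 L0 /(C1_cutoff_widen L0)[M [M1 hM dh0]].
have [ch cdh _ h0] := hM; have M0 : 0 < M by lra.
have ck : continuous (fun p : space R => kink p.1).
  by apply: (continuous_compose (f := fun p : space R => p.1)); [exact: continuous_fst|exact: continuous_kink].
have cs2 : continuous (fun p : space R => sech p.1 ^+ 2) by exact: continuous_sech2_fst.
have cF : continuous (fun p : space R => sech p.1 ^+ 2 / Num.sqrt 2 * dh i0 p - sech p.1 ^+ 2 * kink p.1 * h p).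
  apply: continuous_sub; last by apply: continuous_mul => //; exact: continuous_mul.
  by do 2 apply: continuous_mul => //; exact: continuous_const.
rewrite (cylinder_fiber rho0 cF (L := M) _).2; last by move=> p hp; rewrite dh0// h0// !mulr0 subr0.
apply: Rintegral_eq0 => -[y z] _; rewrite /fiber.
have MM : - M <= M by lra.
have r2 : Num.sqrt (2 : R) != 0 by rewrite sqrtr_eq0 -ltNge; lra.
have r22 : Num.sqrt (2 : R) ^+ 2 = 2 by rewrite sqr_sqrtr//; lra.
have dF x : - M <= x <= M -> is_derive (x : R) 1 (fun x => (Num.sqrt 2)^-1 * (sech x ^+ 2 * h (x, (y, z))))
    (sech x ^+ 2 / Num.sqrt 2 * dh i0 (x, (y, z)) - sech x ^+ 2 * kink x * h (x, (y, z))).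
  move=> _; have [dx _ _] := C1_cutoff_partials hM x y z.
  apply: (is_derive1_eq (is_derive1Z _ (is_derive1M (is_derive1X 2 (is_derive_sech x)) dx))).
  rewrite /= expr1; apply: (mulfI r2); apply: (mulfI r2).
  set A := dh _ _; set B := h _; set k := kink x; set e := sech x.
  have -> : Num.sqrt 2 * (Num.sqrt 2 * ((Num.sqrt 2)^-1 * (2 * e * - (e * k / Num.sqrt 2) * B + e ^+ 2 * A)))
    = - (2 * e ^+ 2 * k * B) + Num.sqrt 2 * (e ^+ 2 * A) by field.
  have -> : Num.sqrt 2 * (Num.sqrt 2 * (e ^+ 2 / Num.sqrt 2 * A - e ^+ 2 * k * B)) =
    Num.sqrt 2 * (e ^+ 2 * A) - Num.sqrt 2 ^+ 2 * (e ^+ 2 * k * B) by field.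
  by rewrite r22; ring.
have cz : continuous (fun x : R => sech x ^+ 2 / Num.sqrt 2 * dh i0 (x, (y, z)) - sech x ^+ 2 * kink x * h (x, (y, z))).
  exact: (continuous_slice cF).
rewrite (FTC_segment MM cz dF).
by rewrite !h0 /= ?normrN ?ger0_norm ?mulr0 ?subr0// ltW.
Qed.

End cylinder_inequalities.

(** * Fields with weak derivatives and integrals over cylinders *)

Section weak_fields.
Context {R : realType}.
Local Notation mR := (measurableTypeR R).
Local Notation T2 := (mR * mR)%type.
Local Notation T3 := (mR * (mR * mR))%type.
Local Notation mu := (@lebesgue_measure R).
Local Notation mu2 := (@lebesgue2 R).
Local Notation lambda := (@lebesgue3 R).
Implicit Types (D : set (space R)) (f g : space R -> R) (j : 'I_3) (rho d : R).

Lemma test_function_partial D j phi : test_function D phi -> test_function D (partial j phi).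
Proof.
move=> [sphi [K [cK KD phi0]]]; split.
  by move=> s; have := sphi (rcons s j); rewrite foldr_rcons.
by exists K; split => // p; exact: partial_eq0.
Qed.

Lemma is_weak_partial_lincomb D j f f' g g' k : measurable (D : set T3) ->
  is_weak_partial D j f f' -> is_weak_partial D j g g' ->
  is_weak_partial D j (fun p => f p + k * g p) (fun p => f' p + k * g' p).
Proof.
move=> mD [lf lf' hf] [lg lg' hg].
have ll u v : locally_integrable_on D u -> locally_integrable_on D v ->
    locally_integrable_on D (fun p => u p + k * v p).
  move=> [mu' iu] [mv iv]; split; first by apply: measurable_funD => //; exact: measurable_funM.
  move=> K cK KD; have mK := compact_measurable3 cK.
  by apply: (RintegrableD mK); [exact: iu|apply: (RintegrableZ mK); exact: iv].
split; [exact: ll..|] => phi tphi; have tp := test_function_partial j tphi.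
have E u v (psi : space R -> R) : locally_integrable_on D u -> locally_integrable_on D v ->
    test_function D psi -> \int[lambda]_(p in D) ((u p + k * v p) * psi p) =
    \int[lambda]_(p in D) (u p * psi p) + k * \int[lambda]_(p in D) (v p * psi p).
  move=> lu lv tpsi; have iu := Rintegrable_mul_supported mD lu tpsi.
  have iv := Rintegrable_mul_supported mD lv tpsi.
  rewrite -(RintegralZ' mD _ iv) -(RintegralD' mD iu (RintegrableZ mD _ iv)).
  by apply: eq_Rintegral => p _; rewrite mulrDl mulrA.
by rewrite (E _ _ _ lf lg tp) (E _ _ _ lf' lg' tphi) (hf _ tphi) (hg _ tphi) mulrN opprD.
Qed.

Lemma weak_partial_measurable D j f : measurable_on D (weak_partial D j f).
Proof.
rewrite /weak_partial; case: xgetP => [h _ [_ [mh _] _]//|_].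
exact: measurable_cst.
Qed.

Lemma ae_square_integrable D f g : measurable (D : set T3) -> measurable_on D g ->
  {ae lambda, forall p, D p -> g p = f p} -> square_integrable D f -> square_integrable D g.
Proof.
move=> mD mg gf [mf if2]; split => //.
have mg2 : measurable_fun (D : set T3) (fun p => g p ^+ 2) by exact: measurable_funX.
apply: (@Rintegrable_ge0P _ _ _ lambda D _ mg2) => [p _|]; first exact: sqr_ge0.
rewrite (@ge0_ae_eq_integral _ _ _ lambda D _ (fun p => (f p ^+ 2)%:E)) //.
- by rewrite (RintegralE mD if2) ltry.
- exact/measurable_EFinP.
- exact: measurable_int if2.
- by move=> p _; rewrite lee_fin sqr_ge0.
- by move=> p _; rewrite lee_fin sqr_ge0.
- by apply: (@filterS _ _ (ae_filter_ringOfSetsType lambda) _ _ _ gf) => p /= h Dp; rewrite h.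
Qed.

Lemma sobolev_weak_partial D f : open D -> sobolev_H1 D f -> forall j,
  is_weak_partial D j f (weak_partial D j f) /\ square_integrable D (weak_partial D j f).
Proof.
move=> oD [sf hf] j; have [g hg sg] := hf j; have [ae_g hw] := weak_partialE oD hg.
split => //; apply: (ae_square_integrable _ _ ae_g sg); first exact: open_measurable3.
exact: weak_partial_measurable.
Qed.

(** sqrt 2 [kink] is a bounded primitive of [sech ^+ 2]. *)
Lemma sech2_integral_lty : (\int[mu]_x (sech x ^+ 2)%:E < +oo)%E.
Proof.
have s0 : 0 < Num.sqrt (2 : R) by rewrite sqrtr_gt0; lra.
have cs : continuous (fun x : R => sech x ^+ 2) by apply: continuous_exp; exact: continuous_sech.
pose A n : set mR := `[- n%:R, n%:R]%classic.
have hb n : (\int[mu]_(x in A n) (sech x ^+ 2)%:E <= (2 * Num.sqrt 2)%:E)%E.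
  have le : - n%:R <= n%:R :> R by have : 0 <= n%:R :> R by []; lra.
  have h (x : R) : - n%:R <= x <= n%:R -> is_derive x 1 (fun x : R => Num.sqrt 2 * kink x) (sech x ^+ 2).
    move=> _; apply: (is_derive1_eq (is_derive1Z _ (is_derive_kink x))).
    by field; rewrite gt_eqF.
  have mA : measurable (A n) by exact: measurable_itv.
  rewrite (RintegralE mA (segment_Rintegrable _ _ cs)) (FTC_segment le cs h) kinkN lee_fin.
  have := sech_gt_bound (n%:R : R); rewrite ler_norml; nra.
have mA n : measurable (A n) by exact: measurable_itv.
have ms : measurable_fun setT (fun x : mR => (sech x ^+ 2)%:E).
  by apply/measurable_EFinP; apply: continuous_measurable_fun.
have UA : \bigcup_n A n = setT.
  apply/seteqP; split => // x _; exists (Num.bound `|x|) => //=.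
  by rewrite /A /= in_itv/= -ler_norml ltW// archi_boundP.
apply: (@le_lt_trans _ _ (2 * Num.sqrt 2)%:E); last by rewrite ltry.
rewrite -UA.
have ndA : nondecreasing_seq A.
  move=> n m nm; apply/subsetPset => x; rewrite /A /= !in_itv/= => /andP[h1 h2].
  have : n%:R <= m%:R :> R by rewrite ler_nat.
  by move=> h; apply/andP; split; lra.
have cvgA := @ge0_nondecreasing_set_cvg_integral _ _ _ A (fun x => (sech x ^+ 2)%:E) mu ndA mA.
have hc : (\int[mu]_(x in A i) (sech x ^+ 2)%:E)%E @[i --> \oo] -->
    (\int[mu]_(x in \bigcup_i A i) (sech x ^+ 2)%:E)%E.
  apply: cvgA => [n|n x _]; last by rewrite lee_fin sqr_ge0.
  exact: measurable_funTS.
rewrite -(cvg_lim (@ereal_hausdorff _) hc); apply: lime_le; first exact: (cvgP _ hc).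
by apply: nearW => n; exact: hb.
Qed.

Lemma sech2_Rintegrable : Rintegrable mu setT (fun x : mR => sech x ^+ 2).
Proof.
apply: Rintegrable_ge0P => //; last exact: sech2_integral_lty.
  by apply: continuous_measurable_fun; apply: continuous_exp; exact: continuous_sech.
by move=> x _; exact: sqr_ge0.
Qed.

(** Tonelli for the absolute values gives integrability, as the integrals of |f| over the line and
    of |g| over the disc are finite; Fubini then factors the integral. *)
Lemma cylinder_tensor rho (f : R -> R) (g : R * R -> R) : 0 < rho -> continuous f ->
  continuous g -> Rintegrable mu setT f ->
  Rintegrable lambda (cylinder rho) (fun p => f p.1 * g p.2) /\
  \int[lambda]_(p in cylinder rho) (f p.1 * g p.2) =
    (\int[mu]_x f x) * \int[mu2]_(q in disc rho) g q.
Proof.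
move=> r0 cf cg jf.
have mD := measurable_disc rho; have ig := disc_Rintegrable r0 cg.
have cE : cylinder rho = ([set: R] `*` disc rho : set T3).
  by apply/seteqP; split => p; [move=> /(cylinderP p r0) h; split|move=> [_ h]; apply/(cylinderP p r0)].
have mC := measurable_cylinder rho.
have cfg : continuous (fun p : space R => f p.1 * g p.2).
  apply: continuous_mul.
    by apply: (continuous_compose (f := fun p : space R => p.1)) => //; exact: continuous_fst.
  by apply: (continuous_compose (f := fun p : space R => p.2)) => //; exact: continuous_snd.
have mfg : measurable_fun (setT : set T3) (fun p => f p.1 * g p.2) by exact: continuous_measurable3.
have hi : Rintegrable lambda (cylinder rho) (fun p => f p.1 * g p.2).
  apply/(integrable_mkcond _ mC); apply/(integrable12ltyP mu mu2).
    by apply/(measurable_restrictT _ mC); apply/measurable_EFinP; exact: measurable_funTS.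
  have K0 : 0 <= \int[mu2]_(q in disc rho) `|g q| by apply: Rintegral_ge0.
  rewrite (eq_integral (fun x : mR => (\int[mu2]_(q in disc rho) `|g q|)%:E * `|(f x)%:E|)%E); last first.
    move=> x _; rewrite -(RintegralE mD (Rintegrable_norm ig)) muleC.
    rewrite -ge0_integralZl//; last first.
      by apply/measurable_EFinP; apply: measurableT_comp => //; exact: (Rintegrable_measurable ig).
    rewrite [RHS]integral_mkcond; apply: eq_integral => q _ /=.
    rewrite !patchE cE; have [h|h] := pselect (disc rho q).
      by rewrite !mem_set//= -EFinM -normrM.
    by rewrite !memNset//; [exact: abse0|case].
  rewrite ge0_integralZl//; [|by apply/measurable_EFinP; apply: measurableT_comp => //;
    exact: (Rintegrable_measurable jf)].
  by apply: lte_mul_pinfty; rewrite ?lee_fin//; have /integrableP[] := jf.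
split => //; rewrite cE in hi *.
rewrite (@Rintegral_prod12 _ _ _ _ R mu mu2 setT (disc rho) (fun p => f p.1 * g p.2)) //=; last first.
  by move=> x _; exact: RintegrableZ.
rewrite mulrC -(RintegralZ' measurableT _ jf); apply: eq_Rintegral => x _.
by rewrite (RintegralZ' mD _ ig) mulrC.
Qed.

Lemma sech_cylinder_L2 rho : 0 < rho -> L2 lambda (cylinder rho) (fun p => sech p.1).
Proof.
move=> r0; split.
  by apply: measurable_funTS; apply: continuous_measurable3; exact: continuous_sech_fst.
have c1 : continuous (fun _ : R * R => (1 : R)) by exact: continuous_const.
have cs : continuous (fun x : R => sech x ^+ 2) by apply: continuous_exp; exact: continuous_sech.
have [h _] := cylinder_tensor r0 cs c1 sech2_Rintegrable.
by apply: eq_Rintegrable h; [exact: measurable_cylinder|move=> p _; rewrite mulr1].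
Qed.

Lemma sech2_cylinder_L2 rho : 0 < rho -> L2 lambda (cylinder rho) (fun p => sech p.1 ^+ 2).
Proof.
move=> r0; apply: L2_le (sech_cylinder_L2 r0); first exact: measurable_cylinder.
  by apply: measurable_funTS; apply: continuous_measurable3; exact: continuous_sech2_fst.
move=> p _; have := sech_gt0 p.1; have := sech_le1 p.1; move=> h1 h0.
by rewrite !ger0_norm ?sqr_ge0//; [rewrite expr2 ler_piMl// ltW|exact: ltW].
Qed.

(** The radii start at rho / 2, so constants uniform for radii above rho / 2 apply along the whole
    sequence. A signed [F] is written as |F| minus (|F| - F), both nonnegative. *)
Lemma cylinder_exhaustion rho F : 0 < rho -> Rintegrable lambda (cylinder rho) F ->
  \int[lambda]_(p in cylinder (rho * (1 - n.+2%:R^-1))) F p @[n --> \oo] -->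
  \int[lambda]_(p in cylinder rho) F p.
Proof.
move=> r0; pose r n := rho * (1 - n.+2%:R^-1).
have rE n : r n = rho - rho / n.+2%:R by rewrite /r mulrBr mulr1.
have rr n : r n <= rho by rewrite rE lerBlDr lerDl divr_ge0// ltW.
have mr n := measurable_cylinder (r n); have mC := measurable_cylinder rho.
have ndr : nondecreasing_seq (fun n => cylinder (r n) : set T3).
  move=> n m nm; apply/subsetPset; apply: subset_cylinder; rewrite !rE lerD2l lerN2.
  by apply: (ler_wpM2l (ltW r0)); rewrite lef_pV2 ?posrE// ler_nat.
have Ur : \bigcup_n (cylinder (r n)) = (cylinder rho : set T3).
  apply/seteqP; split => [p [n _]|p hp]; first exact: subset_cylinder.
  have {hp} hp : Num.sqrt (p.2.1 ^+ 2 + p.2.2 ^+ 2) < rho by [].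
  set z := Num.sqrt _ in hp.
  have z0 : 0 < (rho - z) / rho by rewrite divr_gt0// subr_gt0.
  have [N _ hN] := near_infty_natSinv_lt (PosNum z0).
  exists N => //; rewrite /cylinder /= -/z rE.
  have := hN N (leqnn N); rewrite /= ltr_pdivlMr// => h.
  have : rho / N.+2%:R <= N.+1%:R^-1 * rho.
    by rewrite mulrC; apply: (ler_wpM2r (ltW r0)); rewrite lef_pV2 ?posrE// ler_nat.
  by move=> /le_lt_trans/(_ h); rewrite !ltrBrDr addrC.
have pos G : Rintegrable lambda (cylinder rho) G -> (forall p, 0 <= G p) ->
    \int[lambda]_(p in cylinder (r n)) G p @[n --> \oo] --> \int[lambda]_(p in cylinder rho) G p.
  move=> iG G0; have mG := Rintegrable_measurable iG.
  have hc := @ge0_nondecreasing_set_cvg_integral _ _ _ _ (fun p => (G p)%:E) lambda ndr mr.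
  rewrite Ur in hc; rewrite /Rintegral; apply: fine_cvg; rewrite fineK.
    apply: hc => [n|n p _]; last by rewrite lee_fin.
    by apply/measurable_EFinP; apply: measurable_funS mG => //; exact: subset_cylinder.
  exact: integrable_fin_num.
move=> jF; have iN := Rintegrable_norm jF.
have E n : \int[lambda]_(p in cylinder (r n)) F p = \int[lambda]_(p in cylinder (r n)) `|F p| -
    \int[lambda]_(p in cylinder (r n)) (`|F p| - F p).
  have iS G : Rintegrable lambda (cylinder rho) G -> Rintegrable lambda (cylinder (r n)) G.
    by apply: integrableS => //; exact: subset_cylinder.
  by rewrite (RintegralB' (mr n) (iS _ iN) (iS _ jF)); ring.
have -> : \int[lambda]_(p in cylinder rho) F p = \int[lambda]_(p in cylinder rho) `|F p| -
    \int[lambda]_(p in cylinder rho) (`|F p| - F p).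
  by rewrite (RintegralB' mC iN jF); ring.
rewrite -/r; under eq_fun do rewrite E.
apply: cvgB; first exact: pos iN _.
apply: pos; first exact: RintegrableB.
by move=> p; rewrite subr_ge0 ler_norm.
Qed.

End weak_fields.

(** * Lower bound of the energy *)

Section energy_bound.
Context {R : realType}.
Local Notation mR := (measurableTypeR R).
Local Notation T2 := (mR * mR)%type.
Local Notation T3 := (mR * (mR * mR))%type.
Local Notation mu := (@lebesgue_measure R).
Local Notation mu2 := (@lebesgue2 R).
Local Notation lambda := (@lebesgue3 R).
Implicit Types (f h w : space R -> R) (rho d eta : R) (g dh dw : 'I_3 -> space R -> R).

Definition kink_flux f g p := sech p.1 ^+ 2 / Num.sqrt 2 * g i0 p - sech p.1 ^+ 2 * kink p.1 * f p.

(** The limit e to 0 with an error linear in [e]; the restriction e <= 1 makes it possible to absorb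
    quadratic errors into [C]. *)
Lemma ler_limit (a : R -> R) (x C : R) : (forall e, 0 < e -> e <= 1 -> x - C * e <= a e) ->
  forall y, (forall e, 0 < e -> e <= 1 -> a e <= y) -> x <= y.
Proof.
move=> h y hy; apply/ler_addgt0Pr => e e0.
pose k := Num.min 1 (e / (`|C| + 1)).
have c1 : 0 < `|C| + 1 by rewrite ltr_wpDl.
have k0 : 0 < k by rewrite /k lt_min ltr01 divr_gt0.
have k1 : k <= 1 by rewrite /k ge_min lexx.
have ke : C * k <= e.
  apply: (@le_trans _ _ ((`|C| + 1) * k)); first by rewrite ler_wpM2r// ?(ltW k0)// ler_wpDr// ler_norm.
  by rewrite mulrC -ler_pdivlMr// /k ge_min lexx orbT.
by have := h k k0 k1; have := hy k k0 k1; lra.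
Qed.

Lemma measurable_kink_fst D : measurable (D : set T3) -> measurable_fun D (fun p : T3 => kink p.1).
Proof.
move=> mD; apply: measurable_funTS; apply: continuous_measurable3.
apply: (continuous_compose (f := fun p : space R => p.1)); [exact: continuous_fst|exact: continuous_kink].
Qed.

Lemma measurable_sech_fst D : measurable (D : set T3) -> measurable_fun D (fun p : T3 => sech p.1).
Proof. by move=> mD; apply: measurable_funTS; apply: continuous_measurable3; exact: continuous_sech_fst. Qed.

Lemma sech2_le1 x : `|sech x ^+ 2| <= 1 :> R.
Proof.
by rewrite ger0_norm ?sqr_ge0// expr_le1// ?sech_le1//; exact/ltW/sech_gt0.
Qed.

Lemma well_integral rho f g : 0 < rho -> L2 lambda (cylinder rho) f ->
  (forall j, L2 lambda (cylinder rho) (g j)) ->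
  Rintegrable lambda (cylinder rho) (well f g) /\
  \int[lambda]_(p in cylinder rho) well f g p =
    \int[lambda]_(p in cylinder rho) (1 * g i0 p ^+ 2) + \int[lambda]_(p in cylinder rho) (1 * g i1 p ^+ 2)
    + \int[lambda]_(p in cylinder rho) (1 * g i2 p ^+ 2)
    - \int[lambda]_(p in cylinder rho) (sech p.1 ^+ 2 * f p ^+ 2).
Proof.
move=> r0 lf lg; have mC := measurable_cylinder rho.
have ig j : Rintegrable lambda (cylinder rho) (fun p => 1 * g j p ^+ 2).
  by apply: (eq_Rintegrable mC _ (lg j).2) => p _; rewrite mul1r.
have isf : Rintegrable lambda (cylinder rho) (fun p => sech p.1 ^+ 2 * f p ^+ 2).
  have h := L2_bounded mC (measurable_sech_fst mC) (C := 1) _ lf.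
  have {}h := (h _).2; apply: (eq_Rintegrable mC _ (h _)) => [p _|p _]; first by rewrite exprMn.
  by rewrite ger0_norm ?sech_le1//; exact/ltW/sech_gt0.
have i01 := RintegrableD mC (ig i0) (ig i1); have i012 := RintegrableD mC i01 (ig i2).
have i4 := RintegrableB mC i012 isf.
have E p : well f g p = 1 * g i0 p ^+ 2 + 1 * g i1 p ^+ 2 + 1 * g i2 p ^+ 2 - sech p.1 ^+ 2 * f p ^+ 2.
  by rewrite /well /grad2 !mul1r.
split; first by apply: (eq_Rintegrable mC _ i4) => p _; rewrite E.
rewrite -(RintegralD' mC (ig i0) (ig i1)) -(RintegralD' mC i01 (ig i2)) -(RintegralB' mC i012 isf).
by apply: eq_Rintegral => p _; rewrite E.
Qed.

Lemma L2_sech2_scaled rho : 0 < rho ->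
  L2 lambda (cylinder rho) (fun p => sech p.1 ^+ 2 / Num.sqrt 2) /\
  L2 lambda (cylinder rho) (fun p => sech p.1 ^+ 2 * kink p.1).
Proof.
move=> r0; have mC := measurable_cylinder rho; have ls := sech2_cylinder_L2 r0; split.
  by have := L2Z mC (Num.sqrt 2)^-1 ls; congr L2; apply/funext => p; rewrite mulrC.
have := L2_bounded mC (measurable_kink_fst mC) (C := 1) _ ls.
rewrite (_ : (fun p => _) = (fun p => sech p.1 ^+ 2 * kink p.1)); last by apply/funext => p; rewrite mulrC.
by apply => p _; exact: sech_gt_bound.
Qed.

Lemma flux_integral rho f g : 0 < rho -> L2 lambda (cylinder rho) f ->
  (forall j, L2 lambda (cylinder rho) (g j)) ->
  Rintegrable lambda (cylinder rho) (kink_flux f g) /\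
  \int[lambda]_(p in cylinder rho) kink_flux f g p =
    \int[lambda]_(p in cylinder rho) (sech p.1 ^+ 2 / Num.sqrt 2 * g i0 p) -
    \int[lambda]_(p in cylinder rho) (sech p.1 ^+ 2 * kink p.1 * f p).
Proof.
move=> r0 lf lg; have mC := measurable_cylinder rho; have [l1 l2] := L2_sech2_scaled r0.
have j1 := L2_mul mC l1 (lg i0); have j2 := L2_mul mC l2 lf.
by split; [exact: RintegrableB|rewrite -RintegralB'].
Qed.

Definition weak_field d f g := [/\ square_integrable (cylinder d) f,
  forall j, is_weak_partial (cylinder d) j f (g j) &
  forall j, square_integrable (cylinder d) (g j)].

Lemma weak_field_L2 d rho f g : rho <= d -> weak_field d f g ->
  L2 lambda (cylinder rho) f /\ forall j, L2 lambda (cylinder rho) (g j).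
Proof.
move=> rd [sf _ sg]; have mC := measurable_cylinder rho; have mD := measurable_cylinder d.
have CD : cylinder rho `<=` (cylinder d : set (space R)) by exact: subset_cylinder.
by split => [|j]; [exact: (L2_subset mC mD CD sf)|exact: (L2_subset mC mD CD (sg j))].
Qed.

(** Every functional of the lower bound is continuous in L^2, so a single regular approximation
    serves them all; the factors 4 and 2 count the terms of [well] and of [kink_flux]. *)
Lemma weak_field_approximation d rho f g eta : 0 < rho -> rho < d -> 0 < eta ->
  weak_field d f g -> exists L h dh, [/\ 0 < L, C1_cutoff L h dh,
    L2 lambda (cylinder rho) h /\ \int[lambda]_(p in cylinder rho) ((h p - f p) ^+ 2) <= eta,
    `|\int[lambda]_(p in cylinder rho) well h dh p - \int[lambda]_(p in cylinder rho) well f g p| <= 4 * eta /\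
    `|\int[lambda]_(p in cylinder rho) (h p * sech p.1) -
      \int[lambda]_(p in cylinder rho) (f p * sech p.1)| <= eta &
    `|\int[lambda]_(p in cylinder rho) kink_flux h dh p - \int[lambda]_(p in cylinder rho) kink_flux f g p| <= 2 * eta].
Proof.
move=> r0 rd eta0 fg; have [sf wf sg] := fg; have [lf lg] := weak_field_L2 (ltW rd) fg.
have mC := measurable_cylinder rho; have [l1 l2] := L2_sech2_scaled r0; have ls := sech_cylinder_L2 r0.
have [e0 e00 q0] := L2_quadratic_continuity mC eta0 (lg i0).
have [e1 e10 q1] := L2_quadratic_continuity mC eta0 (lg i1).
have [e2 e20 q2] := L2_quadratic_continuity mC eta0 (lg i2).
have [e3 e30 q3] := L2_quadratic_continuity mC eta0 lf.
have [e4 e40 q4] := L2_linear_continuity mC eta0 l1.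
have [e5 e50 q5] := L2_linear_continuity mC eta0 l2.
have [e6 e60 q6] := L2_linear_continuity mC eta0 ls.
pose e := Num.min eta (Num.min (Num.min (Num.min e0 e1) (Num.min e2 e3)) (Num.min (Num.min e4 e5) e6)).
have eps0 : 0 < e by rewrite /e !lt_min eta0 e00 e10 e20 e30 e40 e50 e60.
have [L [h [dh [L0 hL [lh ldh] hf hg]]]] := H1_approximation r0 rd eps0 sf wf sg.
have le x : (x <= e -> [/\ x <= eta, x <= e0, x <= e1, x <= e2 & [/\ x <= e3, x <= e4, x <= e5 & x <= e6]]).
  by rewrite /e !le_min => /and3P[-> /andP[/andP[-> ->] /andP[-> ->]] /andP[/andP[-> ->] ->]].
have [f_eta _ _ _ [f3 _ f5 f6]] := le _ hf.
have [_ g0 _ _ [_ g4 _ _]] := le _ (hg i0).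
have [_ _ g1 _ _] := le _ (hg i1).
have [_ _ _ g2 _] := le _ (hg i2).
have m1 : measurable_fun (cylinder rho : set T3) (fun _ : T3 => (1 : R)) by exact: measurable_cst.
have b1 (p : space R) : cylinder rho p -> `|1 : R| <= 1 by rewrite normr1.
have ms : measurable_fun (cylinder rho : set T3) (fun p : T3 => sech p.1 ^+ 2).
  by apply: measurable_funX; exact: measurable_sech_fst.
have bs (p : space R) : cylinder rho p -> `|sech p.1 ^+ 2| <= 1 by move=> _; exact: sech2_le1.
exists L, h, dh; split => //; [split|].
- have := q0 _ _ (ldh i0) g0 m1 b1; have := q1 _ _ (ldh i1) g1 m1 b1.
  have := q2 _ _ (ldh i2) g2 m1 b1; have := q3 _ _ lh f3 ms bs.
  rewrite (well_integral r0 lh ldh).2 (well_integral r0 lf lg).2 !ler_norml.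
  by clear; lra.
- have := q6 _ _ lf lh f6.
  have E k : \int[lambda]_(p in cylinder rho) (k p * sech p.1) = \int[lambda]_(p in cylinder rho) (sech p.1 * k p).
    by apply: eq_Rintegral => p _; rewrite mulrC.
  by rewrite !E.
- have := q4 _ _ (lg i0) (ldh i0) g4; have := q5 _ _ lf lh f5.
  rewrite (flux_integral r0 lh ldh).2 (flux_integral r0 lf lg).2 !ler_norml.
  by clear; lra.
Qed.

Variable j : R.
Hypothesis hj : smallest_positive_zero (derive1 (bessel_J 1)) j.

Lemma weak_field_ge_mean r : 0 < r -> exists2 C, 0 <= C & forall rho d f g, r <= rho ->
  rho ^+ 2 <= 2 * j ^+ 2 -> rho < d -> weak_field d f g ->
  - C * (\int[lambda]_(p in cylinder rho) (f p * sech p.1)) ^+ 2 <=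
  \int[lambda]_(p in cylinder rho) well f g p.
Proof.
move=> r0; have [C C0 hC] := well_ge_mean hj r0; exists C => // rho d f g rr rj rd fg.
have rho0 : 0 < rho by lra.
set M := \int[lambda]_(p in cylinder rho) (f p * sech p.1).
set Q := \int[lambda]_(p in cylinder rho) well f g p.
apply: (@ler_limit (fun=> Q) _ (C * (2 * `|M| + 1) + 4)) => // e e0 e1.
have [L [h [dh [L0 hL _ [hq hm] _]]]] := weak_field_approximation rho0 rd e0 fg.
have := hC _ _ _ _ rr rj L0 hL.
set M' := \int[lambda]_(p in cylinder rho) (h p * sech p.1) in hm *.
set Q' := \int[lambda]_(p in cylinder rho) well h dh p in hq *.
have h2 : M' ^+ 2 <= M ^+ 2 + e * (2 * `|M| + 1).
  have h1 : M * (M' - M) <= `|M| * e.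
    by apply: (le_trans (ler_norm _)); rewrite normrM ler_wpM2l.
  have hx : (M' - M) ^+ 2 <= e.
    have n0 := normr_ge0 (M' - M); rewrite -(real_normK (num_real (M' - M))).
    by move: hm; rewrite -/M; move: n0 e0 e1; clear; nra.
  have -> : M' ^+ 2 = M ^+ 2 + 2 * (M * (M' - M)) + (M' - M) ^+ 2 by ring.
  by move: h1 hx; clear; lra.
have h3 := ler_wpM2l C0 h2.
by move: hq; rewrite -/Q ler_norml => /andP[_ hq] hh; clear -hq hh h3; lra.
Qed.

Lemma weak_field_flux rho d f g : 0 < rho -> rho < d -> weak_field d f g ->
  \int[lambda]_(p in cylinder rho) kink_flux f g p = 0.
Proof.
move=> r0 rd fg; set B := Rintegral _ _ _.
have h e : 0 < e -> `|B| <= e.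
  move=> e0; have e2 : 0 < e / 2 by rewrite divr_gt0.
  have [L [h [dh [L0 hL _ _]]]] := weak_field_approximation r0 rd e2 fg.
  rewrite -/B /kink_flux (well_kink r0 L0 hL) sub0r normrN.
  by have -> : 2 * (e / 2) = e by field.
apply/eqP; rewrite -normr_eq0 eq_le normr_ge0 andbT.
by apply/ler_addgt0Pr => e e0; rewrite add0r; exact: h.
Qed.

Lemma reflect_preserving : measure_preserving lambda (reflect : T3 -> T3).
Proof.
have pid : measure_preserving mu2 (id : T2 -> T2) by split; [exact: measurable_id|].
have po : measure_preserving mu (fun x : mR => - x : mR) by exact: preserving_opp.
exact: (@preserving_prod _ _ _ _ R mu mu2 _ _ po pid).
Qed.

Lemma cylinder_reflect_integral d f : Rintegrable lambda (cylinder d) f ->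
  Rintegrable lambda (cylinder d) (fun p => f (reflect p)) /\
  \int[lambda]_(p in cylinder d) f (reflect p) = \int[lambda]_(p in cylinder d) f p.
Proof.
have mC := measurable_cylinder d.
have E : ((EFin \o f) \_ (cylinder d)) \o reflect = (fun p => (f (reflect p))%:E) \_ (cylinder d).
  by apply/funext => p; rewrite /= !patchE.
move=> /(integrable_mkcond _ mC) hf; split.
  apply/(integrable_mkcond _ mC).
  by have := preserving_integrable reflect_preserving hf; rewrite E.
rewrite /Rintegral; congr fine; rewrite integral_mkcond [RHS]integral_mkcond.
rewrite -(preserving_integral reflect_preserving hf); apply: eq_integral => p _.
by rewrite !patchE.
Qed.

(** The approximation [h] need not be odd. As [f] is, the sum of [h] and its reflection equals that
    of h - f and its reflection, so [well_ge_even] costs only the L^2 error. *)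
Lemma weak_field_ge_odd rho d f g : 0 < rho -> rho < d -> weak_field d f g ->
  {ae lambda, forall p, cylinder d p -> f (reflect p) = - f p} ->
  0 <= \int[lambda]_(p in cylinder rho) well f g p.
Proof.
move=> r0 rd fg odd; set Q := Rintegral _ _ _.
apply: (@ler_limit (fun=> Q) _ 5) => // e e0 e1.
have [L [h [dh [L0 hL [lh hf] [hq _] _]]]] := weak_field_approximation r0 rd e0 fg.
have := well_ge_even r0 L0 hL; have [lf _] := weak_field_L2 (ltW rd) fg.
have mC := measurable_cylinder rho.
have lhf := L2B mC lh lf.
have iq := cylinder_reflect_integral lhf.2.
have mr (k : T3 -> R) : measurable_fun (cylinder rho : set T3) k ->
    measurable_fun (cylinder rho : set T3) (fun p : T3 => k (reflect p)).
  move=> mk; apply: (measurable_comp mC _ mk); first by move=> _ [p hp <-].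
  exact: measurable_funTS reflect_preserving.1.
have lhr : L2 lambda (cylinder rho) (fun p => h (reflect p)).
  by split; [exact: mr lh.1|exact: (cylinder_reflect_integral lh.2).1].
have lhfr : L2 lambda (cylinder rho) (fun p => h (reflect p) - f (reflect p)).
  by split; [exact: (mr (fun p => h p - f p) lhf.1)|exact: iq.1].
have hE : \int[lambda]_(p in cylinder rho) ((h p + h (reflect p)) ^+ 2) =
    \int[lambda]_(p in cylinder rho) (((h p - f p) + (h (reflect p) - f (reflect p))) ^+ 2).
  rewrite /Rintegral; congr fine; apply: ae_eq_integral => //.
  - exact: measurable_int (L2D mC lh lhr).2.
  - exact: measurable_int (L2D mC lhf lhfr).2.
  - apply: (@filterS _ _ (ae_filter_ringOfSetsType lambda) _ _ _ odd) => p /= hp Cp.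
    by rewrite hp; [congr EFin; ring|exact: (subset_cylinder (ltW rd))].
have := L2_sqrD mC lhf lhfr; rewrite -hE iq.2.
move: hq hf; rewrite -/Q ler_norml => /andP[_ hq] hf hS hW.
by clear -hq hf hS hW e0; lra.
Qed.

(** The gradients are parameters, so that weak and classical derivatives can both be inserted. *)
Definition density f1 f2 g1 g2 p : R :=
  1 / 2 * \sum_(i < 3) (g1 i p ^+ 2 + g2 i p ^+ 2) + 1 / 4 * (1 - (f1 p ^+ 2 + f2 p ^+ 2)) ^+ 2.

(** For u = (a, T + b) with e = sech and T = kink, 1 - |u|^2 = e^2 - (a^2 + b^2 + 2 T b). On
    expanding the potential, the square of the bracket is dropped, and the other terms add up to the
    left side. *)
Lemma density_ge f1 f2 w g1 g2 dw p : f2 p = w p + kink p.1 ->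
  (forall i, g2 i p = dw i p + (i == i0)%:R * (sech p.1 ^+ 2 / Num.sqrt 2)) ->
  1 / 2 * sech p.1 ^+ 4 + (1 / 2 * well f1 g1 p + (1 / 2 * well w dw p + kink_flux w dw p)) <=
  density f1 f2 g1 g2 p.
Proof.
move=> f2E g2E; rewrite /density f2E !big_ord_recl big_ord0 /= !g2E /well /grad2 /kink_flux.
rewrite (_ : lift ord0 ord0 = i1); last exact: val_inj.
rewrite (_ : lift ord0 (lift ord0 ord0) = i2); last exact: val_inj.
rewrite -/i0 eqxx (_ : (i1 == i0) = false)// (_ : (i2 == i0) = false)// !mul0r !mul1r !addr0.
have sk := sech_kink p.1; set e := sech p.1 in sk *; set T := kink p.1 in sk *.
have s0 : Num.sqrt (2 : R) != 0 by rewrite sqrtr_eq0 -ltNge; lra.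
have s2 : (Num.sqrt (2 : R))^-1 ^+ 2 = 1 / 2 by rewrite exprVn sqr_sqrtr//; lra.
set s := (Num.sqrt 2)^-1 in s2 *.
set a := f1 p; set b := w p; set A0 := g1 i0 p; set A1 := g1 i1 p; set A2 := g1 i2 p.
set B0 := dw i0 p; set B1 := dw i1 p; set B2 := dw i2 p.
have -> : (B0 + e ^+ 2 * s) ^+ 2 = B0 ^+ 2 + 2 * (e ^+ 2 * s * B0) + 1 / 2 * e ^+ 4.
  by rewrite -s2; ring.
have -> : 1 - (a ^+ 2 + (b + T) ^+ 2) = e ^+ 2 - (a ^+ 2 + b ^+ 2 + 2 * T * b).
  have -> : (b + T) ^+ 2 = b ^+ 2 + 2 * T * b + T ^+ 2 by ring.
  by move: sk; clear; lra.
have := sqr_ge0 (a ^+ 2 + b ^+ 2 + 2 * T * b); set r := (_ + _) ^+ 2 => r0.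
rewrite (_ : (e ^+ 2 - _) ^+ 2 = e ^+ 4 - 2 * e ^+ 2 * (a ^+ 2 + b ^+ 2 + 2 * T * b) + r); last by rewrite /r; ring.
by clear -r0; lra.
Qed.

Definition kink_slope (i : 'I_3) (p : space R) : R := (i == i0)%:R * (sech p.1 ^+ 2 / Num.sqrt 2).

Lemma kink_weak_partial D i : measurable (D : set T3) ->
  is_weak_partial D i (fun p => kink p.1) (kink_slope i).
Proof.
move=> mD; apply: classical_weak_partial => //.
- by apply: (continuous_compose (f := fun p : space R => p.1)); [exact: continuous_fst|exact: continuous_kink].
- apply: continuous_mul; first exact: continuous_const.
  by apply: continuous_mul; [exact: continuous_sech2_fst|exact: continuous_const].
- by move=> p; exact: (is_derive_fst_compose i (is_derive_kink p.1)).
Qed.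

Definition deviation (u : space R -> R * R) p : R := comp2 u p - kink p.1.

Lemma admissible_fields d (u : space R -> R * R) : admissible d u ->
  let D := cylinder d in
  [/\ weak_field d (comp1 u) (fun i => weak_partial D i (comp1 u)),
     weak_field d (deviation u) (fun i p => weak_partial D i (comp2 u) p - kink_slope i p) &
     {ae lambda, forall p, D p -> deviation u (reflect p) = - deviation u p}].
Proof.
move=> [s1 s2 sy] D; have oD : open D by exact: open_cylinder.
have mD : measurable (D : set T3) by exact: measurable_cylinder.
have E1 : comp1 (fun p => u p - soliton p) = comp1 u.
  by apply/funext => p; rewrite /comp1 /soliton /= subr0.
rewrite E1 in s1; split.
- by split => [|i|i]; [exact: s1.1|exact: (sobolev_weak_partial oD s1 i).1|exact: (sobolev_weak_partial oD s1 i).2].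
- have s2' : sobolev_H1 D (deviation u) by [].
  have h i : is_weak_partial D i (fun p => deviation u p + 1 * kink p.1)
      (fun p => weak_partial D i (deviation u) p + 1 * kink_slope i p).
    apply: is_weak_partial_lincomb => //; last exact: kink_weak_partial.
    by have [] := sobolev_weak_partial oD s2' i.
  have E2 : (fun p => deviation u p + 1 * kink p.1) = comp2 u.
    by apply/funext => p; rewrite /deviation mul1r subrK.
  have E3 : (fun p => comp2 u p + - 1 * kink p.1) = deviation u.
    by apply/funext => p; rewrite mulN1r.
  have w i : is_weak_partial D i (deviation u) (fun p => weak_partial D i (comp2 u) p - kink_slope i p).
    have := h i; rewrite E2 => /(weak_partialE oD)[_ hw].
    have := is_weak_partial_lincomb (-1) mD hw (kink_weak_partial i mD).
    by rewrite E3; congr is_weak_partial; apply/funext => p; rewrite mulN1r.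
  split; [exact: s2'.1|exact: w|move=> i].
  have [hs ss] := sobolev_weak_partial oD s2' i.
  apply: (ae_square_integrable mD _ (weak_partial_unique oD (w i) hs) ss).
  by have [_ []] := w i.
- apply: (@filterS _ _ (ae_filter_ringOfSetsType lambda) _ _ _ sy) => p /= h Dp.
  by have [_ h2] := h Dp; rewrite /deviation /reflect h2 /= kinkN opprB opprK addrC.
Qed.

Lemma density_measurable f1 f2 g1 g2 D : measurable_on D f1 -> measurable_on D f2 ->
  (forall i, measurable_on D (g1 i)) -> (forall i, measurable_on D (g2 i)) ->
  measurable_on D (density f1 f2 g1 g2).
Proof.
move=> m1 m2 n1 n2; apply: measurable_funD; apply: measurable_funM => //.
  by apply: measurable_sum => i; apply: measurable_funD; apply: measurable_funX; [exact: n1|exact: n2].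
by apply: measurable_funX; apply: measurable_funB => //; apply: measurable_funD; exact: measurable_funX.
Qed.

Lemma density_ge0 f1 f2 g1 g2 p : 0 <= density f1 f2 g1 g2 p.
Proof.
rewrite addr_ge0//; last by rewrite mulr_ge0// ?sqr_ge0//; lra.
by apply: mulr_ge0; [lra|apply: sumr_ge0 => i _; rewrite addr_ge0 ?sqr_ge0].
Qed.

Lemma sech4_Rintegrable rho : 0 < rho -> Rintegrable lambda (cylinder rho) (fun p => 1 / 2 * sech p.1 ^+ 4).
Proof.
move=> r0; apply: RintegrableZ; first exact: measurable_cylinder.
have := (sech2_cylinder_L2 r0).2; apply: eq_Rintegrable => [|p _]; first exact: measurable_cylinder.
by rewrite -exprM.
Qed.

Lemma Rintegral_le_ereal (D : set T3) (f g : T3 -> R) : measurable D -> Rintegrable lambda D f ->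
  measurable_fun D g -> (forall p, D p -> 0 <= g p) -> (forall p, D p -> f p <= g p) ->
  ((\int[lambda]_(p in D) f p)%:E <= \int[lambda]_(p in D) (g p)%:E)%E.
Proof.
move=> mD jf mg g0 fg.
have [goo|] := ltP (\int[lambda]_(p in D) (g p)%:E)%E +oo%E; last by rewrite leye_eq => /eqP->; rewrite leey.
have ig : Rintegrable lambda D g by exact: Rintegrable_ge0P.
by rewrite (RintegralE mD ig) lee_fin; exact: le_Rintegral'.
Qed.

Lemma energy_ge d (u : space R -> R * R) rho : 0 < d -> admissible d u ->
  0 < rho -> rho <= d -> rho ^+ 2 <= 2 * j ^+ 2 ->
  \int[lambda]_(p in cylinder rho) (comp1 u p * sech p.1) = 0 ->
  ((\int[lambda]_(p in cylinder rho) (1 / 2 * sech p.1 ^+ 4))%:E <= energy d u)%E.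
Proof.
move=> d0 au r0 rd rj M0; have [f1 fw od] := admissible_fields au.
set D := cylinder d in f1 fw od.
have mD : measurable (D : set T3) by exact: measurable_cylinder.
set g1 := (fun i => weak_partial D i (comp1 u)) in f1.
set g2 := (fun i => weak_partial D i (comp2 u)).
set w := deviation u in fw od; set dw := (fun i p => g2 i p - kink_slope i p) in fw.
have w2 p : comp2 u p = w p + kink p.1 by rewrite /w /deviation subrK.
have g2E i p : g2 i p = dw i p + (i == i0)%:R * (sech p.1 ^+ 2 / Num.sqrt 2).
  by rewrite /dw /kink_slope subrK.
have m1 : measurable_on D (comp1 u) by case: f1 => -[].
have mw : measurable_on D w by case: fw => -[].
have m2 : measurable_on D (comp2 u).
  rewrite (_ : comp2 u = (fun p => w p + kink p.1)); last exact/funext.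
  by apply: measurable_funD => //; exact: measurable_kink_fst.
have mdens : measurable_on D (density (comp1 u) (comp2 u) g1 g2).
  by apply: density_measurable => // i; exact: weak_partial_measurable.
pose E0 r := \int[lambda]_(p in cylinder r) (1 / 2 * sech p.1 ^+ 4).
pose M r := \int[lambda]_(p in cylinder r) (comp1 u p * sech p.1).
have rh0 : 0 < rho / 2 by rewrite divr_gt0.
have [C C0 hC] := weak_field_ge_mean rh0.
(* For r < rho there is room for the approximation, at the price of a mean [M r] that may differ
   from 0; the error disappears as [r] tends to [rho]. *)
have main r : rho / 2 <= r -> r < rho -> ((E0 r - 1 / 2 * (C * M r ^+ 2))%:E <= energy d u)%E.
  move=> rr rrho; have r0' : 0 < r by lra.
  have rd' : r < d by lra.
  have mC := measurable_cylinder r.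
  have CD : cylinder r `<=` D by apply: subset_cylinder; exact: ltW.
  have rj' : r ^+ 2 <= 2 * j ^+ 2.
    by apply: le_trans rj; rewrite lerXn2r ?nnegrE//; exact: ltW.
  have h1 := hC _ _ _ _ rr rj' rd' f1.
  have h2 := weak_field_ge_odd r0' rd' fw od.
  have h3 := weak_field_flux r0' rd' fw.
  have [l1 lg1] := weak_field_L2 (ltW rd') f1; have [lw ldw] := weak_field_L2 (ltW rd') fw.
  have [i1' _] := well_integral r0' l1 lg1; have [i2' _] := well_integral r0' lw ldw.
  have [i3' _] := flux_integral r0' lw ldw; have i4' := sech4_Rintegrable r0'.
  have j1 := RintegrableZ mC (1 / 2) i1'; have j2 := RintegrableZ mC (1 / 2) i2'.
  have j23 := RintegrableD mC j2 i3'; have j123 := RintegrableD mC j1 j23.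
  have j0 := RintegrableD mC i4' j123.
  apply: (@le_trans _ _ (\int[lambda]_(p in cylinder r)
      (density (comp1 u) (comp2 u) g1 g2 p)%:E)%E); last first.
    apply: ge0_subset_integral => //; first exact/measurable_EFinP.
    by move=> p _; rewrite lee_fin density_ge0.
  apply: (@le_trans _ _ (\int[lambda]_(p in cylinder r) (1 / 2 * sech p.1 ^+ 4 +
    (1 / 2 * well (comp1 u) g1 p + (1 / 2 * well w dw p + kink_flux w dw p))))%:E).
    rewrite lee_fin (RintegralD' mC i4' j123) (RintegralD' mC j1 j23) (RintegralD' mC j2 i3').
    rewrite (RintegralZ' mC _ i1') (RintegralZ' mC _ i2') h3 addr0 -/(E0 r).
    by move: h1 h2; rewrite -/(M r); clear; lra.
  apply: Rintegral_le_ereal => //.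
  - exact: measurable_funS mdens.
  - by move=> p _; exact: density_ge0.
  - by move=> p _; exact: density_ge.
have cE := cylinder_exhaustion r0 (sech4_Rintegrable r0).
have iM : Rintegrable lambda (cylinder rho) (fun p => comp1 u p * sech p.1).
  have [l1 _] := weak_field_L2 rd f1.
  by apply: (L2_mul (measurable_cylinder rho) l1); exact: sech_cylinder_L2.
have cM := cylinder_exhaustion r0 iM; rewrite M0 in cM.
have [eoo|] := ltP (energy d u) +oo%E; last by rewrite leye_eq => /eqP->; rewrite leey.
have e0 : (0 <= energy d u)%E.
  by apply: integral_ge0 => p _; rewrite lee_fin; exact: (density_ge0 (comp1 u) (comp2 u) g1 g2 p).
have ef : energy d u \is a fin_num by rewrite ge0_fin_numE.
rewrite -(fineK ef) lee_fin.
pose r n : R := rho * (1 - n.+2%:R^-1).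
have cl : (E0 (r n) - 1 / 2 * (C * M (r n) ^+ 2)) @[n --> \oo] --> (E0 rho - 1 / 2 * (C * 0 ^+ 2)).
  apply: cvgB; first exact: cE.
  apply: cvgM; first exact: cvg_cst.
  apply: cvgM; first exact: cvg_cst.
  rewrite expr2 (_ : (fun n => M (r n) ^+ 2) = (fun n => M (r n) * M (r n))).
    by apply: cvgM; exact: cM.
  by apply/funext => n; rewrite expr2.
rewrite expr0n/= !mulr0 subr0 in cl.
rewrite -/(E0 rho) -(cvg_lim (@Rhausdorff R) cl); apply: limr_le; first exact: (cvgP _ cl).
apply: nearW => n; rewrite -lee_fin (fineK ef); apply: main; rewrite /r.
  have h : n.+2%:R^-1 <= 2^-1 :> R by rewrite lef_pV2 ?posrE// ler_nat.
  by move: h; set x := n.+2%:R^-1 => h; move: r0 h; clear; nra.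
have h : 0 < n.+2%:R^-1 :> R by rewrite invr_gt0.
by rewrite gtr_pMr//; lra.
Qed.

End energy_bound.

(** * Intermediate values along paths and the lower bound of the mountain pass *)

Section paths.
Context {R : realType}.
Local Notation mR := (measurableTypeR R).
Local Notation T2 := (mR * mR)%type.
Local Notation T3 := (mR * (mR * mR))%type.
Local Notation mu := (@lebesgue_measure R).
Local Notation mu2 := (@lebesgue2 R).
Local Notation lambda := (@lebesgue3 R).
Implicit Types (rho d : R) (u w : space R -> R * R) (h : R -> space R -> R * R).

Definition classical f (g : 'I_3 -> space R -> R) :=
  [/\ continuous f, forall i, continuous (g i) & forall i p, is_derive p (basis_vector i) f (g i p)].

Lemma classical_ae D i f g : open D -> classical f g ->
  {ae lambda, forall p, D p -> weak_partial D i f p = g i p}.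
Proof.
move=> oD [cf cg dg]; have mD : measurable (D : set T3) by exact: open_measurable3.
by have [] := weak_partialE oD (classical_weak_partial mD cf (cg i) (dg i)).
Qed.

Lemma classical_sqr_norm_grad D u g1 g2 : open D -> classical (comp1 u) g1 -> classical (comp2 u) g2 ->
  {ae lambda, forall p, D p -> sqr_norm_grad D u p = \sum_(i < 3) (g1 i p ^+ 2 + g2 i p ^+ 2)}.
Proof.
move=> oD c1 c2.
have h1 : {ae lambda, forall p, forall i, D p -> weak_partial D i (comp1 u) p = g1 i p}.
  apply: (@filter_forall _ _ (fun i p => D p -> weak_partial D i (comp1 u) p = g1 i p) _
    (ae_filter_ringOfSetsType lambda)) => i.
  exact: classical_ae.
have h2 : {ae lambda, forall p, forall i, D p -> weak_partial D i (comp2 u) p = g2 i p}.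
  apply: (@filter_forall _ _ (fun i p => D p -> weak_partial D i (comp2 u) p = g2 i p) _
    (ae_filter_ringOfSetsType lambda)) => i.
  exact: classical_ae.
apply: (@filterS2 _ _ (ae_filter_ringOfSetsType lambda) _ _ _ _ h1 h2) => p /= e1 e2 Dp.
by apply: eq_bigr => i _; rewrite e1// e2.
Qed.

Lemma energy_classical d u g1 g2 : classical (comp1 u) g1 -> classical (comp2 u) g2 ->
  (energy d u = \int[lambda]_(p in cylinder d) (density (comp1 u) (comp2 u) g1 g2 p)%:E)%E.
Proof.
move=> c1 c2; have oD : open (cylinder d : set (space R)) by exact: open_cylinder.
have mD := measurable_cylinder d.
have m1 f g : classical f g -> measurable_on (cylinder d) f.
  by move=> [cf _ _]; exact: continuous_measurable_on.
have m2 f g i : classical f g -> measurable_on (cylinder d) (g i).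
  by move=> [_ cg _]; exact: continuous_measurable_on.
apply: ge0_ae_eq_integral => //.
- apply/measurable_EFinP; apply: density_measurable; [exact: m1 c1|exact: m1 c2|..];
    by move=> i; exact: weak_partial_measurable.
- apply/measurable_EFinP; apply: density_measurable; [exact: m1 c1|exact: m1 c2|move=> i; exact: m2 c1|
    move=> i; exact: m2 c2].
- move=> p _; rewrite lee_fin.
  exact: (density_ge0 (comp1 u) (comp2 u) (fun i => weak_partial (cylinder d) i (comp1 u))
    (fun i => weak_partial (cylinder d) i (comp2 u)) p).
- by move=> p _; rewrite lee_fin density_ge0.
- have := classical_sqr_norm_grad oD c1 c2.
  apply: (@filterS _ _ (ae_filter_ringOfSetsType lambda)) => p /= e Dp.
  by rewrite e.
Qed.

Lemma classical_const (k : R) : classical (fun _ : space R => k) (fun _ _ => 0).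
Proof.
split => [|i|i p]; [exact: continuous_const..|].
by apply: DeriveDef; [exact: derivable_cst|rewrite derive_cst].
Qed.

Lemma classical_kink : classical (fun p : space R => kink p.1) kink_slope.
Proof.
split => [|i|i p].
- by apply: (continuous_compose (f := fun p : space R => p.1)); [exact: continuous_fst|exact: continuous_kink].
- apply: continuous_mul; first exact: continuous_const.
  by apply: continuous_mul; [exact: continuous_sech2_fst|exact: continuous_const].
- exact: (is_derive_fst_compose i (is_derive_kink p.1)).
Qed.

Lemma energy_soliton d : 0 < d ->
  (energy d soliton = (\int[lambda]_(p in cylinder d) (1 / 2 * sech p.1 ^+ 4))%:E)%E.
Proof.
move=> d0; have mD := measurable_cylinder d.
rewrite (@energy_classical d soliton _ _ (classical_const 0) classical_kink) -(RintegralE mD (sech4_Rintegrable d0)).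
apply: eq_integral => p _; congr EFin; rewrite /density /comp1 /comp2 /soliton /= -/(kink p.1).
rewrite !big_ord_recl big_ord0 /kink_slope /= expr0n/= !add0r.
rewrite mul1r !mul0r expr0n/= !addr0.
have sk := sech_kink p.1.
have -> : 1 - kink p.1 ^+ 2 = sech p.1 ^+ 2 by rewrite -sk; ring.
have s2 : (Num.sqrt (2 : R))^-1 ^+ 2 = 1 / 2 by rewrite exprVn sqr_sqrtr//; lra.
by rewrite (mul1r (sech _ ^+ 2 / _)) exprMn s2; field.
Qed.

Lemma H1_norm_ge D w (e : R) : measurable (D : set T3) -> 0 <= e -> L2 lambda D (comp1 w) ->
  measurable_on D (comp2 w) ->
  (H1_norm D w <= (Num.sqrt e)%:E)%E -> \int[lambda]_(p in D) (comp1 w p ^+ 2) <= e.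
Proof.
move=> mD e0 l1 m2 hw; rewrite leNgt; apply/negP => he.
set I := \int[lambda]_(p in D) (comp1 w p ^+ 2) in he.
have hI : (I%:E <= \int[lambda]_(p in D) (sqr_norm (w p) + sqr_norm_grad D w p)%:E)%E.
  rewrite /I -(RintegralE mD l1.2).
  have mw j (f : space R -> R) : measurable_on D (weak_partial D j f) by exact: weak_partial_measurable.
  apply: le_ge0_Rintegral => //.
  - by apply: measurable_funX; exact: l1.1.
  - apply: measurable_funD; first by apply: measurable_funD; apply: measurable_funX; [exact: l1.1|exact: m2].
    by apply: measurable_sum => i; apply: measurable_funD; apply: measurable_funX; exact: mw.
  - by move=> p _; exact: sqr_ge0.
  - move=> p _; rewrite /sqr_norm -addrA lerDl addr_ge0 ?sqr_ge0//.
    by apply: sumr_ge0 => i _; rewrite addr_ge0 ?sqr_ge0.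
have I0 : 0 <= I by lra.
suff : ((Num.sqrt I)%:E <= H1_norm D w)%E.
  by move=> /le_trans/(_ hw); rewrite lee_fin ler_sqrt// leNgt he.
rewrite (_ : (Num.sqrt I)%:E = (I%:E `^ 2^-1)%E); last by rewrite poweR12_sqrt ?lee_fin.
have JI : (0 <= \int[lambda]_(p in D) (sqr_norm (w p) + sqr_norm_grad D w p)%:E)%E.
  by apply: le_trans hI; rewrite lee_fin.
by apply: gt0_ler_poweR => //; rewrite in_itv/= ?lee_fin ?I0 ?JI ?leey.
Qed.

(** The projection is continuous for the H^1 distance, and the two ends have opposite first
    components, hence opposite projections; the intermediate value theorem gives a zero. *)
Lemma path_crossing d rho (chi : R -> R) n h : 0 < rho -> rho <= d ->
  paths d (psi chi (-1) n) (psi chi 1 n) h -> exists2 t : R, t \in `[-1, 1] &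
  \int[lambda]_(p in cylinder rho) (comp1 (h t) p * sech p.1) = 0.
Proof.
move=> r0 rd [adm cont hm1 h1].
have mC := measurable_cylinder rho; have mD := measurable_cylinder d.
have CD : cylinder rho `<=` (cylinder d : set (space R)) by exact: subset_cylinder.
pose G t := \int[lambda]_(p in cylinder rho) (comp1 (h t) p * sech p.1).
have ls := sech_cylinder_L2 r0.
have lh t : t \in `[-1, 1] -> L2 lambda (cylinder d) (comp1 (h t)).
  by move=> ht; have [[]] := admissible_fields (adm t ht).
have mh t : t \in `[-1, 1] -> measurable_on (cylinder d) (comp2 (h t)).
  move=> ht; have [_ [[mw _] _ _] _] := admissible_fields (adm t ht).
  rewrite (_ : comp2 (h t) = (fun p => deviation (h t) p + kink p.1)).
    by apply: measurable_funD => //; exact: measurable_kink_fst.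
  by apply/funext => p; rewrite /deviation subrK.
have cG : {within `[-1, 1]%classic, continuous G}.
  apply/subspace_continuousP => t ht; apply/cvgrPdist_le => e e0.
  have [e1 e10 hl] := L2_linear_continuity mC e0 ls.
  have s10 : 0 < Num.sqrt e1 by rewrite sqrtr_gt0.
  have no : nbhs (0%E : \bar R) [set y | (y < (Num.sqrt e1)%:E)%E].
    by apply: open_nbhs_nbhs; split; [exact: open_ereal_lt_ereal|rewrite /= lte_fin].
  have hc := cont t ht _ no.
  have hin : \forall s \near within [set` `[-1, 1]] (nbhs t), s \in `[(-1 : R), 1].
    by apply: withinT.
  near=> s.
  have hs : (H1_norm (cylinder d) (fun p => (h s p - h t p)%R) < (Num.sqrt e1)%:E)%E by near: s; exact: hc.
  have sin : s \in `[-1, 1] by near: s; exact: hin.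
  rewrite distrC; change (`|G s - G t| <= e).
  have E k : \int[lambda]_(p in cylinder rho) (comp1 (h k) p * sech p.1) =
      \int[lambda]_(p in cylinder rho) (sech p.1 * comp1 (h k) p).
    by apply: eq_Rintegral => p _; rewrite mulrC.
  have lsd k : k \in `[-1, 1] -> L2 lambda (cylinder rho) (comp1 (h k)).
    by move=> hk; exact: (L2_subset mC mD CD (lh k hk)).
  rewrite /G !E; apply: hl; [exact: lsd..|].
  have lst := L2B mD (lh s sin) (lh t ht).
  apply: (le_trans (L2_sqr_subset mC mD CD lst)).
  apply: (@H1_norm_ge _ (fun p => h s p - h t p)) => //.
  - exact: ltW.
  - by apply: measurable_funB; exact: mh.
  - exact: ltW.
have i1 : (1 : R) \in `[-1, 1] by rewrite in_itv/=; lra.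
have im1 : (-1 : R) \in `[-1, 1] by rewrite in_itv/=; lra.
have G1 : G (-1) = - G 1.
  have l1 := L2_subset mC mD CD (lh 1 i1); have lm1 := L2_subset mC mD CD (lh (-1) im1).
  have j1 := L2_mul mC l1 ls; have jm1 := L2_mul mC lm1 ls.
  transitivity (-1 * G 1); last by rewrite mulN1r.
  rewrite /G -(RintegralZ' mC _ j1) /Rintegral; congr fine; apply: ae_eq_integral => //.
  - exact: measurable_int jm1.
  - exact: measurable_int (RintegrableZ mC (-1) j1).
  - apply: (@filterS2 _ _ (ae_filter_ringOfSetsType lambda) _ _ _ _ hm1 h1) => p /= em e Cp.
    rewrite /comp1 em; last exact: CD.
    by rewrite e; [rewrite /psi /=; congr EFin; ring|exact: CD].
have le11 : (-1 : R) <= 1 by lra.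
have [|t ht Gt] := IVT le11 cG (v := 0); last by exists t.
rewrite G1 ge_min le_max; have [h0|h0] := leP 0 (G 1).
  by rewrite oppr_le0 h0 /= orbT.
by rewrite oppr_ge0 (ltW h0) orbT.
Unshelve. all: by end_near. Qed.

(** [rho] is to be [d] itself when d <= sqrt 2 j, and the critical radius sqrt 2 j otherwise. *)
Lemma mountain_pass_ge (j : R) d rho (chi : R -> R) n :
  smallest_positive_zero (derive1 (bessel_J 1)) j -> 0 < d -> 0 < rho -> rho <= d ->
  rho ^+ 2 <= 2 * j ^+ 2 ->
  (energy rho soliton <= mountain_pass d (psi chi (-1) n) (psi chi 1 n))%E.
Proof.
move=> hj d0 r0 rd rj; apply: le_ereal_inf_tmp => _ [h hp <-].
have [t ht Gt] := path_crossing r0 rd hp; have [adm _ _ _] := hp.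
rewrite energy_soliton//; apply: le_trans (energy_ge hj d0 (adm t ht) r0 rd rj Gt) _.
by apply: ereal_sup_ubound; exists t.
Qed.

End paths.

(** * The explicit path *)

Section angle.
Context {R : realType}.
Local Notation mR := (measurableTypeR R).
Local Notation mu := (@lebesgue_measure R).
Implicit Types (x y s : R).

Lemma sech4_line_Rintegrable : Rintegrable mu setT (fun x : mR => sech x ^+ 4).
Proof.
apply: (Rintegrable_le measurableT _ _ (@sech2_Rintegrable R)).
  by apply: continuous_measurable_fun; apply: continuous_exp; exact: continuous_sech.
move=> x _; have -> : sech x ^+ 4 = sech x ^+ 2 * sech x ^+ 2 by ring.
by rewrite normrM -[leRHS]mulr1 ler_pM ?sech2_le1// ger0_norm ?sqr_ge0.
Qed.

(** The linear bound e^y >= 1 + y is crude, but it makes the boundary term in [sech4_integral]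
    vanish. *)
Lemma sech_decay (n : nat) : sech n%:R <= 4 / n.+1%:R :> R.
Proof.
have s0 : 0 < Num.sqrt (2 : R) by rewrite sqrtr_gt0; lra.
have s2 : Num.sqrt (2 : R) <= 2.
  have r2 : Num.sqrt (2 : R) ^+ 2 = 2 by rewrite sqr_sqrtr//; lra.
  by move: s0 r2; clear; nra.
pose y : R := n%:R / Num.sqrt 2.
have y0 : 0 <= y by rewrite divr_ge0// ltW.
have y1 : n.+1%:R / 2 <= 1 + y.
  have : n%:R / 2 <= y by rewrite /y; apply: ler_wpM2l => //; rewrite lef_pV2 ?posrE.
  by rewrite -[n.+1%:R]natr1; lra.
have e1 : 1 + y <= expR y by exact: expR_ge1Dx.
have e2 := expR_gt0 (- y).
have n0 : 0 < n.+1%:R :> R by rewrite ltr0n.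
rewrite /sech -/y ler_pdivrMr ?addr_gt0 ?expR_gt0// mulrAC ler_pdivlMr//.
by lra.
Qed.

Lemma line_integral_cvg (F : R -> R) : continuous F -> (forall x, 0 <= F x) ->
  Rintegrable mu setT F ->
  \int[mu]_(x in `[- n%:R, n%:R]%classic) F x @[n --> \oo] --> \int[mu]_x F x.
Proof.
move=> cF F0 iF; pose A n : set mR := `[- n%:R, n%:R]%classic.
have mA n : measurable (A n) by exact: measurable_itv.
have UA : \bigcup_n A n = setT.
  apply/seteqP; split => // x _; exists (Num.bound `|x|) => //=.
  by rewrite /A /= in_itv/= -ler_norml ltW// archi_boundP.
have ndA : nondecreasing_seq A.
  move=> n m nm; apply/subsetPset => x; rewrite /A /= !in_itv/= => /andP[h1 h2].
  have : n%:R <= m%:R :> R by rewrite ler_nat.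
  by move=> h; apply/andP; split; lra.
have h := @ge0_nondecreasing_set_cvg_integral _ _ _ A (fun x => (F x)%:E) mu ndA mA.
rewrite UA in h; rewrite /Rintegral; apply: fine_cvg; rewrite fineK; last exact: integrable_fin_num.
apply: h => [n|n x _]; last by rewrite lee_fin.
by apply/measurable_EFinP; apply: measurable_funTS; exact: continuous_measurable_fun.
Qed.

(** sqrt 2 kink sech^2 is a primitive of 3 sech^4 - 2 sech^2 and tends to 0 at infinity. *)
Lemma sech4_integral : 3 * \int[mu]_x (sech x ^+ 4) = 2 * \int[mu]_x (sech x ^+ 2).
Proof.
have s0 : 0 < Num.sqrt (2 : R) by rewrite sqrtr_gt0; lra.
have s2 : Num.sqrt (2 : R) ^+ 2 = 2 by rewrite sqr_sqrtr//; lra.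
have sn : Num.sqrt (2 : R) != 0 by rewrite gt_eqF.
have c2 : continuous (fun x : R => sech x ^+ 2) by apply: continuous_exp; exact: continuous_sech.
have c4 : continuous (fun x : R => sech x ^+ 4) by apply: continuous_exp; exact: continuous_sech.
pose H x := Num.sqrt 2 * (kink x * sech x ^+ 2).
have dH x : is_derive x 1 H (3 * sech x ^+ 4 - 2 * sech x ^+ 2).
  apply: (is_derive1_eq (is_derive1Z (Num.sqrt 2) (is_derive1M (is_derive_kink x) (is_derive1X 2 (is_derive_sech x))))).
  rewrite /= expr1; have sk := sech_kink x; set e := sech x in sk *; set T := kink x in sk *.
  have T2 : T ^+ 2 = 1 - e ^+ 2 by rewrite -sk; ring.
  have -> : Num.sqrt 2 * (e ^+ 2 / Num.sqrt 2 * e ^+ 2 + T * (2 * e * - (e * T / Num.sqrt 2))) =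
     e ^+ 4 - 2 * e ^+ 2 * T ^+ 2 by field.
  by rewrite T2; ring.
have c42 : continuous (fun x : R => 3 * sech x ^+ 4 - 2 * sech x ^+ 2).
  by apply: continuous_sub; apply: continuous_mul => //; exact: continuous_const.
have h4 := line_integral_cvg c4 _ sech4_line_Rintegrable.
have h2 := line_integral_cvg c2 (fun x => sqr_ge0 _) (@sech2_Rintegrable R).
have {}h4 := h4 (fun x => exprn_ge0 4 (ltW (sech_gt0 x))).
have E (n : nat) : 3 * \int[mu]_(x in `[- n%:R, n%:R]%classic) (sech x ^+ 4) -
    2 * \int[mu]_(x in `[- n%:R, n%:R]%classic) (sech x ^+ 2) = 2 * H n%:R.
  have mI : measurable (`[- n%:R, n%:R]%classic : set mR) by exact: measurable_itv.
  have i4 : Rintegrable mu `[- n%:R, n%:R]%classic (fun x : mR => sech x ^+ 4) by exact: segment_Rintegrable.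
  have i2 : Rintegrable mu `[- n%:R, n%:R]%classic (fun x : mR => sech x ^+ 2) by exact: segment_Rintegrable.
  rewrite -(RintegralZ' mI _ i4) -(RintegralZ' mI _ i2) -(RintegralB' mI (RintegrableZ mI _ i4) (RintegrableZ mI _ i2)).
  have nn : - n%:R <= n%:R :> R by have : 0 <= n%:R :> R by []; lra.
  rewrite (FTC_segment nn c42 (fun x _ => dH x)) /H kinkN sechN; ring.
have hH : 2 * H n%:R @[n --> \oo] --> 0.
  apply/cvgrPdist_le => e e0.
  have e1 : 0 < e / 16 by rewrite divr_gt0.
  have [N _ hN] := near_infty_natSinv_lt (PosNum e1).
  exists N => // n /= Nn; rewrite sub0r normrN.
  have := hN n Nn; rewrite /= => h; have := sech_decay n.
  have T1 := sech_gt_bound (n%:R : R); have e0' := sech_gt0 (n%:R : R); have e1' := sech_le1 (n%:R : R).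
  rewrite /H normrM (normrM (Num.sqrt 2)) (normrM (kink _)) normr_nat (ger0_norm (ltW s0)) normrX (ger0_norm (ltW e0')).
  have s22 : Num.sqrt (2 : R) <= 2 by move: s0 s2; clear; nra.
  have x0 := normr_ge0 (kink n%:R : R); set x := `|kink n%:R| in T1 x0 *; set z := sech n%:R in e0' e1' *.
  set k := n.+1%:R^-1 in h *; move=> hz.
  have zz : z ^+ 2 <= z by move: e0' e1'; clear; nra.
  have p1 : x * z ^+ 2 <= z by apply: le_trans zz; rewrite ler_piMl ?sqr_ge0.
  have p0 : 0 <= x * z ^+ 2 by rewrite (mulr_ge0 x0 (sqr_ge0 _)).
  have p2 : Num.sqrt 2 * (x * z ^+ 2) <= 2 * z by apply: ler_pM => //; exact: ltW.
  by move: h hz p2 e0; rewrite -/k; clear; lra.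
have h : 3 * \int[mu]_(x in `[- n%:R, n%:R]%classic) (sech x ^+ 4) -
    2 * \int[mu]_(x in `[- n%:R, n%:R]%classic) (sech x ^+ 2) @[n --> \oo] -->
    3 * \int[mu]_x (sech x ^+ 4) - 2 * \int[mu]_x (sech x ^+ 2).
  by apply: cvgB; apply: cvgM => //; exact: cvg_cst.
apply/eqP; rewrite -subr_eq0; apply/eqP.
have {}E := funext E; rewrite -E in hH.
by rewrite -(cvg_lim (@Rhausdorff R) h) -(cvg_lim (@Rhausdorff R) hH).
Qed.

(* The soliton angle: [cos gd = sech] and [sin gd = kink]. *)
Definition gd x : R := asin (kink x).

Lemma kink_bound x : -1 < kink x < 1.
Proof.
have := sech_kink x; have := sech_gt0 x; move=> h0 h.
by have h2 := exprn_gt0 2 h0; apply/andP; split; nra.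
Qed.

Lemma sin_gd x : sin (gd x) = kink x.
Proof. by apply: asinK; rewrite in_itv/=; have /andP[h1 h2] := kink_bound x; rewrite !ltW. Qed.

Lemma cos_gd x : cos (gd x) = sech x.
Proof.
rewrite cos_asin; last by have /andP[h1 h2] := kink_bound x; rewrite !ltW.
have -> : 1 - kink x ^+ 2 = sech x ^+ 2 by rewrite -(sech_kink x); ring.
by rewrite sqrtr_sqr ger0_norm// ltW// sech_gt0.
Qed.

Lemma is_derive_gd x : is_derive x 1 gd (sech x / Num.sqrt 2).
Proof.
have s0 : 0 < Num.sqrt (2 : R) by rewrite sqrtr_gt0; lra.
have kb := kink_bound x.
apply: (is_derive1_eq (@is_derive1_compose _ asin kink x _ _ (is_derive1_asin kb) (is_derive_kink x))).
have -> : 1 - kink x ^+ 2 = sech x ^+ 2 by rewrite -(sech_kink x); ring.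
rewrite sqrtr_sqr ger0_norm ?(ltW (sech_gt0 x))//; field.
by rewrite !gt_eqF// sech_gt0.
Qed.

Lemma continuous_gd : continuous gd.
Proof. exact: is_derive_continuous is_derive_gd. Qed.

Lemma gd0 : gd 0 = 0.
Proof.
have p0 := pi_gt0 R.
by rewrite /gd kink0 -{1}(@sin0 R) sinK// in_itv/=; apply/andP; split; lra.
Qed.

Lemma gdN x : gd (- x) = - gd x.
Proof.
have h y : is_derive y 1 (fun y => gd y + gd (- y)) 0.
  have dN := @is_derive1_compose _ gd (fun y => - y) y _ _ (is_derive_gd (- y)) (is_derive1N (is_derive1_id y)).
  by apply: (is_derive1_eq (is_derive1D (is_derive_gd y) dN)); rewrite sechN mulrN1 subrr.
have [c [_ E]] := MVT_between x 0 h.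
by move: E; rewrite mul0r oppr0 gd0 addr0 subr0 => /eqP; rewrite addrC addr_eq0 => /eqP.
Qed.

Lemma gd_lt x : - (pi / 2) < gd x < pi / 2.
Proof.
have /andP[h1 h2] := kink_bound x; apply/andP; split.
  by apply: asin_gtNpi2; rewrite h1 ltW.
by apply: asin_ltpi2; rewrite h2 ltW.
Qed.

Lemma kink_homo x y : x <= y -> kink x <= kink y.
Proof.
move=> xy; apply: (derive_le0_homo xy) => [z _|z _]; first exact: continuous_kink.
by split; [exact: is_derive_kink|rewrite divr_ge0 ?sqr_ge0].
Qed.

(** The angle y = pi / 2 - gd x lies in [0, pi] with sin y = sech x and cos y = kink x >= kink a,
    and y cos y <= sin y there. *)
Lemma gd_gap a x : 0 < a -> a <= x -> `|pi / 2 - gd x| <= (kink a)^-1 * sech x.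
Proof.
move=> a0 ax; have /andP[h1 h2] := gd_lt x; rewrite ger0_norm; last lra.
set y := pi / 2 - gd x; have y0 : 0 <= y by rewrite /y; lra.
have k0 := kink_gt0 a0; have ka := kink_homo ax.
have Ec : cos y = kink x by rewrite -cosN /y opprB cosBpihalf sin_gd.
have Es : sin y = sech x by rewrite /y -opprB sinN sinBpihalf opprK cos_gd.
have h : y * cos y <= sin y.
  pose f z : R := sin z - z * cos z.
  have df z : is_derive (z : R) 1 f (z * sin z).
    apply: (is_derive1_eq (is_derive1B (is_derive_sin z) (is_derive1M (is_derive1_id z) (is_derive_cos z)))).
    by ring.
  have := @derive_le0_homo _ 0 y f (fun z => z * sin z) y0.
  rewrite /f sin0 mul0r subr0 subr_ge0; apply => z hz; first exact: (is_derive_continuous_at (df z)).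
  split; first exact: df.
  have p0 := pi_gt0 R.
  rewrite mulr_ge0//; first lra.
  by apply: sin_ge0_pi; rewrite /y in hz; apply/andP; split; lra.
rewrite mulrC ler_pdivlMr//; apply: le_trans (_ : y * cos y <= _); last by rewrite -Es.
by rewrite Ec ler_wpM2l.
Qed.

Lemma sqrt2V_le1 : (Num.sqrt (2 : R))^-1 <= 1.
Proof.
have s0 : 0 < Num.sqrt (2 : R) by rewrite sqrtr_gt0; lra.
have r2 : Num.sqrt (2 : R) ^+ 2 = 2 by rewrite sqr_sqrtr//; lra.
by rewrite invf_le1//; move: s0 r2; clear; nra.
Qed.

Variables (X dX : R -> R) (N : R).
Hypotheses (N0 : 0 < N) (derX : forall x, is_derive x 1 X (dX x)) (contX : continuous dX).
Hypotheses (oddX : forall x, X (- x) = - X x) (X_tail : forall x, N <= x -> X x = pi / 2).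

Lemma continuous_X : continuous X.
Proof. exact: is_derive_continuous derX. Qed.

Lemma X_tailN x : x <= - N -> X x = - (pi / 2).
Proof. by move=> h; rewrite -[x]opprK oddX X_tail//; lra. Qed.

Lemma dX_tail x : N < `|x| -> dX x = 0.
Proof.
move=> hx; have [x0|x0] := leP 0 x.
  have d0 : is_derive x 1 X 0.
    apply: (near_eq_is_derive (f := cst (pi / 2))) => //.
    near=> y; rewrite /= X_tail// ltW//; near: y.
    by apply: lt_nbhsr; move: hx; rewrite ger0_norm.
  by have := is_derive1E d0; rewrite (is_derive1E (derX x)).
have d0 : is_derive x 1 X 0.
  apply: (near_eq_is_derive (f := cst (- (pi / 2)))) => //.
  near=> y; rewrite /= X_tailN// ltW//; near: y.
  by apply: lt_nbhsl; move: hx; rewrite ltr0_norm//; lra.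
by have := is_derive1E d0; rewrite (is_derive1E (derX x)).
Unshelve. all: by end_near. Qed.

Lemma compact_sech_bound (f : R -> R) (M : R) : continuous f ->
  exists2 K, 0 <= K & forall x, `|x| <= M -> `|f x| <= K * sech x.
Proof.
move=> cf; have cV : continuous (fun x => f x * (sech x)^-1).
  apply: continuous_mul => //; apply: continuous_inv; first exact: continuous_sech.
  by move=> x; rewrite gt_eqF// sech_gt0.
have [K K0 hK] := continuous_compact_bounded (@segment_compact _ (- M) M) cV.
exists K => // x xM; have e0 := sech_gt0 x.
have := hK x; rewrite /= in_itv/= -ler_norml => /(_ xM).
by rewrite normrM normfV (ger0_norm (ltW e0)) ler_pdivrMr.
Qed.

(** Interpolation takes place in the angle: the map (cos, sin) stays on the unit circle and the
    derivative of the angle is affine in [s], so the gradient energy is convex in [s]. *)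
Definition angle s x := gd x + s * (X x - gd x).
Definition angle' s x := sech x / Num.sqrt 2 + s * (dX x - sech x / Num.sqrt 2).

Lemma is_derive_angle s x : is_derive x 1 (angle s) (angle' s x).
Proof.
apply: is_derive1D; first exact: is_derive_gd.
by apply: is_derive1Z; apply: is_derive1B => //; exact: is_derive_gd.
Qed.

Lemma continuous_angle s : continuous (angle s).
Proof. exact: is_derive_continuous (is_derive_angle s). Qed.

Lemma continuous_angle' s : continuous (angle' s).
Proof.
have c1 : continuous (fun x : R => sech x / Num.sqrt 2).
  by apply: continuous_mul; [exact: continuous_sech|exact: continuous_const].
apply: continuous_add => //; apply: continuous_mul; first exact: continuous_const.
exact: continuous_sub.
Qed.

Lemma angleN s x : angle s (- x) = - angle s x.
Proof. by rewrite /angle gdN oddX; ring. Qed.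

(** On |x| <= N by compactness. Beyond, [X] is constant, so the gap of the angles is that of
    [gd_gap] and the gap of the derivatives is sech / sqrt 2. *)
Lemma angle_gap : exists2 K, 1 <= K & forall x,
  `|X x - gd x| <= K * sech x /\ `|dX x - sech x / Num.sqrt 2| <= K * sech x.
Proof.
have c1 : continuous (fun x : R => sech x / Num.sqrt 2).
  by apply: continuous_mul; [exact: continuous_sech|exact: continuous_const].
have [K1 K10 h1] := compact_sech_bound N (continuous_sub continuous_X continuous_gd).
have [K2 K20 h2] := compact_sech_bound N (continuous_sub contX c1).
have k0 := kink_gt0 N0; have i0 : 0 <= (kink N)^-1 by rewrite invr_ge0 ltW.
exists (K1 + K2 + (kink N)^-1 + 1); first lra.
move=> x; have e0 := sech_gt0 x.
have s1 := sqrt2V_le1.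
have s0 : 0 <= (Num.sqrt (2 : R))^-1 by rewrite invr_ge0 sqrtr_ge0.
have [xN|xN] := leP `|x| N.
  by split; [apply: le_trans (h1 x xN) _|apply: le_trans (h2 x xN) _]; rewrite (ler_wpM2r (ltW e0))//; lra.
split.
  have hN : `|X x - gd x| <= (kink N)^-1 * sech x.
    have [x0|x0] := leP 0 x.
      have Nx : N <= x by rewrite ltW// -(ger0_norm x0).
      by rewrite X_tail//; exact: gd_gap.
    have Nx : N <= - x by rewrite ltW// -(ltr0_norm x0).
    rewrite X_tailN; last lra.
    have := gd_gap N0 Nx; rewrite gdN sechN => h.
    by rewrite -normrN opprB opprK addrC; move: h; rewrite opprK.
  by apply: le_trans hN _; rewrite ler_wpM2r ?(ltW e0)//; lra.
rewrite dX_tail// sub0r normrN normrM !ger0_norm//; last exact: ltW.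
rewrite mulrC; apply: ler_wpM2r; first exact: ltW.
by apply: (le_trans s1); lra.
Qed.

End angle.

(** * Bounds by sech *)

Section sech_bounds.
Context {R : realType}.
Local Notation mR := (measurableTypeR R).
Local Notation T3 := (mR * (mR * mR))%type.
Local Notation lambda := (@lebesgue3 R).
Implicit Types (d k : R) (f : space R -> R) (g : 'I_3 -> space R -> R).

(** A pointwise bound stronger than L^2, since [sech] is square integrable on the cylinder; applied
    to values and gradients it gives membership in H^1 and bounds of [H1_norm]. *)
Definition sech_bounded d k f := forall p, cylinder d p -> `|f p| <= k * sech p.1.

Lemma sech_bounded_L2 d k f : 0 < d -> measurable_on (cylinder d) f -> sech_bounded d k f ->
  L2 lambda (cylinder d) f.
Proof.
move=> d0 mf hf; have mD := measurable_cylinder d.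
apply: (L2_le mD mf _ (L2Z mD k (sech_cylinder_L2 d0))) => p Dp.
exact: le_trans (hf p Dp) (ler_norm _).
Qed.

Lemma classical_sobolev d k f g : 0 < d -> classical f g -> sech_bounded d k f ->
  (forall i, sech_bounded d k (g i)) -> sobolev_H1 (cylinder d) f.
Proof.
move=> d0 [cf cg dg] hf hg; have mD := measurable_cylinder d.
split; first by apply: (sech_bounded_L2 d0 _ hf); exact: continuous_measurable_on.
move=> i; exists (g i); first exact: classical_weak_partial.
by apply: (sech_bounded_L2 d0 _ (hg i)); exact: continuous_measurable_on.
Qed.

Lemma classicalB f1 f2 g1 g2 : classical f1 g1 -> classical f2 g2 ->
  classical (fun p => f1 p - f2 p) (fun i p => g1 i p - g2 i p).
Proof.
move=> [c1 c1' d1] [c2 c2' d2]; split => [|i|i p]; [exact: continuous_sub..|].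
by apply: is_deriveB.
Qed.

(** The 8 counts two components and their six partial derivatives, each at most k sech in absolute
    value. *)
Lemma H1_norm_le d k (w : space R -> R * R) g1 g2 : 0 < d -> 0 <= k ->
  classical (comp1 w) g1 -> classical (comp2 w) g2 ->
  sech_bounded d k (comp1 w) -> sech_bounded d k (comp2 w) ->
  (forall i, sech_bounded d k (g1 i)) -> (forall i, sech_bounded d k (g2 i)) ->
  (H1_norm (cylinder d) w <=
   (k * Num.sqrt (8 * \int[lambda]_(p in cylinder d) (sech p.1 ^+ 2)))%:E)%E.
Proof.
move=> d0 k0 c1 c2 h1 h2 hg1 hg2.
have mD := measurable_cylinder d; have oD : open (cylinder d : set (space R)) by exact: open_cylinder.
set S := \int[lambda]_(p in cylinder d) (sech p.1 ^+ 2).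
have S0 : 0 <= S by apply: Rintegral_ge0 => p _; exact: sqr_ge0.
have is2 := (sech_cylinder_L2 d0).2.
have m f g : classical f g -> measurable_on (cylinder d) f.
  by move=> [cf _ _]; exact: continuous_measurable_on.
have m' f g i : classical f g -> measurable_on (cylinder d) (g i).
  by move=> [_ cg _]; exact: continuous_measurable_on.
have msq (u v : space R -> R) : measurable_on (cylinder d) u -> measurable_on (cylinder d) v ->
    measurable_on (cylinder d) (fun p => u p ^+ 2 + v p ^+ 2).
  by move=> mu' mv; apply: measurable_funD; exact: measurable_funX.
have m0 := msq _ _ (m _ _ c1) (m _ _ c2).
have E : (\int[lambda]_(p in cylinder d) (sqr_norm (w p) + sqr_norm_grad (cylinder d) w p)%:E =
    \int[lambda]_(p in cylinder d) (sqr_norm (w p) + \sum_(i < 3) (g1 i p ^+ 2 + g2 i p ^+ 2))%:E)%E.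
  apply: ae_eq_integral => //.
  - apply/measurable_EFinP; apply: measurable_funD => //; apply: measurable_sum => i.
    by apply: msq; exact: weak_partial_measurable.
  - apply/measurable_EFinP; apply: measurable_funD => //; apply: measurable_sum => i.
    by apply: msq; [exact: m' c1|exact: m' c2].
  - have := classical_sqr_norm_grad oD c1 c2.
    by apply: (@filterS _ _ (ae_filter_ringOfSetsType lambda)) => p /= e Dp; rewrite e.
have hI : (\int[lambda]_(p in cylinder d) (sqr_norm (w p) + sqr_norm_grad (cylinder d) w p)%:E <=
    (8 * k ^+ 2 * S)%:E)%E.
  rewrite E /S -(RintegralZ' mD _ is2) -(RintegralE mD (RintegrableZ mD _ is2)).
  apply: le_ge0_Rintegral => //.
  - apply: measurable_funD => //; apply: measurable_sum => i.
    by apply: msq; [exact: m' c1|exact: m' c2].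
  - by apply: measurable_funM => //; exact: Rintegrable_measurable is2.
  - move=> p _; rewrite addr_ge0 ?addr_ge0 ?sqr_ge0//.
    by apply: sumr_ge0 => i _; rewrite addr_ge0 ?sqr_ge0.
  move=> p Dp; have e0 := sech_gt0 p.1.
  have sq x : `|x| <= k * sech p.1 -> x ^+ 2 <= k ^+ 2 * sech p.1 ^+ 2.
    move=> hx; rewrite -(real_normK (num_real x)) -exprMn lerXn2r ?nnegrE//.
    by rewrite mulr_ge0// ltW.
  have := sq _ (h1 p Dp); have := sq _ (h2 p Dp); rewrite /comp1 /comp2 /sqr_norm => a1 a2.
  have b1 i := sq _ (hg1 i p Dp); have b2 i := sq _ (hg2 i p Dp).
  rewrite !big_ord_recl big_ord0; move: a1 a2 (b1 ord0) (b1 (lift ord0 ord0)) (b1 (lift ord0 (lift ord0 ord0)))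
    (b2 ord0) (b2 (lift ord0 ord0)) (b2 (lift ord0 (lift ord0 ord0))).
  by clear; lra.
have J0 : (0 <= \int[lambda]_(p in cylinder d) (sqr_norm (w p) + sqr_norm_grad (cylinder d) w p)%:E)%E.
  apply: integral_ge0 => p _; rewrite lee_fin addr_ge0 ?addr_ge0 ?sqr_ge0//.
  by apply: sumr_ge0 => i _; rewrite addr_ge0 ?sqr_ge0.
have K0 : 0 <= 8 * k ^+ 2 * S by rewrite mulr_ge0// mulr_ge0 ?sqr_ge0.
have -> : (k * Num.sqrt (8 * S))%:E = ((8 * k ^+ 2 * S)%:E `^ 2^-1)%E.
  rewrite poweR12_sqrt ?lee_fin//=; congr EFin.
  have -> : 8 * k ^+ 2 * S = k ^+ 2 * (8 * S) by ring.
  by rewrite (sqrtrM (8 * S) (sqr_ge0 k)) sqrtr_sqr ger0_norm.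
by apply: gt0_ler_poweR => //; rewrite in_itv/= ?J0 ?leey// lee_fin K0.
Qed.

Lemma cos_lipschitz (x y : R) : `|cos x - cos y| <= `|x - y|.
Proof.
have [c [_ ->]] := MVT_between x y (@is_derive_cos R).
by rewrite normrM normrN ler_piMl// sin_max.
Qed.

Lemma sin_lipschitz (x y : R) : `|sin x - sin y| <= `|x - y|.
Proof.
have [c [_ ->]] := MVT_between x y (@is_derive_sin R).
by rewrite normrM ler_piMl// cos_max.
Qed.

Lemma norm_mul_le (x y A B : R) : `|x| <= A -> `|y| <= B -> `|x * y| <= A * B.
Proof. by move=> h1 h2; rewrite normrM ler_pM. Qed.

Lemma norm_add_le (x y A B : R) : `|x| <= A -> `|y| <= B -> `|x + y| <= A + B.
Proof. by move=> h1 h2; apply: (le_trans (ler_normD _ _)); exact: lerD. Qed.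

End sech_bounds.

Lemma lipschitz_constants (R : realType) (K a b c : R) : 1 <= K -> 0 <= a -> 0 <= b -> 0 <= c ->
  let C := 4 * K ^+ 2 + a + b + c in
  [/\ 0 <= C, 2 * K <= C, K <= C & 3 * K ^+ 2 <= C] /\
  [/\ 2 * K ^+ 2 <= C, a <= C, b <= C & c <= C].
Proof.
move=> K1 a0 b0 c0; have KK : K <= K ^+ 2 by nra.
by split; split; lra.
Qed.

(** * The trial maps *)

Section trial.
Context {R : realType}.
Local Notation mR := (measurableTypeR R).
Local Notation T3 := (mR * (mR * mR))%type.
Local Notation lambda := (@lebesgue3 R).
Implicit Types (a b s d : R) (p : space R).

Variables (X dX : R -> R) (N : R).
Hypotheses (N0 : 0 < N) (derX : forall x : R, is_derive x 1 X (dX x)) (contX : continuous dX).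
Hypotheses (oddX : forall x, X (- x) = - X x) (X_tail : forall x, N <= x -> X x = pi / 2).
Variables (g g1 g2 : R * R -> R).
Hypothesis cg : C1_plane g g1 g2.

(** s = 0 gives (a sech + b sech g, kink), with the soliton at a = b = 0. For b = 0 and a = 1 or -1
    the map takes values in the unit circle, and s = 1 then gives an end point of the path. *)
Definition trial a s b p : R * R :=
  (a * cos (angle X s p.1) + b * (sech p.1 * g p.2), sin (angle X s p.1)).

Definition trial1 a s b (i : 'I_3) p : R := match val i with
  | 0 => a * (- sin (angle X s p.1) * angle' dX s p.1) + b * (- (sech p.1 * kink p.1 / Num.sqrt 2) * g p.2)
  | 1 => b * (sech p.1 * g1 p.2)
  | _ => b * (sech p.1 * g2 p.2)
  end.

Definition trial2 s (i : 'I_3) p : R :=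
  (val i == 0%N)%:R * (cos (angle X s p.1) * angle' dX s p.1).

Lemma continuous_of_fst (f : R -> R) : continuous f -> continuous (fun p : space R => f p.1).
Proof. by move=> cf; apply: (continuous_compose (f := fun p : space R => p.1)) => //; exact: continuous_fst. Qed.

Lemma continuous_of_snd (f : R * R -> R) : continuous f -> continuous (fun p : space R => f p.2).
Proof. by move=> cf; apply: (continuous_compose (f := fun p : space R => p.2)) => //; exact: continuous_snd. Qed.

Lemma continuous_cos_angle s : continuous (fun x => cos (angle X s x)).
Proof. by apply: continuous_compose; [exact: (continuous_angle derX)|exact: continuous_cos]. Qed.

Lemma continuous_sin_angle s : continuous (fun x => sin (angle X s x)).
Proof. by apply: continuous_compose; [exact: (continuous_angle derX)|exact: continuous_sin]. Qed.

Lemma is_derive_cos_angle s x : is_derive (x : R) 1 (fun x => cos (angle X s x))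
  (- sin (angle X s x) * angle' dX s x).
Proof. exact: (@is_derive1_compose _ cos (angle X s) x _ _ (is_derive_cos _) (is_derive_angle derX s x)). Qed.

Lemma is_derive_sin_angle s x : is_derive (x : R) 1 (fun x => sin (angle X s x))
  (cos (angle X s x) * angle' dX s x).
Proof. exact: (@is_derive1_compose _ sin (angle X s) x _ _ (is_derive_sin _) (is_derive_angle derX s x)). Qed.

Lemma classical_trial2 a s b : classical (comp2 (trial a s b)) (trial2 s).
Proof.
split => [|i|i p].
- exact: (continuous_of_fst (@continuous_sin_angle s)).
- apply: continuous_mul; first exact: continuous_const.
  apply: (continuous_of_fst (f := fun x => cos (angle X s x) * angle' dX s x)).
  by apply: continuous_mul; [exact: continuous_cos_angle|exact: continuous_angle'].
- exact: (is_derive_fst_compose i (is_derive_sin_angle s p.1)).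
Qed.

Lemma classical_trial1 a s b : classical (comp1 (trial a s b)) (trial1 a s b).
Proof.
have [c0 c1 c2 d1 d2] := cg.
have ck k : continuous (fun _ : space R => k : R) by exact: continuous_const.
have ce := @continuous_sech_fst R.
have ct (h : R * R -> R) : continuous h -> continuous (fun p : space R => b * (sech p.1 * h p.2)).
  by move=> ch; apply: continuous_mul => //; apply: continuous_mul => //; exact: continuous_of_snd.
split => [|i|i p].
- apply: continuous_add; last exact: ct.
  by apply: continuous_mul => //; exact: (continuous_of_fst (@continuous_cos_angle s)).
- case: i => -[|[|[|//]]] ?; rewrite /trial1 /=; [|exact: ct..].
  apply: continuous_add; apply: continuous_mul => //.
    apply: (continuous_of_fst (f := fun x => - sin (angle X s x) * angle' dX s x)).
    apply: continuous_mul; last exact: continuous_angle'.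
    by apply: continuous_opp; exact: continuous_sin_angle.
  apply: continuous_mul; last exact: continuous_of_snd.
  apply: (continuous_of_fst (f := fun x => - (sech x * kink x / Num.sqrt 2))).
  apply: continuous_opp; apply: continuous_mul; last exact: continuous_const.
  by apply: continuous_mul; [exact: continuous_sech|exact: continuous_kink].
- apply/is_derive_upd; case: p => x [y z]; case: i => -[|[|[|//]]] ?; rewrite /coord /upd /trial1 /comp1 /trial /=.
  + apply: is_derive1D; first by apply: is_derive1Z; exact: is_derive_cos_angle.
    apply: is_derive1Z.
    by apply: (is_derive1_eq (is_derive1M (is_derive_sech x) (is_derive1_cst _ _))); rewrite mulr0 addr0.
  + apply: (is_derive1_eq (is_derive1D (is_derive1_cst _ _) (is_derive1Z b (is_derive1Z (sech x) (d1 y z))))).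
    by rewrite add0r.
  + apply: (is_derive1_eq (is_derive1D (is_derive1_cst _ _) (is_derive1Z b (is_derive1Z (sech x) (d2 y z))))).
    by rewrite add0r.
Qed.

Lemma angle_bounds : exists2 K, 1 <= K & forall s s' x, 0 <= s <= 1 -> 0 <= s' <= 1 ->
  [/\ `|cos (angle X s x)| <= 2 * K * sech x, `|angle' dX s x| <= 2 * K * sech x,
   `|angle X s x - angle X s' x| <= `|s - s'| * (K * sech x) &
   `|angle' dX s x - angle' dX s' x| <= `|s - s'| * (K * sech x)].
Proof.
have [K K1 hK] := angle_gap N0 derX contX oddX X_tail; exists K => // s s' x s01 s01'.
have [h1 h2] := hK x; have e0 := sech_gt0 x.
have sn : `|s| <= 1 by rewrite ler_norml; lra.
have eK : sech x <= K * sech x by rewrite ler_peMl// ltW.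
have r2 := @sqrt2V_le1 R; have r20 : 0 <= (Num.sqrt (2 : R))^-1 by rewrite invr_ge0 sqrtr_ge0.
have es : `|sech x / Num.sqrt 2| <= sech x.
  by rewrite ger0_norm ?mulr_ge0 ?(ltW e0)// ler_piMr// ltW.
have a1 := norm_mul_le sn h1; have a2 := norm_mul_le sn h2; rewrite mul1r in a1 a2.
split.
- rewrite -(subrK (cos (gd x)) (cos (angle X s x))).
  apply: (le_trans (norm_add_le (cos_lipschitz _ _) (lexx _))).
  rewrite /angle [in X in `|X - _|]addrC addrK cos_gd (ger0_norm (ltW e0)).
  by lra.
- apply: (le_trans (norm_add_le es a2)); lra.
- have -> : angle X s x - angle X s' x = (s - s') * (X x - gd x) by rewrite /angle; ring.
  exact: norm_mul_le.
- have -> : angle' dX s x - angle' dX s' x = (s - s') * (dX x - sech x / Num.sqrt 2) by rewrite /angle'; ring.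
  exact: norm_mul_le.
Qed.

Lemma comb_le (x y z c1 c2 c3 C e : R) : 0 <= x -> 0 <= y -> 0 <= z -> 0 <= e ->
  c1 <= C -> c2 <= C -> c3 <= C -> x * (c1 * e) + y * (c2 * e) + z * (c3 * e) <= C * (x + y + z) * e.
Proof.
move=> x0 y0 z0 e0 h1 h2 h3.
have -> : C * (x + y + z) * e = x * (C * e) + y * (C * e) + z * (C * e) by ring.
by rewrite !lerD ?ler_wpM2l ?ler_wpM2r.
Qed.

(** One estimate for two purposes: increments of the parameters give continuity of the path in H^1,
    and comparison with the parameters of the soliton gives admissibility. *)
Lemma trial_lipschitz d : 0 < d -> exists2 C, 0 <= C & forall a a' s s' b b',
  `|a| <= 1 -> `|a'| <= 1 -> 0 <= s <= 1 -> 0 <= s' <= 1 ->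
  let k := C * (`|a - a'| + `|s - s'| + `|b - b'|) in
  [/\ sech_bounded d k (fun p => comp1 (trial a s b) p - comp1 (trial a' s' b') p),
      sech_bounded d k (fun p => comp2 (trial a s b) p - comp2 (trial a' s' b') p),
      forall i, sech_bounded d k (fun p => trial1 a s b i p - trial1 a' s' b' i p) &
      forall i, sech_bounded d k (fun p => trial2 s i p - trial2 s' i p)].
Proof.
move=> d0; have [K K1 hK] := angle_bounds; have [c0 c1 c2 _ _] := cg.
have [G0 G00 hG0] := disc_bounded d0 c0.
have [G1 G10 hG1] := disc_bounded d0 c1.
have [G2 G20 hG2] := disc_bounded d0 c2.
pose C := 4 * K ^+ 2 + G0 + G1 + G2.
have KK : K <= K ^+ 2 by rewrite expr2 ler_peMl// (le_trans ler01).
have [[C0 K2 KC KC3] [KC2 GC0 GC1 GC2]] := lipschitz_constants K1 G00 G10 G20.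
exists C => // a a' s s' b b' a1 a1' s1 s1' k.
have dab (u : R) : `|u - u| = 0 by rewrite subrr normr0.
have main p : cylinder d p -> let e := sech p.1 in
    [/\ `|g p.2| <= G0, `|g1 p.2| <= G1, `|g2 p.2| <= G2, 0 <= e & e <= 1].
  move=> /(cylinderP p d0) Dp; have e0 := sech_gt0 p.1.
  by split; [exact: hG0|exact: hG1|exact: hG2|exact: ltW|exact: sech_le1].
have x0 := normr_ge0 (a - a'); have y0 := normr_ge0 (s - s'); have z0 := normr_ge0 (b - b').
have nd (u v w : R) : `|u| <= w -> `|v| <= 1 -> `|u * v| <= w.
  by move=> h1 h2; rewrite -[w]mulr1; exact: norm_mul_le.
split.
- move=> p /main[q0 q1 q2 e0 e1]; have [h1 h2 h3 h4] := hK s s' p.1 s1 s1'.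
  rewrite /comp1 /trial /=; set u := angle X s p.1 in h1 h3 *; set v := angle X s' p.1 in h3 *.
  have -> : a * cos u + b * (sech p.1 * g p.2) - (a' * cos v + b' * (sech p.1 * g p.2)) =
      (a - a') * cos u + (cos u - cos v) * a' + (b - b') * (g p.2 * sech p.1) by ring.
  apply: (le_trans _ (comb_le x0 y0 z0 e0 K2 KC GC0)).
  apply: norm_add_le; [apply: norm_add_le|].
  + exact: norm_mul_le.
  + by apply: (nd) => //; exact: le_trans (cos_lipschitz _ _) h3.
  + by apply: norm_mul_le => //; apply: norm_mul_le => //; rewrite ger0_norm.
- move=> p /main[q0 q1 q2 e0 e1]; have [h1 h2 h3 h4] := hK s s' p.1 s1 s1'.
  rewrite /comp2 /trial /=; apply: (le_trans (sin_lipschitz _ _)); apply: (le_trans h3).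
  apply: (le_trans _ (comb_le x0 y0 z0 e0 C0 KC C0)).
  by rewrite !mul0r !mulr0 add0r addr0.
- move=> i p /main[q0 q1 q2 e0 e1]; have [h1 h2 h3 h4] := hK s s' p.1 s1 s1'.
  have tb (w G : R) : `|w| <= G -> G <= C -> `|b * (sech p.1 * w) - b' * (sech p.1 * w)| <= k * sech p.1.
    move=> hw GC; have -> : b * (sech p.1 * w) - b' * (sech p.1 * w) = (b - b') * (w * sech p.1) by ring.
    apply: (le_trans _ (comb_le x0 y0 z0 e0 C0 C0 GC)).
    rewrite !mul0r !mulr0 !add0r; apply: norm_mul_le => //.
    by apply: norm_mul_le => //; rewrite ger0_norm.
  case: i => -[|[|[|//]]] ?; rewrite /trial1 /=; [|exact: tb q1 GC1|exact: tb q2 GC2].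
  set u := angle X s p.1 in h1 h3 *; set v := angle X s' p.1 in h3 *.
  set u' := angle' dX s p.1 in h2 h4 *; set v' := angle' dX s' p.1 in h4 *.
  set t := kink p.1; set e := sech p.1 in h1 h2 h3 h4 e0 e1 *.
  (* Telescoping over the three parameters; each summand keeps a factor that is at most a multiple
     of [sech]. *)
  have -> : a * (- sin u * u') + b * (- (e * t / Num.sqrt 2) * g p.2) -
      (a' * (- sin v * v') + b' * (- (e * t / Num.sqrt 2) * g p.2)) =
      (a - a') * (u' * - sin u) + ((sin u - sin v) * u' * - a' + (u' - v') * (- sin v * a')) +
      (b - b') * (g p.2 * (e * (- t * (Num.sqrt 2)^-1))) by ring.
  apply: (le_trans _ (comb_le x0 y0 z0 e0 K2 KC3 GC0)).
  have sm w : `|- sin w| <= 1 :> R by rewrite normrN; exact: sin_max.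
  apply: norm_add_le; [apply: norm_add_le|].
  + by apply: norm_mul_le => //; exact: nd.
  + apply: (@le_trans _ _ (`|s - s'| * (K * e) * (2 * K * e) + `|s - s'| * (K * e))).
      apply: norm_add_le; first apply: (nd); rewrite ?normrN//.
        by apply: norm_mul_le => //; exact: le_trans (sin_lipschitz _ _) h3.
      by apply: (nd) => //; exact: (nd _ _ _ (sm v) a1').
    have -> : `|s - s'| * (K * e) * (2 * K * e) + `|s - s'| * (K * e) =
      `|s - s'| * (2 * K ^+ 2 * e * e + K * e) by ring.
    rewrite ler_wpM2l//.
    have -> : 3 * K ^+ 2 * e = 2 * K ^+ 2 * e + K ^+ 2 * e by ring.
    by apply: lerD; [rewrite ler_piMr//; exact: (mulr_ge0 (mulr_ge0 (ler0n _ 2) (sqr_ge0 K)) e0)|rewrite ler_wpM2r].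
  + apply: norm_mul_le => //; apply: norm_mul_le => //; apply: (nd); first by rewrite ger0_norm.
    apply: (nd); first by rewrite normrN; exact: sech_gt_bound.
    by rewrite ger0_norm ?invr_ge0 ?sqrtr_ge0//; exact: sqrt2V_le1.
- move=> i p /main[q0 q1 q2 e0 e1]; have [h1 h2 h3 h4] := hK s s' p.1 s1 s1'.
  rewrite /trial2 -mulrBr.
  set u := angle X s p.1 in h1 h3 *; set v := angle X s' p.1 in h3 *.
  set u' := angle' dX s p.1 in h2 h4 *; set v' := angle' dX s' p.1 in h4 *.
  set e := sech p.1 in h1 h2 h3 h4 e0 e1 *.
  rewrite mulrC; apply: (nd); last by case: (val i == 0%N); rewrite ?normr1 ?normr0.
  have -> : cos u * u' - cos v * v' = (cos u - cos v) * u' + (u' - v') * cos v by ring.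
  apply: (@le_trans _ _ (`|s - s'| * (K * e) * (2 * K * e) + `|s - s'| * (K * e))).
    apply: norm_add_le; last by apply: (nd) => //; exact: cos_max.
    by apply: norm_mul_le => //; exact: le_trans (cos_lipschitz _ _) h3.
  apply: (le_trans _ (comb_le x0 y0 z0 e0 C0 KC3 C0)).
  rewrite !mul0r !mulr0 add0r addr0.
  have -> : `|s - s'| * (K * e) * (2 * K * e) + `|s - s'| * (K * e) =
    `|s - s'| * (2 * K ^+ 2 * e * e + K * e) by ring.
  rewrite ler_wpM2l//.
  have -> : 3 * K ^+ 2 * e = 2 * K ^+ 2 * e + K ^+ 2 * e by ring.
  by apply: lerD; [rewrite ler_piMr//; exact: (mulr_ge0 (mulr_ge0 (ler0n _ 2) (sqr_ge0 K)) e0)|rewrite ler_wpM2r].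
Qed.

Lemma trial_soliton : trial 0 0 0 = soliton.
Proof. by apply/funext => p; rewrite /trial /soliton /angle !mul0r !addr0 sin_gd. Qed.

Lemma trial_admissible d a s b : 0 < d -> `|a| <= 1 -> 0 <= s <= 1 -> admissible d (trial a s b).
Proof.
move=> d0 a1 s1; have [C C0 hC] := trial_lipschitz d0.
have n0 : `|0 : R| <= 1 by rewrite normr0.
have s0 : 0 <= (0 : R) <= 1 by rewrite lexx ler01.
have [h1 h2 h3 h4] := hC a 0 s 0 b 0 a1 n0 s1 s0.
rewrite /admissible -trial_soliton; split.
- exact: (classical_sobolev d0 (classicalB (classical_trial1 a s b) (classical_trial1 0 0 0)) h1 h3).
- exact: (classical_sobolev d0 (classicalB (classical_trial2 a s b) (classical_trial2 0 0 0)) h2 h4).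
- apply/aeW => p _; rewrite /comp1 /comp2 /trial /= (angleN oddX) cosN sinN sechN.
  by [].
Qed.

Lemma trial_H1 d : 0 < d -> exists2 C, 0 <= C & forall a a' s s' b b',
  `|a| <= 1 -> `|a'| <= 1 -> 0 <= s <= 1 -> 0 <= s' <= 1 ->
  (H1_norm (cylinder d) (fun p => (trial a s b p - trial a' s' b' p)%R) <=
   (C * (`|a - a'| + `|s - s'| + `|b - b'|))%:E)%E.
Proof.
move=> d0; have [C C0 hC] := trial_lipschitz d0.
set r := Num.sqrt (8 * \int[lambda]_(p in cylinder d) (sech p.1 ^+ 2)).
exists (C * r) => [|a a' s s' b b' a1 a1' s1 s1']; first by rewrite mulr_ge0// sqrtr_ge0.
have [h1 h2 h3 h4] := hC a a' s s' b b' a1 a1' s1 s1'.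
have k0 : 0 <= C * (`|a - a'| + `|s - s'| + `|b - b'|) by rewrite mulr_ge0// !addr_ge0.
have := H1_norm_le (w := fun p => trial a s b p - trial a' s' b' p) d0 k0
  (classicalB (classical_trial1 a s b) (classical_trial1 a' s' b'))
  (classicalB (classical_trial2 a s b) (classical_trial2 a' s' b')) h1 h2 h3 h4.
by rewrite -/r mulrAC.
Qed.

End trial.

(** * Elementary inequalities for the trial energy *)

Section trial_estimates.
Context {R : realType}.

Lemma half_sqr_convex (s a b : R) : 0 <= s <= 1 ->
  1 / 2 * ((1 - s) * a + s * b) ^+ 2 <= (1 - s) * (1 / 2 * a ^+ 2) + s * (1 / 2 * b ^+ 2).
Proof.
move=> /andP[s0 s1]; have : 0 <= s * (1 - s) * (a - b) ^+ 2 
  by apply: mulr_ge0; rewrite ?sqr_ge0// mulr_ge0//; lra.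
by lra.
Qed.

Lemma convex_combination_le_max (s a b : R) : 0 <= s <= 1 -> (1 - s) * a + s * b <= Num.max a b.
Proof. by move=> /andP[s0 s1]; rewrite /Num.max; case: ltP; nra. Qed.

(** In [middle_bound] A = a^2, B = b^2, V is the area of the disc, and [m2], [m4] are the second and
    fourth moments of the mode; the left side is the integral of [excess]. *)
Lemma middle_estimate (A B V m m2 m4 : R) :
  A * B * m2 <= A * (V / 24) -> B * B * m4 <= B * ((1 / 2 - m) * m2) -> A ^+ 2 * V <= A * V ->
  0 <= B * ((1 / 2 - m) * m2) ->
  (- (1 / 4) * A + 1 / 6 * A ^+ 2) * V + (- (1 / 4) * B + A * B + 1 / 2 * B * m) * m2 + 1 / 6 * (B * B) * m4 <=
    - (A * V / 24) - (1 / 2 - m) * m2 * B / 4.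
Proof. by lra. Qed.

Lemma large_amplitude (e A V x B : R) : e <= V / 48 -> 1 / 2 * V <= A * V -> 0 <= x * B ->
  - (A * V / 24) - x * B / 4 <= - e.
Proof. by lra. Qed.

Lemma small_amplitude (e A V x E B : R) : e <= x * E / 16 -> x * (E / 4) <= x * B -> 0 <= A * V ->
  - (A * V / 24) - x * B / 4 <= - e.
Proof. by lra. Qed.

Lemma small_amplitude_gap (A : R) : A < 1 / 2 -> 4^-1 <= (1 - A) ^+ 2.
Proof. by nra. Qed.

End trial_estimates.

(** * Energy of the trial maps *)

Section trial_energy.
Context {R : realType}.
Local Notation mR := (measurableTypeR R).
Local Notation T3 := (mR * (mR * mR))%type.
Local Notation mu := (@lebesgue_measure R).
Local Notation mu2 := (@lebesgue2 R).
Local Notation lambda := (@lebesgue3 R).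
Implicit Types (a b s d : R) (p : space R).

Variables (X dX : R -> R) (N : R).
Hypotheses (N0 : 0 < N) (derX : forall x : R, is_derive x 1 X (dX x)) (contX : continuous dX).
Hypotheses (oddX : forall x, X (- x) = - X x) (X_tail : forall x, N <= x -> X x = pi / 2).
Variables (g g1 g2 : R * R -> R).
Hypothesis cg : C1_plane g g1 g2.
Local Notation trial := (trial X g).

Definition sech2_mass := \int[mu]_x (sech x ^+ 2).
Definition disc_area d := \int[mu2]_(q in disc d) (1 : R).
(** The factor 1/3 is 1/2 from the energy density times 2/3 from [sech4_integral]. *)
Definition soliton_energy d : R := sech2_mass * disc_area d / 3.

Lemma continuous_sech_exp n : continuous (fun x : R => sech x ^+ n).
Proof. by apply: continuous_exp; exact: continuous_sech. Qed.

Lemma cylinder_sech2 d (f : R * R -> R) : 0 < d -> continuous f ->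
  Rintegrable lambda (cylinder d) (fun p => sech p.1 ^+ 2 * f p.2) /\
  \int[lambda]_(p in cylinder d) (sech p.1 ^+ 2 * f p.2) = sech2_mass * \int[mu2]_(q in disc d) f q.
Proof. by move=> d0 cf; exact: (cylinder_tensor d0 (@continuous_sech_exp 2) cf (@sech2_Rintegrable R)). Qed.

Lemma cylinder_sech4 d (f : R * R -> R) : 0 < d -> continuous f ->
  Rintegrable lambda (cylinder d) (fun p => sech p.1 ^+ 4 * f p.2) /\
  \int[lambda]_(p in cylinder d) (sech p.1 ^+ 4 * f p.2) = 2 / 3 * sech2_mass * \int[mu2]_(q in disc d) f q.
Proof.
move=> d0 cf; have [h1 h2] := cylinder_tensor d0 (@continuous_sech_exp 4) cf (@sech4_line_Rintegrable R).
split => //; rewrite h2; have := @sech4_integral R; rewrite -/sech2_mass => h.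
by have -> : \int[mu]_x (sech x ^+ 4) = 2 / 3 * sech2_mass by lra.
Qed.

Lemma energy_solitonE d : 0 < d -> energy d soliton = (soliton_energy d)%:E.
Proof.
move=> d0; rewrite energy_soliton//; congr EFin.
have mD := measurable_cylinder d.
have c1 : continuous (fun _ : R * R => (1 : R)) by exact: continuous_const.
have [i4 h4] := cylinder_sech4 d0 c1.
transitivity (\int[lambda]_(p in cylinder d) (1 / 2 * (sech p.1 ^+ 4 * 1))).
  by apply: eq_Rintegral => p _; rewrite mulr1.
by rewrite (RintegralZ' mD _ i4) h4 /soliton_energy /disc_area; field.
Qed.

Lemma sech2_mass_gt0 : 0 < sech2_mass.
Proof.
apply: (lt_le_trans (@sech_mass_gt0 R)).
have m1 : measurable (`[- 1, 1]%classic : set mR) by exact: measurable_itv.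
have j1 : Rintegrable mu `[- 1, 1]%classic (fun x : mR => sech x ^+ 2).
  by apply: segment_Rintegrable; exact: continuous_sech_exp.
rewrite /sech_mass -lee_fin -(RintegralE m1 j1) -(RintegralE measurableT (@sech2_Rintegrable R)).
apply: ge0_subset_integral => //; last by move=> x _; rewrite lee_fin sqr_ge0.
by apply/measurable_EFinP; exact: Rintegrable_measurable (@sech2_Rintegrable R).
Qed.

Lemma soliton_energy_gt0 d : 0 < d -> 0 < soliton_energy d.
Proof.
move=> d0; rewrite divr_gt0// mulr_gt0//; [exact: sech2_mass_gt0|exact: disc_area_gt0].
Qed.

Let density_trial a s b := density (comp1 (trial a s b)) (comp2 (trial a s b))
  (trial1 X dX g g1 g2 a s b) (trial2 X dX s).

Lemma trial_energyE d a s b : (energy d (trial a s b) =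
  \int[lambda]_(p in cylinder d) (density_trial a s b p)%:E)%E.
Proof. by apply: energy_classical; [exact: classical_trial1|exact: classical_trial2]. Qed.

Let lineE d s := \int[lambda]_(p in cylinder d) (1 / 2 * angle' dX s p.1 ^+ 2).

Lemma angle'_Rintegrable d s : 0 < d -> 0 <= s <= 1 ->
  Rintegrable lambda (cylinder d) (fun p => 1 / 2 * angle' dX s p.1 ^+ 2).
Proof.
move=> d0 s1; have [K K1 hK] := angle_bounds N0 derX contX oddX X_tail.
apply: RintegrableZ; first exact: measurable_cylinder.
have mD := measurable_cylinder d.
suff : L2 lambda (cylinder d) (fun p => angle' dX s p.1) by case.
apply: (@sech_bounded_L2 _ d (2 * K)) => //.
  by apply: continuous_measurable_on => //; apply: continuous_of_fst; exact: continuous_angle'.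
by move=> p _; have [] := hK s s p.1 s1 s1.
Qed.

(** On the unit circle the potential vanishes, and the gradient is that of the angle. *)
Lemma unimodular_energy d a s : 0 < d -> a ^+ 2 = 1 -> 0 <= s <= 1 ->
  energy d (trial a s 0) = (lineE d s)%:E.
Proof.
move=> d0 a1 s1; have mD := measurable_cylinder d.
rewrite trial_energyE -(RintegralE mD (angle'_Rintegrable d0 s1)).
apply: eq_integral => p _; congr EFin.
rewrite /density_trial /density /comp1 /comp2 /trial /= !big_ord_recl big_ord0 /trial1 /trial2 /=.
rewrite !mul0r !addr0 expr0n /= !addr0 mul1r !exprMn a1 sqrrN !mul1r.
have := cos2Dsin2 (angle X s p.1); set c := cos _; set z := sin _ => h.
have z2 : z ^+ 2 = 1 - c ^+ 2 by rewrite -h; ring.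
by rewrite z2; field.
Qed.

(** By convexity in [s] only the ends matter: at s = 0 the energy is 3/4 of that of the soliton, and
    at s = 1 it is smaller by hypothesis. *)
Lemma unimodular_bound d : 0 < d -> (energy d (trial 1 1 0) < energy d soliton)%E ->
  exists2 M, M < soliton_energy d & forall a s, a ^+ 2 = 1 -> 0 <= s <= 1 ->
  (energy d (trial a s 0) <= M%:E)%E.
Proof.
move=> d0; rewrite (energy_solitonE d0).
have i0 : 0 <= (0 : R) <= 1 by rewrite lexx ler01.
have i1 : 0 <= (1 : R) <= 1 by rewrite lexx ler01.
rewrite unimodular_energy ?expr1n// lte_fin => h1.
have mD := measurable_cylinder d.
have h0 : lineE d 0 < soliton_energy d.
  have c1 : continuous (fun _ : R * R => (1 : R)) by exact: continuous_const.
  have [i2 h2] := cylinder_sech2 d0 c1.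
  have s2 : (Num.sqrt (2 : R))^-1 ^+ 2 = 1 / 2 by rewrite exprVn sqr_sqrtr// div1r.
  have -> : lineE d 0 = \int[lambda]_(p in cylinder d) (1 / 4 * (sech p.1 ^+ 2 * 1)).
    by apply: eq_Rintegral => p _; rewrite /angle' mul0r addr0 exprMn s2; field.
  rewrite (RintegralZ' mD _ i2) h2 -/(disc_area d) /soliton_energy.
  have := mulr_gt0 sech2_mass_gt0 (disc_area_gt0 d0); rewrite -/(disc_area d); lra.
exists (Num.max (lineE d 0) (lineE d 1)); first by rewrite gt_max h0 h1.
move=> a s a1 s1; rewrite unimodular_energy// lee_fin.
have j0 := angle'_Rintegrable d0 i0; have j1 := angle'_Rintegrable d0 i1.
have k0 := RintegrableZ mD (1 - s) j0; have k1 := RintegrableZ mD s j1.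
apply: (@le_trans _ _ ((1 - s) * lineE d 0 + s * lineE d 1)).
  rewrite -(RintegralZ' mD _ j0) -(RintegralZ' mD _ j1) -(RintegralD' mD k0 k1).
  apply: le_Rintegral' => //; [exact: angle'_Rintegrable|exact: RintegrableD|].
  move=> p _; set A := angle' dX 0 p.1; set B := angle' dX 1 p.1.
  have -> : angle' dX s p.1 = (1 - s) * A + s * B by rewrite /A /B /angle'; ring.
  exact: half_sqr_convex.
exact: convex_combination_le_max.
Qed.

(** With v = a + b g, the energy of (v sech, kink) minus that of the soliton, per unit of
    cross-section and divided by the integral of sech^2 over the line. *)
Definition excess a b q : R := let v := a + b * g q in
  - (1 / 4) * v ^+ 2 + 1 / 6 * v ^+ 4 + 1 / 2 * b ^+ 2 * (g1 q ^+ 2 + g2 q ^+ 2).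

Lemma middle_energy d a b : 0 < d -> energy d (trial a 0 b) =
  (soliton_energy d + sech2_mass * \int[mu2]_(q in disc d) excess a b q)%:E.
Proof.
move=> d0; have mD := measurable_cylinder d; have [c0 c1 c2 _ _] := cg.
have ck k : continuous (fun _ : R * R => k : R) by exact: continuous_const.
have cv : continuous (fun q => a + b * g q) by apply: continuous_add => //; exact: continuous_mul.
(* [F2] and [F4] are the coefficients of sech^2 and sech^4 in the energy density, after kink^2 = 1 -
   sech^2. *)
pose F2 q : R := 1 / 4 * (a + b * g q) ^+ 2 + 1 / 2 * b ^+ 2 * (g1 q ^+ 2 + g2 q ^+ 2).
pose F4 q : R := 1 / 2 - 3 / 4 * (a + b * g q) ^+ 2 + 1 / 4 * (a + b * g q) ^+ 4.
have cF2 : continuous F2.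
  apply: continuous_add; apply: continuous_mul => //; first exact: continuous_exp.
  by apply: continuous_add; exact: continuous_exp.
have cF4 : continuous F4.
  apply: continuous_add; first apply: continuous_sub => //; apply: continuous_mul => //; exact: continuous_exp.
have [i2 h2] := cylinder_sech2 d0 cF2; have [i4 h4] := cylinder_sech4 d0 cF4.
have E p : density_trial a 0 b p = sech p.1 ^+ 2 * F2 p.2 + sech p.1 ^+ 4 * F4 p.2.
  rewrite /density_trial /density /comp1 /comp2 /trial /= !big_ord_recl big_ord0 /trial1 /trial2 /=.
  rewrite /angle /angle' !mul0r !addr0 cos_gd sin_gd expr0n /= !addr0 mul1r /F2 /F4.
  have sk := sech_kink p.1; set e := sech p.1 in sk *; set t := kink p.1 in sk *.
  have s2 : (Num.sqrt (2 : R))^-1 ^+ 2 = 1 / 2 by rewrite exprVn sqr_sqrtr//; lra.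
  set r := (Num.sqrt 2)^-1 in s2 *; set G := g p.2; set G1 := g1 p.2; set G2 := g2 p.2.
  have t2 : t ^+ 2 = 1 - e ^+ 2 by rewrite -sk; ring.
  have -> : a * (- t * (e * r)) + b * (- (e * t * r) * G) = - (e * t * r) * (a + b * G) by ring.
  have -> : a * e + b * (e * G) = e * (a + b * G) by ring.
  have -> : (- (e * t * r) * (a + b * G)) ^+ 2 = e ^+ 2 * t ^+ 2 * r ^+ 2 * (a + b * G) ^+ 2 by ring.
  have -> : (1 * (e * (e * r))) ^+ 2 = e ^+ 4 * r ^+ 2 by ring.
  by rewrite t2 s2; field.
have jj := RintegrableD mD i2 i4.
rewrite trial_energyE.
have -> : (\int[lambda]_(p in cylinder d) (density_trial a 0 b p)%:E =
    \int[lambda]_(p in cylinder d) (sech p.1 ^+ 2 * F2 p.2 + sech p.1 ^+ 4 * F4 p.2)%:E)%E.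
  by apply: eq_integral => p _; rewrite E.
rewrite (RintegralE mD jj) (RintegralD' mD i2 i4) h2 h4; congr EFin.
have mB := measurable_disc d; have j2 := disc_Rintegrable d0 cF2; have j4 := disc_Rintegrable d0 cF4.
have j1 := disc_Rintegrable d0 (ck 1).
transitivity (sech2_mass * (\int[mu2]_(q in disc d) F2 q + 2 / 3 * \int[mu2]_(q in disc d) F4 q)); first by ring.
have -> : soliton_energy d + sech2_mass * \int[mu2]_(q in disc d) excess a b q =
    sech2_mass * (1 / 3 * disc_area d + \int[mu2]_(q in disc d) excess a b q).
  by rewrite /soliton_energy; field.
have cE : continuous (excess a b).
  apply: continuous_add; first by apply: continuous_add; apply: continuous_mul => //; exact: continuous_exp.
  by apply: continuous_mul => //; apply: continuous_add; exact: continuous_exp.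
congr (_ * _); rewrite -(RintegralZ' mB _ j4) -(RintegralZ' mB _ j1).
rewrite -(RintegralD' mB j2 (RintegrableZ mB _ j4)) -(RintegralD' mB (RintegrableZ mB _ j1) (disc_Rintegrable d0 cE)).
by apply: eq_Rintegral => q _; rewrite /F2 /F4 /excess; field.
Qed.

Lemma middle_bound0 d a : 0 < d -> `|a| <= 1 -> (energy d (trial a 0 0) <= (soliton_energy d)%:E)%E.
Proof.
move=> d0 a1; rewrite middle_energy// lee_fin gerDl.
have c20 := sech2_mass_gt0; rewrite pmulr_rle0//.
have ck k : continuous (fun _ : R * R => k : R) by exact: continuous_const.
have -> : \int[mu2]_(q in disc d) excess a 0 q = \int[mu2]_(q in disc d) ((- (1 / 4) * a ^+ 2 + 1 / 6 * a ^+ 4) * 1).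
  by apply: eq_Rintegral => q _; rewrite /excess mul0r addr0 expr0n /= mulr0 mul0r addr0 mulr1.
rewrite (RintegralZ' (measurable_disc d) _ (disc_Rintegrable d0 (ck 1))).
have V0 := disc_area_gt0 d0; rewrite pmulr_lle0//.
have a2 : a ^+ 2 <= 1 by rewrite -(real_normK (num_real a)) expr_le1.
have -> : a ^+ 4 = a ^+ 2 * a ^+ 2 by ring.
by have := sqr_ge0 a; set A := a ^+ 2 in a2 *; nra.
Qed.

(** At a = 0 the perturbation lowers the energy because [m] is below 1/2; for larger |a| the
    unperturbed energy is already lower. The choice b = eps (1 - a^2) vanishes at |a| = 1, so that
    the pieces of the path fit together. *)
Lemma middle_bound (m : R) d : 0 < d -> m < 1 / 2 ->
  \int[mu2]_(q in disc d) g q = 0 -> \int[mu2]_(q in disc d) (g q ^+ 3) = 0 ->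
  \int[mu2]_(q in disc d) (g1 q ^+ 2 + g2 q ^+ 2) = m * \int[mu2]_(q in disc d) (g q ^+ 2) ->
  0 < \int[mu2]_(q in disc d) (g q ^+ 2) ->
  exists2 eps, 0 < eps & exists2 M, M < soliton_energy d & forall a, `|a| <= 1 ->
    (energy d (trial a 0 (eps * (1 - a ^+ 2))) <= M%:E)%E.
Proof.
move=> d0 m12 I1 I3 ID I2; have [c0 c1 c2 _ _] := cg.
set m2 := \int[mu2]_(q in disc d) (g q ^+ 2) in ID I2.
set m4 := \int[mu2]_(q in disc d) (g q ^+ 4).
have V0 : 0 < disc_area d by exact: disc_area_gt0.
set V := disc_area d in V0.
have m40 : 0 <= m4 by apply: Rintegral_ge0 => q _; exact: exprn_even_ge0.
pose ka := 1 / 2 - m; have ka0 : 0 < ka by rewrite /ka; lra.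
(* [E2] is the square of [eps]: the first bound controls the mixed term a^2 b^2, the second the
   quartic term in [b]. *)
pose E2 := Num.min (V / (24 * m2)) (ka * m2 / (m4 + 1)).
have m41 : 0 < m4 + 1 by lra.
have E20 : 0 < E2 by rewrite /E2 lt_min !divr_gt0 ?mulr_gt0.
have h1 : E2 * m2 <= V / 24.
  have : E2 <= V / (24 * m2) by rewrite /E2 ge_min lexx.
  by rewrite !ler_pdivlMr ?mulr_gt0// mulrCA mulrC.
have h2 : E2 * m4 <= ka * m2.
  have : E2 <= ka * m2 / (m4 + 1) by rewrite /E2 ge_min lexx orbT.
  by rewrite ler_pdivlMr// => h; lra.
pose eps := Num.sqrt E2; have eps0 : 0 < eps by rewrite sqrtr_gt0.
have eps2 : eps ^+ 2 = E2 by rewrite sqr_sqrtr// ltW.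
(* The gains in the two regimes a^2 >= 1/2 and a^2 < 1/2; in the second, (1 - a^2)^2 is at least
   1/4. *)
pose eta := Num.min (V / 48) (ka * m2 * E2 / 16).
have eta0 : 0 < eta by rewrite /eta lt_min !divr_gt0 ?mulr_gt0.
have c20 := sech2_mass_gt0.
exists eps => //; exists (soliton_energy d + sech2_mass * - eta); first by rewrite mulrN gtrDl oppr_lt0 mulr_gt0.
move=> a a1; rewrite middle_energy// lee_fin lerD2l (ler_wpM2l (ltW c20))//.
set b := eps * (1 - a ^+ 2).
have mD := measurable_disc d.
have ck k : continuous (fun _ : R * R => k : R) by exact: continuous_const.
have iD (u : R * R -> R) : continuous u -> Rintegrable mu2 (disc d) u by exact: disc_Rintegrable.
have cX n : continuous (fun q => g q ^+ n) by exact: continuous_exp.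
have cG : continuous (fun q => g1 q ^+ 2 + g2 q ^+ 2) by apply: continuous_add; exact: continuous_exp.
have cZ k (u : R * R -> R) : continuous u -> continuous (fun q => k * u q) by move=> cu; exact: continuous_mul.
have lin k (u v : R * R -> R) : continuous u -> continuous v ->
    \int[mu2]_(q in disc d) (u q + k * v q) = \int[mu2]_(q in disc d) u q + k * \int[mu2]_(q in disc d) v q.
  by move=> cu cv; rewrite (RintegralD' mD (iD _ cu) (RintegrableZ mD _ (iD _ cv))) (RintegralZ' mD _ (iD _ cv)).
set A := a ^+ 2 in b *.
(* Expansion in powers of [g]: the first and third moments vanish, and the gradient term is [m]
   times the second moment. *)
have -> : \int[mu2]_(q in disc d) excess a b q = (- (1 / 4) * A + 1 / 6 * A ^+ 2) * V +
    (- (1 / 4) * b ^+ 2 + A * b ^+ 2 + 1 / 2 * b ^+ 2 * m) * m2 + 1 / 6 * b ^+ 4 * m4.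
  pose k0 := - (1 / 4) * A + 1 / 6 * A ^+ 2.
  pose k1 := - (1 / 2) * a * b + 2 / 3 * a ^+ 3 * b.
  pose k2 := - (1 / 4) * b ^+ 2 + A * b ^+ 2.
  pose k3 := 2 / 3 * a * b ^+ 3.
  transitivity (\int[mu2]_(q in disc d) (k0 * 1 + k1 * g q + k2 * g q ^+ 2 + k3 * g q ^+ 3 +
      1 / 6 * b ^+ 4 * g q ^+ 4 + 1 / 2 * b ^+ 2 * (g1 q ^+ 2 + g2 q ^+ 2))).
    by apply: eq_Rintegral => q _; rewrite /excess /k0 /k1 /k2 /k3 /A; field.
  have e1 := continuous_add (cZ k0 _ (ck 1)) (cZ k1 _ c0).
  have e2 := continuous_add e1 (cZ k2 _ (cX 2)).
  have e3 := continuous_add e2 (cZ k3 _ (cX 3)).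
  have e4 := continuous_add e3 (cZ (1 / 6 * b ^+ 4) _ (cX 4)).
  rewrite (lin _ _ _ e4 cG) (lin _ _ _ e3 (cX 4)) (lin _ _ _ e2 (cX 3)) (lin _ _ _ e1 (cX 2)).
  rewrite (lin _ _ _ (cZ k0 _ (ck 1)) c0) (RintegralZ' mD _ (iD _ (ck 1))) I1 I3 ID -/m2 -/m4 -/(disc_area d) -/V /k0 /k2.
  by ring.
have A0 : 0 <= A by exact: sqr_ge0.
have A1 : A <= 1 by rewrite /A -(real_normK (num_real a)) expr_le1.
set B := b ^+ 2; have B0 : 0 <= B by exact: sqr_ge0.
have BE : B = E2 * (1 - A) ^+ 2 by rewrite /B /b exprMn eps2.
have BE2 : B <= E2.
  by rewrite BE ler_piMr ?(ltW E20)// expr_le1 ?subr_ge0// gerBl.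
have -> : b ^+ 4 = B * B by rewrite /B; ring.
have g1' : A * B * m2 <= A * (V / 24).
  rewrite -mulrA ler_wpM2l//; apply: le_trans h1; rewrite ler_wpM2r//; exact: ltW.
have g2' : B * B * m4 <= B * (ka * m2).
  rewrite -mulrA ler_wpM2l//; apply: le_trans h2; rewrite ler_wpM2r//.
have g3' : A ^+ 2 * V <= A * V by rewrite ler_wpM2r ?(ltW V0)// expr2 ler_piMr.
have key : (- (1 / 4) * A + 1 / 6 * A ^+ 2) * V + (- (1 / 4) * B + A * B + 1 / 2 * B * m) * m2 + 1 / 6 * (B * B) * m4 <=
    - (A * V / 24) - ka * m2 * B / 4.
  by apply: middle_estimate g1' g2' g3' _; rewrite mulr_ge0// mulr_ge0 ?ltW.
apply: (le_trans key).
have p2 : 0 <= ka * m2 * B by rewrite mulr_ge0// mulr_ge0 ?ltW.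
have p1 : 0 <= A * V by rewrite mulr_ge0// ltW.
have [Ah|Ah] := leP (1 / 2) A.
  have et : eta <= V / 48 by rewrite /eta ge_min lexx.
  have AV : 1 / 2 * V <= A * V by rewrite ler_wpM2r// ltW.
  exact: (large_amplitude et AV p2).
have et : eta <= ka * m2 * E2 / 16 by rewrite /eta ge_min lexx orbT.
have BB : E2 / 4 <= B.
  rewrite BE ler_wpM2l ?(ltW E20)//; exact: small_amplitude_gap.
exact: (small_amplitude et (ler_wpM2l (ltW (mulr_gt0 ka0 I2)) BB) p1).
Qed.

End trial_energy.

(** * Parameters of the path *)

Section path_parameters.
Context {R : realType}.
Implicit Types (t eps : R).

(** Equal to 2 t for |t| <= 1/2 and constant, 1 or -1, beyond: [a] moves only in the middle half of
    the path. *)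
Definition amplitude t : R := `|t + 1 / 2| - `|t - 1 / 2|.
(** The positive part of 2 |t| - 1: [s] moves only outside the middle half, where a^2 = 1. *)
Definition homotopy t : R := `|t| - 1 / 2 + `| `|t| - 1 / 2|.

Lemma continuous_norm : continuous (fun x : R => `|x|).
Proof. by move=> x; exact: norm_continuous. Qed.

Lemma continuous_amplitude : continuous amplitude.
Proof.
apply: continuous_sub; apply: (continuous_compose _ continuous_norm).
  by apply: continuous_add; [exact: continuous_self|exact: continuous_const].
by apply: continuous_sub; [exact: continuous_self|exact: continuous_const].
Qed.

Lemma continuous_homotopy : continuous homotopy.
Proof.
have c : continuous (fun x : R => `|x| - 1 / 2).
  by apply: continuous_sub; [exact: continuous_norm|exact: continuous_const].
by apply: continuous_add => //; exact: (continuous_compose c continuous_norm).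
Qed.

Lemma path_parameters t : -1 <= t <= 1 -> [/\ `|amplitude t| <= 1, 0 <= homotopy t <= 1 &
  amplitude t ^+ 2 = 1 \/ homotopy t = 0].
Proof.
move=> t1; rewrite /amplitude /homotopy.
have [t0|t0] := leP 0 t.
  rewrite (ger0_norm t0) (@ger0_norm _ (t + 1 / 2)); last lra.
  have [th|th] := leP 0 (t - 1 / 2).
    rewrite ?(ger0_norm th); split; [by rewrite ler_norml; lra|lra|left].
    by have -> : t + 1 / 2 - (t - 1 / 2) = 1 by [field]; rewrite expr1n.
  rewrite !(ltr0_norm th); split; [by rewrite ler_norml; lra|lra|right; lra].
rewrite (ltr0_norm t0) (@ler0_norm _ (t - 1 / 2)); last lra.
have [th|th] := leP 0 (t + 1 / 2).
  rewrite (ger0_norm th) (@ler0_norm _ (- t - 1 / 2)); last lra.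
  by split; [by rewrite ler_norml; lra|lra|right; lra].
rewrite (ltr0_norm th) (@ger0_norm _ (- t - 1 / 2)); last lra.
split; [by rewrite ler_norml; lra|lra|left].
by have -> : - (t + 1 / 2) - - (t - 1 / 2) = -1 by [field]; rewrite sqrrN expr1n.
Qed.

Lemma amplitude1 : amplitude 1 = 1 /\ amplitude (-1) = -1.
Proof.
rewrite /amplitude; split.
  by rewrite !ger0_norm; lra.
by rewrite !ler0_norm; lra.
Qed.

Lemma homotopy1 : homotopy 1 = 1 /\ homotopy (-1) = 1.
Proof. by rewrite /homotopy normrN normr1 ger0_norm; lra. Qed.

End path_parameters.

(** * The trial path and the upper bound of the mountain pass *)

Section trial_path.
Context {R : realType}.
Local Notation mR := (measurableTypeR R).
Local Notation mu2 := (@lebesgue2 R).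
Local Notation lambda := (@lebesgue3 R).
Implicit Types (t eps d : R).

(** The choice g = 0 gives the unperturbed path, used for d <= sqrt 2 j. *)
Lemma C1_plane0 : C1_plane (fun _ : R * R => 0 : R) (fun _ => 0) (fun _ => 0).
Proof. by split; [exact: continuous_const..| |] => x y; exact: is_derive1_cst. Qed.

Variables (chi : R -> R) (n : nat).
Hypotheses (hchi : profile chi) (n0 : (0 < n)%N).
Local Notation X := (fun x : R => chi (x / n%:R)).
Local Notation dX := (fun x : R => derive1 chi (x / n%:R) * n%:R^-1).

Let n0' : 0 < n%:R :> R. Proof. by rewrite ltr0n. Qed.

Lemma profile_is_derive x : is_derive (x : R) 1 X (dX x).
Proof.
have [_ _ dchi _] := hchi.
have h : is_derive (x / n%:R) 1 chi (derive1 chi (x / n%:R)).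
  by apply: DeriveDef; [exact: (dchi 0%N)|rewrite derive1E].
exact: (@is_derive1_compose _ chi (fun x => x / n%:R) x _ _ h (is_derive_scaled n%:R x)).
Qed.

Lemma profile_continuous_derive : continuous dX.
Proof.
have [_ _ dchi _] := hchi.
have c : continuous (derive1 chi).
  by move=> y; apply: differentiable_continuous; apply/derivable1_diffP; exact: (dchi 1%N y).
apply: continuous_mul; last exact: continuous_const.
apply: (continuous_compose (f := fun x : R => x / n%:R)) => //.
by apply: continuous_mul; [exact: continuous_self|exact: continuous_const].
Qed.

Lemma profile_odd x : X (- x) = - X x.
Proof. by have [_ odd _ _] := hchi; rewrite mulNr odd. Qed.

Lemma profile_tail x : n%:R <= x -> X x = pi / 2.
Proof. by have [_ _ _ tail] := hchi; move=> nx; rewrite tail// ler_pdivlMr// mul1r. Qed.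

Section mode_path.
Variables (g g1 g2 : R * R -> R).
Hypothesis cg : C1_plane g g1 g2.

Definition trial_path eps t := trial X g (amplitude t) (homotopy t) (eps * (1 - amplitude t ^+ 2)).

Lemma trial_path_paths d eps : 0 < d -> paths d (psi chi (-1) n) (psi chi 1 n) (trial_path eps).
Proof.
move=> d0; have dX' := profile_is_derive; have cX' := profile_continuous_derive.
have [C C0 hC] := trial_H1 n0' dX' cX' profile_odd profile_tail cg d0.
have [a1 a1'] := @amplitude1 R; have [h1 h1'] := @homotopy1 R.
have ang x : angle X 1 x = X x by rewrite /angle mul1r addrC subrK.
split.
- move=> t; rewrite in_itv/= => ht; have [p1 p2 _] := path_parameters ht.
  exact: (trial_admissible n0' dX' cX' profile_odd profile_tail cg _ d0 p1 p2).
- move=> t; rewrite in_itv/= => ht; have [p1 p2 _] := path_parameters ht.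
  pose D s := C * (`|amplitude s - amplitude t| + `|homotopy s - homotopy t| +
    `|eps * (1 - amplitude s ^+ 2) - eps * (1 - amplitude t ^+ 2)|).
  have cD : continuous D.
    have cn (f : R -> R) k : continuous f -> continuous (fun s => `|f s - k|).
      move=> cf; apply: (continuous_compose _ (@continuous_norm R)).
      by apply: continuous_sub => //; exact: continuous_const.
    apply: continuous_mul; first exact: continuous_const.
    apply: continuous_add; first by apply: continuous_add; apply: cn; [exact: continuous_amplitude|exact: continuous_homotopy].
    apply: cn; apply: continuous_mul; first exact: continuous_const.
    by apply: continuous_sub; [exact: continuous_const|apply: continuous_exp; exact: continuous_amplitude].
  have Dt : D t = 0 by rewrite /D !subrr !normr0 !addr0 mulr0.
  have cvD : D s @[s --> within [set` `[-1, 1]] (nbhs t)] --> (0 : R).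
    by rewrite -Dt; apply: cvg_within_filter; exact: cD.
  apply: (@squeeze_cvge _ _ _ _ (fun=> 0%E) _ (fun s => (D s)%:E)).
  + have hin : \forall s \near within [set` `[-1, 1]] (nbhs t), s \in `[(-1 : R), 1].
      by apply: withinT.
    near=> s; rewrite poweR_ge0 /=.
    have : s \in `[(-1 : R), 1] by near: s; exact: hin.
    rewrite in_itv/= => hs; have [q1 q2 _] := path_parameters hs.
    exact: hC.
  + exact: cvg_cst.
  + by apply: cvg_EFin; [exact: nearW|exact: cvD].
- apply/aeW => p _; rewrite /trial_path /trial /psi a1' h1' ang sqrrN expr1n subrr mulr0 mul0r addr0.
  by [].
- apply/aeW => p _; rewrite /trial_path /trial /psi a1 h1 ang expr1n subrr mulr0 mul0r addr0.
  by [].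
Unshelve. all: by end_near. Qed.

Lemma mountain_pass_le d eps (M : R) : 0 < d ->
  (forall a s, a ^+ 2 = 1 -> 0 <= s <= 1 -> (energy d (trial X g a s 0) <= M%:E)%E) ->
  (forall a, (`|a| <= 1)%R -> (energy d (trial X g a 0 (eps * (1 - a ^+ 2))) <= M%:E)%E) ->
  (mountain_pass d (psi chi (-1) n) (psi chi 1 n) <= M%:E)%E.
Proof.
move=> d0 h1 h2; apply: ge_ereal_inf.
exists (ereal_sup [set energy d (trial_path eps t) | t in [set` `[-1, 1]]]).
  by exists (trial_path eps) => //; exact: trial_path_paths.
apply: ub_ereal_sup => _ [t ht <-]; move: ht; rewrite /= in_itv/= => ht.
have [p1 p2 [p3|p3]] := path_parameters ht; rewrite /trial_path; last by rewrite p3; exact: h2.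
by rewrite p3 subrr mulr0; exact: h1.
Qed.

End mode_path.

Lemma trial_psi g : trial X g 1 1 0 = psi chi 1 n.
Proof.
apply/funext => p; rewrite /trial /psi /angle !mul1r mul0r addr0.
by rewrite addrC subrK.
Qed.

End trial_path.

(** * The critical mode and the conclusion *)

Section main.
Context {R : realType}.
Local Notation mR := (measurableTypeR R).
Local Notation mu := (@lebesgue_measure R).
Local Notation mu2 := (@lebesgue2 R).
Implicit Types (d : R).

Lemma disc_integral_gt0 d (F : R * R -> R) (q0 : R * R) : 0 < d -> continuous F ->
  (forall q, 0 <= F q) -> disc d q0 -> 0 < F q0 -> 0 < \int[mu2]_(q in disc d) F q.
Proof.
move=> d0 cF F0 Dq Fq; set c := F q0.
have n1 : nbhs q0 [set q | c / 2 < F q].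
  apply: (cF q0 [set y | c / 2 < y]); apply: open_nbhs_nbhs; split; first exact: open_gt.
  by move: Fq; rewrite /= -/c; lra.
have n2 : nbhs q0 (disc d) by apply: open_nbhs_nbhs; split => //; exact: open_disc.
have [e /= e0 he] := (nbhs_ballP _ _).1 (filterI n1 n2).
pose B : set (mR * mR) := `[q0.1 - e / 2, q0.1 + e / 2]%classic `*` `[q0.2 - e / 2, q0.2 + e / 2]%classic.
have hB q : B q -> c / 2 < F q /\ disc d q.
  move=> [/= b1 b2]; apply: he; move: b1 b2; rewrite !in_itv/= => b1 b2.
  by split; rewrite -ball_normE /= distrC ltr_norml; lra.
have mB : measurable B by apply: measurableX; exact: measurable_itv.
have mD := measurable_disc d.
have muB : mu2 B = (e * e)%:E.
  rewrite [LHS](@product_measure1E _ _ _ _ R mu mu)//.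
  have L (x : R) : mu `[x - e / 2, x + e / 2]%classic = e%:E.
    rewrite lebesgue_measure_itv/= lte_fin ifT; last lra.
    by rewrite -EFinB; congr EFin; field.
  by rewrite EFinM; congr mule; exact: L.
have jF := disc_Rintegrable d0 cF.
have jB : Rintegrable mu2 B F by apply: (integrableS mD mB _ jF) => q /hB[].
have jc : Rintegrable mu2 B (fun=> c / 2).
  have Boo : (mu2 B < +oo)%E by rewrite muB ltry.
  apply: (@bounded_Rintegrable _ _ _ mu2 B _ (c / 2) mB Boo) => [|q _]; first exact: measurable_cst.
  by rewrite ger0_norm// divr_ge0// F0.
apply: (@lt_le_trans _ _ (\int[mu2]_(q in B) (c / 2))).
  have -> : \int[mu2]_(q in B) (c / 2) = c / 2 * (e * e).
    by rewrite Rintegral_cst//; congr (_ * _); exact: (congr1 fine muB).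
  by rewrite !mulr_gt0.
apply: (@le_trans _ _ (\int[mu2]_(q in B) F q)).
  by apply: le_Rintegral' => // q /hB[h _]; exact: ltW.
rewrite -lee_fin -(RintegralE mB jB) -(RintegralE mD jF).
apply: ge0_subset_integral => // [|q _|q /hB[]//]; last by rewrite lee_fin F0.
by apply/measurable_EFinP; exact: Rintegrable_measurable jF.
Qed.

(** (j / d)^2 < 1/2 expresses d > sqrt 2 j. The mode is odd in the first transverse coordinate, so
    its first and third moments vanish, and [mode_energy] relates the gradient to the second
    moment. *)
Lemma critical_mode (j d : R) : smallest_positive_zero (derive1 (bessel_J 1)) j -> Num.sqrt 2 * j < d ->
  let g := mode 1 0 ((j / d) ^+ 2) in
  [/\ (j / d) ^+ 2 < 1 / 2, \int[mu2]_(q in disc d) g q = 0, \int[mu2]_(q in disc d) (g q ^+ 3) = 0,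
    \int[mu2]_(q in disc d) (mode1 1 0 ((j / d) ^+ 2) q ^+ 2 + mode2 1 0 ((j / d) ^+ 2) q ^+ 2) =
      (j / d) ^+ 2 * \int[mu2]_(q in disc d) (g q ^+ 2) &
    0 < \int[mu2]_(q in disc d) (g q ^+ 2)].
Proof.
move=> hj jd; have [j0 _ _] := hj.
have s0 : 0 < Num.sqrt (2 : R) by rewrite sqrtr_gt0; lra.
have s2 : Num.sqrt (2 : R) ^+ 2 = 2 by rewrite sqr_sqrtr//; lra.
have sj : 0 < Num.sqrt 2 * j by rewrite mulr_gt0.
have d0 : 0 < d by lra.
set m := (j / d) ^+ 2; set g := mode 1 0 m; have cC := @C1_mode R 1 0 m; have [c0 c1 c2 _ _] := cC.
have mD := measurable_disc d.
have go q : g (flip (-1) 1 q) = - g q.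
  by rewrite /g /mode /slope /radius /flip /= mulN1r sqrrN !mul1r !mul0r !addr0 mulNr.
have odd0 (f : R * R -> R) : continuous f -> (forall q, f (flip (-1) 1 q) = - f q) -> \int[mu2]_(q in disc d) f q = 0.
  move=> cf fo; have m1 : (-1 : R) ^+ 2 = 1 by rewrite sqrrN expr1n.
  have := disc_flip d0 m1 (expr1n _ 2) cf.
  have -> : \int[mu2]_(q in disc d) f (flip (-1) 1 q) = \int[mu2]_(q in disc d) (-1 * f q).
    by apply: eq_Rintegral => q _; rewrite fo mulN1r.
  by rewrite (RintegralZ' mD _ (disc_Rintegrable d0 cf)); lra.
have jd2 : 2 * j ^+ 2 < d ^+ 2.
  by rewrite -s2 -exprMn ltrXn2r// ?nnegrE ltW.
split.
- rewrite /m exprMn exprVn ltr_pdivrMr ?exprn_gt0//; lra.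
- exact: odd0.
- by apply: odd0 => [|q]; [exact: continuous_exp|rewrite go; ring].
- have := mode_energy hj 1 0 d0; rewrite -/m /=.
  have i2 : continuous (fun q => g q ^+ 2) by exact: continuous_exp.
  have i1 : continuous (fun q => mode1 1 0 m q ^+ 2 + mode2 1 0 m q ^+ 2).
    by apply: continuous_add; exact: continuous_exp.
  have j1 := disc_Rintegrable d0 i1; have j2 := disc_Rintegrable d0 i2.
  rewrite (RintegralB' mD j1 (RintegrableZ mD _ j2)) (RintegralZ' mD _ j2).
  by move/eqP; rewrite subr_eq0 => /eqP.
- apply: (@disc_integral_gt0 d (fun q => g q ^+ 2) (d / 2, 0)) => //.
  + exact: continuous_exp.
  + by move=> q; exact: sqr_ge0.
  + by rewrite /disc /= expr0n/= addr0; nra.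
  apply: exprn_gt0; rewrite /g /mode /slope /= mul1r mulr0 addr0 mulr_gt0 ?divr_gt0//.
  apply: (clifford_gt0 hj); rewrite /radius /= expr0n /= addr0.
    by rewrite mulr_ge0 ?sqr_ge0// divr_ge0 ?sqr_ge0.
  have -> : m / 4 * (d / 2) ^+ 2 = j ^+ 2 / 16 by rewrite /m; field; rewrite gt_eqF.
  by have := sqr_ge0 j; lra.
Qed.

Lemma critical_radius_sqr (j : R) : (Num.sqrt 2 * j) ^+ 2 = 2 * j ^+ 2.
Proof. by rewrite exprMn sqr_sqrtr//; lra. Qed.

End main.

Theorem theorem1p6 (R : realType) :
  exists2 c : R, 0 < c &
    forall (j : R), smallest_positive_zero (derive1 (bessel_J 1)) j ->
    forall (chi : R -> R), profile chi ->
    forall (d : R), 0 < d ->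
    forall (n : nat), (0 < n)%N ->
      (energy d (psi chi 1 n) < energy d soliton)%E ->
      (energy d (psi chi (-1) n) < energy d soliton)%E ->
      let cd := mountain_pass d (psi chi (-1) n) (psi chi 1 n) in
      (d <= Num.sqrt 2 * j -> cd = energy d soliton) /\
      (Num.sqrt 2 * j < d -> (c%:E <= cd)%E /\ (cd < energy d soliton)%E).
Proof.
have s0 : 0 < Num.sqrt (2 : R) by rewrite sqrtr_gt0; lra.
(* The constant must be chosen before [j]. Without a smallest positive zero every constant works;
   otherwise [j] is unique and the critical radius is determined. *)
have [[j0 hj0]|noj] := pselect (exists j : R, smallest_positive_zero (derive1 (bessel_J 1)) j); last first.
  by exists 1 => // j hj; case: noj; exists j.
have [j00 zj0 minj0] := hj0.
have r0 : 0 < Num.sqrt 2 * j0 by rewrite mulr_gt0.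
exists (soliton_energy (Num.sqrt 2 * j0)); first exact: soliton_energy_gt0.
move=> j hj; have {j hj} -> : j = j0.
  by have [j1 zj minj] := hj; apply/eqP; rewrite eq_le minj// minj0.
move=> chi hchi d d0 n n0 Epsi _ /=.
have n0' : 0 < n%:R :> R by rewrite ltr0n.
have dX := profile_is_derive n hchi.
have cX := @profile_continuous_derive R chi n hchi.
have oX := @profile_odd R chi n hchi; have tX := profile_tail hchi n0.
split => [dj|jd].
  apply/eqP; rewrite eq_le; apply/andP; split.
    rewrite (energy_solitonE d0).
    rewrite -(trial_psi chi n (fun=> 0)) in Epsi.
    have [M ME hM] := unimodular_bound n0' dX cX oX tX (@C1_plane0 R) d0 Epsi.
    apply: (mountain_pass_le hchi n0 (@C1_plane0 R) (eps := 0)) => // [a s a1 s1|a a1].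
      by apply: le_trans (hM a s a1 s1) _; rewrite lee_fin ltW.
    by rewrite mul0r; exact: (middle_bound0 dX cX (@C1_plane0 R)).
  apply: (mountain_pass_ge _ _ hj0) => //.
  by rewrite -critical_radius_sqr lerXn2r ?nnegrE// ltW.
split.
  rewrite -(energy_solitonE r0); apply: (mountain_pass_ge _ _ hj0) => //; first exact: ltW.
  by rewrite critical_radius_sqr.
have [m12 I1 I3 ID I2] := critical_mode hj0 jd.
set m := (j0 / d) ^+ 2 in m12 I1 I3 ID I2; have cm := @C1_mode R 1 0 m.
have [eps eps0 [M1 M1E hM1]] := middle_bound dX cX cm d0 m12 I1 I3 ID I2.
rewrite -(trial_psi chi n (mode 1 0 m)) in Epsi.
have [M2 M2E hM2] := unimodular_bound n0' dX cX oX tX cm d0 Epsi.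
rewrite (energy_solitonE d0); apply: (@le_lt_trans _ _ (Num.max M1 M2)%:E); last by rewrite lte_fin gt_max M1E M2E.
apply: (mountain_pass_le hchi n0 cm (eps := eps)) => // [a s a1 s1|a a1].
  by apply: le_trans (hM2 a s a1 s1) _; rewrite lee_fin le_max lexx orbT.
by apply: le_trans (hM1 a a1) _; rewrite lee_fin le_max lexx.
Qed.
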